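(* Let $n=2$ and $\lambda\in[0,1[$. Let $\Omega'$ be an open subset of $\Omega$ with $0\notin\overline{\Omega'}$. Then there are $\boldsymbol\varepsilon'\in\,]\mathbf 0,\boldsymbol\varepsilon^{\rm ad}[$ with $\overline{\omega_{\boldsymbol\varepsilon}}\cap\overline{\Omega'}=\emptyset$ for all $\boldsymbol\varepsilon\in\,]-\boldsymbol\varepsilon',\boldsymbol\varepsilon'[$, an open neighborhood $\mathcal V_\lambda$ of $(0,\lambda)$ in $\mathbb R^2$, and a real analytic map $$\mathfrak U_{\Omega'}:\ ]-\boldsymbol\varepsilon',\boldsymbol\varepsilon'[\,\times\mathcal V_\lambda\to C^{1,\alpha}(\overline{\Omega'})$$ such that the following holds. For every function $\eta\mapsto\boldsymbol\varepsilon(\eta)=(\varepsilon_1(\eta),\varepsilon_2(\eta))$ from $]0,1[$ to $]\mathbf 0,\boldsymbol\varepsilon^{\rm ad}[$ with $$\lim_{\eta\to0^+}\boldsymbol\varepsilon(\eta)=\mathbf 0,\qquad \lim_{\eta\to0^+}\frac{\log\varepsilon_1(\eta)}{\log(\varepsilon_1(\eta)\varepsilon_2(\eta))}=\lambda,$$ setting $$\boldsymbol\delta(\eta)=(\delta_1(\eta),\delta_2(\eta))=\Big(\frac1{\log(\varepsilon_1(\eta)\varepsilon_2(\eta))},\frac{\log\varepsilon_1(\eta)}{\log(\varepsilon_1(\eta)\varepsilon_2(\eta))}\Big),$$ and for every $\eta'\in\,]0,1[$ such that $(\boldsymbol\varepsilon(\eta),\boldsymbol\delta(\eta))\in\,]\mathbf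 0,\boldsymbol\varepsilon'[\,\times\mathcal V_\lambda$ for all $\eta\in\,]0,\eta'[$, one has $$u_{\boldsymbol\varepsilon(\eta)|\overline{\Omega'}}=\mathfrak U_{\Omega'}[\boldsymbol\varepsilon(\eta),\boldsymbol\delta(\eta)]\qquad\forall\,\eta\in\,]0,\eta'[\,.$$ At the singular point, $\mathfrak U_{\Omega'}[\mathbf 0,(0,\lambda)]=u_{0|\overline{\Omega'}}$.
   Context: Here $n=2$, $\alpha\in\,]0,1[$ (open intervals are written $]a,b[$), $\mathbb R^2_+=\{x\in\mathbb R^2: x_2>0\}$, $B(0,r)$ the open ball, $B^+(0,r)=B(0,r)\cap\mathbb R^2_+$. $C^{k,\alpha}$ denotes the usual Schauder classes. Domain: $\Omega$ is an open bounded connected subset of $\mathbb R^2_+$ of class $C^{1,\alpha}$. Set $\partial_0\Omega=\partial\Omega\cap\partial\mathbb R^2_+$, $\partial_+\Omega=\partial\Omega\cap\mathbb R^2_+$. Assume $\partial_0\Omega$ is a neighbourhood of $0$ in $\partial\mathbb R^2_+$ and that $\overline{\partial_+\Omega}$ is a compact submanifold with boundary of $\mathbb R^2$ of class $C^{1,\alpha}$ (in dimension two this takes the form: $\overline{\partial_0\Omega}$ is a finite union of closed disjoint intervals in $\partial\mathbb R^2_+$). Hole: $\omega$ is a bounded open connected subset of $\mathbb R^2$ of class $C^{1,\alpha}$ with $0\in\omega$; $p=(p_1,p_2)\in\mathbb R^2_+$ is fixed. For $\boldsymbol\varepsilon=(\varepsilon_1,\varepsilon_2)\in\mathbb R^2$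 let $\omega_{\boldsymbol\varepsilon}=\varepsilon_1p+\varepsilon_1\varepsilon_2\,\omega$. Inequalities between pairs are componentwise, $]\boldsymbol\varepsilon',\boldsymbol\varepsilon''[$ is the open rectangle of $\boldsymbol\varepsilon\in\mathbb R^2$ with $\boldsymbol\varepsilon'<\boldsymbol\varepsilon<\boldsymbol\varepsilon''$, and $\mathbf 0=(0,0)$. Fix $\boldsymbol\varepsilon^{\rm ad}\in\,]0,+\infty[^2$ with $\varepsilon^{\rm ad}_1<1<\varepsilon_2^{\rm ad}<1/\varepsilon_1^{\rm ad}$ such that $\overline{\omega_{\boldsymbol\varepsilon}}\subseteq\Omega$ for all $\boldsymbol\varepsilon\in\,]\mathbf 0,\boldsymbol\varepsilon^{\rm ad}[$; set $\Omega_{\boldsymbol\varepsilon}=\Omega\setminus\overline{\omega_{\boldsymbol\varepsilon}}$. Data: $g^{\mathrm o}\in C^{1,\alpha}(\partial\Omega)$, $g^{\mathrm i}\in C^{1,\alpha}(\partial\omega)$, and there is $r_0>0$ such that the restriction of $g^{\mathrm o}$ to $B(0,r_0)\cap\partial_0\Omega$ is real analytic. For $\boldsymbol\varepsilon\in\,]\mathbf 0,\boldsymbol\varepsilon^{\rm ad}[$, $u_{\boldsymbol\varepsilon}\in C^{1,\alpha}(\overline{\Omega_{\boldsymbol\varepsilon}})$ is the unique solution of $\Delta u=0$ in $\Omega_{\boldsymbol\varepsilon}$, $u=g^{\mathrm o}$ on $\partial\Omega$, $u(x)=g^{\mathrm i}\big(\frac{x-\varepsilon_1p}{\varepsilon_1\varepsilon_2}\big)$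 for $x\in\partial\omega_{\boldsymbol\varepsilon}$. $u_0\in C^{1,\alpha}(\overline\Omega)$ is the unique solution of $\Delta u_0=0$ in $\Omega$, $u_0=g^{\mathrm o}$ on $\partial\Omega$. There are $r_1\in\,]0,r_0]$ with $B^+(0,r_1)\subseteq\Omega$ and a function $U_0$ on $\overline{B(0,r_1)}$, harmonic in $B(0,r_1)$, with $U_0=u_0$ on $\overline{B^+(0,r_1)}$; these are fixed and $\varepsilon_1^{\rm ad}$ is taken so small that $\varepsilon_1p+\varepsilon_1\varepsilon_2\overline\omega\subseteq B(0,r_1)$ for all $\boldsymbol\varepsilon\in\,]-\boldsymbol\varepsilon^{\rm ad},\boldsymbol\varepsilon^{\rm ad}[$. Real analytic maps between (open subsets of) Banach spaces are those locally given by convergent power series. *)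

(* Defs.v *)
From HB Require Import structures.
From mathcomp Require Import all_boot all_order all_algebra.
From mathcomp Require Import all_classical all_reals all_analysis.

Set Implicit Arguments.
Unset Strict Implicit.
Unset Printing Implicit Defensive.

Import Order.TTheory GRing.Theory Num.Theory.
Import numFieldNormedType.Exports.

Local Open Scope classical_set_scope.
Local Open Scope ring_scope.

(** The library norm of [R * R] is the sup norm: it carries the topology (open
sets, closures, limits, boundedness), while balls, unit vectors and Hoelder
quotients use the Euclidean norm [enorm]. *)

Definition enorm (R : realType) (x : R * R) : R :=
  Num.sqrt (x.1 ^+ 2 + x.2 ^+ 2).

Definition eball (R : realType) (r : R) : set (R * R) :=
  [set x | enorm x < r].

Definition upper_half (R : realType) : set (R * R) := [set x | 0 < x.2].

Definition horiz_axis (R : realType) : set (R * R) := [set x | x.2 = 0].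

Definition bdry (R : realType) (A : set (R * R)) : set (R * R) :=
  closure A `\` A^°.

Definition plt (R : realType) (a b : R * R) : Prop := a.1 < b.1 /\ a.2 < b.2.

Definition rect (R : realType) (a b : R * R) : set (R * R) :=
  [set e | plt a e /\ plt e b].

Definition evec (R : realType) (i : 'I_2) : R * R :=
  if i == ord0 then (1, 0) else (0, 1).

Definition partial (R : realType) (i : 'I_2) (f : R * R -> R) : R * R -> R :=
  fun x => 'D_(evec R i) f x.

(** Continuity of the second partial derivatives forces that of [u] and of
its first partial derivatives, so the first two conditions say that [u] is
twice continuously differentiable on the open set [O]. *)
Definition harmonic_on (R : realType) (O : set (R * R)) (u : R * R -> R) :
    Prop :=
  [/\ forall i x, O x -> derivable u x (evec R i),
      forall i j x, O x -> derivable (partial i u) x (evec R j) /\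
                           {for x, continuous (partial j (partial i u))}
    & forall x, O x -> \sum_(i < 2) partial i (partial i u) x = 0].

Definition bounded_fn (R : realType) (T : Type) (A : set T) (g : T -> R) :
    Prop :=
  has_ubound [set `|g z| | z in A].

(** Equal to [0] when [A] is empty. *)
Definition sup_norm (R : realType) (T : Type) (A : set T) (g : T -> R) : R :=
  sup [set `|g z| | z in A].

(** On the diagonal the value is [0], since the numerator vanishes. *)
Definition holder_quot (R : realType) (al : R) (g : R * R -> R)
    (z : (R * R) * (R * R)) : R :=
  (g z.1 - g z.2) / (enorm (z.1 - z.2) `^ al).

Definition holder_on (R : realType) (al : R) (O : set (R * R))
    (g : R * R -> R) : Prop :=
  bounded_fn (O `*` O) (holder_quot al g).

(** Functions of class C^1 in [O] which extend continuously to the closure of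
[O] together with their first partial derivatives; [f] itself denotes its
extension, and its values off the closure of [O] are irrelevant. *)
Definition C1_closure (R : realType) (O : set (R * R)) (f : R * R -> R) :
    Prop :=
  [/\ {within closure O, continuous f},
      forall i x, O x -> derivable f x (evec R i)
    & forall i, exists2 g : R * R -> R,
        {within closure O, continuous g} &
        forall x, O x -> g x = partial i f x].

(** The boundedness conditions follow from the first one when [O] is
bounded. *)
Definition C1a_closure (R : realType) (al : R) (O : set (R * R))
    (f : R * R -> R) : Prop :=
  [/\ C1_closure O f, bounded_fn (closure O) f,
      forall i, bounded_fn O (partial i f)
    & forall i, holder_on al O (partial i f)].

Definition schauder_norm (R : realType) (al : R) (O : set (R * R))
    (f : R * R -> R) : R :=
  sup_norm (closure O) f +
  \sum_(i < 2) (sup_norm O (partial i f) +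
                sup_norm (O `*` O) (holder_quot al (partial i f))).

(** A function on the closure of [O] is represented by its extension by [0]
to the plane, so that elements are equal as soon as they agree on the closure
of [O]. *)
Definition C1a_pred (R : realType) (al : R) (O : set (R * R)) :
    {pred (R * R -> R)} :=
  fun f => `[< C1a_closure al O f /\ forall x, ~ closure O x -> f x = 0 >].

Record C1a_space (R : realType) (al : R) (O : set (R * R)) := C1aSpace {
  C1a_fun :> R * R -> R ;
  _ : C1a_fun \in C1a_pred al O }.

HB.instance Definition _ (R : realType) (al : R) (O : set (R * R)) :=
  [isSub for @C1a_fun R al O].
HB.instance Definition _ (R : realType) (al : R) (O : set (R * R)) :=
  [Choice of C1a_space al O by <:].

Lemma bounded_fnD (R : realType) (T : Type) (A : set T) (g h : T -> R) :
  bounded_fn A g -> bounded_fn A h -> bounded_fn A (fun z => g z + h z).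
Proof.
move=> [M gM] [N hN]; exists (M + N) => _ [z Az <-].
rewrite (le_trans (ler_normD _ _))// lerD//; first by apply: gM; exists z.
by apply: hN; exists z.
Qed.

Lemma bounded_fnZ (R : realType) (T : Type) (A : set T) (a : R) (g : T -> R) :
  bounded_fn A g -> bounded_fn A (fun z => a * g z).
Proof.
move=> [M gM]; exists (`|a| * M) => _ [z Az <-].
by rewrite normrM ler_wpM2l//; apply: gM; exists z.
Qed.

Lemma eq_bounded_fn (R : realType) (T : Type) (A : set T) (g h : T -> R) :
  (forall z, A z -> g z = h z) -> bounded_fn A g -> bounded_fn A h.
Proof.
by move=> gh [M gM]; exists M => _ [z Az <-]; rewrite -gh//; apply: gM; exists z.
Qed.

Lemma bounded_fn0 (R : realType) (T : Type) (A : set T) :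
  bounded_fn A (fun=> 0 : R).
Proof. by exists 0 => _ [z Az <-]; rewrite normr0. Qed.

Lemma eq_sup_norm (R : realType) (T : Type) (A : set T) (g h : T -> R) :
  (forall z, A z -> g z = h z) -> sup_norm A g = sup_norm A h.
Proof.
move=> gh; congr sup; apply/seteqP.
by split=> _ [z Az <-]; exists z => //; rewrite gh.
Qed.

Lemma sup_norm_ub (R : realType) (T : Type) (A : set T) (g : T -> R) (z : T) :
  bounded_fn A g -> A z -> `|g z| <= sup_norm A g.
Proof. by move=> bg Az; apply: ub_le_sup => //; exists z. Qed.

Lemma sup_norm_le (R : realType) (T : Type) (A : set T) (g : T -> R) (M : R) :
  0 <= M -> (forall z, A z -> `|g z| <= M) -> sup_norm A g <= M.
Proof.
move=> M0 gM; have [->|/set0P[z Az]] := eqVneq A set0.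
  by rewrite /sup_norm image_set0 sup0.
by apply: ge_sup; [exists `|g z|, z | move=> _ [y Ay <-]; exact: gM].
Qed.

Lemma sup_norm_ge0 (R : realType) (T : Type) (A : set T) (g : T -> R) :
  bounded_fn A g -> 0 <= sup_norm A g.
Proof.
move=> bg; have [->|/set0P[z Az]] := eqVneq A set0.
  by rewrite /sup_norm image_set0 sup0.
by rewrite (le_trans _ (sup_norm_ub bg Az)).
Qed.

Lemma sup_normD (R : realType) (T : Type) (A : set T) (g h : T -> R) :
  bounded_fn A g -> bounded_fn A h ->
  sup_norm A (fun z => g z + h z) <= sup_norm A g + sup_norm A h.
Proof.
move=> bg bh; apply: sup_norm_le => [|z Az].
  by rewrite addr_ge0// sup_norm_ge0.
by rewrite (le_trans (ler_normD _ _))// lerD// sup_norm_ub.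
Qed.

Lemma sup_normZ (R : realType) (T : Type) (A : set T) (a : R) (g : T -> R) :
  bounded_fn A g -> sup_norm A (fun z => a * g z) = `|a| * sup_norm A g.
Proof.
move=> bg; have sup_normZ_le (b : R) (k : T -> R) : bounded_fn A k ->
    sup_norm A (fun z => b * k z) <= `|b| * sup_norm A k.
  move=> bk; apply: sup_norm_le => [|z Az].
    by rewrite mulr_ge0// sup_norm_ge0.
  by rewrite normrM ler_wpM2l// sup_norm_ub.
apply/le_anti; rewrite sup_normZ_le//=.
have [->|a0] := eqVneq a 0.
  by rewrite normr0 mul0r sup_norm_ge0//; exact: bounded_fnZ.
rewrite -ler_pdivlMl ?normr_gt0// -normfV.
apply: le_trans (sup_normZ_le _ _ (bounded_fnZ a bg)).
rewrite le_eqVlt (@eq_sup_norm _ _ _ g (fun z => a^-1 * (a * g z))) ?eqxx//.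
by move=> z _; rewrite mulrA mulVf// mul1r.
Qed.

Lemma holder_quotD (R : realType) (al : R) (g h : R * R -> R) z :
  holder_quot al (fun x => g x + h x) z =
  holder_quot al g z + holder_quot al h z.
Proof. by rewrite /holder_quot -mulrDl opprD addrACA. Qed.

Lemma holder_quotZ (R : realType) (al a : R) (g : R * R -> R) z :
  holder_quot al (fun x => a * g x) z = a * holder_quot al g z.
Proof. by rewrite /holder_quot -mulrBr mulrA. Qed.

Lemma eq_holder_quot (R : realType) (al : R) (O : set (R * R))
    (g h : R * R -> R) : (forall x, O x -> g x = h x) ->
  forall z, (O `*` O) z -> holder_quot al g z = holder_quot al h z.
Proof. by move=> gh z [Oz1 Oz2]; rewrite /holder_quot !gh. Qed.

Lemma partial0 (R : realType) i (x : R * R) :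
  partial i (0 : R * R -> R) x = 0.
Proof. exact: derive_cst. Qed.

Lemma partialD (R : realType) i (f g : R * R -> R) x :
  derivable f x (evec R i) -> derivable g x (evec R i) ->
  partial i (f + g) x = partial i f x + partial i g x.
Proof. exact: deriveD. Qed.

Lemma partialZ (R : realType) i a (f : R * R -> R) x :
  derivable f x (evec R i) ->
  partial i (a *: f) x = a * partial i f x.
Proof. exact: deriveZ. Qed.

Lemma C1_closure_lin (R : realType) (O : set (R * R)) (a : R)
    (f g : R * R -> R) :
  C1_closure O f -> C1_closure O g -> C1_closure O (a *: f + g).
Proof.
move=> [cf df ef] [cg dg eg]; split.
- move=> x; apply: (@continuousD _ _ (subspace (closure O))) => //=.
  by apply: (@continuousZr _ _ (subspace (closure O))) => //; exact: cf.
  exact: cg.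
- by move=> i x Ox; apply: derivableD; [apply: derivableZ; exact: df|exact: dg].
- move=> i; have [p cp pf] := ef i; have [q cq qg] := eg i.
  exists (a *: p + q).
    move=> x; apply: (@continuousD _ _ (subspace (closure O))) => //=.
    by apply: (@continuousZr _ _ (subspace (closure O))) => //; exact: cp.
    exact: cq.
  move=> x Ox; rewrite partialD ?partialZ; [|exact: df|..|exact: dg].
    by rewrite -pf// -qg.
  by apply: derivableZ; exact: df.
Qed.

Lemma partial_lin (R : realType) (O : set (R * R)) (a : R) i
    (f g : R * R -> R) : C1_closure O f -> C1_closure O g ->
  forall x, O x ->
  partial i (a *: f + g) x = a * partial i f x + partial i g x.
Proof.
move=> [_ df _] [_ dg _] x Ox.
rewrite partialD ?partialZ//; [exact: df| |exact: dg].
by apply: derivableZ; exact: df.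
Qed.

Lemma C1a_closure_lin (R : realType) (al : R) (O : set (R * R)) (a : R)
    (f g : R * R -> R) :
  C1a_closure al O f -> C1a_closure al O g -> C1a_closure al O (a *: f + g).
Proof.
move=> [c1f bf bdf hf] [c1g bg bdg hg]; split.
- exact: C1_closure_lin.
- exact: (bounded_fnD (bounded_fnZ a bf) bg).
- move=> i; apply: eq_bounded_fn.
    by move=> z Oz; apply/esym/(partial_lin a i c1f c1g Oz).
  exact: (bounded_fnD (bounded_fnZ a (bdf i)) (bdg i)).
- move=> i; apply: eq_bounded_fn.
    move=> z Oz; rewrite (eq_holder_quot al (partial_lin a i c1f c1g) Oz).
    by rewrite holder_quotD holder_quotZ.
  exact: (bounded_fnD (bounded_fnZ a (hf i)) (hg i)).
Qed.

Lemma C1a_closure0 (R : realType) (al : R) (O : set (R * R)) :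
  C1a_closure al O 0.
Proof.
split; first split.
- by move=> x; exact: cvg_cst.
- by move=> i x _; exact: derivable_cst.
- by move=> i; exists 0 => [x|x _]; [exact: cvg_cst|rewrite partial0].
- exact: bounded_fn0.
- move=> i; apply: eq_bounded_fn (bounded_fn0 _ _) => x _.
  by rewrite partial0.
- move=> i; apply: eq_bounded_fn (bounded_fn0 _ _) => x _.
  by rewrite /holder_quot !partial0 subrr mul0r.
Qed.

Lemma C1a_pred_submod (R : realType) (al : R) (O : set (R * R)) :
  GRing.submod_closed (C1a_pred al O).
Proof.
split; first by apply/asboolP; split; first exact: C1a_closure0.
move=> a f g /asboolP[cf f0] /asboolP[cg g0]; apply/asboolP; split.
  exact: C1a_closure_lin.
by move=> x Ox; rewrite !fctE f0// g0// scaler0 addr0.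
Qed.
HB.instance Definition _ (R : realType) (al : R) (O : set (R * R)) :=
  GRing.isSubmodClosed.Build _ _ (C1a_pred al O) (@C1a_pred_submod R al O).
HB.instance Definition _ (R : realType) (al : R) (O : set (R * R)) :=
  [SubChoice_isSubLmodule of C1a_space al O by <:].

Lemma C1a_funP (R : realType) (al : R) (O : set (R * R))
    (f : C1a_space al O) : C1a_closure al O f.
Proof. by case: f => f /= /asboolP[]. Qed.

Definition C1a_norm (R : realType) (al : R) (O : set (R * R))
    (f : C1a_space al O) : R := schauder_norm al O f.

Lemma ler_C1a_normD (R : realType) (al : R) (O : set (R * R))
    (f g : C1a_space al O) : C1a_norm (f + g) <= C1a_norm f + C1a_norm g.
Proof.
have [c1f bf bdf hf] := C1a_funP f; have [c1g bg bdg hg] := C1a_funP g.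
have dE i x (Ox : O x) : partial i (C1a_fun f + C1a_fun g) x =
    partial i f x + partial i g x.
  by have := partial_lin 1 i c1f c1g Ox; rewrite scale1r mul1r.
rewrite /C1a_norm /schauder_norm addrACA -big_split/=.
apply: lerD; first exact: (sup_normD bf bg).
apply: ler_sum => i _; rewrite addrACA; apply: lerD.
  by rewrite (eq_sup_norm (dE i)); exact: (sup_normD (bdf i) (bdg i)).
rewrite (@eq_sup_norm _ _ _ _ (fun z => holder_quot al (partial i f) z +
  holder_quot al (partial i g) z)); first exact: (sup_normD (hf i) (hg i)).
by move=> z Oz; rewrite (eq_holder_quot al (dE i) Oz) holder_quotD.
Qed.

Lemma C1a_normZ (R : realType) (al : R) (O : set (R * R))
    (a : R) (f : C1a_space al O) : C1a_norm (a *: f) = `|a| * C1a_norm f.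
Proof.
have [c1f bf bdf hf] := C1a_funP f.
have dE i x (Ox : O x) : partial i (a *: C1a_fun f) x = a * partial i f x.
  by rewrite partialZ//; case: c1f => _ df _; exact: df.
rewrite /C1a_norm /schauder_norm mulrDr mulr_sumr -(sup_normZ a bf); congr (_ + _).
apply: eq_bigr => i _.
rewrite mulrDr -(sup_normZ a (bdf i)) -(sup_normZ a (hf i)); congr (_ + _).
  exact: eq_sup_norm (dE i).
apply: eq_sup_norm => z Oz.
by rewrite (eq_holder_quot al (dE i) Oz) holder_quotZ.
Qed.

Lemma C1a_norm0_eq0 (R : realType) (al : R) (O : set (R * R))
    (f : C1a_space al O) : C1a_norm f = 0 -> f = 0.
Proof.
have [c1f bf bdf hf] := C1a_funP f => nf0; apply/val_inj/funext => x /=.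
have [Ox|Ox] := pselect (closure O x); last first.
  by case: f Ox {c1f bf bdf hf nf0} => f /= /asboolP[_]; exact.
apply/eqP; rewrite -normr_le0 -nf0 (le_trans (sup_norm_ub bf Ox))//.
rewrite lerDl sumr_ge0// => i _.
by apply: addr_ge0; apply: sup_norm_ge0; [exact: bdf|exact: hf].
Qed.

HB.instance Definition _ (R : realType) (al : R) (O : set (R * R)) :=
  Lmodule_isNormed.Build R (C1a_space al O)
    (@ler_C1a_normD R al O) (@C1a_normZ R al O) (@C1a_norm0_eq0 R al O).

(** Class C^(1,alpha) on the closed interval [[-r, r]]: a Hoelder continuous
derivative on the open interval extends to the end points. *)
Definition C1a_itv (R : realType) (al r : R) (f : R -> R) : Prop :=
  (forall s, `|s| < r -> derivable f s 1) /\
  exists C : R, forall s t, `|s| < r -> `|t| < r ->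
    `|'D_1 f s - 'D_1 f t| <= C * `|s - t| `^ al.

(** The point with coordinates [(s, t)] in the orthonormal frame with origin
[x0] and first axis [tau]. *)
Definition frame_pt (R : realType) (x0 tau : R * R) (s t : R) : R * R :=
  x0 + s *: tau + t *: (- tau.2, tau.1).

(** In a rectangle centred at [x0], [O] is the strict hypograph of a
C^(1,alpha) function [gam]. *)
Definition graph_chart (R : realType) (al : R) (O : set (R * R))
    (x0 tau : R * R) (r d : R) (gam : R -> R) : Prop :=
  [/\ enorm tau = 1, 0 < r, 0 < d, C1a_itv al r gam & gam 0 = 0 /\
   forall s, `|s| < r -> `|gam s| < d /\
     forall t, `|t| < d -> (O (frame_pt x0 tau s t) <-> t < gam s)].

Definition class_C1a (R : realType) (al : R) (O : set (R * R)) : Prop :=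
  forall x0, bdry O x0 -> exists tau r d gam, graph_chart al O x0 tau r d gam.

(** The regularity is tested in the parametrisations of the boundary by
graphs; the values of [g] off the boundary are irrelevant. *)
Definition C1a_bdry (R : realType) (al : R) (O : set (R * R))
    (g : R * R -> R) : Prop :=
  forall x0, bdry O x0 -> exists tau r d gam,
    graph_chart al O x0 tau r d gam /\
    C1a_itv al r (fun s => g (frame_pt x0 tau s (gam s))).

Definition multilinear (K : pzRingType) (V W : lmodType K) (k : nat)
    (A : ('I_k -> V) -> W) : Prop :=
  forall i (v : 'I_k -> V) a x y,
    A [eta v with i |-> a *: x + y] =
    a *: A [eta v with i |-> x] + A [eta v with i |-> y].

(** Near [x0], the restriction of [f] to [D] is the sum of a power series whose
[k]-th term is a bounded [k]-linear map of norm at most [M k], restricted to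
the diagonal (symmetry is therefore not required), with [M k * r ^+ k]
summable. *)
Definition analytic_at_within (R : realType) (V W : normedModType R)
    (D : set V) (f : V -> W) (x0 : V) : Prop :=
  exists (A : forall k, ('I_k -> V) -> W) (M : nat -> R) (r : R),
  [/\ 0 < r,
      forall k, multilinear (A k),
      forall k v, `|A k v| <= M k * \prod_(i < k) `|v i|,
      cvgn (series (fun k => M k * r ^+ k))
    & forall x, D x -> `|x - x0| < r ->
        series (fun k => A k (fun=> x - x0)) @ \oo --> f x].

Definition analytic_on (R : realType) (V W : normedModType R) (D : set V)
    (f : V -> W) : Prop :=
  forall x, D x -> analytic_at_within D f x.

Definition bdry0 (R : realType) (Om : set (R * R)) : set (R * R) :=
  bdry Om `&` @horiz_axis R.

(** In dimension two, the condition that the closure of the part of the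
boundary of [Om] lying in the open half plane is a submanifold with boundary is
imposed through the flat part: a finite union of disjoint closed intervals,
which may degenerate to points. *)
Definition flat_part_intervals (R : realType) (Om : set (R * R)) : Prop :=
  exists (N : nat) (a b : 'I_N -> R),
  [/\ forall i, a i <= b i,
      forall i j, i != j -> `[a i, b i]%classic `&` `[a j, b j]%classic = set0
    & closure (bdry0 Om) =
        [set x | x.2 = 0 /\ exists i, x.1 \in `[a i, b i]]].

Definition hole (R : realType) (p : R * R) (om : set (R * R)) (e : R * R) :
    set (R * R) :=
  [set e.1 *: p + (e.1 * e.2) *: y | y in om].

Definition perforated (R : realType) (Om om : set (R * R)) (p e : R * R) :
    set (R * R) :=
  Om `\` closure (hole p om e).

Definition admissible_domain (R : realType) (al : R) (Om : set (R * R)) :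
    Prop :=
  [/\ [/\ open Om, bounded_set Om, connected Om & class_C1a al Om],
      Om `<=` @upper_half R,
      exists2 r : R, 0 < r & forall t, `|t| < r -> bdry0 Om (t, 0)
    & flat_part_intervals Om].

Definition admissible_hole (R : realType) (al : R) (om : set (R * R)) : Prop :=
  [/\ open om, bounded_set om, connected om, class_C1a al om & om (0, 0)].

Definition dirichlet_solution (R : realType) (al : R) (O : set (R * R))
    (g : R * R -> R) (u : R * R -> R) : Prop :=
  [/\ C1a_closure al O u, harmonic_on O u & forall x, bdry O x -> u x = g x].

(** The boundary of the perforated domain is that of [Om] together with that of
the hole. *)
Definition perforated_solution (R : realType) (al : R) (Om om : set (R * R))
    (p : R * R) (go gi : R * R -> R) (e : R * R) (u : R * R -> R) : Prop :=
  [/\ C1a_closure al (perforated Om om p e) u,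
      harmonic_on (perforated Om om p e) u,
      forall x, bdry Om x -> u x = go x
    & forall x, bdry (hole p om e) x ->
        u x = gi ((e.1 * e.2)^-1 *: (x - e.1 *: p))].

Definition log_delta (R : realType) (e : R * R) : R * R :=
  (1 / ln (e.1 * e.2), ln e.1 / ln (e.1 * e.2)).

(* Main.v *)
(** Identify the plane with C and rescale by y = (x - e1 p) / (e1 e2). Around
the hole, u_e - u_0 is a singular part, consisting of a logarithm and of
decaying multipoles encoded by one continuous function f on the unit circle,
minus its image under the reflection in the flat boundary, minus the solution
of a Dirichlet problem in Omega which restores the zero boundary values.
Requiring that this agree with the solution of a Dirichlet problem in an
annular neighbourhood of the hole gives a linear fixed point equation for f.
Its principal part is a contraction, by comparison with the radial logarithm,
and the rest is small. Since d1 log e2 = 1 - d2, no logarithm of the parameters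
survives, and the equation is given by power series in e1, e2, d1, d2 - lambda
with values in bounded linear operators; hence so is its solution f. Finally
u_e - u_0 on Omega' is a bounded linear image of the singular part in C^(1,alpha),
by Schauder estimates away from 0.

Dirichlet problems are solved by Perron's method, starting from the disc, where
continuous data are approximated by harmonic polynomials. The boundary Schauder
estimate is an iteration over scales which compares, in a half disc, with
harmonic polynomials odd across the flat side. *)

Require Import Defs.
From HB Require Import structures.
From mathcomp Require Import all_boot all_order all_algebra.
From mathcomp Require Import all_classical all_reals all_analysis.
From mathcomp Require Import cyclic separable cyclotomic complex ring lra.
Set Implicit Arguments.
Unset Strict Implicit.
Unset Printing Implicit Defensive.
Import Order.TTheory GRing.Theory Num.Theory.
Import numFieldNormedType.Exports.
Local Open Scope classical_set_scope.
Local Open Scope ring_scope.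
Local Open Scope complex_scope.
Local Notation "z ^*" := (conjc z) : ring_scope.
(* Dropping what [lra] cannot use keeps it fast in large contexts. *)
Ltac zlra := repeat match goal with
  | x := _ |- _ => clearbody x
  | H : forall _ : _, _ |- _ => clear H
  | H : _ /\ _ |- _ => clear H
  end; lra.

(** * Modulus and continuity in the complex plane *)

Section Complex.
Variable R : realType.
Local Notation C := R[i].
Local Notation Re := (@complex.Re R).
Local Notation Im := (@complex.Im R).
Implicit Types (x y z w : C) (a b : R).

(** The limit is singular twice: the hole shrinks to a boundary point, and in the plane this
    produces logarithms. The equation for [f], which lives on a fixed circle in the rescaled
    variable, is one round of an alternating method: the exterior representation gives values on a
    larger circle, and the annular Dirichlet problem returns values on the first one. The
    coefficient of the logarithm is tied to the mean of [f] by the factor [1 / (1 - lam)], which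
    makes the constants cancel; this is where [lam < 1] enters. In the equation the four parameters
    are independent, of any sign and possibly zero; the relation between them is used only to check
    the solution. Harmonicity is a condition on second differences, to which classical harmonicity
    reduces once and for all. On discs it amounts to uniform approximation by real parts of
    polynomials, which carries expansions, limits and holomorphic changes of variable. Power series
    of operators are never formed: the class [An] consists of scalar functions on a set, and a
    family of operators counts as analytic when it preserves that class. *)

Definition cabs z : R := Num.sqrt (Re z ^+ 2 + Im z ^+ 2).

Lemma cabsE z : (cabs z)%:C = `|z|.
Proof. by rewrite normc_def. Qed.

Lemma ReD z w : Re (z + w) = Re z + Re w. Proof. by case: z w => ? ? []. Qed.
Lemma ImD z w : Im (z + w) = Im z + Im w. Proof. by case: z w => ? ? []. Qed.
Lemma ReN z : Re (- z) = - Re z. Proof. by case: z. Qed.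
Lemma ImN z : Im (- z) = - Im z. Proof. by case: z. Qed.
Lemma ReB z w : Re (z - w) = Re z - Re w. Proof. by rewrite ReD ReN. Qed.
Lemma ImB z w : Im (z - w) = Im z - Im w. Proof. by rewrite ImD ImN. Qed.
Lemma ReM z w : Re (z * w) = Re z * Re w - Im z * Im w.
Proof. by case: z w => ? ? []. Qed.
Lemma ImM z w : Im (z * w) = Re z * Im w + Im z * Re w.
Proof. by case: z w => ? ? []. Qed.
Lemma ReZ a z : Re (a%:C * z) = a * Re z.
Proof. by rewrite ReM /= mul0r subr0. Qed.
Lemma ImZ a z : Im (a%:C * z) = a * Im z.
Proof. by rewrite ImM /= mul0r addr0. Qed.
Lemma Re_sum I (r : seq I) (P : pred I) (F : I -> C) :
  Re (\sum_(i <- r | P i) F i) = \sum_(i <- r | P i) Re (F i).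
Proof. by elim/big_rec2: _ => // i u v _ <-; rewrite ReD. Qed.
Lemma Im_sum I (r : seq I) (P : pred I) (F : I -> C) :
  Im (\sum_(i <- r | P i) F i) = \sum_(i <- r | P i) Im (F i).
Proof. by elim/big_rec2: _ => // i u v _ <-; rewrite ImD. Qed.
Lemma ReJ z : Re z^* = Re z. Proof. by case: z. Qed.
Lemma ImJ z : Im z^* = - Im z. Proof. by case: z. Qed.
Lemma complex_ext z w : Re z = Re w -> Im z = Im w -> z = w.
Proof. by case: z w => ? ? [? ?] /= -> ->. Qed.

Lemma cabs_ge0 z : 0 <= cabs z. Proof. exact: sqrtr_ge0. Qed.
Lemma cabs_sqr z : cabs z ^+ 2 = Re z ^+ 2 + Im z ^+ 2.
Proof. by rewrite sqr_sqrtr// addr_ge0// sqr_ge0. Qed.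
Lemma cabs0 : cabs 0 = 0.
Proof. by apply: complexI; rewrite cabsE normr0. Qed.
Lemma cabs1 : cabs 1 = 1.
Proof. by apply: complexI; rewrite cabsE normr1. Qed.
Lemma cabsM z w : cabs (z * w) = cabs z * cabs w.
Proof. by apply: complexI; rewrite rmorphM/= !cabsE normrM. Qed.
Lemma cabsX z n : cabs (z ^+ n) = cabs z ^+ n.
Proof. by apply: complexI; rewrite rmorphXn/= !cabsE normrX. Qed.
Lemma cabsV z : cabs z^-1 = (cabs z)^-1.
Proof. by apply: complexI; rewrite fmorphV/= !cabsE normfV. Qed.
Lemma cabsN z : cabs (- z) = cabs z.
Proof. by apply: complexI; rewrite !cabsE normrN. Qed.
Lemma cabsD z w : cabs (z + w) <= cabs z + cabs w.
Proof. by rewrite -lecR rmorphD/= !cabsE ler_normD. Qed.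
Lemma cabsB z w : cabs (z - w) <= cabs z + cabs w.
Proof. by rewrite -(cabsN w) cabsD. Qed.
Lemma cabs_sub z w : cabs (z - w) = cabs (w - z).
Proof. by rewrite -cabsN opprB. Qed.
Lemma cabs_eq0 z : (cabs z == 0) = (z == 0).
Proof. by rewrite -(inj_eq (@complexI _)) cabsE normr_eq0. Qed.
Lemma cabs_gt0 z : (0 < cabs z) = (z != 0).
Proof. by rewrite lt_def cabs_eq0 cabs_ge0 andbT. Qed.
Lemma cabs_real a : cabs a%:C = `|a|.
Proof. by rewrite /cabs/= expr0n addr0 sqrtr_sqr. Qed.
Lemma cabsZ a z : cabs (a%:C * z) = `|a| * cabs z.
Proof. by rewrite cabsM cabs_real. Qed.
Lemma cabsJ z : cabs z^* = cabs z.
Proof. by rewrite /cabs ReJ ImJ sqrrN. Qed.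
Lemma cabs_i : cabs 'i = 1.
Proof. by rewrite /cabs/= expr0n expr1n add0r sqrtr1. Qed.
Lemma Re_le z : `|Re z| <= cabs z.
Proof. by rewrite -lecR cabsE normc_ge_Re. Qed.
Lemma Im_le z : `|Im z| <= cabs z.
Proof.
have := Re_le (z * 'i); rewrite cabsM cabs_i mulr1 ReM /= mulr0 mulr1 sub0r.
by rewrite normrN.
Qed.
Lemma cabs_le z : cabs z <= `|Re z| + `|Im z|.
Proof.
rewrite -(ler_pXn2r (n := 2)) ?nnegrE ?cabs_ge0 ?addr_ge0//.
rewrite cabs_sqr sqrrD -(real_normK (num_real (Re z))) -(real_normK (num_real (Im z))).
by rewrite lerD2r lerDl mulrn_wge0// mulr_ge0.
Qed.
Lemma cabs_leD z w : cabs z <= cabs (z - w) + cabs w.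
Proof. by rewrite -{1}(subrK w z) cabsD. Qed.
Lemma cabs_tri x y z : cabs (x - z) <= cabs (x - y) + cabs (y - z).
Proof. by rewrite (le_trans _ (cabsD _ _))// addrA subrK. Qed.
Lemma cabs_sum I (r : seq I) (P : pred I) (F : I -> C) :
  cabs (\sum_(i <- r | P i) F i) <= \sum_(i <- r | P i) cabs (F i).
Proof.
elim/big_rec2: _ => [|i u v _ h]; first by rewrite cabs0.
by rewrite (le_trans (cabsD _ _))// lerD2l.
Qed.

Definition opn (D : set C) := forall x, D x ->
  exists2 r : R, 0 < r & forall y, cabs (y - x) < r -> D y.
Definition clos (D : set C) : set C :=
  [set x | forall r : R, 0 < r -> exists2 y, D y & cabs (y - x) < r].
(** For open [D], the case of interest, this is the topological boundary. *)
Definition bd (D : set C) : set C := [set x | clos D x /\ ~ D x].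
Definition bnd (D : set C) := exists M, forall x, D x -> cabs x <= M.
Definition cont (A : set C) (f : C -> R) := forall x, A x -> forall e : R, 0 < e ->
  exists2 d : R, 0 < d & forall y, A y -> cabs (y - x) < d -> `|f y - f x| < e.
Definition cball x a : set C := [set y | cabs (y - x) <= a].
Definition oball x a : set C := [set y | cabs (y - x) < a].

Lemma sub_clos D : D `<=` clos D.
Proof. by move=> x Dx r r0; exists x => //; rewrite subrr cabs0. Qed.

Lemma clos_mono (D E : set C) : D `<=` E -> clos D `<=` clos E.
Proof. by move=> DE x Dx r /Dx[y /DE Ey yx]; exists y. Qed.

Lemma clos_clos D : clos (clos D) `<=` clos D.
Proof.
move=> x h r r0; have [y hy yx] := h _ (divr_gt0 r0 (ltr0Sn _ 1)).
have [z Dz zy] := hy _ (divr_gt0 r0 (ltr0Sn _ 1)); exists z => //.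
by rewrite (le_lt_trans (cabs_tri _ y _))//; lra.
Qed.

Lemma bnd_clos D : bnd D -> bnd (clos D).
Proof.
move=> [M h]; exists (M + 1) => x /(_ 1 ltr01)[y Dy yx].
by rewrite (le_trans (cabs_leD _ y))// addrC lerD ?h// cabs_sub ltW.
Qed.

Lemma opn_oball x a : opn (oball x a).
Proof.
move=> y hy; exists (a - cabs (y - x)); first by rewrite subr_gt0.
move=> z hz; rewrite /oball/= (le_lt_trans (cabs_tri _ y _))//; lra.
Qed.

Lemma clos_cball x a : clos (cball x a) `<=` cball x a.
Proof.
move=> y h; rewrite /cball/= leNgt; apply/negP => hlt.
have [|z zx yz] := h (cabs (y - x) - a); first by rewrite subr_gt0.
have := cabs_tri y z x; rewrite /cball/= in zx; rewrite (cabs_sub y z); lra.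
Qed.

Lemma bnd_cball x a : bnd (cball x a).
Proof.
exists (a + cabs x) => y; rewrite /cball/= => h.
by rewrite (le_trans (cabs_leD y x))// lerD2r.
Qed.

Lemma cont_sub A B f : A `<=` B -> cont B f -> cont A f.
Proof.
move=> AB h x Ax e e0; have [d d0 hd] := h x (AB _ Ax) e e0.
by exists d => // y Ay; apply: hd; apply: AB.
Qed.

Lemma contD A f g : cont A f -> cont A g -> cont A (fun x => f x + g x).
Proof.
move=> hf hg x Ax e e0.
have [d d0 hd] := hf x Ax _ (divr_gt0 e0 (ltr0Sn _ 1)).
have [d' d0' hd'] := hg x Ax _ (divr_gt0 e0 (ltr0Sn _ 1)).
exists (Num.min d d'); first by rewrite lt_min d0.
move=> y Ay; rewrite lt_min => /andP[/(hd y Ay) h1 /(hd' y Ay) h2].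
by rewrite opprD addrACA (le_lt_trans (ler_normD _ _))//; lra.
Qed.

Lemma cont_cst A a : cont A (fun=> a).
Proof. by move=> x _ e e0; exists 1 => // y _ _; rewrite subrr normr0. Qed.

Lemma contZ A a f : cont A f -> cont A (fun x => a * f x).
Proof.
move=> hf x Ax e e0.
have a1 : 0 < `|a| + 1 by rewrite ltr_wpDl.
have [d d0 hd] := hf x Ax _ (divr_gt0 e0 a1).
exists d => // y Ay yx; rewrite -mulrBr normrM.
rewrite (@le_lt_trans _ _ ((`|a|+1) * `|f y - f x|)) ?ler_wpM2r ?lerDl//.
by rewrite mulrC -ltr_pdivlMr// hd.
Qed.

Lemma contN A f : cont A f -> cont A (fun x => - f x).
Proof.
move=> hf x Ax e e0; have [d d0 hd] := hf x Ax e e0.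
by exists d => // y Ay yx; rewrite -opprD normrN hd.
Qed.

Lemma contB A f g : cont A f -> cont A g -> cont A (fun x => f x - g x).
Proof. by move=> hf hg; apply: contD => //; apply: contN. Qed.

Lemma cont_max A f g : cont A f -> cont A g -> cont A (fun x => Num.max (f x) (g x)).
Proof.
move=> hf hg x Ax e e0.
have [d d0 hd] := hf x Ax e e0; have [d' d0' hd'] := hg x Ax e e0.
exists (Num.min d d'); first by rewrite lt_min d0.
move=> y Ay; rewrite lt_min => /andP[/(hd y Ay) h1 /(hd' y Ay) h2].
move: h1 h2; rewrite !ltr_norml; case: (leP (f x)); case: (leP (f y)); lra.
Qed.

Lemma cont_eq A f g : (forall x, A x -> f x = g x) -> cont A f -> cont A g.
Proof.
move=> fg hf x Ax e e0; have [d d0 hd] := hf x Ax e e0.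
by exists d => // y Ay yx; rewrite -!fg// hd.
Qed.

Lemma cont_lip A K f : (forall x y, A x -> A y -> `|f x - f y| <= K * cabs (x - y)) ->
  cont A f.
Proof.
move=> h x Ax e e0; have K1 : 0 < `|K| + 1 by rewrite ltr_wpDl.
exists (e / (`|K| + 1)); first by rewrite divr_gt0.
move=> y Ay yx; rewrite (le_lt_trans (h _ _ Ay Ax))//.
rewrite (@le_lt_trans _ _ ((`|K|+1) * cabs (y - x)))//.
  by rewrite ler_wpM2r ?cabs_ge0// (le_trans (ler_norm _))// lerDl.
by rewrite mulrC -ltr_pdivlMr.
Qed.

(** The approximating function may depend on the point and on the accuracy, and has to be close only
    near the point; partial sums and approximations on discs are of this kind. *)
Lemma cont_unif_lim A f : (forall x, A x -> forall e : R, 0 < e -> exists2 r : R, 0 < r &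
  exists2 g, cont A g & forall y, A y -> cabs (y - x) < r -> `|f y - g y| <= e) -> cont A f.
Proof.
move=> h x Ax e e0.
have e4 : 0 < e / 4 by rewrite divr_gt0.
have [r r0 [g cg hg]] := h x Ax _ e4; have [d d0 hd] := cg x Ax _ e4.
exists (Num.min r d); first by rewrite lt_min r0.
move=> y Ay; rewrite lt_min => /andP[yr /(hd y Ay) h1].
have h2 := hg y Ay yr; have := hg x Ax; rewrite subrr cabs0 => /(_ r0) h3.
move: h1 h2 h3; rewrite ltr_norml !ler_norml ltr_norml; lra.
Qed.

Definition toC (p : R * R) : C := p.1 +i* p.2.
Definition ofC z : R * R := (Re z, Im z).
Lemma ofCK : cancel ofC toC. Proof. by case. Qed.
Lemma toCK : cancel toC ofC. Proof. by case. Qed.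

Lemma ball_toC (p q : R * R) a : cabs (toC q - toC p) < a -> ball p a q.
Proof.
move=> h; have h1 := Re_le (toC q - toC p); have h2 := Im_le (toC q - toC p).
by split; rewrite /ball/= distrC (le_lt_trans _ h).
Qed.

Lemma toC_ball (p q : R * R) a : ball p (a / 2) q -> cabs (toC q - toC p) < a.
Proof.
move=> [/= h1 h2]; rewrite (le_lt_trans (cabs_le _))//=.
by rewrite /ball/= in h1 h2; rewrite -(opprB p.1) -(opprB p.2) !normrN; lra.
Qed.

Lemma closure_toC (A : set (R * R)) (B : set C) p :
  (forall q, A q <-> B (toC q)) -> closure A p <-> clos B (toC p).
Proof.
move=> AB; split=> h.
  move=> r r0; have [q [Aq hq]] := h _ (nbhsx_ballx p _ (divr_gt0 r0 (ltr0Sn _ 1))).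
  by exists (toC q); [exact/AB|exact: toC_ball].
move=> N /nbhs_ballP[r /= r0 hr].
have [y By yp] := h _ r0; exists (ofC y); split; first by apply/AB; rewrite ofCK.
by apply: hr; apply: ball_toC; rewrite ofCK.
Qed.

Lemma compact_toC (K : set C) : bnd K -> clos K `<=` K ->
  compact [set p : R * R | K (toC p)].
Proof.
move=> [M hM] cK; apply: (@subclosed_compact _ _ (`[-M, M] `*` `[-M, M])).
- move=> p; rewrite (@closure_toC _ K)//; exact: cK.
- by apply: compact_setX; apply: segment_compact.
- move=> p /hM h; split; rewrite /= in_itv/= -ler_norml (le_trans _ h)//.
    exact: Re_le (toC p).
  exact: Im_le (toC p).
Qed.

Lemma finite_cover (K : set C) (d : C -> R) : bnd K -> clos K `<=` K ->
  (forall x, K x -> 0 < d x) ->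
  exists s : seq C, (forall x, x \in s -> K x) /\
    forall x, K x -> exists2 y, y \in s & cabs (x - y) < d y.
Proof.
move=> bK cK hd.
pose ok (s : seq C) := forall x, x \in s -> K x.
(* The finite lists of points of [K], directed by inclusion, generate this filter; compactness in
   its near-covering form turns a covering of each point by all large lists into a covering of [K]
   by one list. *)
pose F : set_system (seq C) := [set S : set (seq C) | exists2 s0, ok s0 &
  forall s, ok s -> {subset s0 <= s} -> S s].
have FF : Filter F.
  split; first by exists [::].
  - move=> S T [s sK hs] [t tK ht]; exists (s ++ t).
      by move=> x; rewrite mem_cat => /orP[/sK|/tK].
    move=> u uK hu; split; [apply: hs|apply: ht] => // x xs; apply: hu.
      by rewrite mem_cat xs.
    by rewrite mem_cat xs orbT.
  - by move=> S T ST [s sK hs]; exists s => // u uK su; apply/ST/hs.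
have /compact_near_coveringP := compact_toC bK cK.
move=> /(_ _ F (fun s p => exists2 y, y \in s & cabs (toC p - y) < d y) FF).
case.
- move=> p Kp.
  exists (ball p (d (toC p) / 2), [set s : seq C | toC p \in s]) => /=.
    split; first by apply: nbhsx_ballx; rewrite divr_gt0// hd.
    exists [:: toC p]; first by move=> x; rewrite inE => /eqP->.
    by move=> s _; apply; rewrite inE.
  by move=> [q s] /= [pq ps]; exists (toC p) => //; exact: toC_ball.
move=> s sK /(_ s sK (fun _ h => h)) h; exists s; split=> // x Kx.
by have := h (ofC x); rewrite /= ofCK; apply.
Qed.

Lemma cont_within (A : set (R * R)) (B : set C) (f : R * R -> R) :
  (forall q, A q <-> B (toC q)) -> {within A, continuous f} <-> cont B (f \o ofC).
Proof.
move=> AB; split.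
  move=> h x Bx e e0; have Ax : A (ofC x) by apply/AB; rewrite ofCK.
  have /cvgrPdist_lt/(_ _ e0) H := h (ofC x).
  have {H} : \forall t \near nbhs_subspace (ofC x : subspace A), `|f (ofC x) - f t| < e.
    exact: H.
  rewrite -nbhs_subspace_in// => /nbhs_ballP[r /= r0 hr].
  exists r => // y By yx; rewrite /= distrC; apply: hr; last first.
    by apply/AB; rewrite ofCK.
  by apply: ball_toC; rewrite !ofCK.
(* Off [A] the point is isolated in the subspace topology, so continuity there is automatic. *)
move=> h x; have [Ax|Ax] := pselect (A x); last first.
  move=> B' hB'.
  rewrite /fmap /= /nbhs /= -nbhs_subspace_out//.
  by move=> y /= ->; apply: (@nbhs_singleton R) hB'.
have Bx : B (toC x) by apply/AB.
apply/cvgrPdist_lt => e e0; have [d d0 hd] := h _ Bx _ e0.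
suff : \forall t \near nbhs_subspace (x : subspace A), `|f x - f t| < e by [].
rewrite -nbhs_subspace_in//; apply/nbhs_ballP; exists (d / 2); first exact: divr_gt0.
move=> y xy Ay; rewrite distrC; have := hd (toC y).
by rewrite /= !toCK; apply; [exact/AB|exact: toC_ball].
Qed.

Lemma cont_attains (K : set C) f : bnd K -> clos K `<=` K -> (exists x, K x) ->
  cont K f -> exists2 x, K x & forall y, K y -> f y <= f x.
Proof.
move=> bK cK [x0 Kx0] cf.
have [|//|c] := @compact_EVT_max _ _ (f \o toC) [set p : R * R | K (toC p)] _ (compact_toC bK cK).
- by exists (ofC x0); rewrite /= ofCK.
- apply/(@cont_within _ K) => //; apply: cont_eq cf => x Kx.
  by rewrite /= ofCK.
rewrite inE /= => Kc hc; exists (toC c) => // y Ky.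
by have := hc (ofC y); rewrite inE /= ofCK; apply.
Qed.

Lemma cont_unif (K : set C) f : bnd K -> clos K `<=` K -> cont K f ->
  forall e : R, 0 < e -> exists2 d : R, 0 < d &
    forall x y, K x -> K y -> cabs (x - y) < d -> `|f x - f y| < e.
Proof.
move=> bK cK cf e e0.
have /choice[d hd] : forall x, exists d, K x -> 0 < d /\
    forall y, K y -> cabs (y - x) < d -> `|f y - f x| < e / 2.
  move=> x; have [Kx|nK] := pselect (K x); last by exists 0 => /nK.
  by have [d d0 h] := cf x Kx _ (divr_gt0 e0 (ltr0Sn _ 1)); exists d.
have [|s [sK cov]] := @finite_cover K (fun x => d x / 2) bK cK.
  by move=> x /hd[d0 _]; rewrite divr_gt0.
have [dd dd0 hdd] : exists2 dd, 0 < dd & forall x, x \in s -> dd <= d x / 2.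
  elim: s sK {cov} => [|a s IH] sK; first by exists 1.
  have [|dd dd0 h] := IH; first by move=> x xs; apply: sK; rewrite inE xs orbT.
  have [da _] := hd a (sK _ (mem_head _ _)).
  exists (Num.min dd (d a / 2)); first by rewrite lt_min dd0 divr_gt0.
  move=> x; rewrite inE => /orP[/eqP->|/h xs]; first by rewrite ge_min lexx orbT.
  by rewrite ge_min xs.
exists dd => // x y Kx Ky xy.
have [z zs xz] := cov x Kx; have [dz hz] := hd z (sK _ zs).
have yz : cabs (y - z) < d z.
  have := cabs_tri y x z; rewrite (cabs_sub y x); have := hdd z zs; lra.
have xz' : cabs (x - z) < d z by lra.
move: (hz x Kx xz') (hz y Ky yz); rewrite !ltr_norml; lra.
Qed.

End Complex.

(** * Harmonic functions and the maximum principle *)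

Section Laplacian.
Variable R : realType.
Local Notation C := R[i].
Local Notation Re := (@complex.Re R).
Local Notation Im := (@complex.Im R).
Implicit Types (x y z w : C) (a b h e : R) (u v : C -> R).

(* Second order symmetric difference of [u], i.e. [h ^+ 2] times a discrete
   Laplacian; harmonicity is understood in this generalized sense. *)
Definition lap4 u x h : R :=
  u (x + h%:C) + u (x - h%:C) + u (x + h%:C * 'i) + u (x - h%:C * 'i) - 4 * u x.

Definition subh u x := forall e, 0 < e -> exists2 d : R, 0 < d &
  forall h, 0 < h -> h < d -> - (e * h ^+ 2) <= lap4 u x h.

Definition harm u x := forall e, 0 < e -> exists2 d : R, 0 < d &
  forall h, 0 < h -> h < d -> `|lap4 u x h| <= e * h ^+ 2.

Lemma harm_subh u x : harm u x -> subh u x.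
Proof.
move=> hu e /hu[d d0 hd]; exists d => // h h0 /(hd h h0).
by rewrite ler_norml => /andP[].
Qed.

Lemma lap4N u x h : lap4 (fun z => - u z) x h = - lap4 u x h.
Proof. by rewrite /lap4; ring. Qed.

Lemma lap4D u v x h : lap4 (fun z => u z + v z) x h = lap4 u x h + lap4 v x h.
Proof. by rewrite /lap4; ring. Qed.

Lemma lap4Z a u x h : lap4 (fun z => a * u z) x h = a * lap4 u x h.
Proof. by rewrite /lap4; ring. Qed.

Lemma harmN u x : harm u x -> harm (fun z => - u z) x.
Proof.
move=> hu e /hu[d d0 hd]; exists d => // h h0 hlt.
by rewrite lap4N normrN hd.
Qed.

Lemma harm_cst a x : harm (fun=> a) x.
Proof.
move=> e e0; exists 1 => // h h0 _.
have -> : lap4 (fun=> a) x h = 0 by rewrite /lap4; ring.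
by rewrite normr0 mulr_ge0 ?sqr_ge0// ltW.
Qed.

Lemma harmD u v x : harm u x -> harm v x -> harm (fun z => u z + v z) x.
Proof.
move=> hu hv e e0.
have [d d0 hd] := hu _ (divr_gt0 e0 (ltr0Sn _ 1)).
have [d' d0' hd'] := hv _ (divr_gt0 e0 (ltr0Sn _ 1)).
exists (Num.min d d'); first by rewrite lt_min d0.
move=> h h0; rewrite lt_min => /andP[/(hd h h0) h1 /(hd' h h0) h2].
by rewrite lap4D (le_trans (ler_normD _ _))//; lra.
Qed.

Lemma harmZ a u x : harm u x -> harm (fun z => a * u z) x.
Proof.
move=> hu e e0; have a1 : 0 < `|a| + 1 by rewrite ltr_wpDl.
have [d d0 hd] := hu _ (divr_gt0 e0 a1); exists d => // h h0 hlt.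
rewrite lap4Z normrM (le_trans (ler_wpM2l (normr_ge0 a) (hd h h0 hlt)))//.
by rewrite mulrA ler_wpM2r ?sqr_ge0// mulrA ler_pdivrMr// mulrC ler_pM2l// lerDl.
Qed.

Lemma harmB u v x : harm u x -> harm v x -> harm (fun z => u z - v z) x.
Proof. by move=> hu hv; apply: harmD => //; apply: harmN. Qed.

Lemma subhD u v x : subh u x -> subh v x -> subh (fun z => u z + v z) x.
Proof.
move=> hu hv e e0.
have [d d0 hd] := hu _ (divr_gt0 e0 (ltr0Sn _ 1)).
have [d' d0' hd'] := hv _ (divr_gt0 e0 (ltr0Sn _ 1)).
exists (Num.min d d'); first by rewrite lt_min d0.
move=> h h0; rewrite lt_min => /andP[/(hd h h0) h1 /(hd' h h0) h2].
by rewrite lap4D; lra.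
Qed.

Lemma dist_shift x w : cabs (x + w - x) = cabs w.
Proof. by rewrite addrAC subrr add0r. Qed.
Lemma cabs_hi h : cabs (h%:C * 'i) = `|h|.
Proof. by rewrite cabsZ cabs_i mulr1. Qed.

(** Raising a function near [x] without changing it at [x] can only increase [lap4]. This replaces
    the mean value property for maxima and for Perron modifications. *)
Lemma subh_touch u v x r : 0 < r -> (forall y, cabs (y - x) < r -> u y <= v y) ->
  u x = v x -> subh u x -> subh v x.
Proof.
move=> r0 uv uvx hu e /hu[d d0 hd]; exists (Num.min r d); first by rewrite lt_min r0.
move=> h h0; rewrite lt_min => /andP[hr /(hd h h0) h1]; apply: le_trans h1 _.
have h1 : `|h| < r by rewrite gtr0_norm.
rewrite /lap4 uvx lerD2r !lerD//; apply: uv; rewrite dist_shift ?cabsN ?cabs_real ?cabs_hi//.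
Qed.

Lemma subh_max u v x : subh u x -> subh v x -> subh (fun z => Num.max (u z) (v z)) x.
Proof.
move=> hu hv; have [uv|vu] := leP (u x) (v x).
  apply: (@subh_touch v _ x 1) => //; last by rewrite max_r.
  by move=> y _; rewrite le_max lexx orbT.
apply: (@subh_touch u _ x 1) => //; last by rewrite max_l// ltW.
by move=> y _; rewrite le_max lexx.
Qed.

Lemma harm_local u v x r : 0 < r -> (forall y, cabs (y - x) < r -> u y = v y) ->
  harm u x -> harm v x.
Proof.
move=> r0 uv hu e /hu[d d0 hd]; exists (Num.min r d); first by rewrite lt_min r0.
move=> h h0; rewrite lt_min => /andP[hr /(hd h h0)].
have h1 : `|h| < r by rewrite gtr0_norm.
by rewrite /lap4 !uv// ?subrr ?cabs0// dist_shift ?cabsN ?cabs_real ?cabs_hi.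
Qed.

Lemma subh_local u v x r : 0 < r -> (forall y, cabs (y - x) < r -> u y = v y) ->
  subh u x -> subh v x.
Proof.
move=> r0 uv; apply: (subh_touch r0) => [y /uv->//|].
by apply: uv; rewrite subrr cabs0.
Qed.

Lemma harm_scale u c a x : a != 0 -> harm u (c + a%:C * x) ->
  harm (fun z => u (c + a%:C * z)) x.
Proof.
move=> a0 hu e e0.
have a2 : 0 < a ^+ 2 by rewrite exprn_even_gt0.
have an : 0 < `|a| by rewrite normr_gt0.
have [d d0 hd] := hu _ (divr_gt0 e0 a2).
exists (d / `|a|); first by rewrite divr_gt0.
move=> h h0; rewrite ltr_pdivlMr// => hlt.
have -> : lap4 (fun z => u (c + a%:C * z)) x h = lap4 u (c + a%:C * x) (`|a| * h).
  rewrite /lap4 !mulrDr !mulrN !addrA !mulrA -!rmorphM/=.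
  have [a_ge0|a_lt0] := leP 0 a; first by rewrite ger0_norm.
  rewrite ltr0_norm// !mulNr !rmorphN/= !mulNr !opprK; ring.
have := hd (`|a| * h) (mulr_gt0 an h0).
rewrite [_ * h]mulrC => /(_ hlt); rewrite exprMn real_normK ?num_real//.
by rewrite [h ^+ 2 * _]mulrC mulrA divfK ?gt_eqF.
Qed.

Lemma cont_cabs_sqr (A : set C) : bnd A -> cont A (fun z => cabs z ^+ 2).
Proof.
move=> [M hM]; apply: (@cont_lip _ _ (M + M)) => x y Ax Ay.
rewrite subr_sqr normrM mulrC ler_pM//.
  by rewrite (le_trans (ler_normD _ _))// !ger0_norm ?cabs_ge0// lerD// hM.
rewrite ler_norml; have := cabs_leD x y; have := cabs_leD y x.
rewrite (cabs_sub y x); lra.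
Qed.

Lemma lap4_cabs2 x h : lap4 (fun z => cabs z ^+ 2) x h = 4 * h ^+ 2.
Proof.
rewrite /lap4 !cabs_sqr !(ReD, ReN, ImD, ImN, ReZ, ImZ) /=; ring.
Qed.

(** A multiple of [cabs z ^+ 2] makes the subsolution strict: at an interior maximum [lap4] is at
    most 0, but the perturbation contributes [4 * n * h ^+ 2] while [u] can lose only
    [n * h ^+ 2]. *)
Theorem max_principle (D : set C) u M : opn D -> bnd D -> cont (clos D) u ->
  (forall x, D x -> subh u x) -> (forall x, bd D x -> u x <= M) ->
  forall x, clos D x -> u x <= M.
Proof.
move=> oD bD cu hu hM x1 cx1; rewrite leNgt; apply/negP => Mx1.
have [B' hB'] := bnd_clos bD; pose B := Num.max B' 0.
have hB y : clos D y -> cabs y ^+ 2 <= B ^+ 2.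
  move=> /hB' h; rewrite ler_pXn2r ?nnegrE ?cabs_ge0//.
    by rewrite le_max h.
  by rewrite le_max lexx orbT.
have B1 : 0 < 2 * (B ^+ 2 + 1) by rewrite mulr_gt0// ltr_wpDl// sqr_ge0.
(* The closure lies in the disc of radius [B], so [n * B ^+ 2 < u x1 - M] keeps the maximum of [v]
   off the boundary. *)
pose n := (u x1 - M) / (2 * (B ^+ 2 + 1)).
have n0 : 0 < n by rewrite divr_gt0// subr_gt0.
have nB : n * B ^+ 2 < u x1 - M.
  rewrite /n mulrAC ltr_pdivrMr// ltr_pM2l ?subr_gt0//.
  by have := sqr_ge0 B; lra.
pose v z := u z + n * cabs z ^+ 2.
have cv : cont (clos D) v by apply/contD/contZ/cont_cabs_sqr/bnd_clos.
have [|xm cxm hxm] := cont_attains (bnd_clos bD) (@clos_clos _ D) _ cv.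
  by exists x1.
have Dxm : D xm.
  apply: contrapT => nD; have := hM xm (conj cxm nD); have := hxm x1 cx1.
  rewrite /v; have := ler_wpM2l (ltW n0) (hB _ cxm).
  have := mulr_ge0 (ltW n0) (sqr_ge0 (cabs x1)); lra.
have [r r0 hr] := oD _ Dxm; have [d d0 hd] := hu _ Dxm _ n0.
pose h := Num.min r d / 2.
have m0 : 0 < Num.min r d by rewrite lt_min r0.
have h0 : 0 < h by rewrite divr_gt0.
have hm : h < Num.min r d by rewrite /h; lra.
move: hm; rewrite lt_min => /andP[h_r h_d].
have := hd h h0 h_d; have h1 : `|h| < r by rewrite gtr0_norm.
have le z : cabs (z - xm) < r -> v z <= v xm by move=> /hr Dz; apply/hxm/sub_clos.
have := le (xm + h%:C); have := le (xm - h%:C).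
have := le (xm + h%:C * 'i); have := le (xm - h%:C * 'i).
rewrite !dist_shift !cabsN cabs_real cabs_hi => /(_ h1) l1 /(_ h1) l2 /(_ h1) l3 /(_ h1) l4.
have : lap4 v xm h <= 0 by rewrite /lap4; lra.
rewrite lap4D lap4Z lap4_cabs2.
have := mulr_gt0 n0 (exprn_gt0 2 h0); lra.
Qed.

Corollary max_principle_abs (D : set C) u M : opn D -> bnd D -> cont (clos D) u ->
  (forall x, D x -> harm u x) -> (forall x, bd D x -> `|u x| <= M) ->
  forall x, clos D x -> `|u x| <= M.
Proof.
move=> oD bD cu hu hM x cx; rewrite ler_norml lerNl; apply/andP; split.
  apply: (max_principle oD bD (contN cu)) cx => [y Dy|y /hM].
    exact/harm_subh/harmN/hu.
  by rewrite ler_norml lerNl => /andP[].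
apply: (max_principle oD bD cu) cx => [y Dy|y /hM]; first exact/harm_subh/hu.
by rewrite ler_norml => /andP[].
Qed.

Lemma harm_uniq (D : set C) u v : opn D -> bnd D -> cont (clos D) u -> cont (clos D) v ->
  (forall x, D x -> harm u x) -> (forall x, D x -> harm v x) ->
  (forall x, bd D x -> u x = v x) -> forall x, clos D x -> u x = v x.
Proof.
move=> oD bD cu cv hu hv uv x cx; apply/eqP; rewrite -subr_eq0 -normr_le0.
apply: (max_principle_abs oD bD (contB cu cv)) cx => y Dy.
  by apply: harmB; [exact: hu|exact: hv].
by rewrite uv// subrr normr0.
Qed.

Lemma cabs_nat n : cabs (n%:R : C) = n%:R.
Proof. by apply: complexI; rewrite cabsE normr_nat rmorph_nat. Qed.

Lemma cabsD_le z w a b : cabs z <= a -> cabs w <= b -> cabs (z + w) <= a + b.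
Proof. by move=> ha hb; rewrite (le_trans (cabsD _ _))// lerD. Qed.

(** Stands in for holomorphy: a complex second order expansion with cubic remainder is stable under
    products, inverses and affine substitutions, and is all that [lap4] sees. *)
Definition taylor3 (f : C -> C) (a : C) := exists c1 c2 : C, exists K r : R,
  [/\ 0 < r, 0 <= K & forall w, cabs w < r ->
    cabs (f (a + w) - (f a + c1 * w + c2 * w ^+ 2)) <= K * cabs w ^+ 3].

Lemma taylor3_cst c (a : C) : taylor3 (fun=> c) a.
Proof.
exists 0, 0, 0, 1; split=> // w _.
by rewrite !mul0r !addr0 subrr cabs0.
Qed.

Lemma taylor3_id (a : C) : taylor3 id a.
Proof.
exists 1, 0, 0, 1; split=> // w _.
by rewrite mul1r !mul0r addr0 subrr cabs0.
Qed.

Lemma taylor3_affine f c d (a : C) : taylor3 f (c * a + d) ->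
  taylor3 (fun z => f (c * z + d)) a.
Proof.
move=> [c1 [c2 [K [r [r0 K0 h]]]]].
exists (c1 * c), (c2 * c ^+ 2), (K * cabs c ^+ 3), (r / (cabs c + 1)).
have c0 : 0 < cabs c + 1 by rewrite ltr_wpDl// cabs_ge0.
split; [by rewrite divr_gt0|by rewrite mulr_ge0// exprn_ge0// cabs_ge0|].
move=> w; rewrite ltr_pdivlMr// => hw.
have hcw : cabs (c * w) < r.
  by rewrite cabsM mulrC (le_lt_trans _ hw)// ler_wpM2l ?cabs_ge0// lerDl.
have := h _ hcw; rewrite [cabs (c * w)]cabsM [(_ * _) ^+ 3]exprMn [K * (_ * _)]mulrA.
have -> : c * a + d + c * w = c * (a + w) + d by ring.
by have -> : f (c * a + d) + c1 * (c * w) + c2 * (c * w) ^+ 2 =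
          f (c * a + d) + c1 * c * w + c2 * c ^+ 2 * w ^+ 2 by ring.
Qed.

Lemma taylor3M f g (a : C) : taylor3 f a -> taylor3 g a -> taylor3 (fun z => f z * g z) a.
Proof.
move=> [c1 [c2 [K [r [r0 K0 hf]]]]] [d1 [d2 [L [s [s0 L0 hg]]]]].
pose A := cabs (c1 * d2 + c2 * d1) + cabs (c2 * d2) +
  K * (cabs (g a) + cabs d1 + cabs d2 + L) + (cabs (f a) + cabs c1 + cabs c2) * L.
exists (c1 * g a + f a * d1), (c2 * g a + c1 * d1 + f a * d2), A, (Num.min 1 (Num.min r s)).
have g0 := cabs_ge0 (g a); have f0 := cabs_ge0 (f a).
have c10 := cabs_ge0 c1; have c20 := cabs_ge0 c2.
have d10 := cabs_ge0 d1; have d20 := cabs_ge0 d2.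
split; first by rewrite !lt_min ltr01 r0.
  by rewrite /A !addr_ge0 ?cabs_ge0// mulr_ge0// !addr_ge0.
move=> w; rewrite !lt_min => /and3P[w1 /hf hw1 /hg hw2].
set t := cabs w in w1 hw1 hw2 *.
have t0 : 0 <= t := cabs_ge0 w.
have t1 : t <= 1 := ltW w1.
have t21 : t ^+ 2 <= 1 by rewrite exprn_ile1.
have t31 : t ^+ 3 <= 1 by rewrite exprn_ile1.
set E := f (a + w) - _ in hw1; set E' := g (a + w) - _ in hw2.
have -> : f (a + w) * g (a + w) - (f a * g a + (c1 * g a + f a * d1) * w +
    (c2 * g a + c1 * d1 + f a * d2) * w ^+ 2) =
  (c1 * d2 + c2 * d1) * w ^+ 3 + c2 * d2 * w ^+ 3 * w +
  E * (g a + d1 * w + d2 * w ^+ 2 + E') + (f a + c1 * w + c2 * w ^+ 2) * E'.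
  by rewrite /E /E'; ring.
rewrite /A !(mulrDl _ _ (t ^+ 3)).
apply: cabsD_le; [apply: cabsD_le; [apply: cabsD_le|]|].
- by rewrite cabsM cabsX.
- rewrite (cabsM _ w) (cabsM _ (w ^+ 3)) cabsX -/t -[leRHS]mulr1.
  by rewrite ler_wpM2l// mulr_ge0 ?exprn_ge0 ?cabs_ge0.
- rewrite cabsM [K * _ * _]mulrAC ler_pM ?cabs_ge0//.
  apply: cabsD_le; [apply: cabsD_le; [apply: cabsD_le|]|] => //.
  + by rewrite cabsM -/t -[leRHS]mulr1 ler_wpM2l.
  + by rewrite cabsM cabsX -/t -[leRHS]mulr1 ler_wpM2l.
  + by rewrite (le_trans hw2)// -[leRHS]mulr1 ler_wpM2l.
- rewrite cabsM -mulrA ler_pM ?cabs_ge0//.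
  apply: cabsD_le; [apply: cabsD_le|] => //.
  + by rewrite cabsM -/t -[leRHS]mulr1 ler_wpM2l.
  + by rewrite cabsM cabsX -/t -[leRHS]mulr1 ler_wpM2l.
Qed.

Lemma taylor3V (a : C) : a != 0 -> taylor3 (fun z => z^-1) a.
Proof.
move=> a0; have ca : 0 < cabs a by rewrite cabs_gt0.
exists (- a^-1 ^+ 2), (a^-1 ^+ 3), (2 / cabs a ^+ 4), (cabs a / 2).
split; [by rewrite divr_gt0|by rewrite divr_ge0// exprn_ge0// ltW|].
move=> w hw.
have haw : cabs a / 2 <= cabs (a + w).
  by have := cabs_leD a (- w); rewrite opprK cabsN; lra.
have aw0 : a + w != 0 by rewrite -cabs_gt0 (lt_le_trans _ haw)// divr_gt0.
have -> : (a + w)^-1 - (a^-1 + - a^-1 ^+ 2 * w + a^-1 ^+ 3 * w ^+ 2) =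
   - (w ^+ 3 * (a^-1 ^+ 3 * (a + w)^-1)) by field; rewrite a0 aw0.
rewrite cabsN (cabsM (w ^+ 3)) (cabsM (a^-1 ^+ 3)) !cabsX !cabsV mulrC ler_wpM2r ?exprn_ge0 ?cabs_ge0//.
have -> : 2 / cabs a ^+ 4 = (cabs a)^-1 ^+ 3 * (cabs a / 2)^-1.
  by field; rewrite gt_eqF.
by rewrite ler_wpM2l ?exprn_ge0 ?invr_ge0 ?cabs_ge0// lef_pV2// posrE ?divr_gt0// cabs_gt0.
Qed.

(** The principal root has nonnegative real part everywhere, so [sqrtc (a + w) + s] stays at
    distance at least [Re s] from 0 even if [a + w] crosses the cut. Dividing by it bounds the
    increment [k], and [2 * s * k + k ^+ 2 = w] makes the remainder a multiple of [k ^+ 3]. *)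
Lemma taylor3_sqrt (a : C) : 0 < Re (sqrtc a) -> taylor3 (@sqrtc R) a.
Proof.
move=> s0; set s := sqrtc a; have sE : s ^+ 2 = a := sqr_sqrtc a.
have cs : Re s <= cabs s := le_trans (ler_norm _) (Re_le s).
have cs0 : 0 < cabs s by exact: lt_le_trans cs.
have sn : s != 0 by rewrite -cabs_gt0.
exists ((2 * s)^-1), (- (8 * s ^+ 3)^-1).
pose A := (Re s)^-1; have A0 : 0 < A by rewrite invr_gt0.
exists (A ^+ 3 * ((4 * cabs s + A) / (8 * cabs s ^+ 3))), 1; split=> //.
  by rewrite !mulr_ge0 ?exprn_ge0 ?invr_ge0 ?addr_ge0 ?mulr_ge0 ?exprn_ge0 ?cabs_ge0// ltW.
move=> w w1; set k := sqrtc (a + w) - s.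
have kE : k * (sqrtc (a + w) + s) = w.
  by rewrite /k -subr_sqr sqr_sqrtc sE; ring.
have kE2 : 2 * s * k + k ^+ 2 = w by rewrite -kE /k; ring.
have Re2 : Re s <= cabs (sqrtc (a + w) + s).
  rewrite (le_trans _ (Re_le _))// (le_trans _ (ler_norm _))// ReD lerDr.
  rewrite /sqrtc; case: (a + w) => p q /=; exact: sqrtr_ge0.
have hk : cabs k <= A * cabs w.
  rewrite -kE cabsM mulrCA -[leLHS]mulr1 ler_wpM2l ?cabs_ge0//.
  by rewrite /A -ler_pdivrMl ?invr_gt0// invrK mulr1.
have -> : sqrtc (a + w) - (s + (2 * s)^-1 * w + - (8 * s ^+ 3)^-1 * w ^+ 2) =
   k ^+ 3 * (4 * s + k) / (8 * s ^+ 3).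
  have -> : sqrtc (a + w) = k + s by rewrite /k subrK.
  by rewrite -kE2; field.
rewrite (cabsM _ (8 * s ^+ 3)^-1) (cabsM (k ^+ 3)) cabsV (cabsM 8) !cabsX.
have -> : cabs 8 = 8 :> R by rewrite cabs_nat.
have -> : A ^+ 3 * ((4 * cabs s + A) / (8 * cabs s ^+ 3)) * cabs w ^+ 3 =
  (A * cabs w) ^+ 3 * (4 * cabs s + A) / (8 * cabs s ^+ 3) by ring.
rewrite ler_wpM2r ?invr_ge0 ?mulr_ge0 ?exprn_ge0 ?cabs_ge0//.
rewrite ler_pM ?exprn_ge0 ?cabs_ge0// ?lerXn2r ?nnegrE ?mulr_ge0 ?cabs_ge0// ?(ltW A0)//.
apply: cabsD_le.
  by rewrite cabsM cabs_nat.
by rewrite (le_trans hk)// -[leRHS]mulr1 ler_wpM2l// ltW.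
Qed.

(** In the sum over the four points of the cross the linear terms cancel in pairs and the quadratic
    ones because the square of ['i] is [-1]; four cubic remainders are left. *)
Lemma taylor3_harm f (a : C) : taylor3 f a -> harm (Re \o f) a.
Proof.
move=> [c1 [c2 [K [r [r0 K0 hf]]]]] e e0.
have K1 : 0 < 4 * K + 1 by rewrite ltr_wpDl// mulr_ge0.
exists (Num.min r (e / (4 * K + 1))); first by rewrite lt_min r0 divr_gt0.
move=> h h0; rewrite lt_min => /andP[hr]; rewrite ltr_pdivlMr// => he.
have hn : `|h| < r by rewrite gtr0_norm.
pose E w := f (a + w) - (f a + c1 * w + c2 * w ^+ 2).
have hE w : cabs w = h -> cabs (E w) <= K * h ^+ 3 by move=> hw; rewrite -hw; apply: hf; rewrite hw.
have -> : lap4 (Re \o f) a h = Re (E h%:C + E (- h%:C) + E (h%:C * 'i) + E (- (h%:C * 'i))).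
  have -> : E h%:C + E (- h%:C) + E (h%:C * 'i) + E (- (h%:C * 'i)) =
    f (a + h%:C) + f (a - h%:C) + f (a + h%:C * 'i) + f (a - h%:C * 'i) - 4%:R%:C * f a.
    have ii : 'i ^+ 2 = -1 :> C := sqr_i _.
    rewrite /E !exprMn !sqrrN !exprMn ii rmorph_nat; ring.
  by rewrite /lap4 /= !ReD ReN ReZ.
clearbody E.
rewrite (le_trans (Re_le _))//.
have : cabs (E h%:C + E (- h%:C) + E (h%:C * 'i) + E (- (h%:C * 'i))) <=
   K * h ^+ 3 + K * h ^+ 3 + K * h ^+ 3 + K * h ^+ 3.
  by do 3?[apply: cabsD_le]; apply: hE; rewrite ?cabsN ?cabs_hi ?cabs_real gtr0_norm.
move/le_trans; apply.
have := ler_wpM2r (sqr_ge0 h) (ltW he); have := exprn_gt0 3 h0.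
have -> : h * (4 * K + 1) * h ^+ 2 = K * h ^+ 3 + K * h ^+ 3 + K * h ^+ 3 + K * h ^+ 3 + h ^+ 3 by ring.
lra.
Qed.

Lemma ln_le_sub1 a : 0 < a -> ln a <= a - 1.
Proof.
move=> a0; have := @le_ln1Dx R (a - 1); have -> : 1 + (a - 1) = a by ring.
by apply; lra.
Qed.

(** The four points of the cross around [a] multiply to [a ^+ 4 - h ^+ 4], so the second difference
    of the logarithm is exactly [ln (cabs (1 - w))] with [w] the fourth power of [h / a]. *)
Lemma harm_ln (a : C) : a != 0 -> harm (fun z => ln (cabs z)) a.
Proof.
move=> a0 e e0; have ca : 0 < cabs a by rewrite cabs_gt0.
pose K := 2 / cabs a ^+ 4; have K0 : 0 < K by rewrite divr_gt0// exprn_gt0.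
exists (Num.min (Num.min 1 (cabs a / 2)) (e / K)).
  by rewrite !lt_min ltr01 (divr_gt0 ca)// (divr_gt0 e0 K0).
move=> h h0; rewrite !lt_min => /andP[/andP[h1 h2]]; rewrite ltr_pdivlMr// => hK.
have nz w : cabs w = h -> 0 < cabs (a + w).
  move=> hw; have := cabs_leD a (- w); rewrite opprK cabsN hw; lra.
have n1 : 0 < cabs (a + h%:C) by apply: nz; rewrite cabs_real gtr0_norm.
have n2 : 0 < cabs (a - h%:C) by apply: nz; rewrite cabsN cabs_real gtr0_norm.
have n3 : 0 < cabs (a + h%:C * 'i) by apply: nz; rewrite cabs_hi gtr0_norm.
have n4 : 0 < cabs (a - h%:C * 'i) by apply: nz; rewrite cabsN cabs_hi gtr0_norm.
pose w := h%:C ^+ 4 / a ^+ 4.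
have cw : cabs w = h ^+ 4 / cabs a ^+ 4.
  by rewrite (cabsM _ (a ^+ 4)^-1) cabsV !cabsX cabs_real gtr0_norm.
have w12 : cabs w <= 1 / 2.
  rewrite cw ler_pdivrMr ?exprn_gt0//.
  have : h ^+ 4 <= (cabs a / 2) ^+ 4 by rewrite lerXn2r ?nnegrE ?divr_ge0// ?ltW.
  have := exprn_gt0 4 ca; rewrite expr_div_n; lra.
have prd : cabs (a + h%:C) * cabs (a - h%:C) * cabs (a + h%:C * 'i) * cabs (a - h%:C * 'i)
   = cabs a ^+ 4 * cabs (1 - w).
  rewrite -!cabsM -cabsX -cabsM; congr cabs.
  have ii : 'i ^+ 2 = -1 :> C := sqr_i _.
  have -> : a ^+ 4 * (1 - w) = a ^+ 4 - h%:C ^+ 4 by rewrite /w; field.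
  have -> : (a + h%:C) * (a - h%:C) * (a + h%:C * 'i) * (a - h%:C * 'i) =
    (a ^+ 2 - h%:C ^+ 2) * (a ^+ 2 - h%:C ^+ 2 * 'i ^+ 2) by ring.
  rewrite ii; ring.
have c1w : `|cabs (1 - w) - 1| <= cabs w.
  rewrite ler_norml; have := cabs_leD 1 w; have := cabs_leD (1 - w) 1.
  rewrite addrAC subrr add0r cabsN cabs1; lra.
have c1w0 : 1 / 2 <= cabs (1 - w) by move: c1w; rewrite ler_norml; lra.
have c1wp : 0 < cabs (1 - w) by lra.
have -> : lap4 (fun z => ln (cabs z)) a h = ln (cabs (1 - w)).
  rewrite /lap4 -!lnM ?posrE ?mulr_gt0// prd lnM ?posrE ?exprn_gt0//.
  rewrite lnXn// mulr_natl; ring.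
have le1 : ln (cabs (1 - w)) <= cabs w.
  by rewrite (le_trans (ln_le_sub1 c1wp))//; move: c1w; rewrite ler_norml; lra.
have le2 : - ln (cabs (1 - w)) <= 2 * cabs w.
  have ci0 : 0 < (cabs (1 - w))^-1 by rewrite invr_gt0.
  rewrite -lnV ?posrE// (le_trans (ln_le_sub1 ci0))//.
  rewrite lerBlDr -(mul1r (cabs (1 - w))^-1) ler_pdivrMr//.
  have : 0 <= cabs w := cabs_ge0 _; move: c1w; rewrite ler_norml => /andP[c1 _].
  nra.
have : `|ln (cabs (1 - w))| <= 2 * cabs w.
  by rewrite ler_norml lerNl le2; have := cabs_ge0 w; lra.
move/le_trans; apply; rewrite cw.
have -> : 2 * (h ^+ 4 / cabs a ^+ 4) = (h * K) * h * h ^+ 2 by rewrite /K; ring.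
rewrite ler_wpM2r ?sqr_ge0//; have := mulr_gt0 h0 K0; nra.
Qed.

End Laplacian.

(** * Harmonic polynomials and the disc *)

Section Fourier.
Variable R : realType.
Local Notation C := R[i].
Local Notation Re := (@complex.Re R).
Local Notation Im := (@complex.Im R).
Implicit Types (x y z w t : C) (u v f : C -> R) (c d : nat -> C).

Lemma conjM z w : (z * w)^* = z^* * w^*. Proof. exact: rmorphM. Qed.

Lemma conj_sum n (F : 'I_n -> C) : (\sum_(i < n) F i)^* = \sum_(i < n) (F i)^*.
Proof. exact: rmorph_sum. Qed.
Lemma conjX z n : (z ^+ n)^* = z^* ^+ n. Proof. exact: rmorphXn. Qed.

Lemma prim_root_ex n : exists z : C, n.+1.-primitive_root z.
Proof.
pose p : {poly C} := 'X^(n.+1) - 1; have [r Dp] := closed_field_poly_normal p.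
rewrite (monicP _) ?monicXnsubC// scale1r in Dp.
have rn1 : all n.+1.-unity_root r by apply/allP=> z; rewrite -root_prod_XsubC -Dp.
have sz_r : (n.+1 < (size r).+1)%N by rewrite -(size_prod_XsubC r id) -Dp size_XnsubC.
have [|z] := hasP (has_prim_root (ltn0Sn n) rn1 _ sz_r); last by exists z.
by rewrite -separable_prod_XsubC -Dp separable_Xn_sub_1// pnatr_eq0.
Qed.

(** Its powers are the [n + 1] equidistant nodes on the unit circle. Averages over them take the
    place of integrals and are exact on harmonic polynomials of low degree. *)
Definition wr n : C := xget 0 [set z : C | n.+1.-primitive_root z].

Lemma wrP n : n.+1.-primitive_root (wr n).
Proof. by have [z hz] := prim_root_ex n; rewrite /wr; case: xgetP => [w -> //|/(_ z)]. Qed.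

Lemma cabs_wr n j : cabs (wr n ^+ j) = 1.
Proof.
have h : cabs (wr n) ^+ n.+1 = 1 by rewrite -cabsX (prim_expr_order (wrP n)) cabs1.
have /eqP : cabs (wr n) ^+ n.+1 == 1 by apply/eqP.
move/eqP; rewrite pexpr_eq1 ?cabs_ge0// => /eqP h1.
by rewrite cabsX h1 expr1n.
Qed.

Lemma conj_unit z : cabs z = 1 -> z * z^* = 1.
Proof.
move=> h; apply: complex_ext; rewrite !(ReM, ImM) ReJ ImJ /=; last ring.
by rewrite mulrN opprK -!expr2 -cabs_sqr h expr1n.
Qed.

Lemma sum_wr n k : (0 < k <= n)%N -> \sum_(j < n.+1) (wr n ^+ j) ^+ k = 0.
Proof.
move=> /andP[k0 kn]; have wk : wr n ^+ k != 1.
  rewrite -(prim_order_dvd (wrP n)); apply/negP => /dvdn_leq.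
  by move=> /(_ k0); rewrite ltnNge kn.
have := subrX1 (wr n ^+ k) n.+1; rewrite -exprM mulnC exprM (prim_expr_order (wrP n)) expr1n subrr.
move/esym/eqP; rewrite mulf_eq0 subr_eq0 (negPf wk)/= => /eqP h; rewrite -[RHS]h.
by apply: eq_bigr => j _; rewrite -!exprM mulnC.
Qed.

Lemma sum_wrJ n k l : (k < n.+1)%N -> (l < n.+1)%N ->
  \sum_(j < n.+1) (wr n ^+ j) ^+ l * ((wr n ^+ j)^*) ^+ k = (n.+1%:R) *+ (l == k).
Proof.
move=> kn ln; have E (j : 'I_n.+1) : (wr n ^+ j) ^+ l * ((wr n ^+ j)^*) ^+ k =
    if (k <= l)%N then (wr n ^+ j) ^+ (l - k) else (((wr n ^+ j) ^+ (k - l)))^*.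
  move: (cabs_wr n j); move: (wr n ^+ j) => w cw; case: leqP => kl.
    by rewrite -{1}(subnK kl) exprD -mulrA -exprMn conj_unit// expr1n mulr1.
  rewrite conjX -{1}(subnK (ltnW kl)) exprD mulrCA -exprMn.
  by rewrite conj_unit// expr1n mulr1.
rewrite (eq_bigr _ (fun j _ => E j)); case: (ltngtP l k) => lk.
- rewrite -conj_sum sum_wr ?conjc0// subn_gt0 lk/=.
  by rewrite (leq_trans (leq_subr _ _)).
- by rewrite sum_wr// subn_gt0 lk (leq_trans (leq_subr _ _)).
- by rewrite lk subnn (eq_bigr (fun=> 1)) ?sumr_const ?card_ord.
Qed.

Lemma sum_wrJJ n k l : (k + l < n.+1)%N ->
  \sum_(j < n.+1) ((wr n ^+ j) ^+ l)^* * ((wr n ^+ j)^*) ^+ k = (n.+1%:R) *+ (k + l == 0)%N.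
Proof.
move=> kln; have E (j : 'I_n.+1) : ((wr n ^+ j) ^+ l)^* * ((wr n ^+ j)^*) ^+ k =
    (((wr n ^+ j) ^+ (k + l)))^*.
  by rewrite !conjX exprD mulrC.
rewrite (eq_bigr _ (fun j _ => E j)) -conj_sum.
case: (posnP (k + l)) => kl.
  by rewrite kl (eq_bigr (fun=> 1)) ?sumr_const ?card_ord ?conjc_nat.
by rewrite sum_wr ?kl// conjc0.
Qed.

Definition dft n u k : C := n.+1%:R^-1 * \sum_(j < n.+1) (u (wr n ^+ j))%:C * ((wr n ^+ j)^*) ^+ k.

Definition wt (k : nat) : C := if k == 0%N then 1 else 2.

(* The harmonic polynomial [Re (c_0 + 2 c_1 z + 2 c_2 z^2 + ...)], the factor [2] making
   [c_k] the usual Fourier coefficients. *)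
Definition hp n c z : R := Re (\sum_(k < n) wt k * c k * z ^+ k).

(** The imaginary part of [c 0] is invisible in [hp]; fixing it to 0 makes the coefficients
    unique. *)
Definition fin_supp n c := Im (c 0%N) = 0 /\ forall k, (n <= k)%N -> c k = 0.

Lemma Re2 z : Re (2 * z) = 2 * Re z.
Proof. by rewrite mulr_natl mulr2n ReD; ring. Qed.

Lemma ReC2 z : (Re z)%:C = (z + z^*) / 2.
Proof. exact: ReJ_add. Qed.

(** With at least [n + k] nodes, guaranteed by [n + k < N.+1], neither the powers nor their
    conjugates alias with order [k]. A frequency [l > 0] and its conjugate each carry [wt l / 2],
    which is the reason for the factor 2 in [wt]. *)
Lemma dft_hp n c N k : fin_supp n c -> (n + k < N.+1)%N -> dft N (hp n c) k = c k.
Proof.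
move=> [c0 cn] nk.
have N0 : (N.+1%:R : C) != 0 by rewrite pnatr_eq0.
rewrite /dft; apply: (canLR (mulKf N0)).
have E (j : 'I_N.+1) : (hp n c (wr N ^+ j))%:C * ((wr N ^+ j)^*) ^+ k =
   \sum_(l < n) (wt l / 2 * c l * ((wr N ^+ j) ^+ l * ((wr N ^+ j)^*) ^+ k) +
     wt l / 2 * (c l)^* * (((wr N ^+ j) ^+ l)^* * ((wr N ^+ j)^*) ^+ k)).
  rewrite /hp ReC2 conj_sum -big_split/= mulr_suml mulr_suml; apply: eq_bigr => l _.
  rewrite !conjM; have -> : (wt l)^* = wt l.
    by rewrite /wt; case: ifP => _; rewrite ?conjc1// conjc_nat.
  by field.
rewrite (eq_bigr _ (fun j _ => E j)) exchange_big/=.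
have E2 (l : 'I_n) : \sum_(j < N.+1) (wt l / 2 * c l * ((wr N ^+ j) ^+ l * ((wr N ^+ j)^*) ^+ k) +
     wt l / 2 * (c l)^* * (((wr N ^+ j) ^+ l)^* * ((wr N ^+ j)^*) ^+ k)) =
   if (l : nat) == k then N.+1%:R * c k else 0.
  have ln : (l < N.+1)%N by apply: leq_trans nk; rewrite ltnS (leq_trans (ltnW (ltn_ord l)))// leq_addr.
  have kn : (k < N.+1)%N by apply: leq_ltn_trans nk; rewrite leq_addl.
  have kl : (k + l < N.+1)%N by apply: leq_trans nk; rewrite ltnS addnC leq_add2r ltnW.
  rewrite big_split/= -!mulr_sumr sum_wrJ// sum_wrJJ// addn_eq0.
  case: eqP => [->|lk].
    case: (posnP k) => [->|k0].
      rewrite /wt /= !mulr1n; have -> : (c 0%N)^* = c 0%N.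
        by apply: complex_ext; rewrite ?ReJ// ImJ c0 oppr0.
      by field.
    by rewrite /= mulr1n mulr0n mulr0 addr0 /wt gtn_eqF//; field.
  rewrite mulr0n mulr0 add0r; case: eqP => //= k0; last by rewrite mulr0n mulr0.
  by case: eqP => //= l0; [move: lk; rewrite k0 l0|rewrite mulr0n mulr0].
rewrite (eq_bigr _ (fun l _ => E2 l)).
have [kn|kn] := ltnP k n; last first.
  by rewrite cn// mulr0 big1// => l _; case: ifP.
rewrite (bigD1 (Ordinal kn))//= eqxx big1 ?addr0// => l.
by move=> hl; case: eqP => // h; case/eqP: hl; apply/val_inj.
Qed.

Lemma dft_bound n u k M : (forall z, cabs z = 1 -> `|u z| <= M) -> cabs (dft n u k) <= M.
Proof.
move=> hu; rewrite /dft cabsM cabsV cabs_nat ler_pdivrMl ?ltr0Sn//.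
rewrite (le_trans (cabs_sum _ _ _))//.
have -> : n.+1%:R * M = \sum_(j < n.+1) M by rewrite sumr_const card_ord mulr_natl.
apply: ler_sum => j _; rewrite cabsM cabs_real cabsX cabsJ cabs_wr expr1n mulr1.
by rewrite hu// cabs_wr.
Qed.

Lemma dft_pos n u k : (forall z, cabs z = 1 -> 0 <= u z) ->
  cabs (dft n u k) <= Re (dft n u 0).
Proof.
move=> hu; rewrite /dft; rewrite (_ : n.+1%:R^-1 = (n.+1%:R^-1 : R)%:C :> C); last first.
  by rewrite fmorphV rmorph_nat.
rewrite cabsZ ReZ ger0_norm ?invr_ge0// ler_wpM2l ?invr_ge0//.
rewrite (le_trans (cabs_sum _ _ _))// Re_sum; apply: ler_sum => j _.
rewrite cabsM cabs_real cabsX cabsJ cabs_wr expr1n expr0 !mulr1 /=.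
by rewrite ger0_norm// hu// cabs_wr.
Qed.

Lemma dftD n u v k : dft n (fun z => u z + v z) k = dft n u k + dft n v k.
Proof.
rewrite /dft -mulrDr -big_split/=; congr (_ * _); apply: eq_bigr => j _.
by rewrite rmorphD/= mulrDl.
Qed.

Lemma dftZ n (a : R) u k : dft n (fun z => a * u z) k = a%:C * dft n u k.
Proof.
rewrite /dft [RHS]mulrCA; congr (_ * _); rewrite mulr_sumr; apply: eq_bigr => j _.
by rewrite rmorphM/= mulrA.
Qed.

Lemma dft_eq n u v k : (forall z, cabs z = 1 -> u z = v z) -> dft n u k = dft n v k.
Proof.
move=> h; rewrite /dft; congr (_ * _); apply: eq_bigr => j _.
by rewrite h// cabs_wr.
Qed.

Definition fejer n t : R := Re (\sum_(k < n) wt k * (1 - k%:R / n%:R) * t ^+ k).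

(* [n * fejer n t = |1 + t + ... + t^(n-1)|^2] on the unit circle *)
Lemma fejer_ge0 n t : cabs t = 1 -> 0 <= fejer n.+1 t.
Proof.
move=> ht; pose A m : C := \sum_(k < m) t ^+ k.
pose G m : C := \sum_(k < m) wt k * (m%:R - k%:R) * t ^+ k.
have AE m : Re (t ^+ m * (A m)^*) = Re (\sum_(k < m) t ^+ k.+1).
  congr Re; rewrite /A conj_sum mulr_sumr [RHS](reindex_inj rev_ord_inj)/=.
  apply: eq_bigr => k _; rewrite conjX -subSn ?ltn_ord// subSS.
  rewrite -{1}(subnK (ltnW (ltn_ord k))) exprD -mulrA -exprMn conj_unit// expr1n mulr1//.
have GE m : Re (G m) = cabs (A m) ^+ 2.
  elim: m => [|m IH]; first by rewrite /G /A !big_ord0 cabs0 expr0n.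
  have -> : cabs (A m.+1) ^+ 2 = cabs (A m) ^+ 2 + 2 * Re (t ^+ m * (A m)^*) + cabs (t ^+ m) ^+ 2.
    rewrite /A big_ord_recr/= -/(A m) !cabs_sqr !(ReD, ImD, ReM, ImM, ReJ, ImJ); ring.
  rewrite cabsX ht !expr1n AE -IH.
  rewrite -[X in X = _]/(Re (\sum_(k < m.+1) _)) !Re_sum mulr_sumr.
  have -> : \sum_(i < m.+1) Re (wt i * (m.+1%:R - i%:R) * t ^+ i) =
    \sum_(i < m.+1) Re (wt i * (m%:R - i%:R) * t ^+ i) + \sum_(i < m.+1) Re (wt i * t ^+ i).
    rewrite -big_split/=; apply: eq_bigr => i _; rewrite -ReD; congr Re.
    by have -> : m.+1%:R = m%:R + 1 :> C by [rewrite -natr1]; ring.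
  rewrite big_ord_recr/= subrr mulr0 mul0r addr0 -addrA; congr (_ + _).
  rewrite big_ord_recl addrC; congr (_ + _); first by rewrite expr0 mulr1.
  by apply: eq_bigr => i _; rewrite /wt/= Re2.
have -> : fejer n.+1 t = n.+1%:R^-1 * Re (G n.+1).
  rewrite -ReZ /fejer /G mulr_sumr; congr Re; apply: eq_bigr => k _.
  rewrite fmorphV rmorph_nat; have : n.+1%:R != 0 :> C by rewrite pnatr_eq0.
  by move: (n.+1%:R : C) => N N0; field.
by rewrite GE mulr_ge0 ?invr_ge0 ?sqr_ge0.
Qed.

(** Fejer means built from discrete coefficients; [n + 2] nodes make those of order below [n] exact
    on [hp 2], which is where Korovkin's argument tests the operator. *)
Definition fejer_op n u : {poly C} :=
  \poly_(k < n) (wt k * (1 - k%:R / n%:R) * dft n.+1 u k).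

Lemma fejer_opE n u z : Re (fejer_op n u).[z] =
  n.+2%:R^-1 * \sum_(j < n.+2) u (wr n.+1 ^+ j) * fejer n (z * (wr n.+1 ^+ j)^*).
Proof.
rewrite horner_poly.
have -> : \sum_(i < n) wt i * (1 - i%:R / n%:R) * dft n.+1 u i * z ^+ i =
  (n.+2%:R^-1 : R)%:C * \sum_(j < n.+2) (u (wr n.+1 ^+ j))%:C *
     \sum_(i < n) wt i * (1 - i%:R / n%:R) * (z * (wr n.+1 ^+ j)^*) ^+ i.
  rewrite mulr_sumr; under [RHS]eq_bigr do rewrite !mulr_sumr.
  rewrite exchange_big/=; apply: eq_bigr => i _.
  rewrite /dft fmorphV rmorph_nat mulrA mulr_sumr mulr_suml; apply: eq_bigr => j _.
  by rewrite exprMn; ring.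
rewrite ReZ Re_sum; congr (_ * _); apply: eq_bigr => j _.
by rewrite ReZ.
Qed.

Lemma fejer_op_hp n c z : fin_supp 2 c ->
  Re (fejer_op n.+1 (hp 2 c)).[z] = hp n.+1 (fun k => (1 - k%:R / n.+1%:R) * c k) z.
Proof.
move=> hc; rewrite horner_poly /hp; congr Re; apply: eq_bigr => k _.
rewrite dft_hp//; last by rewrite addnC !addnS addn0 !ltnS; exact: ltn_ord k.
by ring.
Qed.
End Fourier.

(** * Approximation by harmonic polynomials and the Dirichlet problem in a disc *)

Section Approximation.
Variable R : realType.
Local Notation C := R[i].
Local Notation Re := (@complex.Re R).
Local Notation Im := (@complex.Im R).
Local Notation wr := (wr R).
Implicit Types (x y z w t a b : C) (u v f : C -> R) (c d : nat -> C).

Lemma nested (a b : nat -> R) : (forall n m, a n <= b m) ->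
  exists l, forall n, a n <= l <= b n.
Proof.
move=> ab; have ne : range a !=set0 by exists (a 0%N), 0%N.
exists (sup (range a)) => n; apply/andP; split.
  by apply: ub_le_sup; [exists (b 0%N) => _ [m _ <-]|exists n].
by apply: ge_sup => // _ [m _ <-].
Qed.

Lemma inv_lt (e : R) : 0 < e -> exists n : nat, n.+1%:R^-1 < e.
Proof.
move=> e0; exists (Num.truncn e^-1); rewrite invf_plt ?posrE// ?ltr0Sn//.
by rewrite truncnS_gt// invr_ge0 ltW.
Qed.

Lemma cauchy_limit (s : nat -> R) :
  (forall n m, `|s n - s m| <= n.+1%:R^-1 + m.+1%:R^-1) ->
  exists l, forall n, `|s n - l| <= n.+1%:R^-1.
Proof.
move=> hs; have [|l hl] := @nested (fun n => s n - n.+1%:R^-1) (fun n => s n + n.+1%:R^-1).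
  move=> n m /=; have := hs n m; rewrite ler_norml.
  by move: (n.+1%:R^-1) (m.+1%:R^-1) => p q; lra.
exists l => n; have /= := hl n; rewrite ler_norml.
by move: (n.+1%:R^-1) => p; lra.
Qed.

Lemma taylor3_cont (f : C -> C) (A : set C) : (forall a, A a -> taylor3 f a) -> cont A (Re \o f).
Proof.
move=> hf a Aa e e0; have [c1 [c2 [K [r [r0 K0 h]]]]] := hf a Aa.
pose L := cabs c1 + cabs c2 + K + 1.
have L0 : 0 < L by rewrite ltr_wpDl// !addr_ge0// cabs_ge0.
exists (Num.min (Num.min 1 r) (e / L)); first by rewrite !lt_min ltr01 r0 divr_gt0.
move=> y _; rewrite !lt_min ltr_pdivlMr// => /andP[/andP[y1 yr] ye].
rewrite /= -ReB (le_lt_trans (Re_le _))//; apply: le_lt_trans ye.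
set w := y - a in y1 yr *; have -> : y = a + w by rewrite /w addrC subrK.
have -> : f (a + w) - f a = (f (a + w) - (f a + c1 * w + c2 * w ^+ 2)) + (c1 * w + c2 * w ^+ 2).
  by ring.
have w2 : cabs w ^+ 2 <= cabs w by rewrite expr2 ler_piMr ?cabs_ge0// ltW.
have w3 : cabs w ^+ 3 <= cabs w.
  by rewrite exprS ler_piMr ?cabs_ge0// exprn_ile1 ?cabs_ge0// ltW.
rewrite (le_trans (cabsD _ _))// (le_trans (lerD (h w yr) (cabsD _ _)))//.
rewrite (cabsM c1) (cabsM c2) cabsX.
have := ler_wpM2l K0 w3; have := ler_wpM2l (cabs_ge0 c2) w2.
have := cabs_ge0 w; rewrite /L; lra.
Qed.

Lemma taylor3D (f g : C -> C) a : taylor3 f a -> taylor3 g a -> taylor3 (fun z => f z + g z) a.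
Proof.
move=> [c1 [c2 [K [r [r0 K0 hf]]]]] [d1 [d2 [L [s [s0 L0 hg]]]]].
exists (c1 + d1), (c2 + d2), (K + L), (Num.min r s); split.
- by rewrite lt_min r0.
- by rewrite addr_ge0.
move=> w; rewrite lt_min => /andP[/hf hw1 /hg hw2].
rewrite [leRHS]mulrDl; apply: le_trans _ (cabsD_le hw1 hw2).
by rewrite le_eqVlt; apply/orP; left; apply/eqP; congr cabs; ring.
Qed.

Lemma taylor3_poly (P : {poly C}) a : taylor3 (fun z => P.[z]) a.
Proof.
elim/poly_ind: P => [|P b IH].
  have := taylor3_cst 0 a; congr (taylor3 _ a).
  by apply/funext => z; rewrite horner0.
have := taylor3D (taylor3M IH (taylor3_id a)) (taylor3_cst b a).
by congr (taylor3 _ a); apply/funext => z; rewrite hornerMXaddC.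
Qed.

Definition dil a (r : R) u z := u (a + r%:C * z).
(** Amounts to continuity on the closed disc and harmonicity inside, see [harm_apx], [apx_cont] and
    [apx_harm]. This form is closed under uniform limits and gives expansions and compositions
    directly. *)
Definition apx u := forall e : R, 0 < e -> exists P : {poly C},
  forall z, cabs z <= 1 -> `|u z - Re P.[z]| <= e.
Local Notation circ := [set z : C | cabs z = 1].

Lemma bnd_circ : bnd circ.
Proof. by exists 1 => z /= ->. Qed.

Lemma clos_circ : clos circ `<=` circ.
Proof.
move=> z h; apply/eqP; rewrite eq_le; apply/andP; split; rewrite leNgt; apply/negP => hlt.
  have [|w /= cw wz] := h (cabs z - 1); first by rewrite subr_gt0.
  by have := cabs_leD z w; rewrite cw (cabs_sub z w); lra.
have [|w /= cw wz] := h (1 - cabs z); first by rewrite subr_gt0.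
by have := cabs_leD w z; rewrite cw; lra.
Qed.

Lemma cont_bounded (K : set C) f : bnd K -> clos K `<=` K -> cont K f ->
  exists2 M : R, 0 <= M & forall x, K x -> `|f x| <= M.
Proof.
move=> bK cK cf; have [[x0 Kx0]|n] := pselect (exists x, K x); last first.
  by exists 0 => // x Kx; case: n; exists x.
have ex : exists x, K x by exists x0.
have [x Kx hx] := cont_attains bK cK ex cf.
have [y Ky hy] := cont_attains bK cK ex (contN cf).
exists (`|f x| + `|f y|); first by rewrite addr_ge0.
move=> z Kz; rewrite ler_norml; have := hx z Kz; have := hy z Kz.
have := ler_norm (f x); have := ler_norm (- f y); rewrite normrN.
have := normr_ge0 (f x); have := normr_ge0 (f y); lra.
Qed.

(* Korovkin's argument: a positive operator, exact on constants, whose error on the first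
   harmonics tends to 0, approximates all continuous functions. *)
Lemma korovkin f : cont circ f -> forall e : R, 0 < e -> exists P : {poly C},
  forall z, cabs z = 1 -> `|f z - Re P.[z]| <= e.
Proof.
move=> cf e e0.
have [d d0 hd] := cont_unif bnd_circ clos_circ cf (divr_gt0 e0 (ltr0Sn _ 1)).
have [M M0 hM] := cont_bounded bnd_circ clos_circ cf.
pose K : R := 2 * M / d ^+ 2; have K0 : 0 <= K by apply: divr_ge0; [exact: mulr_ge0|exact: sqr_ge0].
(* On the circle [2 - 2 * Re (w * z^* )] is the squared distance of [z] and [w], so the oscillation
   of [f] is controlled by a constant and a first harmonic, on which the operator is explicit. *)
have key z w : cabs z = 1 -> cabs w = 1 -> `|f z - f w| <= e / 2 + K * (2 - 2 * Re (w * z^*)).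
  move=> cz cw; have -> : 2 - 2 * Re (w * z^*) = cabs (z - w) ^+ 2.
    have := cabs_sqr z; have := cabs_sqr w; rewrite cz cw !expr1n => h1 h2.
    by rewrite cabs_sqr !(ReM, ReB, ImB, ReJ, ImJ); lra.
  have [zw|dz] := ltP (cabs (z - w)) d.
    by rewrite (le_trans (ltW (hd _ _ cz cw zw)))// lerDl (mulr_ge0 K0 (sqr_ge0 _)).
  have h : 1 <= cabs (z - w) ^+ 2 / d ^+ 2.
    by rewrite ler_pdivlMr ?exprn_gt0// mul1r lerXn2r// nnegrE ?cabs_ge0// ltW.
  have -> : K * cabs (z - w) ^+ 2 = 2 * M * (cabs (z - w) ^+ 2 / d ^+ 2) by rewrite /K; ring.
  have := ler_normB (f z) (f w); have := hM z cz; have := hM w cw.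
  have := ler_wpM2l (mulr_ge0 (ler0n R 2) M0) h; lra.
have [n hn] : exists n : nat, 2 * K * n.+1%:R^-1 <= e / 2.
  have K1 : 0 < 4 * (K + 1) by rewrite mulr_gt0// ltr_wpDl.
  have [n hn] := inv_lt (divr_gt0 e0 K1); exists n.
  have := ler_wpM2l (mulr_ge0 (ler0n R 2) K0) (ltW hn) => h; apply: le_trans h _.
  by rewrite mulrA ler_pdivrMr//; lra.
exists (fejer_op n.+1 f) => z cz; rewrite fejer_opE.
set N := n.+3; pose wj (j : 'I_N) := wr n.+2 ^+ j.
pose F (j : 'I_N) := fejer n.+1 (z * (wj j)^*).
have F0 j : 0 <= F j by apply: fejer_ge0; rewrite cabsM cabsJ cabs_wr cz mul1r.
have sum1 : N%:R^-1 * \sum_(j < N) F j = 1 :> R.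
  pose c k : C := if k == 0%N then 1 else 0.
  have := @fejer_op_hp _ n c z; rewrite fejer_opE => /(_ _) h.
  have hc : hp 2 c = fun=> 1.
    by apply/funext => x; rewrite /hp !big_ord_recl big_ord0 /c/wt/= !(mul0r, mulr0, addr0, mul1r, mulr1, expr0).
  have h1 : fin_supp 2 c by split=> //; case=> // -[].
  have h2 : hp n.+1 (fun k => (1 - k%:R / n.+1%:R) * c k) z = 1.
    rewrite /hp big_ord_recl big1 ?addr0; last by move=> j _; rewrite /c/= !mulr0 mul0r.
    by rewrite /c /wt /= ?(mul0r, subr0, mulr1, mul1r, expr0).
  rewrite -[RHS]h2 -(h h1) hc; congr (_ * _); apply: eq_bigr => j _.
  by rewrite mul1r.
have sum2 : N%:R^-1 * \sum_(j < N) Re (wj j * z^*) * F j = 1 - n.+1%:R^-1 :> R.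
  pose c k : C := if k == 1%N then z^* / 2 else 0.
  have := @fejer_op_hp _ n c z; rewrite fejer_opE => /(_ _) h.
  have hc x : hp 2 c x = Re (x * z^*).
    rewrite /hp !big_ord_recl big_ord0 /c/wt/= !(mul0r, mulr0, addr0, add0r, mul1r, mulr1, expr1).
    by congr Re; field.
  have h1 : fin_supp 2 c by split=> //; case=> // -[].
  have -> : \sum_(j < N) Re (wj j * z^*) * F j = \sum_(j < N) hp 2 c (wr n.+2 ^+ j) * F j.
    by apply: eq_bigr => j _; rewrite hc.
  rewrite (h h1) /hp; case: (n) => [|m].
    rewrite big_ord_recl big_ord0 /c/= !(mulr0, mul0r, addr0). by rewrite !subr0 mulr0 mul0r invr1 subrr.
  rewrite !big_ord_recl big1.
    rewrite /c/wt/= !(mulr0, mul0r, addr0, add0r) expr1.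
    have -> : 2 * ((1 - 1 / m.+2%:R) * (z^* / 2)) * z = (1 - m.+2%:R^-1 : R)%:C * (z * z^*).
      rewrite rmorphB/= fmorphV rmorph_nat rmorph1.
      have : m.+2%:R != 0 :> C by rewrite pnatr_eq0.
      by move: (m.+2%:R : C) => q q0; field.
    by rewrite conj_unit// mulr1.
  by move=> j _; rewrite /c/= !mulr0 mul0r.
have -> : f z = N%:R^-1 * \sum_(j < N) f z * F j by rewrite -mulr_sumr mulrCA sum1 mulr1.
rewrite -mulrBr -sumrB normrM ger0_norm ?invr_ge0//.
apply: (@le_trans _ _ (N%:R^-1 * \sum_(j < N) (e / 2 + K * (2 - 2 * Re (wj j * z^*))) * F j)).
  rewrite ler_wpM2l ?invr_ge0// (le_trans (ler_norm_sum _ _ _))//.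
  apply: ler_sum => j _; rewrite -mulrBl normrM (ger0_norm (F0 j)) ler_wpM2r//.
  by rewrite key// /wj cabs_wr.
have -> : \sum_(j < N) (e / 2 + K * (2 - 2 * Re (wj j * z^*))) * F j =
   (e / 2 + 2 * K) * \sum_(j < N) F j - 2 * K * \sum_(j < N) Re (wj j * z^*) * F j.
  rewrite !mulr_sumr -sumrB; apply: eq_bigr => j _; ring.
rewrite mulrBr mulrCA sum1 [X in _ - X]mulrCA sum2.
by move: hn; move: (n.+1%:R^-1) => q; lra.
Qed.

Lemma cabs1_cball z : cabs z <= 1 -> cball 0 1 z.
Proof. by rewrite /cball/= subr0. Qed.

Lemma clos_oball a (r : R) : clos (oball a r) `<=` cball a r.
Proof.
move=> x hx; apply: clos_cball; apply: clos_mono hx => y.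
by rewrite /oball /cball/= => /ltW.
Qed.

Lemma bnd_oball a (r : R) : bnd (oball a r).
Proof.
by have [M hM] := bnd_cball a r; exists M => x hx; apply: hM; apply: ltW.
Qed.

Lemma bd_oball a (r : R) z : bd (oball a r) z -> cabs (z - a) = r.
Proof.
move=> [/clos_oball h1 h2]; apply/eqP; rewrite eq_le h1/= leNgt.
by apply/negP.
Qed.

Lemma poly_max_disc (P : {poly C}) M : (forall z, cabs z = 1 -> `|Re P.[z]| <= M) ->
  forall z, cabs z <= 1 -> `|Re P.[z]| <= M.
Proof.
move=> hM z; rewrite le_eqVlt => /orP[/eqP/hM//|z1].
apply: (@max_principle_abs _ _ (Re \o horner P) M (@opn_oball R 0 1) (@bnd_oball 0 1)) => [||y|].
- by apply: (@taylor3_cont (horner P)) => y _; exact: taylor3_poly.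
- by move=> y _; apply: (@taylor3_harm _ (horner P)); exact: taylor3_poly.
- by move=> /bd_oball; rewrite subr0 => /hM.
- by apply: sub_clos; rewrite /oball/= subr0.
Qed.

Lemma cabs_dil a (r : R) z : 0 <= r -> cabs (a + r%:C * z - a) = r * cabs z.
Proof. by move=> r0; rewrite dist_shift cabsZ ger0_norm. Qed.

Lemma cont_dil a (r : R) (A B : set C) u : 0 < r -> (forall z, B z -> A (a + r%:C * z)) ->
  cont A u -> cont B (dil a r u).
Proof.
move=> r0 BA cu x Bx e e0; have [d d0 hd] := cu _ (BA _ Bx) e e0.
exists (d / r); first by rewrite divr_gt0.
move=> y By yx; apply: hd; first exact: BA.
rewrite opprD addrACA subrr add0r -mulrBr cabsZ gtr0_norm//.
by rewrite mulrC -ltr_pdivlMr.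
Qed.

(** A polynomial close to [u] on the circle is close in the disc, by the maximum principle for the
    difference. *)
Lemma harm_apx u a (r : R) : 0 < r -> cont (cball a r) u ->
  (forall x, oball a r x -> harm u x) -> apx (dil a r u).
Proof.
move=> r0 cu hu e e0.
have cv : cont (cball 0 1) (dil a r u).
  apply: (cont_dil r0 _ cu) => z; rewrite /cball/= subr0 cabs_dil ?(ltW r0)// => z1.
  by rewrite -[leRHS]mulr1 ler_pM2l.
have [|P hP] := @korovkin (dil a r u) _ e e0.
  by apply: cont_sub cv => z /= z1; rewrite /cball/= subr0 z1.
exists P => z; rewrite le_eqVlt => /orP[/eqP/hP//|z1].
pose v z := dil a r u z - Re P.[z].
apply: (@max_principle_abs _ _ v _ (@opn_oball R 0 1) (@bnd_oball 0 1)) => [|y|y|].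
- apply: contB; first exact: cont_sub (@clos_oball _ _) cv.
  by apply: (@taylor3_cont (horner P)) => y _; exact: taylor3_poly.
- rewrite /oball/= subr0 => y1; apply: harmB.
    apply: harm_scale; first by rewrite gt_eqF.
    by apply: hu; rewrite /oball/= cabs_dil ?(ltW r0)// -[ltRHS]mulr1 ltr_pM2l.
  by apply: (@taylor3_harm _ (horner P)); exact: taylor3_poly.
- by move=> /bd_oball; rewrite subr0 => /hP.
- by apply: sub_clos; rewrite /oball/= subr0.
Qed.

Lemma apx_cont u : apx u -> cont (cball 0 1) u.
Proof.
move=> hu; apply: cont_unif_lim => x _ e e0; exists 1 => //.
have [P hP] := hu e e0; exists (Re \o horner P).
  by apply: taylor3_cont => y _; exact: taylor3_poly.
by move=> y; rewrite /cball/= subr0 => y1 _; exact: hP.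
Qed.

Lemma apxD u v : apx u -> apx v -> apx (fun z => u z + v z).
Proof.
move=> hu hv e e0; have e2 : 0 < e / 2 by rewrite divr_gt0.
have [P hP] := hu _ e2; have [Q hQ] := hv _ e2.
exists (P + Q) => z z1; rewrite hornerD ReD opprD addrACA.
by rewrite (le_trans (ler_normD _ _))// [e]splitr lerD ?hP ?hQ.
Qed.

Lemma apxN u : apx u -> apx (fun z => - u z).
Proof.
move=> hu e e0; have [P hP] := hu _ e0.
by exists (- P) => z z1; rewrite hornerN ReN -opprD normrN hP.
Qed.

Lemma apx_eq u v : (forall z, cabs z <= 1 -> u z = v z) -> apx u -> apx v.
Proof.
move=> uv hu e e0; have [P hP] := hu _ e0.
by exists P => z z1; rewrite -uv// hP.
Qed.

Lemma apx_lim u : (forall e : R, 0 < e -> exists2 v, apx v &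
  forall z, cabs z <= 1 -> `|u z - v z| <= e) -> apx u.
Proof.
move=> h e e0; have e2 : 0 < e / 2 by rewrite divr_gt0.
have [v hv uv] := h _ e2; have [P hP] := hv _ e2; exists P => z z1.
have := hP z z1; have := uv z z1; rewrite !ler_norml; lra.
Qed.

Lemma apx_sub u a b (r s : R) : 0 < r -> 0 <= s -> cabs (b - a) + s <= r ->
  apx (dil a r u) -> apx (dil b s u).
Proof.
move=> r0 s0 bs hu e e0; have [P hP] := hu _ e0.
have rC : r%:C != 0 :> C by rewrite (inj_eq (@complexI _)) gt_eqF.
exists (P \Po (((b - a) / r%:C)%:P + (s%:C / r%:C)%:P * 'X)) => z z1.
rewrite horner_comp !hornerE.
set w := _ / _ + _; have wE : r%:C * w = b - a + s%:C * z by rewrite /w; field.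
have w1 : cabs w <= 1.
  rewrite -(ler_pM2l r0) mulr1 -[X in X * _]ger0_norm ?(ltW r0)// -cabsZ wE.
  rewrite (le_trans (cabsD _ _))// cabsZ ger0_norm// (le_trans _ bs)// lerD2l.
  by rewrite -[leRHS]mulr1 ler_wpM2l.
have := hP _ w1; rewrite /dil wE.
by have -> : a + (b - a + s%:C * z) = b + s%:C * z by ring.
Qed.

(** Polynomials that approximate the data on the circle form a Cauchy sequence on the whole disc by
    [poly_max_disc]; their uniform limit is the solution, without a Poisson kernel. *)
Theorem disc_dirichlet f a (r : R) : 0 < r ->
  cont [set x | cabs (x - a) = r] f ->
  exists u, [/\ apx (dil a r u), cont (cball a r) u &
    forall x, cabs (x - a) = r -> u x = f x].
Proof.
move=> r0 cf; pose g z := dil a r f z.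
have cg : cont circ g.
  by apply: (cont_dil r0 _ cf) => z /= z1; rewrite cabs_dil ?z1 ?mulr1// ltW.
have /choice[P hP] : forall n, exists P : {poly C}, forall z, cabs z = 1 ->
    `|g z - Re P.[z]| <= n.+1%:R^-1.
  by move=> n; apply: korovkin => //; rewrite invr_gt0.
have PP n m z : cabs z <= 1 -> `|Re (P n).[z] - Re (P m).[z]| <= n.+1%:R^-1 + m.+1%:R^-1.
  move=> z1; rewrite -ReB -hornerN -hornerD; apply: poly_max_disc z1 => w w1.
  rewrite hornerD hornerN ReB; have := hP n w w1; have := hP m w w1.
  by rewrite !ler_norml; move: (n.+1%:R^-1) (m.+1%:R^-1) => p q; lra.
have /choice[v hv] : forall z, exists l, cabs z <= 1 -> forall n,
    `|Re (P n).[z] - l| <= n.+1%:R^-1.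
  move=> z; case: (leP (cabs z) 1) => z1; last by exists 0.
  by have [l hl] := cauchy_limit (fun n m => @PP n m z z1); exists l.
have av : apx v.
  move=> e e0; have [n hn] := inv_lt e0; exists (P n) => z z1.
  by rewrite distrC (le_trans (hv z z1 n))// ltW.
have vg z : cabs z = 1 -> v z = g z.
  move=> z1; apply/eqP; rewrite -subr_eq0 -normr_le0 leNgt; apply/negP => h.
  have [n hn] := inv_lt (divr_gt0 h (ltr0Sn _ 1)).
  have := hP n z z1; have := hv z _ n; rewrite z1 => /(_ (lexx _)).
  have := ler_normD (v z - Re (P n).[z]) (Re (P n).[z] - g z).
  rewrite addrA subrK (distrC (v z) (Re _)) (distrC (Re _) (g z)).
  by move: hn; move: (n.+1%:R^-1) => q; lra.
have rC : r%:C != 0 :> C by rewrite (inj_eq (@complexI _)) gt_eqF.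
pose u x := v ((x - a) / r%:C).
have uE : dil a r u = v.
  apply/funext => z; rewrite /dil /u; congr v; rewrite addrAC subrr add0r.
  by field.
have cr x : cabs ((x - a) / r%:C) = cabs (x - a) / r.
  by rewrite cabsM cabsV cabs_real gtr0_norm.
exists u; split; first by rewrite uE.
- have := apx_cont av; rewrite /cball/= => h x; rewrite /cball/= => xa e e0.
  have [|d d0 hd] := h ((x - a) / r%:C) _ e e0.
    by rewrite /= subr0 cr ler_pdivrMr// mul1r.
  exists (d * r); first by rewrite mulr_gt0.
  move=> y ya yx; apply: hd; first by rewrite /= subr0 cr ler_pdivrMr// mul1r.
  rewrite -mulrBl opprB addrA subrK cabsM cabsV cabs_real gtr0_norm//.
  by rewrite ltr_pdivrMr.
- move=> x xa; rewrite /u vg ?cr ?xa ?divff ?gt_eqF//.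
  by rewrite /g /dil; congr f; field.
Qed.
End Approximation.

(** * Fourier coefficients and power series in the disc *)

Section Expansion.
Variable R : realType.
Local Notation C := R[i].
Local Notation Re := (@complex.Re R).
Local Notation Im := (@complex.Im R).
Implicit Types (x y z w t a b : C) (u v f : C -> R) (c d : nat -> C).

Definition Clim (s : nat -> C) (l : C) := forall e : R, 0 < e ->
  exists N, forall n, (N <= n)%N -> cabs (s n - l) <= e.

Lemma le_eps (a b : R) : (forall e, 0 < e -> a <= b + e) -> a <= b.
Proof.
move=> h; rewrite leNgt; apply/negP => ba.
have := h ((a - b) / 2); rewrite divr_gt0 ?subr_gt0// => /(_ isT); lra.
Qed.

Lemma Clim_uniq s l l' : Clim s l -> Clim s l' -> l = l'.
Proof.
move=> h h'; apply/eqP; rewrite -subr_eq0 -cabs_eq0; apply/eqP/le_anti.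
rewrite cabs_ge0 andbT; apply: le_eps => e e0; rewrite add0r.
have [N hN] := h _ (divr_gt0 e0 (ltr0Sn _ 1)); have [N' hN'] := h' _ (divr_gt0 e0 (ltr0Sn _ 1)).
have := hN _ (leq_maxl N N'); have := hN' _ (leq_maxr N N').
have := cabs_tri l (s (maxn N N')) l'; rewrite (cabs_sub l (s _)); lra.
Qed.

Lemma Clim_le s l a (M : R) : Clim s l ->
  (exists N, forall n, (N <= n)%N -> cabs (s n - a) <= M) -> cabs (l - a) <= M.
Proof.
move=> h [N hN]; apply: le_eps => e e0; have [N' hN'] := h _ e0.
have := hN _ (leq_maxl N N'); have := hN' _ (leq_maxr N N').
have := cabs_tri l (s (maxn N N')) a; rewrite (cabs_sub l (s _)); lra.
Qed.

(** The limit of the discrete coefficients as the number of nodes grows; the default 0 never occurs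
    for functions satisfying [apx], by [coef_lim]. *)
Definition coef v k : C := xget 0 [set l | Clim (fun N => dft N v k) l].

Lemma coefE v k l : Clim (fun N => dft N v k) l -> coef v k = l.
Proof.
move=> h; rewrite /coef; case: xgetP => [l' _ h'|/(_ l)//].
exact: Clim_uniq h' h.
Qed.

Lemma fin_supp_le n m c z : fin_supp n c -> (n <= m)%N -> hp m c z = hp n c z.
Proof.
move=> [_ h] nm; rewrite /hp -!(big_mkord xpredT (fun k => wt R k * c k * z ^+ k)).
rewrite (big_cat_nat (leq0n n) nm)/= ReD [X in _ + Re X](_ : _ = 0) ?addr0//.
by rewrite big_nat big1// => k /andP[nk _]; rewrite h// mulr0 mul0r.
Qed.

Lemma poly_hp (P : {poly C}) : exists n c, fin_supp n c /\ forall z, Re P.[z] = hp n c z.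
Proof.
pose c k : C := if k == 0%N then (Re P`_0)%:C else P`_k / 2.
exists (size P), c; split.
  split=> // k kn; rewrite /c; case: eqP => [k0|_].
    by have := nth_default 0 kn; rewrite k0 => ->.
  by rewrite nth_default// mul0r.
move=> z; rewrite horner_coef /hp !Re_sum; apply: eq_bigr => k _.
rewrite /c /wt; case: eqP => [->|_]; first by rewrite mul1r !expr0 !mulr1.
by congr Re; field.
Qed.

Lemma apx_hp v (e : R) : apx v -> 0 < e -> exists n c, fin_supp n c /\
  forall z, cabs z <= 1 -> `|v z - hp n c z| <= e.
Proof.
move=> hv e0; have [P hP] := hv e e0; have [n [c [hc Pc]]] := poly_hp P.
by exists n, c; split=> // z /hP; rewrite Pc.
Qed.

Lemma dft_hp_close v n c (e : R) k N : fin_supp n c ->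
  (forall z, cabs z <= 1 -> `|v z - hp n c z| <= e) -> (n + k < N.+1)%N ->
  cabs (dft N v k - c k) <= e.
Proof.
move=> hc hv nk; rewrite -(dft_hp hc nk).
have -> : dft N v k - dft N (hp n c) k = dft N (fun z => v z + (-1) * hp n c z) k.
  by rewrite (dftD N v) dftZ rmorphN rmorph1 mulN1r.
by apply: dft_bound => z z1; rewrite mulN1r hv// z1.
Qed.

(** The coefficients of two approximating polynomials are close to the same discrete coefficient of
    [v], once there are enough nodes, hence close to each other; their limit is the limit of the
    discrete coefficients too. *)
Lemma coef_lim v k : apx v -> Clim (fun N => dft N v k) (coef v k).
Proof.
move=> hv; suff [l hl] : exists l, Clim (fun N => dft N v k) l by rewrite (coefE hl).
have /choice[n /choice[c hc]] : forall j : nat, exists n c, fin_supp n c /\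
    forall z, cabs z <= 1 -> `|v z - hp n c z| <= j.+1%:R^-1.
  by move=> j; apply: apx_hp; rewrite // invr_gt0.
have cc i j : cabs (c i k - c j k) <= i.+1%:R^-1 + j.+1%:R^-1.
  pose N := (n i + n j + k)%N.
  have := @dft_hp_close v _ _ _ k N (hc i).1 (hc i).2.
  rewrite /N addnAC ltnS leq_addr => /(_ isT).
  have := @dft_hp_close v _ _ _ k N (hc j).1 (hc j).2.
  rewrite /N -addnA ltnS leq_addl addnAC addnA => /(_ isT).
  have := cabs_tri (c i k) (dft (n i + k + n j)%N v k) (c j k).
  rewrite (cabs_sub (c i k) (dft _ _ _)); have -> : (n i + n j + k = n i + k + n j)%N by rewrite addnAC.
  by move: (i.+1%:R^-1) (j.+1%:R^-1) => p q; lra.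
have [a ha] : exists a : R, forall i, `|Re (c i k) - a| <= i.+1%:R^-1.
  by apply: cauchy_limit => i j; rewrite -ReB (le_trans (Re_le _)).
have [b hb] : exists b : R, forall i, `|Im (c i k) - b| <= i.+1%:R^-1.
  by apply: cauchy_limit => i j; rewrite -ImB (le_trans (Im_le _)).
exists (a +i* b) => e e0; have [j hj] := inv_lt (divr_gt0 e0 (ltr0Sn _ 2)).
exists (n j + k)%N => N hN; have := @dft_hp_close v _ _ _ k N (hc j).1 (hc j).2.
rewrite ltnS => /(_ hN); have := cabs_tri (dft N v k) (c j k) (a +i* b).
have := cabs_le (c j k - (a +i* b)); rewrite ReB ImB /=.
have := ha j; have := hb j; move: hj; move: (j.+1%:R^-1) => p; lra.
Qed.

Lemma coef_close v n c (e : R) k : apx v -> fin_supp n c ->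
  (forall z, cabs z <= 1 -> `|v z - hp n c z| <= e) -> cabs (coef v k - c k) <= e.
Proof.
move=> av hc hv; apply: Clim_le (coef_lim k av) _.
by exists (n + k)%N => N hN; apply: dft_hp_close hc hv _.
Qed.

Lemma coef_bound v k (M : R) : apx v -> (forall z, cabs z = 1 -> `|v z| <= M) ->
  cabs (coef v k) <= M.
Proof.
move=> av hv; rewrite -[coef v k]subr0; apply: Clim_le (coef_lim k av) _.
by exists 0%N => N _; rewrite subr0 dft_bound.
Qed.

Lemma coefD u v k : apx u -> apx v -> coef (fun z => u z + v z) k = coef u k + coef v k.
Proof.
move=> au av; apply: coefE => e e0.
have [N hN] := coef_lim k au (divr_gt0 e0 (ltr0Sn _ 1)).
have [N' hN'] := coef_lim k av (divr_gt0 e0 (ltr0Sn _ 1)).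
exists (maxn N N') => n; rewrite geq_max => /andP[/hN h1 /hN' h2].
by rewrite (dftD n u) opprD addrACA [e]splitr; exact: cabsD_le.
Qed.

Lemma coefZ (a : R) v k : apx v -> coef (fun z => a * v z) k = a%:C * coef v k.
Proof.
move=> av; apply: coefE => e e0; have a1 : 0 < `|a| + 1 by rewrite ltr_wpDl.
have [N hN] := coef_lim k av (divr_gt0 e0 a1).
exists N => n /hN h; rewrite dftZ -mulrBr cabsZ.
apply: le_trans (ler_wpM2l (normr_ge0 a) h) _.
by rewrite mulrA ler_pdivrMr// mulrC ler_pM2l// lerDl.
Qed.

Lemma coef_eq u v k : (forall z, cabs z = 1 -> u z = v z) -> coef u k = coef v k.
Proof.
move=> uv; have E : (fun N => dft N u k) = (fun N => dft N v k).
  by apply/funext => N; exact: dft_eq.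
by rewrite /coef E.
Qed.

Lemma coef_hp n c k : fin_supp n c -> coef (hp n c) k = c k.
Proof.
move=> hc; apply: coefE => e e0; exists (n + k)%N => N hN.
by rewrite (dft_hp hc)// subrr cabs0 ltW.
Qed.

Lemma coef_pos v k : apx v -> (forall z, cabs z = 1 -> 0 <= v z) ->
  cabs (coef v k) <= Re (coef v 0).
Proof.
move=> av hv; apply: le_eps => e e0.
have [N hN] := coef_lim k av (divr_gt0 e0 (ltr0Sn _ 1)).
have [N' hN'] := coef_lim 0 av (divr_gt0 e0 (ltr0Sn _ 1)).
have h := hN _ (leq_maxl N N'); have h' := hN' _ (leq_maxr N N').
move: h h'; set M := maxn N N' => h h'.
have := dft_pos M k hv; have := cabs_leD (coef v k) (dft M v k).
rewrite (cabs_sub (coef v k) (dft _ _ _)); have := Re_le (dft M v 0 - coef v 0).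
rewrite ReB ler_norml; lra.
Qed.

Lemma cabs_wt k : cabs (wt R k) <= 2.
Proof. by rewrite /wt; case: eqP => _; rewrite ?cabs1 ?ler1n// cabs_nat. Qed.

Lemma hp_diff n m c (B : R) z : (n <= m)%N -> (forall k, (n <= k)%N -> cabs (c k) <= B) ->
  cabs z < 1 -> `|hp m c z - hp n c z| <= 2 * B * cabs z ^+ n / (1 - cabs z).
Proof.
move=> nm hB z1; set q := cabs z; have q0 : 0 <= q := cabs_ge0 z.
have q1 : 0 < 1 - q by rewrite subr_gt0.
have B0 : 0 <= B := le_trans (cabs_ge0 _) (hB n (leqnn n)).
suff h : `|hp m c z - hp n c z| <= 2 * B * (q ^+ n - q ^+ m) / (1 - q).
  apply: le_trans h _; rewrite ler_wpM2r ?invr_ge0 ?(ltW q1)//.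
  by rewrite ler_wpM2l ?mulr_ge0// gerBl exprn_ge0.
rewrite -(subnKC nm); elim: (m - n)%N => [|k IH].
  by rewrite addn0 !subrr normr0 mulr0 mul0r.
rewrite addnS {1}/hp big_ord_recr/= ReD -/(hp _ c z) addrAC.
apply: le_trans (ler_normD _ _) _.
have hk : `|Re (wt R (n + k) * c (n + k)%N * z ^+ (n + k))| <= 2 * B * q ^+ (n + k).
  rewrite (le_trans (Re_le _))// (cabsM _ (z ^+ _)) (cabsM (wt _ _)) cabsX.
  by rewrite ler_wpM2r ?exprn_ge0// ler_pM ?cabs_ge0 ?cabs_wt// hB// leq_addr.
apply: le_trans (lerD IH hk) _; rewrite exprS.
rewrite le_eqVlt; apply/orP; left; apply/eqP; field; by rewrite gt_eqF.
Qed.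

Lemma hpD n c d z : hp n (fun k => c k + d k) z = hp n c z + hp n d z.
Proof.
by rewrite /hp -ReD -big_split/=; congr Re; apply: eq_bigr => k _; ring.
Qed.

Lemma hpN n c z : hp n (fun k => - c k) z = - hp n c z.
Proof.
by rewrite /hp -ReN -sumrN; congr Re; apply: eq_bigr => k _; ring.
Qed.

Lemma hp0 c z : hp 0 c z = 0.
Proof. by rewrite /hp big_ord0. Qed.

Lemma apx_exp_lim v z (e : R) : apx v -> cabs z < 1 -> 0 < e ->
  exists N, forall m, (N <= m)%N -> `|v z - hp m (coef v) z| <= e.
Proof.
move=> av z1 e0; set q := cabs z; have q1 : 0 < 1 - q by rewrite subr_gt0.
pose K := 1 + 2 / (1 - q); have K0 : 0 < K by rewrite /K addr_gt0// divr_gt0.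
have [n [c [hc vc]]] := apx_hp av (divr_gt0 e0 K0).
exists n => m nm; have h1 := vc z (ltW z1).
have := @hp_diff 0 m (fun k => coef v k + - c k) (e / K) z (leq0n _) _ z1.
rewrite hp0 subr0 hpD hpN (fin_supp_le z hc nm) => /(_ _) h2.
have {h2} h2 := h2 (fun k _ => coef_close k av hc vc).
rewrite expr0 mulr1 in h2.
have -> : v z - hp m (coef v) z = (v z - hp n c z) - (hp m (coef v) z - hp n c z) by ring.
rewrite (le_trans (ler_normB _ _))// (le_trans (lerD h1 h2))//.
have -> : e / K + 2 * (e / K) / (1 - cabs z) = e / K * (1 + 2 / (1 - q)) by rewrite /q; ring.
by rewrite divfK// gt_eqF.
Qed.

(** The constant [2 * B] bounds each coefficient including the weight [wt], and the tail is
    geometric. Gradient bounds, Harnack's inequality and compositions all come from this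
    remainder. *)
Theorem apx_exp v n z (B : R) : apx v -> (forall k, (n <= k)%N -> cabs (coef v k) <= B) ->
  cabs z < 1 -> `|v z - hp n (coef v) z| <= 2 * B * cabs z ^+ n / (1 - cabs z).
Proof.
move=> av hB z1; apply: le_eps => e e0; have [N hN] := apx_exp_lim av z1 e0.
have := hN _ (leq_maxl N n); have := @hp_diff n _ _ B z (leq_maxr N n) hB z1.
have := ler_normD (v z - hp (maxn N n) (coef v) z) (hp (maxn N n) (coef v) z - hp n (coef v) z).
rewrite addrA subrK; lra.
Qed.

Lemma coef0E v : apx v -> v 0 = Re (coef v 0).
Proof.
move=> av; apply/eqP; rewrite -subr_eq0 -normr_le0.
have [M M0 hM] := cont_bounded (@bnd_cball R 0 1) (@clos_cball R 0 1) (apx_cont av).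
have := @apx_exp v 1 0 M av _; rewrite cabs0 expr1 mulr0 mul0r => /(_ _ ltr01).
rewrite /hp big_ord_recl big_ord0 /wt/= expr0 mul1r mulr1 addr0; apply => k _.
by apply: coef_bound => // z z1; apply: hM; rewrite /cball/= subr0 z1.
Qed.

(** For nonnegative data every coefficient is at most [coef v 0], which is [v 0]; the expansion then
    gives a deviation of at most [2 * v 0] for [cabs z <= 1 / 2]. *)
Lemma harnack v z : apx v -> (forall w, cabs w = 1 -> 0 <= v w) -> cabs z <= 1 / 2 ->
  v z <= 3 * v 0.
Proof.
move=> av hv z1; have c0 : 0 <= v 0.
  by rewrite coef0E// (le_trans (cabs_ge0 _) (coef_pos 0 av hv)).
have := @apx_exp v 1 z (v 0) av.
have hz : cabs z < 1 by lra.
rewrite /hp big_ord_recl big_ord0 /wt/= expr0 mul1r mulr1 addr0 -coef0E// expr1.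
move=> /(_ _ hz) h.
have h2 : `|v z - v 0| <= 2 * v 0 * cabs z / (1 - cabs z).
  by apply: h => k _; rewrite (coef0E av); exact: coef_pos.
have h3 : 2 * v 0 * cabs z / (1 - cabs z) <= 2 * v 0.
  rewrite ler_pdivrMr ?subr_gt0// ; nra.
by move: h2; rewrite ler_norml; lra.
Qed.

Lemma gradient v (M : R) : apx v -> (forall z, cabs z = 1 -> `|v z| <= M) ->
  exists g : C, cabs g <= 2 * M /\ forall z, cabs z <= 1 / 2 ->
    `|v z - v 0 - Re (g * z)| <= 4 * M * cabs z ^+ 2.
Proof.
move=> av hM; exists (2 * coef v 1); split.
  by rewrite cabsM cabs_nat ler_pM2l//; exact: coef_bound.
move=> z z1; have hz : cabs z < 1 by lra.
have M0 : 0 <= M := le_trans (cabs_ge0 _) (coef_bound 0 av hM).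
have := @apx_exp v 2 z M av (fun k _ => coef_bound k av hM) hz.
rewrite /hp !big_ord_recl big_ord0 /wt/= expr0 expr1 mul1r mulr1 addr0 ReD -coef0E//.
rewrite opprD addrA => h; apply: le_trans h _.
rewrite ler_pdivrMr ?subr_gt0//; have := mulr_ge0 M0 (sqr_ge0 (cabs z)); nra.
Qed.

(** The polynomial part is harmonic by [taylor3_harm], and the remainder from degree 4 on is of
    order [h ^+ 4] at the points of the cross. *)
Lemma apx_harm0 v : apx v -> harm v 0.
Proof.
move=> av; pose c := coef v; pose E z := v z - hp 4 c z.
have [M M0 hM] := cont_bounded (@bnd_cball R 0 1) (@clos_cball R 0 1) (apx_cont av).
have hE z : cabs z <= 1 / 2 -> `|E z| <= 4 * M * cabs z ^+ 4.
  move=> z1; have hz : cabs z < 1 by lra.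
  have := @apx_exp v 4 z M av _ hz; rewrite -/c => /(_ _) h.
  have {h}h : `|v z - hp 4 c z| <= 2 * M * cabs z ^+ 4 / (1 - cabs z).
    apply: h => k _; apply: coef_bound => // w w1; apply: hM; by rewrite /cball/= subr0 w1.
  apply: le_trans h _; rewrite ler_pdivrMr ?subr_gt0//.
  have := mulr_ge0 M0 (exprn_ge0 4 (cabs_ge0 z)); nra.
have -> : v = fun z => E z + hp 4 c z by apply/funext => z; rewrite /E subrK.
apply: harmD; last first.
  have -> : hp 4 c = Re \o horner (\poly_(k < 4) (wt R k * c k)).
    by apply/funext => z; rewrite /hp /= horner_poly.
  by apply: taylor3_harm; exact: taylor3_poly.
move=> e e0; pose K : R := 16 * M + 1; have K0 : 0 < K by rewrite /K; lra.
exists (Num.min (1 / 2) (e / K)); first by rewrite lt_min (divr_gt0 e0 K0) divr_gt0.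
move=> h h0; rewrite lt_min (ltr_pdivlMr _ _ K0) => /andP[h1 h2].
have E0 : E 0 = 0.
  apply/eqP; rewrite -normr_le0; have := hE 0; rewrite cabs0 expr0n mulr0.
  by apply; lra.
have hh w : cabs w = h -> `|E w| <= 4 * M * h ^+ 4.
  by move=> hw; rewrite -hw; apply: hE; rewrite hw; lra.
rewrite /lap4 !add0r E0 mulr0 subr0.
have := hh h%:C; have := hh (- h%:C); have := hh (h%:C * 'i); have := hh (- (h%:C * 'i)).
rewrite !cabsN cabs_hi cabs_real gtr0_norm// => /(_ erefl) l1 /(_ erefl) l2 /(_ erefl) l3 /(_ erefl) l4.
set T := 4 * M * h ^+ 4 in l1 l2 l3 l4.
apply: (@le_trans _ _ (T + T + T + T)).
  apply: le_trans (ler_normD _ _) (lerD _ l1).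
  apply: le_trans (ler_normD _ _) (lerD _ l2).
  exact: le_trans (ler_normD _ _) (lerD l4 l3).
have -> : T + T + T + T = (16 * M * h) * h * h ^+ 2 by rewrite /T; ring.
rewrite ler_wpM2r ?sqr_ge0//.
have : 0 <= 16 * M * h by rewrite !mulr_ge0// ltW.
have le1 : 16 * M * h <= e.
  have -> : 16 * M * h = h * K - h by rewrite /K; ring.
  by rewrite lerBlDr ler_wpDr ?ltW.
move=> p0; rewrite -[leRHS]mulr1 ler_pM//; first exact: ltW.
by rewrite ltW// (lt_trans h1)// ltr_pdivrMr// mul1r ltrDl.
Qed.

Lemma apx_harm u a (r : R) x : 0 < r -> apx (dil a r u) -> oball a r x -> harm u x.
Proof.
move=> r0 au hx; pose s := r - cabs (x - a).
have s0 : 0 < s by rewrite subr_gt0.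
have := @apx_harm0 _ (@apx_sub _ u a x r s r0 (ltW s0) _ au).
rewrite addrC subrK => /(_ (lexx _)) h.
have sC : s%:C != 0 :> C by rewrite (inj_eq (@complexI _)) gt_eqF.
have E : u = fun z => dil x s u (- (s^-1)%:C * x + (s^-1)%:C * z).
  apply/funext => z; rewrite /dil; congr u; rewrite fmorphV/=.
  by move: sC; move: (s%:C) => t t0; field.
rewrite E; apply: harm_scale; first by rewrite invr_eq0 gt_eqF.
by rewrite mulNr addNr.
Qed.

Lemma harm_cont u (D : set C) : opn D -> cont D u -> (forall x, D x -> harm u x) ->
  forall x (r : R), 0 < r -> cball x r `<=` D -> apx (dil x r u).
Proof.
move=> oD cu hu x r r0 xrD; apply: harm_apx => //; first exact: cont_sub cu.
by move=> y hy; apply/hu/xrD/ltW.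
Qed.
End Expansion.

(** * Perron's method *)

Section Perron.
Variable R : realType.
Local Notation C := R[i].
Local Notation Re := (@complex.Re R).
Local Notation Im := (@complex.Im R).
Implicit Types (x y z w : C) (u v f b : C -> R) (D : set C).

(** Near [x] the rotated set [nu * (y - x)] stays in a sector around the positive axis that omits a
    neighbourhood of the negative one. There the principal square root is holomorphic, and its real
    part is the barrier. *)
Definition sector D x := exists (nu : C) (k r : R),
  [/\ cabs nu = 1, k < 1, 0 < r &
   forall y, D y -> cabs (y - x) < r -> - k * cabs (y - x) <= Re (nu * (y - x))].

Lemma Re_sqrtc z : Re (sqrtc z) = Num.sqrt ((cabs z + Re z) / 2).
Proof. by case: z => a b. Qed.

Lemma sqrt_dist (a b : R) : 0 <= a -> 0 <= b ->
  `|Num.sqrt a - Num.sqrt b| ^+ 2 <= `|a - b|.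
Proof.
move=> a0 b0; rewrite -{2}(sqr_sqrtr a0) -{2}(sqr_sqrtr b0) subr_sqr normrM expr2.
rewrite ler_wpM2l// ler_norml; have := sqrtr_ge0 a; have := sqrtr_ge0 b.
by move=> *; rewrite ger0_norm ?addr_ge0//; lra.
Qed.

Lemma Re_sqrtc_cont A nu x : cabs nu = 1 -> cont A (fun y => Re (sqrtc (nu * (y - x)))).
Proof.
move=> nu1 y _ e e0; exists (e ^+ 2); first by rewrite exprn_gt0.
move=> z _ zy; rewrite -(ltr_pXn2r (n := 2)) ?nnegrE ?(ltW e0)//.
apply: le_lt_trans zy; rewrite !Re_sqrtc.
have nn w : 0 <= (cabs w + Re w) / 2.
  by have := Re_le w; rewrite ler_norml => h; apply: divr_ge0 => //; lra.
apply: le_trans (sqrt_dist (nn _) (nn _)) _.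
set p := nu * (z - x); set q := nu * (y - x).
have -> : cabs (z - y) = cabs (p - q).
  by rewrite /p /q -mulrBr cabsM nu1 mul1r; congr cabs; ring.
clearbody p q; have h1 := cabs_leD p q; have h2 := cabs_leD q p.
rewrite (cabs_sub q p) in h2; have h3 := Re_le (p - q).
by rewrite ReB ler_norml in h3; rewrite ler_norml; lra.
Qed.

Lemma sector_clos D x : opn D -> sector D x -> sector (clos D) x.
Proof.
move=> oD [nu [k [r [nu1 k1 r0 h]]]]; exists nu, k, r; split=> // y cy yr.
apply: le_eps => e e0.
pose K := 1 + `|k|; have K0 : 0 < K by rewrite /K ltr_pwDl.
pose d := Num.min (r - cabs (y - x)) (e / K).
have d0 : 0 < d by rewrite lt_min subr_gt0 yr (divr_gt0 e0 K0).
have [z Dz zy] := cy d d0; move: zy; rewrite lt_min (ltr_pdivlMr _ _ K0) => /andP[z1 z2].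
have zr : cabs (z - x) < r by have := cabs_tri z y x; lra.
have := h z Dz zr.
have e1 : Re (nu * (z - x)) <= Re (nu * (y - x)) + cabs (z - y).
  have := Re_le (nu * (z - y)); rewrite cabsM nu1 mul1r.
  have -> : nu * (z - y) = nu * (z - x) - nu * (y - x) by ring.
  by rewrite ReB ler_norml; lra.
have e2 : `|k * cabs (z - x) - k * cabs (y - x)| <= `|k| * cabs (z - y).
  rewrite -mulrBr normrM ler_wpM2l// ler_norml.
  have := cabs_tri z y x; have := cabs_tri y z x; rewrite (cabs_sub y z); lra.
by move: e2; rewrite ler_norml; rewrite /K in z2; lra.
Qed.

(** The explicit formula [Re_sqrtc] and the sector inequality give the lower bound by
    [Num.sqrt (cabs (y - x))]. Positivity of this real part also keeps the argument off the cut,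
    which yields harmonicity. *)
Lemma barrier D x : opn D -> bd D x -> sector D x -> exists b (c r : R),
  [/\ 0 < c, 0 < r, cont (clos D) b, b x = 0 & forall y, cabs (y - x) < r ->
    (clos D y -> c * Num.sqrt (cabs (y - x)) <= b y) /\ (D y -> harm b y)].
Proof.
move=> oD [cx nDx] /(sector_clos oD)[nu [k [r [nu1 k1 r0 h]]]].
exists (fun y => Re (sqrtc (nu * (y - x)))), (Num.sqrt ((1 - k) / 2)), r.
have lo y : clos D y -> cabs (y - x) < r ->
    Num.sqrt ((1 - k) / 2) * Num.sqrt (cabs (y - x)) <= Re (sqrtc (nu * (y - x))).
  move=> Dy yr; rewrite Re_sqrtc -sqrtrM ?divr_ge0 ?subr_ge0 ?(ltW k1)//.
  apply: ler_wsqrtr; rewrite cabsM nu1 mul1r.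
  have := h y Dy yr; lra.
split => //.
- by rewrite sqrtr_gt0 divr_gt0// subr_gt0.
- exact: Re_sqrtc_cont.
- by rewrite subrr mulr0 sqrtc0.
move=> y yr; split=> [cy|Dy]; first exact: lo.
apply: (@taylor3_harm _ (fun z => sqrtc (nu * (z - x)))).
have -> : (fun z => sqrtc (nu * (z - x))) = (fun z => sqrtc (nu * z + - (nu * x))).
  by apply/funext => z; rewrite mulrBr.
apply: taylor3_affine; apply: taylor3_sqrt.
rewrite -mulrBr; apply: lt_le_trans (lo y (sub_clos Dy) yr).
rewrite mulr_gt0// sqrtr_gt0 ?divr_gt0 ?subr_gt0//.
rewrite cabs_gt0 subr_eq0; apply/eqP => yx; apply: nDx; by rewrite -yx.
Qed.

Lemma clos_bd D : opn D -> clos (bd D) `<=` bd D.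
Proof.
move=> oD x hx; split.
  by apply: clos_clos; apply: clos_mono hx => y [].
move=> Dx; have [r r0 hr] := oD x Dx; have [y [_ nDy] yx] := hx r r0.
exact/nDy/hr.
Qed.

Lemma bnd_sub (A B : set C) : A `<=` B -> bnd B -> bnd A.
Proof. by move=> AB [M h]; exists M => x /AB/h. Qed.

Variables (D : set C) (f : C -> R) (M : R).
Hypotheses (oD : opn D) (bD : bnd D) (cf : cont (bd D) f) (M0 : 0 <= M).
Hypothesis fM : forall x, bd D x -> `|f x| <= M.

Let F : set (C -> R) := [set v | [/\ cont (clos D) v, forall x, D x -> subh v x &
  forall x, bd D x -> v x <= f x]].

Let FM v x : F v -> clos D x -> v x <= M.
Proof.
move=> [cv sv bv]; apply: max_principle => // y hy.
by rewrite (le_trans (bv y hy))// (le_trans (ler_norm _) (fM hy)).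
Qed.

Let Fcst : F (fun=> - M).
Proof.
split; [exact: cont_cst|by move=> x _; apply/harm_subh/harm_cst|].
by move=> x /fM; rewrite ler_norml => /andP[].
Qed.

Let F_max v (w : C -> R) : F v -> F w -> F (fun x => Num.max (v x) (w x)).
Proof.
move=> [cv sv bv] [cw sw bw]; split; first exact: cont_max.
  by move=> x Dx; apply: subh_max; [exact: sv|exact: sw].
by move=> x hx; rewrite ge_max bv// bw.
Qed.

(** Inside the disc the modification is harmonic; at every other point of [D] it touches [v] from
    above, so [subh_touch] applies, on the circle as well. *)
Let F_modif v x0 r : F v -> 0 < r -> cball x0 r `<=` D ->
  exists v', [/\ F v', forall x, clos D x -> v x <= v' x & apx (dil x0 r v')].
Proof.
move=> [cv sv bv] r0 BD; have cBv : cont (cball x0 r) v.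
  by apply: cont_sub cv => x /BD/sub_clos.
have [|P [aP cP Pv]] := @disc_dirichlet _ v x0 r r0.
  by apply: cont_sub cBv => x /= h; rewrite /cball/= h.
have vP x : cball x0 r x -> v x <= P x.
  rewrite /cball/= le_eqVlt => /orP[/eqP/Pv->//|xr]; rewrite -subr_le0.
  apply: (@max_principle _ _ (fun y => v y - P y) 0 (@opn_oball _ x0 r) (@bnd_oball _ x0 r)).
  - by apply: contB; apply: cont_sub (@clos_oball _ x0 r) _.
  - move=> y yr; apply: subhD; first by apply/sv/BD/ltW.
    by apply: harm_subh; apply: harmN; exact: apx_harm aP yr.
  - by move=> y /bd_oball/Pv->; rewrite subrr.
  - exact: sub_clos.
pose v' x := if cabs (x - x0) <= r then P x else v x.
have v'ge x : clos D x -> v x <= v' x.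
  by move=> _; rewrite /v'; case: ifP => // h; exact: vP.
exists v'; split=> //; last first.
  apply: apx_eq aP => z z1; rewrite /dil /v' cabs_dil ?ifT ?(ltW r0)//.
  by rewrite -[leRHS]mulr1 ler_pM2l.
split.
- move=> x cx e e0; rewrite /v'; case: (leP (cabs (x - x0)) r) => xr.
    have [d d0 hd] := cP x xr e e0.
    have [d' d0' hd'] := cv x cx e e0.
    move: xr; rewrite le_eqVlt => /orP[/eqP xr|xr].
      exists (Num.min d d'); first by rewrite lt_min d0.
      move=> y cy; rewrite lt_min => /andP[y1 y2]; case: ifP => yr; first exact: hd.
      by rewrite (Pv x xr); exact: hd'.
    exists (Num.min d (r - cabs (x - x0))); first by rewrite lt_min d0 subr_gt0.
    move=> y cy; rewrite lt_min => /andP[y1 y2]; case: ifP => yr; first exact: hd.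
    by have := cabs_tri y x x0; lra.
  have [d' d0' hd'] := cv x cx e e0.
  exists (Num.min d' (cabs (x - x0) - r)); first by rewrite lt_min d0' subr_gt0.
  move=> y cy; rewrite lt_min => /andP[y1 y2]; case: ifP => yr; last exact: hd'.
  by have := cabs_tri x y x0; rewrite (cabs_sub x y); lra.
- move=> x Dx; case: (ltP (cabs (x - x0)) r) => xr.
    apply: (@subh_local _ P _ _ (r - cabs (x - x0))); first by rewrite subr_gt0.
      move=> y yx; rewrite /v' ifT//; have := cabs_tri y x x0; lra.
    by apply: harm_subh; exact: apx_harm aP xr.
  have [s s0 hs] := oD Dx; apply: (subh_touch s0) (sv x Dx).
    by move=> y /hs Dy; apply/v'ge/sub_clos.
  rewrite /v'; case: leP => // xr'; rewrite Pv//.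
  by apply/eqP; rewrite eq_le xr xr'.
- move=> x hx; rewrite /v' ifF; first exact: bv.
  by apply/negbTE/negP => /BD; case: hx.
Qed.

Let U x := sup [set v x | v in F].

Let U_ub v x : F v -> clos D x -> v x <= U x.
Proof.
move=> Fv cx; apply: ub_le_sup; last by exists v.
by exists M => _ [w Fw <-]; exact: FM.
Qed.

Let U_le x (a : R) : (forall v, F v -> v x <= a) -> U x <= a.
Proof.
move=> h; apply: ge_sup; first by exists (- M), (fun=> - M).
by move=> _ [v Fv <-]; exact: h.
Qed.

Let U_adh x e : 0 < e -> exists2 v, F v & U x - e < v x.
Proof.
move=> e0; apply: contrapT => h; have : U x <= U x - e.
  apply: U_le => v Fv; rewrite leNgt; apply/negP => hv.
  by apply: h; exists v.
lra.
Qed.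

(** No monotone sequence is needed: [v1] is within [e / 4] of [U] at the centre, and a larger member
    [v2] is within [e / 4] of [U] at a given [x]. The difference [v2 - v1] is nonnegative and
    harmonic in the disc and at most [e / 4] at the centre, so at most [3 * e / 4] at [x] by
    Harnack. Hence [v1] approximates [U] uniformly on the half disc. *)
Let U_apx x0 r : 0 < r -> cball x0 r `<=` D -> apx (dil x0 (r / 2) U).
Proof.
move=> r0 BD; apply: apx_lim => e e0.
have e4 : 0 < e / 4 by rewrite divr_gt0.
have x0B : cball x0 r x0 by rewrite /cball/= subrr cabs0 ltW.
have [v Fv hv] := U_adh x0 e4; have [v1 [Fv1 vv1 av1]] := F_modif Fv r0 BD.
exists (dil x0 (r / 2) v1).
  apply: apx_sub av1 => //; first by rewrite divr_ge0// ltW.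
  by rewrite subrr cabs0 add0r; lra.
move=> z z1; rewrite /dil; set x := x0 + _.
have xE : x = x0 + r%:C * (z / 2).
  by rewrite /x rmorphM/= fmorphV rmorph_nat; ring.
have z2 : cabs (z / 2) <= 1 / 2.
  by rewrite cabsM cabsV cabs_nat ler_pM2r ?invr_gt0.
have xB : cball x0 r x.
  by rewrite /cball/= xE cabs_dil ?(ltW r0)//; nra.
have [w Fw hw] := U_adh x e4.
have [v2 [Fv2 wv2 av2]] := F_modif (F_max Fv1 Fw) r0 BD.
have cx := sub_clos (BD _ xB); have cx0 := sub_clos (BD _ x0B).
have pos y : cabs y = 1 -> 0 <= dil x0 r v2 y + - dil x0 r v1 y.
  move=> y1; rewrite subr_ge0 /dil.
  have yB : cball x0 r (x0 + r%:C * y) by rewrite /cball/= cabs_dil ?y1 ?mulr1// ltW.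
  by have := wv2 _ (sub_clos (BD _ yB)); rewrite ge_max => /andP[].
have := harnack (apxD av2 (apxN av1)) pos z2.
rewrite /dil -xE mulr0 addr0 => h.
have := U_ub Fv1 cx; have := U_ub Fv2 cx0; have := wv2 x cx; rewrite ge_max => /andP[h1 h2].
have := vv1 x0 cx0; move=> *; rewrite ler_norml; lra.
Qed.

Let U_harm x : D x -> harm U x /\ exists2 r, 0 < r & cont (cball x r) U.
Proof.
move=> Dx; have [r r0 hr] := oD Dx; pose s := r / 2; have s0 : 0 < s by rewrite divr_gt0.
have a : apx (dil x (s / 2) U).
  by apply: U_apx => // y; rewrite /cball/= => h; apply: hr; rewrite /s in h; lra.
have s20 : 0 < s / 2 by rewrite divr_gt0.
split; first by apply: (apx_harm s20 a); rewrite /oball/= subrr cabs0.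
exists (s / 2) => //.
have sC : (s / 2)%:C != 0 :> C by rewrite (inj_eq (@complexI _)) gt_eqF.
have -> : U = fun y => dil x (s / 2) U ((y - x) / (s / 2)%:C).
  by apply/funext => y; rewrite /dil; congr U; move: sC; move: ((s / 2)%:C) => t t0; field.
have := apx_cont a => h y yx e e0.
have cs z : cball x (s / 2) z -> cball 0 1 ((z - x) / (s / 2)%:C).
  rewrite /cball/= subr0 => hz; rewrite cabsM cabsV cabs_real gtr0_norm//.
  by rewrite ler_pdivrMr// mul1r.
have [d d0 hd] := h _ (cs y yx) e e0; exists (d * (s / 2)); first by rewrite mulr_gt0.
move=> z zx zy; apply: hd; first exact: cs.
rewrite -mulrBl opprB addrA subrK cabsM cabsV cabs_real gtr0_norm//.
by rewrite ltr_pdivrMr.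
Qed.

Let U_bd x e : bd D x -> sector D x -> 0 < e ->
  exists2 d : R, 0 < d & forall y, D y -> cabs (y - x) < d -> `|U y - f x| <= e.
Proof.
move=> hx sx e0; have cx : clos D x := hx.1.
have [b [c [r [c0 r0 cb bx hb]]]] := barrier oD hx sx.
have e2 : 0 < e / 2 by rewrite divr_gt0.
have [d d0 hd] := cf hx e2.
pose s := Num.min r d / 2; have m0 : 0 < Num.min r d by rewrite lt_min r0.
have s0 : 0 < s by rewrite divr_gt0.
have sm : s < Num.min r d by rewrite /s; lra.
move: sm; rewrite lt_min => /andP[sr sd]; clearbody s.
(* With this factor [K * b] exceeds [2 * M], the largest possible oscillation, on the ring from
   radius [s / 2] to [r], so comparison is needed only in a small disc around [x]. *)
pose K := 2 * M / (c * Num.sqrt (s / 2)).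
have cs0 : 0 < c * Num.sqrt (s / 2) by rewrite mulr_gt0// sqrtr_gt0 divr_gt0.
have K0 : 0 <= K by apply: divr_ge0; [rewrite mulr_ge0|exact: ltW].
have big y : clos D y -> cabs (y - x) < r -> s / 2 <= cabs (y - x) -> 2 * M <= K * b y.
  move=> cy yr ys; have [/(_ cy) h _] := hb y yr.
  have : c * Num.sqrt (s / 2) <= b y.
    by rewrite (le_trans _ h)// ler_wpM2l ?(ltW c0)// ler_wsqrtr.
  move=> h2; have := ler_wpM2l K0 h2; rewrite {1}/K divfK ?gt_eqF//.
have bpos y : clos D y -> cabs (y - x) < r -> 0 <= K * b y.
  move=> cy yr; have [/(_ cy) h _] := hb y yr; rewrite mulr_ge0// (le_trans _ h)//.
  by rewrite mulr_ge0 ?sqrtr_ge0// ltW.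
have fx := fM hx; rewrite ler_norml in fx.
have cKb : cont (clos D) (fun y => K * b y) by exact: contZ.
have up v y : F v -> D y -> cabs (y - x) < s -> v y <= f x + e / 2 + K * b y.
  move=> Fv Dy ys; have [cv sv bv] := Fv.
  rewrite -lerBlDr.
  pose G := D `&` oball x s.
  have cGD : clos G `<=` clos D by apply: clos_mono => z [].
  have cGB : clos G `<=` cball x s by move=> z hz; apply: clos_oball; apply: clos_mono hz => t [].
  apply: (@max_principle _ G (fun y => v y - K * b y)).
  - move=> z [Dz zs]; have [r1 r10 h1] := oD Dz; have [r2 r20 h2] := opn_oball zs.
    exists (Num.min r1 r2); first by rewrite lt_min r10.
    by move=> t; rewrite lt_min => /andP[/h1 ? /h2 ?].
  - by apply: bnd_sub bD => z [].
  - by apply: cont_sub cGD _; exact: contB.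
  - move=> z [Dz zs]; apply: subhD; first exact: sv.
    apply: harm_subh; apply: harmN; apply: harmZ.
    have zr : cabs (z - x) < r by apply: lt_trans sr.
    by have [_] := hb z zr; apply.
  - move=> z [cz nz]; have zs : cabs (z - x) <= s := cGB z cz.
    have zr : cabs (z - x) < r := le_lt_trans zs sr.
    have cDz := cGD z cz.
    have [Dz|nDz] := pselect (D z); last first.
      have hz : bd D z by split.
      have := hd z hz (le_lt_trans zs sd); have := bv z hz; have := bpos z cDz zr.
      by rewrite ltr_norml; lra.
    have zs' : s <= cabs (z - x) by rewrite leNgt; apply/negP => ?; apply: nz.
    have := FM Fv cDz; have := big z cDz zr; move: fx; lra.
  - exact/sub_clos.
(* Lower barrier, cut off at the constant member [- M] of the family. From radius [s / 2] on the cut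
   is active, so the two pieces join. *)
pose v y := if cabs (y - x) < s then Num.max (f x - e / 2 - K * b y) (- M) else - M.
have vout y : clos D y -> s / 2 <= cabs (y - x) -> v y = - M.
  move=> cy ys; rewrite /v; case: ltP => // yr; apply/max_idPr.
  by have := big y cy (lt_trans yr sr) ys; move: fx; lra.
have cin : cont (clos D) (fun y => Num.max (f x - e / 2 - K * b y) (- M)).
  by apply: cont_max; [apply: contB => //|]; exact: cont_cst.
have Fv : F v.
  split.
  - move=> y cy a a0; case: (ltP (cabs (y - x)) s) => ys.
      have [t t0 ht] := cin y cy a a0.
      exists (Num.min t (s - cabs (y - x))); first by rewrite lt_min t0 subr_gt0.
      move=> z cz; rewrite lt_min => /andP[z1 z2].
      by rewrite /v ys ifT; [exact: ht|have := cabs_tri z y x; lra].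
    exists (s / 2); first by rewrite divr_gt0.
    move=> z cz zy; rewrite !vout ?subrr ?normr0//.
      by lra.
    by have := cabs_tri y z x; rewrite (cabs_sub y z); lra.
  - move=> y Dy; case: (ltP (cabs (y - x)) s) => ys.
      apply: (@subh_local _ (fun y => Num.max (f x - e / 2 - K * b y) (- M)) _ _ (s - cabs (y - x))).
      + by rewrite subr_gt0.
      + by move=> z z1; rewrite /v ifT//; have := cabs_tri z y x; lra.
      + apply: subh_max; last exact/harm_subh/harm_cst.
        apply/harm_subh/harmB; first exact: harm_cst.
        by apply: harmZ; have [_] := hb y (lt_trans ys sr); apply.
    have [t t0 ht] := oD Dy.
    apply: (@subh_local _ (fun=> - M) _ _ (Num.min t (s / 2))); last exact/harm_subh/harm_cst.
      by rewrite lt_min t0 divr_gt0.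
    move=> z; rewrite lt_min => /andP[/ht Dz zy]; rewrite vout//; first exact: sub_clos.
    by have := cabs_tri y z x; rewrite (cabs_sub y z); lra.
  - move=> y hy; have := fM hy; rewrite ler_norml => /andP[fy _].
    rewrite /v; case: ltP => // ys; rewrite ge_max fy andbT.
    have := hd y hy (lt_trans ys sd); have := bpos y hy.1 (lt_trans ys sr).
    by rewrite ltr_norml; lra.
have [t t0 ht] := cKb x cx _ e2.
exists (Num.min t s); first by rewrite lt_min t0.
move=> y Dy; rewrite lt_min => /andP[yt ys].
have cy := sub_clos Dy.
have := ht y cy yt; rewrite bx mulr0 subr0 ltr_norml => ht'.
have u1 : U y <= f x + e / 2 + K * b y by apply: U_le => w Fw; exact: up.
have := U_ub Fv cy; rewrite /v ys ge_max => /andP[u2 _].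
by rewrite ler_norml; lra.
Qed.

Lemma perron_aux : (forall x, bd D x -> sector D x) ->
  exists u, [/\ cont (clos D) u, forall x, D x -> harm u x & forall x, bd D x -> u x = f x].
Proof.
move=> hs; pose u x := if `[< D x >] then U x else f x.
have uD x : D x -> u x = U x by move=> Dx; rewrite /u asboolT.
have uB x : ~ D x -> u x = f x by move=> Dx; rewrite /u asboolF.
exists u; split; last by move=> x [_ /uB].
- move=> x cx e e0; have [Dx|nDx] := pselect (D x).
    have [_ [r r0 cU]] := U_harm Dx; have [s s0 hs'] := oD Dx.
    have xx : cball x r x by rewrite /cball/= subrr cabs0 ltW.
    have [d d0 hd] := cU x xx e e0.
    exists (Num.min (Num.min r s) d); first by rewrite !lt_min r0 s0.
    move=> y cy; rewrite !lt_min => /andP[/andP[yr ys] yd].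
    by rewrite !uD//; [apply: hd => //; exact: ltW|exact: hs'].
  have hx : bd D x by split.
  have e2 : 0 < e / 2 by rewrite divr_gt0.
  have [d d0 hd] := U_bd hx (hs x hx) e2.
  have [d' d0' hd'] := cf hx e0.
  exists (Num.min d d'); first by rewrite lt_min d0.
  move=> y cy; rewrite lt_min => /andP[y1 y2]; rewrite (uB x)//.
  have [Dy|nDy] := pselect (D y).
    by rewrite uD// (le_lt_trans (hd y Dy y1))//; lra.
  by rewrite uB//; apply: hd'.
- move=> x Dx; have [r r0 hr] := oD Dx; have [hU _] := U_harm Dx.
  by apply: harm_local r0 _ hU => y /hr Dy; rewrite uD.
Qed.
End Perron.

Theorem dirichlet_exists (R : realType) (D : set R[i]) (f : R[i] -> R) : opn D -> bnd D ->
  (forall x, bd D x -> sector D x) -> cont (bd D) f ->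
  exists u, [/\ cont (clos D) u, forall x, D x -> harm u x & forall x, bd D x -> u x = f x].
Proof.
move=> oD bD sD cf.
have bb : bnd (bd D) by apply: bnd_sub (bnd_clos bD) => x [].
have [M M0 hM] := cont_bounded bb (clos_bd oD) cf.
exact: perron_aux oD bD cf M0 hM sD.
Qed.

(** * Schauder estimates up to the boundary *)

Section BoundaryRegularity.
Variable R : realType.
Local Notation C := R[i].
Local Notation Re := (@complex.Re R).
Local Notation Im := (@complex.Im R).
Implicit Types (x y z w : C) (u v f : C -> R) (D E : set C) (c : nat -> C).

(** In the model half disc the flat side is the imaginary axis, and [- z^*] is the reflection in it;
    [odd_coef] below projects on the coefficients of odd functions. *)
Lemma hp_refl n c z : hp n c (- z^*) = hp n (fun k => (-1) ^+ k * (c k)^*) z.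
Proof.
rewrite /hp -[LHS]ReJ conj_sum; congr Re; apply: eq_bigr => k _.
rewrite !conjM conjX; have -> : (wt R k)^* = wt R k.
  by rewrite /wt; case: ifP => _; rewrite ?conjc1// conjc_nat.
have -> : (- z^*)^* = - z :> C by apply: complex_ext; rewrite !(ReJ, ReN, ImJ, ImN) ?opprK.
by rewrite (exprNn z) -!mulrA; congr (_ * _); rewrite mulrCA.
Qed.

Definition odd_coef c k : C := (c k - (-1) ^+ k * (c k)^*) / 2.

Lemma hp_odd n c z : hp n (odd_coef c) z = (hp n c z - hp n c (- z^*)) / 2.
Proof.
rewrite hp_refl /hp -ReB -sumrB.
have -> (a : C) : Re a / 2 = Re ((1 / 2)%:C * a) by rewrite ReZ; ring.
congr Re; rewrite mulr_sumr; apply: eq_bigr => k _.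
rewrite /odd_coef rmorphM/= rmorph1 fmorphV rmorph_nat.
by move: ((-1) ^+ k * (c k)^*) => a; field.
Qed.

Lemma fin_supp_odd n c : fin_supp n c -> fin_supp n (odd_coef c).
Proof.
move=> [c0 cn]; split; last by move=> k /cn; rewrite /odd_coef => ->; rewrite conjc0 mulr0 subrr mul0r.
rewrite /odd_coef expr0 mul1r.
have -> : (c 0%N)^* = c 0%N by apply: complex_ext; rewrite ?ReJ// ImJ c0 oppr0.
by rewrite subrr mul0r.
Qed.

Lemma conj_negJ z : - (- z^*)^* = z.
Proof. by apply: complex_ext; rewrite !(ReJ, ReN, ImJ, ImN) ?opprK. Qed.

Lemma cabs_negJ z : cabs (- z^*) = cabs z.
Proof. by rewrite cabsN cabsJ. Qed.

Lemma Re_negJ z : Re (- z^*) = - Re z.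
Proof. by rewrite ReN ReJ. Qed.

Lemma harm_hp n c z : harm (hp n c) z.
Proof.
have -> : hp n c = Re \o horner (\poly_(k < n) (wt R k * c k)).
  by apply/funext => x; rewrite /hp /= horner_poly.
by apply: taylor3_harm; exact: taylor3_poly.
Qed.

Lemma cont_hp n c A : cont A (hp n c).
Proof.
have -> : hp n c = Re \o horner (\poly_(k < n) (wt R k * c k)).
  by apply/funext => x; rewrite /hp /= horner_poly.
by apply: taylor3_cont => y _; exact: taylor3_poly.
Qed.

Lemma apx_hpoly n c : apx (hp n c).
Proof.
move=> e e0; exists (\poly_(k < n) (wt R k * c k)) => z _.
by rewrite /hp horner_poly subrr normr0 ltW.
Qed.

Definition half_disc : set C := [set z | cabs z <= 1 /\ 0 <= Re z].

(* Odd reflection of [v] across the flat side, after truncating its small boundary values. *)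
Lemma half_disc_approx v (m n e : R) : 0 <= n -> 0 < e ->
  cont half_disc v -> (forall z, cabs z < 1 -> 0 < Re z -> harm v z) ->
  (forall z, half_disc z -> `|v z| <= m) ->
  (forall z, cabs z <= 1 -> Re z = 0 -> `|v z| <= n) ->
  exists N c, [/\ fin_supp N (odd_coef c),
    forall z, cabs z <= 1 -> `|hp N (odd_coef c) z| <= m + e &
    forall z, half_disc z -> `|v z - hp N (odd_coef c) z| <= n + e].
Proof.
move=> n0 e0 cv hv vm vn.
(* Soft truncation at height [n]: it moves [v] by at most [n] and vanishes where [v] is at most [n]
   in modulus, so that the odd reflection is continuous across the flat side. *)
pose g z := Num.max (v z - n) 0 - Num.max (- v z - n) 0.
have gv z : `|v z - g z| <= n.
  by rewrite /g ler_norml; case: (leP (v z - n)); case: (leP (- v z - n)); lra.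
have gm z : half_disc z -> `|g z| <= m.
  move=> /vm; rewrite /g !ler_norml.
  by case: (leP (v z - n)); case: (leP (- v z - n)); lra.
have g0 z : cabs z <= 1 -> Re z = 0 -> g z = 0.
  move=> z1 z0; have := vn z z1 z0; rewrite /g ler_norml.
  by case: (leP (v z - n)); case: (leP (- v z - n)); lra.
have cg : cont half_disc g.
  apply: contB; apply: cont_max; try exact: cont_cst.
    by apply: contB => //; exact: cont_cst.
  by apply: contB; [exact: contN|exact: cont_cst].
clearbody g.
pose f z := if 0 <= Re z then g z else - g (- z^*).
have f_odd z : cabs z = 1 -> f (- z^*) = - f z.
  move=> z1; rewrite /f Re_negJ conj_negJ oppr_ge0; case: ifP => h1; case: ifP => h2 //.
  - have z0 : Re z = 0 by apply/le_anti; rewrite h1 h2.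
    by rewrite !g0 ?oppr0 ?cabs_negJ ?z1// Re_negJ z0 oppr0.
  - by rewrite opprK.
  - by move: h1 h2; case: (leP 0 (Re z)) => // /ltW ->.
have fm z : cabs z = 1 -> `|f z| <= m.
  move=> z1; rewrite /f; case: ifP => h; first by apply: gm; split=> //; rewrite z1.
  rewrite normrN; apply: gm; split; first by rewrite cabs_negJ z1.
  by rewrite Re_negJ oppr_ge0; case: leP h => // /ltW.
have conf : cont [set z : C | cabs z = 1] f.
  move=> x x1 a a0; case: (leP 0 (Re x)) => x0; last first.
    have hx : half_disc (- x^*).
      by split; [rewrite cabs_negJ x1|rewrite Re_negJ oppr_ge0 ltW].
    have [d d0 hd] := cg _ hx a a0.
    exists (Num.min d (- Re x)); first by rewrite lt_min d0 oppr_gt0.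
    move=> y y1; rewrite lt_min => /andP[yd yx].
    have ry : Re y < 0 by have := Re_le (y - x); rewrite ReB ler_norml; lra.
    rewrite /f !leNgt x0 ry /= -opprD normrN; apply: hd.
      by split; [rewrite cabs_negJ y1|rewrite Re_negJ oppr_ge0 ltW].
    by rewrite opprK addrC -rmorphB cabsJ cabs_sub.
  have hx : half_disc x by split; rewrite ?x1.
  have [d d0 hd] := cg _ hx a a0.
  move: x0; rewrite le_eqVlt => /orP[/eqP x0|x0].
    exists d => // y y1 yx; rewrite /f -x0 lexx; case: ifP => ry.
      by apply: hd => //; split; rewrite ?y1.
    rewrite [g x]g0 ?x1// subr0 normrN -[g _]subr0 -(g0 x) ?x1//; apply: hd.
      split; first by rewrite cabs_negJ y1.
      by rewrite Re_negJ oppr_ge0; case: leP ry => // /ltW.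
    have -> : - y^* - x = - (y - x)^*.
      by apply: complex_ext; rewrite !(ReN, ImN, ReB, ImB, ReJ, ImJ) -?x0 ?subr0 ?opprK//; ring.
    by rewrite cabs_negJ.
  exists (Num.min d (Re x)); first by rewrite lt_min d0.
  move=> y y1; rewrite lt_min => /andP[yd yx].
  have ry : 0 < Re y by have := Re_le (y - x); rewrite ReB ler_norml; lra.
  rewrite /f !ltW//; apply: hd => //; split; rewrite ?y1//; exact: ltW.
have [P hP] := korovkin conf e0; have [N [c [hc Pc]]] := poly_hp P.
exists N, c.
have Qf z : cabs z = 1 -> `|f z - hp N (odd_coef c) z| <= e.
  move=> z1; rewrite hp_odd; have := hP z z1; have := hP (- z^*).
  rewrite cabs_negJ => /(_ z1); rewrite !Pc f_odd// !ler_norml; lra.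
have Qm z : cabs z <= 1 -> `|hp N (odd_coef c) z| <= m + e.
  rewrite le_eqVlt => /orP[/eqP z1|z1].
    have := Qf z z1; have := fm z z1; rewrite !ler_norml; lra.
  apply: (@max_principle_abs _ _ (hp N (odd_coef c)) _ (@opn_oball R 0 1) (@bnd_oball R 0 1)).
  - exact: cont_hp.
  - by move=> y _; exact: harm_hp.
  - move=> y /bd_oball; rewrite subr0 => y1.
    have := Qf y y1; have := fm y y1; rewrite !ler_norml; lra.
  - by apply: sub_clos; rewrite /oball/= subr0.
have Q0 z : Re z = 0 -> hp N (odd_coef c) z = 0.
  move=> z0; have zz : - z^* = z by apply: complex_ext; rewrite ?Re_negJ ?ImN ?ImJ ?z0 ?oppr0 ?opprK.
  by rewrite hp_odd zz subrr mul0r.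
split=> //; first exact: fin_supp_odd.
pose H : set C := [set z | cabs z < 1 /\ 0 < Re z].
have oH : opn H.
  move=> z [z1 z0]; exists (Num.min (1 - cabs z) (Re z)); first by rewrite lt_min subr_gt0 z1.
  move=> y; rewrite lt_min => /andP[y1 y2]; split; first by have := cabs_leD y z; lra.
  by have := Re_le (y - z); rewrite ReB ler_norml; lra.
have cH : clos H `<=` half_disc.
  move=> z hz; split; rewrite leNgt; apply/negP => h.
    have [|y [y1 _] yz] := hz (cabs z - 1); first by rewrite subr_gt0.
    by have := cabs_leD z y; rewrite (cabs_sub z y); lra.
  have [|y [_ y0] yz] := hz (- Re z); first by rewrite oppr_gt0.
  by have := Re_le (y - z); rewrite ReB ler_norml; lra.
have bH : bnd H by exists 1 => z [/ltW].
have main z : clos H z -> `|v z - hp N (odd_coef c) z| <= n + e.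
  apply: (@max_principle_abs _ _ (fun z => v z - hp N (odd_coef c) z)) => //.
  - by apply: contB; [exact: cont_sub cv|exact: cont_hp].
  - by move=> y [y1 y0]; apply: harmB; [exact: hv|exact: harm_hp].
  - move=> y [/cH[y1 y0] nH].
    move: y0; rewrite le_eqVlt => /orP[/eqP y0|y0].
      by rewrite Q0// subr0 (le_trans (vn y y1 _))// lerDl ltW.
    have {}y1 : cabs y = 1.
      by apply/eqP; rewrite eq_le y1 leNgt; apply/negP => ?; apply: nH.
    have := Qf y y1; rewrite /f (ltW y0) => hq; have := gv y; move: hq; rewrite !ler_norml; lra.
move=> z [z1 z0]; apply: main => r r0.
pose t := Num.min (r / 2) 1; have t0 : 0 < t by rewrite lt_min divr_gt0// ltr01.
have tr : t <= r / 2 by rewrite ge_min lexx.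
have t1 : t <= 1 by rewrite ge_min lexx orbT.
(* Contracting towards 0 and shifting to the right brings a point of the closed half disc into its
   interior. *)
exists ((1 - t / 2)%:C * z + (t / 4)%:C); last first.
  have -> : (1 - t / 2)%:C * z + (t / 4)%:C - z = (t / 4)%:C - (t / 2)%:C * z.
    by rewrite rmorphB rmorph1; ring.
  rewrite (le_lt_trans (cabsB _ _))// cabsZ cabs_real !ger0_norm; nra.
split.
  rewrite (le_lt_trans (cabsD _ _))// cabsZ cabs_real !ger0_norm; nra.
rewrite ReD ReZ /=; nra.
Qed.
End BoundaryRegularity.

(** * Comparison with a linear function at one scale *)

Section OneStep.
Variable R : realType.
Local Notation C := R[i].
Local Notation Re := (@complex.Re R).
Local Notation Im := (@complex.Im R).
Implicit Types (x y z w : C) (u v f : C -> R) (D E : set C) (c : nat -> C).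

(** Oddness makes the coefficient of order 0 vanish and that of order 1 real, so the first order
    part of the approximating polynomial is a multiple of [Re z]. *)
Lemma half_disc_linear v (m n e : R) : 0 <= n -> 0 < e ->
  cont (@half_disc R) v -> (forall z, cabs z < 1 -> 0 < Re z -> harm v z) ->
  (forall z, half_disc z -> `|v z| <= m) ->
  (forall z, cabs z <= 1 -> Re z = 0 -> `|v z| <= n) ->
  exists b, `|b| <= 2 * (m + e) /\ forall z, half_disc z -> cabs z <= 1 / 2 ->
    `|v z - b * Re z| <= n + e + 4 * (m + e) * cabs z ^+ 2.
Proof.
move=> n0 e0 cv hv vm vn; have [N [c [hc Qm vQ]]] := half_disc_approx n0 e0 cv hv vm vn.
have aQ := apx_hpoly N (odd_coef c).
have cb k : cabs (odd_coef c k) <= m + e.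
  rewrite -(coef_hp k hc); apply: coef_bound => // z z1; apply: Qm; by rewrite z1.
have c1 : odd_coef c 1 = (Re (odd_coef c 1))%:C.
  by apply: complex_ext => //=; rewrite /odd_coef expr1 mulN1r opprK -ReC2.
exists (2 * Re (odd_coef c 1)); split.
  by rewrite normrM ger0_norm// ler_pM2l// (le_trans (Re_le _)).
move=> z hz z2; have z1 : cabs z < 1 by zlra.
have h2 : `|hp N (odd_coef c) z - 2 * Re (odd_coef c 1) * Re z| <= 4 * (m + e) * cabs z ^+ 2.
  have me0 : 0 <= m + e := le_trans (cabs_ge0 _) (cb 0%N).
  have h3 : 2 * (m + e) * cabs z ^+ 2 / (1 - cabs z) <= 4 * (m + e) * cabs z ^+ 2.
    rewrite ler_pdivrMr ?subr_gt0//; have := mulr_ge0 me0 (sqr_ge0 (cabs z)); nra.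
  apply: le_trans h3; have <- : hp 2 (coef (hp N (odd_coef c))) z = 2 * Re (odd_coef c 1) * Re z.
    rewrite /hp !big_ord_recl big_ord0 /wt/= !(coef_hp _ hc) expr1 addr0 ReD.
    have -> : odd_coef c 0 = 0.
      apply: complex_ext; last exact: hc.1.
      have -> : odd_coef c 0 = (1 / 2)%:C * (c 0%N - (c 0%N)^*).
        by rewrite /odd_coef expr0 mul1r rmorphM/= rmorph1 fmorphV rmorph_nat; ring.
      by rewrite ReZ ReB ReJ subrr mulr0.
    by rewrite mulr0 mul0r add0r c1 -mulrA Re2 ReZ mulrA.
  apply: apx_exp => // k _; by rewrite (coef_hp _ hc).
have := vQ z hz; move: h2; rewrite !ler_norml; zlra.
Qed.

Lemma apx_affine u (c a z : C) (r : R) : a != 0 -> apx (dil (c + a * z) r u) ->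
  apx (dil z (r / cabs a) (fun y => u (c + a * y))).
Proof.
move=> a0 h e e0; have [P hP] := h e e0.
have ca : (cabs a)%:C != 0 :> C by rewrite (inj_eq (@complexI _)) cabs_eq0.
exists (P \Po (a / (cabs a)%:C)%:P * 'X) => y y1.
rewrite horner_comp !hornerE.
have := hP (a / (cabs a)%:C * y); rewrite !cabsM cabsV cabs_real ger0_norm ?cabs_ge0//.
rewrite mulfV ?cabs_eq0// mul1r => /(_ y1); rewrite /dil.
have -> : c + a * z + r%:C * (a / (cabs a)%:C * y) = c + a * (z + (r / cabs a)%:C * y).
  by rewrite rmorphM/= fmorphV/=; field.
by [].
Qed.

(** The boundary of [E] lies in the strip of half width [k] around the imaginary axis. A comparison
    function bounds [v] in the strip, and to the right of it a shifted half disc allows the flat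
    estimate. *)
Lemma one_step E v (k m n e p : R) : opn E -> 0 <= k -> k <= p -> p <= 1 / 16 -> 0 <= n ->
  0 < e -> e <= m ->
  (forall z, E z -> cabs z < 1 -> - k <= Re z) ->
  (forall z, cabs z < 1 -> k < Re z -> E z) ->
  cont (clos E `&` oball 0 1) v -> (forall z, E z -> cabs z < 1 -> harm v z) ->
  (forall z, clos E z -> cabs z < 1 -> `|v z| <= m) ->
  (forall z, bd E z -> cabs z < 1 -> `|v z| <= n) ->
  exists b : R, `|b| <= 8 * m /\ forall z, clos E z -> cabs z <= p ->
    `|v z - b * Re z| <= n + e + 264 * k * m + 128 * m * p ^+ 2.
Proof.
move=> oE k0 kp p1 n0 e0 em Elo Ehi cv hv vm vn.
have m0 : 0 < m := lt_le_trans e0 em.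
have cElo z : clos E z -> cabs z < 1 -> - k <= Re z.
  move=> cz z1; apply: le_eps => d d0.
  have [|y Ey yz] := cz (Num.min d (1 - cabs z)); first by rewrite lt_min d0 subr_gt0.
  move: yz; rewrite lt_min => /andP[y1 y2].
  have := Elo y Ey; have := Re_le (y - z); have := cabs_leD y z.
  rewrite ReB ler_norml => h1 h2 /(_ _); have : cabs y < 1 by zlra.
  by move=> h3 /(_ h3); zlra.
(* [256 = 32 * 8]: the comparison function enters with the factor [32 * m] and is at most [8 * k] in
   the strip. The constant 264 of the statement adds 8 for the linear term there. *)
pose n' := n + 256 * k * m.
have bot z1 : clos E z1 -> cabs z1 <= 5 / 8 -> Re z1 <= k -> `|v z1| <= n'.
  move=> cz1 z1a z1b.
  have t1 : - k <= Re z1 by apply: cElo => //; zlra.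
  pose G := E `&` oball z1 (1 / 4).
  have cGE : clos G `<=` clos E by apply: clos_mono => y [].
  have cGB : clos G `<=` cball z1 (1 / 4).
    by move=> y hy; apply: clos_oball; apply: clos_mono hy => t [].
  have B1 y : cball z1 (1 / 4) y -> cabs y < 1.
    by rewrite /cball/= => h; have := cabs_leD y z1; zlra.
  (* Harmonic, as the real part of a polynomial. It is nonnegative on [clos E], where [Re z + k]
     lies between 0 and 4, at most [8 * k] at [z1], and at least [1 / 32] at distance [1 / 4] from
     [z1]. *)
  pose q z := Re (4 * (z + k%:C - (Im z1)%:C * 'i) - (z + k%:C - (Im z1)%:C * 'i) ^+ 2).
  have qE z : q z = 4 * (Re z + k) + (Im z - Im z1) ^+ 2 - (Re z + k) ^+ 2.
    have R4 w : Re (4 * w) = 4 * Re w by rewrite mulr_natl (_ : 4%N = 2 + 2)%N// mulrnDr !mulr2n !ReD; ring.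
    by rewrite /q ReB R4 expr2 ReM !(ReD, ReN, ImD, ImN, ReZ, ImZ) /=; ring.
  have hq z : harm q z.
    apply: (@taylor3_harm _ (fun z => 4 * (z + k%:C - (Im z1)%:C * 'i) - (z + k%:C - (Im z1)%:C * 'i) ^+ 2)).
    pose P : {poly C} := 4%:P * ('X + k%:C%:P - ((Im z1)%:C * 'i)%:P) - ('X + k%:C%:P - ((Im z1)%:C * 'i)%:P) ^+ 2.
    have := taylor3_poly P z; congr (taylor3 _ z); apply/funext => y.
    by rewrite /P !hornerE.
  have cq A : cont A q.
    apply: (@taylor3_cont _ (fun z => 4 * (z + k%:C - (Im z1)%:C * 'i) - (z + k%:C - (Im z1)%:C * 'i) ^+ 2)) => z _.
    pose P : {poly C} := 4%:P * ('X + k%:C%:P - ((Im z1)%:C * 'i)%:P) - ('X + k%:C%:P - ((Im z1)%:C * 'i)%:P) ^+ 2.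
    have := taylor3_poly P z; congr (taylor3 _ z); apply/funext => y.
    by rewrite /P !hornerE.
  clearbody q.
  have q0 z : clos E z -> cabs z < 1 -> 0 <= q z.
    move=> cz z2; rewrite qE; have := cElo z cz z2; have := Re_le z.
    by rewrite ler_norml; have := sqr_ge0 (Im z - Im z1); nra.
  have bound s : `|s| = 1 -> s * v z1 <= n + 32 * m * q z1.
    move=> s1; rewrite -lerBlDr.
    have sv z (a : R) : `|v z| <= a -> s * v z <= a.
      by move=> h; rewrite (le_trans (ler_norm _))// normrM s1 mul1r.
    apply: (@max_principle _ G (fun z => s * v z - 32 * m * q z)).
    - move=> y [Ey y2]; have [r1 r10 h1] := oE _ Ey; have [r2 r20 h2] := opn_oball y2.
      exists (Num.min r1 r2); first by rewrite lt_min r10.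
      by move=> t; rewrite lt_min => /andP[/h1 ? /h2 ?].
    - by apply: bnd_sub (@bnd_oball _ z1 (1 / 4)) => y [].
    - apply: contB; apply: contZ => //; apply: cont_sub cv => y cy.
      by split; [exact: cGE|rewrite /oball/= subr0; apply/B1/cGB].
    - move=> y [Ey y2]; apply/harm_subh/harmB; apply: harmZ => //.
      by apply: hv => //; apply/B1/ltW.
    - move=> y [cy nG]; have yB := cGB y cy; have y1 := B1 y yB; have cEy := cGE y cy.
      have qy := q0 y cEy y1.
      have [Ey|nE] := pselect (E y); last first.
        have := sv y n (vn y (conj cEy nE) y1); have := mulr_ge0 (ltW m0) qy; zlra.
      have yd : cabs (y - z1) = 1 / 4.
        by apply/eqP; rewrite eq_le yB leNgt; apply/negP => ?; apply: nG.
      have := sv y m (vm y cEy y1).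
      suff : 1 <= 32 * q y by move=> h; have := ler_wpM2l (ltW m0) h; zlra.
      have := cabs_sqr (y - z1); rewrite yd ReB ImB qE.
      have := cElo y cEy y1; have := Re_le y; rewrite ler_norml.
      move: (Re y) (Re z1) (Im y - Im z1) t1 z1b => a b' d.
      nra.
    - move=> r r0; have [|y Ey yz] := cz1 (Num.min r (1 / 4)); first by rewrite lt_min r0 divr_gt0.
      by move: yz; rewrite lt_min => /andP[y1 y2]; exists y.
  have qz1 : q z1 <= 8 * k.
    rewrite qE subrr expr0n addr0; have := sqr_ge0 (Re z1 + k); zlra.
  have := bound 1; have := bound (-1); rewrite normrN normr1 => /(_ erefl) h1 /(_ erefl) h2.
  have := ler_wpM2l (ltW m0) qz1; rewrite /n' ler_norml; zlra.
have k16 : k <= 1 / 16 by zlra.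
(* The half disc of radius [1 / 2] moved to the right by [k] lies in the closure of [E], with its
   flat side in the strip already treated. Its odd linear part is [b * (2 * (Re z - k))], whence the
   witness [2 * b]. *)
have hin z : half_disc z -> clos E (k%:C + (1 / 2)%:C * z).
  move=> [z1 z0] r r0; pose t := Num.min (r / 2) (1 / 8).
  have t0 : 0 < t by rewrite lt_min !divr_gt0.
  have t1 : t <= 1 / 8 by rewrite ge_min lexx orbT.
  have tr : t <= r / 2 by rewrite ge_min lexx.
  exists (k%:C + (1 / 2)%:C * z + t%:C); last first.
    by rewrite dist_shift cabs_real gtr0_norm//; zlra.
  apply: Ehi; last by rewrite !ReD ReZ /=; zlra.
  have := cabsD (k%:C + (1 / 2)%:C * z) t%:C; have := cabsD k%:C ((1 / 2)%:C * z).
  by rewrite cabsZ !cabs_real !ger0_norm ?(ltW t0)//; zlra.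
have hin2 z : cabs z <= 1 -> cabs (k%:C + (1 / 2)%:C * z) <= 5 / 8.
  move=> z1; have := cabsD k%:C ((1 / 2)%:C * z).
  by rewrite cabsZ !cabs_real !ger0_norm//; zlra.
have n'0 : 0 <= n' by apply: addr_ge0 n0 _; apply: mulr_ge0; [apply: mulr_ge0; [exact: ler0n|exact: k0]|exact: ltW].
have hlf : (0 : R) < 1 / 2 by rewrite divr_gt0.
have [||||b [hb1 hb2]] := @half_disc_linear (dil k%:C (1 / 2) v) m n' e n'0 e0.
- apply: (cont_dil hlf _ cv) => z hz; split; first exact: hin.
  by rewrite /oball/= subr0; have := hin2 z hz.1; zlra.
- move=> z z1 z0; apply: harm_scale; first by rewrite gt_eqF.
  have z2 : cabs (k%:C + (1 / 2)%:C * z) < 1 by have := hin2 z (ltW z1); zlra.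
  by apply: hv => //; apply: Ehi => //; rewrite ReD ReZ /=; zlra.
- by move=> z hz; apply: vm; [exact: hin|have := hin2 z hz.1; zlra].
- move=> z z1 z0; apply: bot; [apply: hin; split; rewrite ?z0//|exact: hin2|].
  by rewrite ReD ReZ z0 /=; zlra.
have hb : `|b| <= 4 * m by zlra.
exists (2 * b); split; first by rewrite normrM ger0_norm//; zlra.
move=> z cz zp; have km : 0 <= k * m by rewrite mulr_ge0// ltW.
have mp : 0 <= m * p ^+ 2 by rewrite mulr_ge0 ?sqr_ge0// ltW.
have bk (t : R) : `|t| <= k -> `|2 * b * t| <= 8 * (k * m).
  move=> tk; rewrite !normrM (ger0_norm (ler0n R 2)) -mulrA.
  have : `|b| * `|t| <= 4 * m * k by rewrite ler_pM.
  zlra.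
have [zk|zk] := ltP (Re z) k.
  have z1 : cabs z < 1 by zlra.
  have v1 : `|v z| <= n' by apply: bot => //; [zlra|exact: ltW].
  have v2 : `|2 * b * Re z| <= 8 * (k * m).
    by apply: bk; rewrite ler_norml (ltW zk) andbT; exact: cElo.
  have := ler_normB (v z) (2 * b * Re z); rewrite /n' in v1; zlra.
pose y := 2%:R * (z - k%:C).
have yz : k%:C + (1 / 2)%:C * y = z.
  by rewrite /y rmorphM/= rmorph1 fmorphV rmorph_nat; field.
have Ry : Re y = 2 * (Re z - k) by rewrite /y Re2 ReB.
have cy : cabs y <= 4 * p.
  rewrite /y cabsM cabs_nat; have := cabsB z k%:C; rewrite cabs_real ger0_norm//; zlra.
have := hb2 y; rewrite /dil yz Ry => /(_ _ _) h.
have {h} : `|v z - b * (2 * (Re z - k))| <= n' + e + 4 * (m + e) * cabs y ^+ 2.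
  by apply: h; [split; [zlra|rewrite Ry; zlra]|zlra].
have : 4 * (m + e) * cabs y ^+ 2 <= 128 * (m * p ^+ 2).
  have -> : 128 * (m * p ^+ 2) = 4 * (2 * m) * (4 * p) ^+ 2 by ring.
  apply: ler_pM; rewrite ?sqr_ge0//; first by rewrite mulr_ge0//; zlra.
    by zlra.
  by rewrite lerXn2r ?nnegrE ?cabs_ge0//; zlra.
have := bk k; rewrite ger0_norm// => /(_ (lexx _)) h1 h2 h3.
have -> : v z - 2 * b * Re z = (v z - b * (2 * (Re z - k))) - 2 * b * k by ring.
apply: le_trans (ler_normB _ _) _; rewrite /n' in h3; zlra.
Qed.

Lemma geo_limit (s : nat -> R) (a q : R) : 0 <= q -> q < 1 ->
  (forall k, `|s k.+1 - s k| <= a * q ^+ k) ->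
  exists l, forall k, `|s k - l| <= a * q ^+ k / (1 - q).
Proof.
move=> q0 q1 hs; have q10 : 0 < 1 - q by rewrite subr_gt0.
have a0 : 0 <= a by have := hs 0%N; rewrite expr0 mulr1; exact: le_trans.
pose B k := a * q ^+ k / (1 - q).
have BS k : B k.+1 = B k - a * q ^+ k.
  by rewrite /B exprS; field; rewrite gt_eqF.
have B0 k : 0 <= B k by rewrite /B !mulr_ge0 ?exprn_ge0 ?invr_ge0// ltW.
have lo k m : s k - B k <= s (k + m)%N - B (k + m)%N.
  elim: m => [|m IH]; first by rewrite addn0.
  by rewrite addnS BS; have := hs (k + m)%N; rewrite ler_norml; zlra.
have hi k m : s (k + m)%N + B (k + m)%N <= s k + B k.
  elim: m => [|m IH]; first by rewrite addn0.
  by rewrite addnS BS; have := hs (k + m)%N; rewrite ler_norml; zlra.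
have [|l hl] := @nested R (fun k => s k - B k) (fun k => s k + B k).
  move=> k m /=; have := lo k m; have := hi m k; rewrite (addnC m k).
  by have := B0 (k + m)%N; zlra.
by exists l => k; have /= := hl k; rewrite ler_norml -/(B k); zlra.
Qed.
End OneStep.

(** * Iteration over geometric scales *)

Section Iteration.
Variable R : realType.
Local Notation C := R[i].
Local Notation Re := (@complex.Re R).
Local Notation Im := (@complex.Im R).
Implicit Types (x y z w : C) (u v f : C -> R) (D E : set C) (c : nat -> C).

Lemma powRXn (a b : R) n : 0 <= a -> powR (a ^+ n) b = powR a b ^+ n.
Proof.
move=> a0; elim: n => [|n IH]; first by rewrite !expr0 powR1.
by rewrite !exprS powRM ?exprn_ge0// IH.
Qed.

Lemma powR_lt_mono (a b c : R) : 0 <= c -> 0 <= a -> a <= b -> powR a c <= powR b c.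
Proof. by move=> c0 a0 ab; apply: ge0_ler_powR; rewrite // nnegrE// (le_trans a0). Qed.

Lemma small_exp (r e : R) : 0 <= r -> r <= 1 / 2 -> 0 < e -> exists n, r ^+ n <= e.
Proof.
move=> r0 r1 e0; have [n hn] := inv_lt e0; exists n; apply: le_trans (ltW hn).
elim: n {hn} => [|n IH]; first by rewrite expr0 invr1.
rewrite exprS (le_trans (ler_pM r0 (exprn_ge0 _ r0) r1 IH))//.
rewrite mul1r -invfM lef_pV2 ?posrE ?mulr_gt0// -natrM ler_nat.
by rewrite mul2n -addnn addnS !ltnS leq_addl.
Qed.

(** At scale [p ^+ k] the function [v] minus a multiple of [Re z] is at most [M * mu ^+ k], where
    [mu] is [p] to the power [1 + al]. The subtracted multiples do not vanish on the curved
    boundary, but the error is proportional to [k0]; therefore flatness is required with a small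
    constant depending on [al] alone. *)
Lemma iterate (al : R) : 0 < al -> al < 1 -> exists k0 K : R, [/\ 0 < k0, 0 < K &
  forall E v (M : R), opn E -> 0 < M ->
  (forall z, E z -> cabs z < 1 -> - (k0 * powR (cabs z) (1 + al)) <= Re z) ->
  (forall z, cabs z < 1 -> k0 * powR (cabs z) (1 + al) < Re z -> E z) ->
  cont (clos E `&` oball 0 1) v -> (forall z, E z -> cabs z < 1 -> harm v z) ->
  (forall z, clos E z -> cabs z < 1 -> `|v z| <= M) ->
  (forall z, bd E z -> cabs z < 1 -> v z = 0) ->
  exists b : R, `|b| <= K * M /\ forall z, clos E z -> cabs z < 1 ->
    `|v z - b * Re z| <= K * M * powR (cabs z) (1 + al)].
Proof.
move=> al0 al1; have al10 : 0 < 1 + al by rewrite addr_gt0.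
(* With [p ^+ 2 = mu * c5] the quadratic error [128 * m * p ^+ 2] of [one_step] is [mu / 4 * m]. The
   choices of [e] and [k0] allot as much to the approximation error and to the flatness error, so
   that three quarters of [mu * m] are used. *)
have [c5 c5E] : exists a : R, a = 1 / 512 by eexists.
have c50 : 0 < c5 by zlra.
have c51 : c5 <= 1 by zlra.
pose p : R := powR c5 (1 - al)^-1.
have p0 : 0 < p by rewrite powR_gt0.
have al1' : 0 < 1 - al by rewrite subr_gt0.
have pE : powR p (1 - al) = c5.
  by rewrite -powRrM mulVf ?gt_eqF// powRr1// ltW.
have p512 : p <= c5.
  apply: ge1r_powR; first by rewrite c50.
  by rewrite invf_ge1// gerBl ltW.
pose q := powR p al; have q0 : 0 < q by rewrite powR_gt0.
have q1 : q < 1.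
  have e1 : powR 1 al = 1 :> R by rewrite powR1.
  by rewrite /q -[ltRHS]e1; apply: gt0_ltr_powR; rewrite ?nnegrE ?(ltW p0)//; zlra.
pose mu := powR p (1 + al).
have muE : mu = p * q by rewrite /mu powRD ?gt_eqF// ?implybT// powRr1// ltW.
have mu0 : 0 < mu by rewrite muE mulr_gt0.
have p2 : p ^+ 2 = mu * c5.
  have h : powR p al * powR p (1 - al) = p.
    rewrite -powRD; last by rewrite (gt_eqF p0) implybT.
    by have -> : al + (1 - al) = 1 by [ring]; rewrite powRr1// ltW.
  by rewrite muE /q -pE -mulrA h.
have q10 : 0 < 1 - q by rewrite subr_gt0.
pose B := (1 - q)^-1; have B0 : 0 < B by rewrite invr_gt0.
have B264 : 0 < 4 * (8 * B + 264) by clear -B0; zlra.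
pose k0 := Num.min p (mu / (4 * (8 * B + 264))).
have k00 : 0 < k0 by rewrite lt_min p0 divr_gt0.
have k0p : k0 <= p by rewrite ge_min lexx.
have k0B : k0 * (4 * (8 * B + 264)) <= mu by rewrite -ler_pdivlMr// ge_min lexx orbT.
have mu1 : mu <= p by rewrite muE -[leRHS]mulr1 ler_pM2l// ltW.
clearbody k0.
pose K := (1 + 8 * B) / mu; have K0 : 0 < K by rewrite divr_gt0// addr_gt0// mulr_gt0.
exists k0, K; split=> // E v M oE M0 Elo Ehi cv hv vM v0.
have pk0 k : 0 < p ^+ k by rewrite exprn_gt0.
have pk1 k : p ^+ k <= 1 by rewrite exprn_ile1// ?ltW//; zlra.
have muk k : powR (p ^+ k) (1 + al) = mu ^+ k by rewrite powRXn// ltW.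
have mukp k : mu ^+ k <= p ^+ k by rewrite lerXn2r ?nnegrE ?(ltW mu0) ?(ltW p0).
(* The bound on [b] is the partial sum of the geometric series of the corrections, whose ratio is
   [q]; it stays below [8 * M * B] at all scales. *)
pose P k (b : R) := `|b| <= 8 * M * B * (1 - q ^+ k) /\
  forall z, clos E z -> cabs z < p ^+ k -> `|v z - b * Re z| <= M * mu ^+ k.
have step k b : P k b -> exists b', P k.+1 b' /\ `|b' - b| <= 8 * M * q ^+ k.
  move=> [hb1 hb2]; pose s := p ^+ k; pose m := M * mu ^+ k.
  have s0 : 0 < s := pk0 k.
  have m0 : 0 < m by rewrite mulr_gt0// exprn_gt0.
  have sC z : cabs (s%:C * z) = s * cabs z by rewrite cabsZ gtr0_norm.
  have s1 z : cabs z < 1 -> cabs (s%:C * z) < s by move=> h; rewrite sC -[ltRHS]mulr1 ltr_pM2l.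
  have s11 z : cabs z < 1 -> cabs (s%:C * z) < 1 by move=> /s1 h; apply: lt_le_trans h (pk1 k).
  pose Es : set C := [set z | E (s%:C * z)].
  have cEs z : clos Es z -> clos E (s%:C * z).
    move=> h r r0; have [y Ey yz] := h (r / s) (divr_gt0 r0 s0).
    exists (s%:C * y) => //; rewrite -mulrBr sC mulrC.
    by rewrite -ltr_pdivlMr.
  have pw z : cabs z < s -> powR (cabs z) (1 + al) <= mu ^+ k.
    by move=> /ltW h; rewrite -muk powR_lt_mono ?cabs_ge0// ltW.
  have cElo z : clos E z -> cabs z < s -> - (k0 * mu ^+ k) <= Re z.
    move=> cz zs; apply: le_eps => d d0.
    have [|y Ey yz] := cz (Num.min d (s - cabs z)); first by rewrite lt_min d0 subr_gt0.
    move: yz; rewrite lt_min => /andP[y1 y2].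
    have ys : cabs y < s by have := cabs_leD y z; zlra.
    have := Elo y Ey (lt_le_trans ys (pk1 k)).
    have := ler_wpM2l (ltW k00) (pw y ys); have := Re_le (y - z).
    by rewrite ReB ler_norml; zlra.
  have eta0 : 0 <= 8 * B * k0 * m.
    by apply: mulr_ge0 (ltW m0); apply: mulr_ge0 (ltW k00); apply: mulr_ge0 (ltW B0).
  have em : mu / 4 * m <= m.
    by rewrite ler_piMl ?(ltW m0)//; zlra.
  have e0 : 0 < mu / 4 * m by rewrite mulr_gt0// divr_gt0.
  have p16 : p <= 1 / 16 by zlra.
  (* The rescaled difference has the boundary values of the linear term only: at most [8 * M * B]
     times the width [k0 * mu ^+ k] of the boundary strip, that is [8 * B * k0 * m]. *)
  have [|||||||b' [hb'1 hb'2]] := @one_step R Es (fun z => v (0 + s%:C * z) - b * (s * Re z)) k0 m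
     (8 * B * k0 * m) (mu / 4 * m) p _ (ltW k00) k0p p16 eta0 e0 em.
  - move=> z Ez; have [r r0 hr] := oE _ Ez; exists (r / s); first by rewrite divr_gt0.
    move=> y yz; apply: hr; rewrite -mulrBr sC mulrC; by rewrite -ltr_pdivlMr.
  - move=> z Ez z1; have := cElo _ (cEs _ (sub_clos Ez)) (s1 z z1); rewrite ReZ => h.
    rewrite -(ler_pM2l s0) mulrN; apply: le_trans h; rewrite lerN2 mulrC ler_pM2r//; exact: mukp.
  - move=> z z1 kz; apply: Ehi; first exact: s11.
    rewrite ReZ; apply: le_lt_trans (_ : k0 * s < _); last by rewrite mulrC ltr_pM2l.
    by rewrite ler_pM2l// (le_trans (pw _ (s1 z z1))).
  - apply: contB.
      apply: (cont_dil s0 _ cv) => z [cz z1]; rewrite /oball/= subr0 in z1.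
      by split; rewrite add0r; [exact: cEs|rewrite /oball/= subr0; exact: s11].
    apply: contZ; apply: contZ; apply: (@taylor3_cont _ id) => z _; exact: taylor3_id.
  - move=> z Ez z1; apply: harmB.
      apply: harm_scale; first by rewrite gt_eqF.
      by rewrite add0r; apply: hv => //; exact: s11.
    by do 2 apply: harmZ; apply: (@taylor3_harm _ id); exact: taylor3_id.
  - move=> z cz z1; rewrite add0r -ReZ; apply: hb2; [exact: cEs|exact: s1].
  - move=> z [cz nz] z1; rewrite add0r -ReZ v0; last exact: s11; last first.
      by split=> //; exact: cEs.
    rewrite sub0r normrN normrM.
    have hB : `|b| <= 8 * M * B.
      by rewrite (le_trans hb1)// ler_piMr ?mulr_ge0 ?(ltW M0) ?(ltW B0)// gerBl exprn_ge0// ltW.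
    have hR : `|Re (s%:C * z)| <= k0 * mu ^+ k.
      rewrite ler_norml cElo ?s1//=; last exact: cEs.
      rewrite leNgt; apply/negP => h; apply: nz; apply: Ehi; first exact: s11.
      by apply: le_lt_trans h; rewrite ler_pM2l// pw// s1.
    apply: le_trans (ler_pM _ _ hB hR) _ => //.
    by rewrite /m le_eqVlt; apply/orP; left; apply/eqP; ring.
  have bs : `|b' / s| <= 8 * M * q ^+ k.
    rewrite normrM normfV (gtr0_norm s0) ler_pdivrMr//.
    apply: le_trans hb'1 _; rewrite /m muE exprMn /s.
    by rewrite le_eqVlt; apply/orP; left; apply/eqP; ring.
  exists (b + b' / s); split; last by rewrite addrAC subrr add0r.
  split.
    apply: le_trans (ler_normD _ _) _; apply: le_trans (lerD hb1 bs) _.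
    have -> : 8 * M * q ^+ k = 8 * M * B * ((1 - q) * q ^+ k) by rewrite /B; field; rewrite gt_eqF.
    rewrite -mulrDr ler_wpM2l ?mulr_ge0 ?(ltW M0) ?(ltW B0)// exprS.
    by rewrite le_eqVlt; apply/orP; left; apply/eqP; ring.
  move=> z cz zk; pose y := (s^-1)%:C * z.
  have sCn : s%:C != 0 :> C by rewrite (inj_eq (@complexI _)) gt_eqF.
  have yz : s%:C * y = z by rewrite /y fmorphV/= mulrA mulfV// mul1r.
  have cy : clos Es y.
    move=> r r0; have [t Et tz] := cz (r * s) (mulr_gt0 r0 s0).
    exists ((s^-1)%:C * t).
      by rewrite /Es/= fmorphV/= mulrA mulfV// mul1r.
    by rewrite /y -mulrBr cabsZ gtr0_norm ?invr_gt0// mulrC ltr_pdivrMr.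
  have cyp : cabs y <= p.
    rewrite /y cabsZ gtr0_norm ?invr_gt0// mulrC ler_pdivrMr// /s -exprS; exact: ltW.
  have := hb'2 y cy cyp; rewrite add0r yz.
  have -> : v z - b * (s * Re y) - b' * Re y = v z - (b + b' / s) * Re z.
    by rewrite -yz ReZ; field; rewrite gt_eqF.
  move/le_trans; apply; rewrite p2 c5E exprS [leRHS]mulrCA -/m.
  have := ler_wpM2l (ltW m0) k0B; have := mulr_gt0 m0 mu0.
  move: (m) (B) => m' B'; zlra.
have P0 : P 0%N 0.
  split; first by rewrite normr0 expr0 subrr mulr0.
  by move=> z cz z1; rewrite mul0r subr0 expr0 mulr1; apply: vM.
have /choice[F hF] : forall a : nat * R, exists b', P a.1 a.2 -> P a.1.+1 b' /\ `|b' - a.2| <= 8 * M * q ^+ a.1.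
  move=> [k b]; have [h|n] := pselect (P k b); last by exists 0.
  by have [b' hb'] := step k b h; exists b'.
pose b := fix b k := if k is k'.+1 then F (k', b k') else 0 : R.
have Pb k : P k (b k) by elim: k => [//|k IH]; have [] := hF (k, b k) IH.
have bS k : `|b k.+1 - b k| <= 8 * M * q ^+ k by have [] := hF (k, b k) (Pb k).
have [l hl] := geo_limit (ltW q0) q1 bS.
have lM : `|l| <= 8 * M * B by have := hl 0%N; rewrite sub0r normrN expr0 mulr1.
exists l; split.
  apply: le_trans lM _; rewrite /K.
  have -> : (1 + 8 * B) / mu * M = (M + 8 * M * B) / mu by ring.
  rewrite ler_pdivlMr// (@le_trans _ _ (8 * M * B)) ?lerDr ?(ltW M0)//.
  by rewrite ler_piMr ?mulr_ge0 ?(ltW M0) ?(ltW B0)//; zlra.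
have est k z : clos E z -> cabs z < p ^+ k -> `|v z - l * Re z| <= M * (1 + 8 * B) * mu ^+ k.
  move=> cz zk; have [_ /(_ z cz zk) h1] := Pb k.
  have h2 : `|(b k - l) * Re z| <= 8 * M * B * mu ^+ k.
    rewrite normrM muE exprMn.
    have := ler_pM (normr_ge0 _) (normr_ge0 _) (hl k) (le_trans (Re_le z) (ltW zk)).
    move/le_trans; apply; rewrite /B le_eqVlt; apply/orP; left; apply/eqP; ring.
  have -> : v z - l * Re z = (v z - b k * Re z) + (b k - l) * Re z by ring.
  by apply: le_trans (ler_normD _ _) _; zlra.
(* At 0 the bound is 0 and follows from the estimates at all scales; elsewhere the last scale
   containing [z] is used, at the cost of a factor [1 / mu]. *)
move=> z cz z1; have [z0|z0] := eqVneq z 0.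
  rewrite z0 cabs0 powR0 ?gt_eqF// [K * M * _]mulr0; apply: le_eps => e e0; rewrite add0r.
  have MB : 0 < M * (1 + 8 * B) by rewrite mulr_gt0// addr_gt0// mulr_gt0.
  have p12 : p <= 1 / 2 by zlra.
  have [k hk] := small_exp (ltW p0) p12 (divr_gt0 e0 MB).
  have := est k 0; rewrite -z0 => /(_ cz); rewrite z0 cabs0 => /(_ (pk0 k)) h.
  apply: le_trans h _; rewrite mulrC -ler_pdivlMr//.
  exact: le_trans (mukp k) hk.
have cz0 : 0 < cabs z by rewrite cabs_gt0.
have p12 : p <= 1 / 2 by zlra.
have ex : exists n, p ^+ n <= cabs z by exact: small_exp (ltW p0) p12 cz0.
case: (ex_minnP ex) => [[|k]]; first by rewrite expr0 leNgt z1.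
move=> hk hmin; have zk : cabs z < p ^+ k.
  by rewrite ltNge; apply/negP => /hmin; rewrite ltnn.
apply: le_trans (est k z cz zk) _.
have : mu ^+ k.+1 <= powR (cabs z) (1 + al).
  by rewrite -muk powR_lt_mono ?(ltW al10)// ltW.
have MBm : 0 <= M * (1 + 8 * B) / mu by rewrite !mulr_ge0 ?invr_ge0 ?(ltW mu0) ?(ltW M0)// addr_ge0// mulr_ge0// ltW.
move/(ler_wpM2l MBm) => h.
have -> : K * M = M * (1 + 8 * B) / mu by rewrite /K; ring.
apply: le_trans h; rewrite exprS le_eqVlt; apply/orP; left; apply/eqP.
by field; rewrite gt_eqF.
Qed.
End Iteration.

(** * From first order expansions to Hoelder gradients *)

Section LocalEstimate.
Variable R : realType.
Local Notation C := R[i].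
Local Notation Re := (@complex.Re R).
Local Notation Im := (@complex.Im R).
Implicit Types (x y z p : C) (u v w f : C -> R) (D E : set C).
Variable al : R.
Hypotheses (al0 : 0 < al) (al1 : al < 1).

Let al10 : 0 < 1 + al. Proof. by rewrite addr_gt0. Qed.

Lemma powR1D (a : R) : 0 < a -> powR a (1 + al) = a * powR a al.
Proof. by move=> a0; rewrite powRD ?(gt_eqF a0) ?implybT// powRr1// ltW. Qed.

Lemma powR_pos_mono (a b : R) : 0 <= a -> a <= b -> powR a (1 + al) <= powR b (1 + al).
Proof. by apply: powR_lt_mono; exact: ltW. Qed.

(** The crude factor [k ^+ 2] for the power [1 + al] of [k] keeps all later constants rational. *)
Lemma powR_scale (k a b : R) : 1 <= k -> 0 <= b -> 0 <= a -> a <= k * b ->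
  powR a (1 + al) <= k ^+ 2 * powR b (1 + al).
Proof.
move=> k1 b0 a0 ab; have k0 : 0 <= k by zlra.
apply: le_trans (powR_pos_mono a0 ab) _; rewrite powRM// ler_wpM2r ?powR_ge0//.
have h2 : 1 + al <= 2%:R by move: al1; zlra.
by rewrite -powR_mulrn// ler_powR.
Qed.

Lemma small_power (K e : R) : 0 < e -> exists2 s : R, 0 < s & forall t, 0 <= t -> t <= s -> K * powR t al <= e.
Proof.
move=> e0; have K1 : 0 < `|K| + 1 by rewrite ltr_wpDl.
exists (powR (e / (`|K| + 1)) al^-1); first by apply: powR_gt0; rewrite divr_gt0.
move=> t t0 ts.
have : powR t al <= e / (`|K| + 1).
  have <- : powR (powR (e / (`|K| + 1)) al^-1) al = e / (`|K| + 1).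
    by rewrite -powRrM mulVf ?lt0r_neq0// powRr1// ltW// divr_gt0.
  by apply: powR_lt_mono => //; exact: ltW.
rewrite ler_pdivlMr// => h; apply: le_trans h; rewrite mulrC ler_wpM2l ?powR_ge0//.
by rewrite (le_trans (ler_norm _))// lerDl.
Qed.

Lemma quad_le_powR (h d : R) : 0 <= h -> 0 < d -> h <= d ->
  powR d (1 + al) * h ^+ 2 <= d ^+ 2 * powR h (1 + al).
Proof.
move=> h0 d0 hd; move: h0; rewrite le_eqVlt => /orP[/eqP<-|h0].
  by rewrite expr0n mulr0 powR0 ?gt_eqF// mulr0.
have sq (a : R) : 0 < a -> a ^+ 2 = powR a (1 + al) * powR a (1 - al).
  move=> a0; rewrite -powRD; last by rewrite (gt_eqF a0) implybT.
  by rewrite -powR_mulrn ?ltW//; congr powR; ring.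
rewrite (sq h)// (sq d)// -[leRHS]mulrA ler_wpM2l ?powR_ge0// mulrC.
by rewrite ler_wpM2r ?powR_ge0// powR_lt_mono ?subr_ge0// ltW.
Qed.

(** [lap4] depends on the coordinate axes, so a rotation cannot be substituted into it; polynomial
    approximation on a disc is invariant under complex affine maps. *)
Lemma harm_affine D w (c a : C) z : opn D -> cont D w -> (forall x, D x -> harm w x) ->
  a != 0 -> D (c + a * z) -> harm (fun y => w (c + a * y)) z.
Proof.
move=> oD cw hw a0 Dz; have [r r0 hr] := oD _ Dz.
have r20 : 0 < r / 2 by rewrite divr_gt0.
have h : apx (dil (c + a * z) (r / 2) w).
  apply: (harm_cont oD cw hw) => // y; rewrite /cball/= => hy; apply: hr; zlra.
have := apx_affine a0 h => /(@apx_harm _ _ _ _ z); apply.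
  by rewrite divr_gt0// cabs_gt0.
by rewrite /oball/= subrr cabs0 divr_gt0// cabs_gt0.
Qed.

(** Near [x] the boundary deviates from the line orthogonal to the inner normal [nu] by at most [K]
    times the power [1 + al] of the distance; multiplication by [nu^*] turns the normal into the
    real direction. *)
Definition flat D x (nu : C) (K r : R) := [/\ cabs nu = 1,
  forall y, cabs (y - x) < r -> D y -> - (K * powR (cabs (y - x)) (1 + al)) <= Re (nu^* * (y - x)) &
  forall y, cabs (y - x) < r -> K * powR (cabs (y - x)) (1 + al) < Re (nu^* * (y - x)) -> D y].

Definition cls D p (r M : R) w := [/\ cont (clos D `&` oball p r) w,
  forall x, D x -> cabs (x - p) < r -> harm w x,
  forall x, clos D x -> cabs (x - p) < r -> `|w x| <= M &
  forall x, bd D x -> cabs (x - p) < r -> w x = 0].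

Lemma cls_sub D p q (r s M : R) w : cabs (q - p) + s <= r -> cls D p r M w -> cls D q s M w.
Proof.
move=> qs [cw hw wM w0].
have h x : cabs (x - q) < s -> cabs (x - p) < r by have := cabs_tri x q p; zlra.
split.
- by apply: cont_sub cw => x [cx /h]; split.
- by move=> x Dx /h; exact: hw.
- by move=> x Dx /h; exact: wM.
- by move=> x Dx /h; exact: w0.
Qed.

Lemma opnI D E : opn D -> opn E -> opn (D `&` E).
Proof.
move=> oD oE x [/oD[r r0 hr] /oE[s s0 hs]]; exists (Num.min r s); first by rewrite lt_min r0.
by move=> y; rewrite lt_min => /andP[/hr ? /hs ?].
Qed.

(** Zooming in by [s] multiplies the flatness constant by the power [al] of [s], so any [K] falls
    below the [k0] of [iterate]. The resulting constants depend on [K] and [r] only, hence are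
    uniform over boundary points. *)
Lemma pointwise (K r : R) : 0 < r -> exists K' s : R, [/\ 0 < s, s <= r, 0 < K' &
  forall D x nu, opn D -> flat D x nu K r -> forall w M, 0 < M -> cls D x s M w ->
  exists b : R, `|b| <= K' * M /\ forall y, clos D y -> cabs (y - x) < s ->
    `|w y - b * Re (nu^* * (y - x))| <= K' * M * powR (cabs (y - x)) (1 + al)].
Proof.
move=> r0; have [k0 [K0 [k00 K00 main]]] := iterate al0 al1.
have [s1 s10 hs1] := small_power K k00.
pose s := Num.min s1 r; have s0 : 0 < s by rewrite lt_min s10.
have Ks : K * powR s al <= k0 by apply: hs1; [exact: ltW|rewrite ge_min lexx].
have sr : s <= r by rewrite ge_min lexx orbT.
clearbody s.
pose P := powR s (1 + al); have P0 : 0 < P by rewrite powR_gt0.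
exists (K0 * (s^-1 + P^-1)), s; split=> //; first by rewrite mulr_gt0// addr_gt0 ?invr_gt0.
move=> D x nu oD [nu1 lo hi] w M M0 [cw hw wM w0].
pose a := s%:C * nu; have ca : cabs a = s by rewrite cabsZ nu1 mulr1 gtr0_norm.
have a0 : a != 0 by rewrite -cabs_gt0 ca.
have nuC : nu^* * nu = 1 by rewrite mulrC conj_unit.
pose E : set C := [set z | D (x + a * z)]; pose v z := w (x + a * z).
have dx z : x + a * z - x = a * z by rewrite addrAC subrr add0r.
have cx z : cabs (x + a * z - x) = s * cabs z by rewrite dx cabsM ca.
have lt1 z : cabs z < 1 -> cabs (x + a * z - x) < s.
  by rewrite cx => h; rewrite -[ltRHS]mulr1 ltr_pM2l.
have Rx z : Re (nu^* * (x + a * z - x)) = s * Re z.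
  have -> : nu^* * (x + a * z - x) = s%:C * (nu^* * nu * z) by rewrite dx /a; ring.
  by rewrite nuC mul1r ReZ.
have cE z : clos E z -> clos D (x + a * z).
  move=> h d d0; have [y Ey yz] := h (d / s) (divr_gt0 d0 s0).
  exists (x + a * y) => //; rewrite opprD addrACA subrr add0r -mulrBr cabsM ca mulrC.
  by rewrite -ltr_pdivlMr.
have pz z : powR (cabs (x + a * z - x)) (1 + al) = s * (powR s al * powR (cabs z) (1 + al)).
  by rewrite cx powRM ?cabs_ge0 ?ltW// powR1D// mulrA.
have Kz z : K * powR (cabs (x + a * z - x)) (1 + al) <= s * (k0 * powR (cabs z) (1 + al)).
  rewrite pz mulrCA ler_pM2l// mulrA ler_wpM2r ?powR_ge0//.
have [|||||||b [hb1 hb2]] := main E v M _ M0.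
- move=> z Ez; have [d d0 hd] := oD _ Ez; exists (d / s); first by rewrite divr_gt0.
  move=> y yz; apply: hd; rewrite opprD addrACA subrr add0r -mulrBr cabsM ca mulrC.
  by rewrite -ltr_pdivlMr.
- move=> z Ez z1; have := lo _ (lt_le_trans (lt1 z z1) sr) Ez; rewrite Rx => h.
  by rewrite -(ler_pM2l s0) mulrN; apply: le_trans h; rewrite lerN2.
- move=> z z1 kz; apply: hi; first exact: lt_le_trans (lt1 z z1) sr.
  by rewrite Rx; apply: le_lt_trans (Kz z) _; rewrite ltr_pM2l.
- move=> z [cz z1] e e0; rewrite /oball/= subr0 in z1.
  have [d d0 hd] := cw (x + a * z) (conj (cE z cz) (lt1 z z1)) e e0.
  exists (d / s); first by rewrite divr_gt0.
  move=> y [cy y1] yz; rewrite /oball/= subr0 in y1; apply: hd.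
    by split; [exact: cE|exact: lt1].
  rewrite opprD addrACA subrr add0r -mulrBr cabsM ca mulrC; by rewrite -ltr_pdivlMr.
- move=> z Ez z1; apply: (@harm_affine (D `&` oball x s)) => //.
  + exact/opnI/opn_oball.
  + by apply: cont_sub cw => y [/sub_clos].
  + by move=> y [Dy]; exact: hw.
  + by split=> //; exact: lt1.
- by move=> z cz z1; apply: wM; [exact: cE|exact: lt1].
- by move=> z [cz nz] z1; apply: w0; [split=> //; exact: cE|exact: lt1].
exists (b / s); split.
  rewrite normrM normfV (gtr0_norm s0) ler_pdivrMr// (le_trans hb1)//.
  have -> : K0 * (s^-1 + P^-1) * M * s = K0 * M + K0 * M * (s / P) by field; rewrite !gt_eqF.
  by rewrite lerDl mulr_ge0 ?mulr_ge0 ?invr_ge0// ltW.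
move=> y cy ys; pose z := a^-1 * (y - x).
have yz : y = x + a * z by rewrite /z mulrA mulfV// mul1r addrC subrK.
have cz : clos E z.
  move=> d d0; have [t Dt ty] := cy (d * s) (mulr_gt0 d0 s0).
  exists (a^-1 * (t - x)); first by rewrite /E/= mulrA mulfV// mul1r addrC subrK.
  rewrite /z -mulrBr opprB addrA subrK cabsM cabsV ca mulrC.
  by rewrite ltr_pdivrMr.
have z1 : cabs z < 1.
  by rewrite /z cabsM cabsV ca mulrC ltr_pdivrMr// mul1r.
have := hb2 z cz z1; rewrite /v -yz.
have -> : b / s * Re (nu^* * (y - x)) = b * Re z.
  by rewrite {1}yz Rx; field; rewrite gt_eqF.
move/le_trans; apply; rewrite {1}yz cx powRM ?cabs_ge0 ?(ltW s0)// -/P.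
have -> : K0 * (s^-1 + P^-1) * M * (P * powR (cabs z) (1 + al)) =
  K0 * M * powR (cabs z) (1 + al) + K0 * M * powR (cabs z) (1 + al) * (P / s).
  by field; rewrite !gt_eqF.
by rewrite lerDl !mulr_ge0 ?powR_ge0 ?invr_ge0// ltW.
Qed.

(** The two first order expansions are compared at two points [z0] and [z0 + t] of a ball in [D] of
    radius proportional to [h], the distance of [x] and [y]. Each of the four errors is at most
    [16 * K * M] times the power [1 + al] of [h]; division by [h / 8] gives 512. *)
Lemma holder_of_taylor D p (rh K M : R) w (g : C -> C) : 0 <= K * M ->
  (forall x, D x -> cabs (x - p) < rh -> forall y, D y -> cabs (y - p) < 8 * rh ->
    `|w y - w x - Re (g x * (y - x))| <= K * M * powR (cabs (y - x)) (1 + al)) ->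
  (forall x, D x -> cabs (x - p) < rh -> forall h, 0 < h -> h < 2 * rh ->
    exists2 z0, cabs (z0 - x) <= 2 * h & oball z0 (h / 4) `<=` D) ->
  forall x y, D x -> cabs (x - p) < rh -> D y -> cabs (y - p) < rh ->
  cabs (g x - g y) <= 512 * (K * M) * powR (cabs (x - y)) al.
Proof.
move=> KM hT hC x y Dx xp Dy yp; pose h := cabs (x - y); pose G := g x - g y.
have R0 : 0 <= 512 * (K * M) * powR (cabs (x - y)) al.
  by apply: mulr_ge0; [apply: mulr_ge0 KM; zlra|exact: powR_ge0].
have [xy|xy] := eqVneq x y.
  by move: R0; rewrite xy !subrr cabs0.
have h0 : 0 < h by rewrite /h cabs_gt0 subr_eq0.
have h2 : h < 2 * rh by rewrite /h; have := cabs_tri x p y; rewrite (cabs_sub p y); zlra.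
have [z0 z0x zD] := hC x Dx xp h h0 h2.
have [G0|G0] := eqVneq G 0.
  by rewrite -/G G0 cabs0.
have cG : 0 < cabs G by rewrite cabs_gt0.
(* The increment is aligned with the conjugate of [G], so that [Re (G * t)] is the full product of
   the moduli. *)
pose t := (h / 8 / cabs G)%:C * G^*.
have ct : cabs t = h / 8.
  by rewrite /t cabsZ cabsJ gtr0_norm ?divfK ?gt_eqF// !divr_gt0.
have GG : Re (G * t) = cabs G * (h / 8).
  have -> : G * t = (h / 8 / cabs G)%:C * (G * G^*) by rewrite /t; ring.
  rewrite ReZ (ReM G) ReJ ImJ; have := cabs_sqr G.
  have -> : Re G * Re G - Im G * - Im G = Re G ^+ 2 + Im G ^+ 2 by ring.
  by move=> <-; field; rewrite gt_eqF.
have D0 : D z0 by apply: zD; rewrite /oball/= subrr cabs0 divr_gt0.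
have D1 : D (z0 + t) by apply: zD; rewrite /oball/= dist_shift ct; zlra.
have z0p : cabs (z0 - p) < 8 * rh by have := cabs_tri z0 x p; zlra.
have z1p : cabs (z0 + t - p) < 8 * rh.
  have := cabs_tri (z0 + t) z0 p; have := cabs_tri z0 x p; rewrite dist_shift ct; zlra.
have pw a : cabs a <= 4 * h -> K * M * powR (cabs a) (1 + al) <= 16 * (K * M * powR h (1 + al)).
  move=> ha; have := @powR_scale 4 (cabs a) h _ (ltW h0) (cabs_ge0 _) ha.
  rewrite [_ ^+ 2](_ : _ = 16); last by ring.
  move=> /(_ _)/(ler_wpM2l KM) hh; apply: le_trans (hh _) _; first zlra.
  by rewrite mulrCA.
have p1 : cabs (z0 - x) <= 4 * h by zlra.
have p2 : cabs (z0 + t - x) <= 4 * h.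
  by have := cabs_tri (z0 + t) z0 x; rewrite dist_shift ct; zlra.
have p3 : cabs (z0 - y) <= 4 * h by have := cabs_tri z0 x y; rewrite -/h; zlra.
have p4 : cabs (z0 + t - y) <= 4 * h.
  have := cabs_tri (z0 + t) z0 y; have := cabs_tri z0 x y; rewrite dist_shift ct -/h; zlra.
have e1 := hT x Dx xp z0 D0 z0p; have e2 := hT x Dx xp _ D1 z1p.
have e3 := hT y Dy yp z0 D0 z0p; have e4 := hT y Dy yp _ D1 z1p.
have {}e1 := le_trans e1 (pw _ p1); have {}e2 := le_trans e2 (pw _ p2).
have {}e3 := le_trans e3 (pw _ p3); have {}e4 := le_trans e4 (pw _ p4).
have : Re (G * t) <= 64 * (K * M * powR h (1 + al)).
  have -> : G * t = (g x * (z0 + t - x) - g x * (z0 - x)) - (g y * (z0 + t - y) - g y * (z0 - y)).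
    by rewrite /G; ring.
  rewrite !ReB; move: e1 e2 e3 e4; rewrite !ler_norml.
  move: (K * M * _) (Re _) (Re _) (Re _) (Re _) (w _) (w _) (w _) (w _) => *; zlra.
rewrite GG powR1D// => hh.
have : cabs G * (h / 8) <= (512 * (K * M) * powR h al) * (h / 8) by zlra.
by rewrite ler_pM2r// divr_gt0.
Qed.

Definition local_est D p := forall r, 0 < r -> exists K rh : R, [/\ 0 < K, 0 < rh &
  forall w M, 0 < M -> cls D p r M w -> exists g : C -> C,
  forall x, D x -> cabs (x - p) < rh -> cabs (g x) <= K * M /\
  forall y, D y -> cabs (y - p) < rh ->
    `|w y - w x - Re (g x * (y - x))| <= K * M * powR (cabs (y - x)) (1 + al) /\
    cabs (g x - g y) <= K * M * powR (cabs (x - y)) al].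

Lemma local_est_int D p : opn D -> D p -> local_est D p.
Proof.
move=> oD Dp r r0; have [r1 r10 hr1] := oD p Dp.
pose s := Num.min (Num.min r r1) 1 / 2.
have m0 : 0 < Num.min (Num.min r r1) 1 by rewrite !lt_min r0 r10 ltr01.
have s0 : 0 < s by rewrite divr_gt0.
have : 2 * s <= Num.min (Num.min r r1) 1 by rewrite /s; zlra.
rewrite !le_min => /andP[/andP[sr sr1] s1]; clearbody s.
have s2 : 0 < s / 2 by rewrite divr_gt0.
pose K := 64 / s ^+ 2; have K0 : 0 < K by rewrite divr_gt0// exprn_gt0.
exists (512 * K), (s / 64); split; [by apply: mulr_gt0 K0; zlra|zlra|].
move=> w M M0 [cw hw wM w0].
have DB x : cabs (x - p) < s -> cball x (s / 2) `<=` D `&` oball p r.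
  move=> xp y; rewrite /cball/= => yx; have := cabs_tri y x p => h.
  by split; [apply: hr1|rewrite /oball/=]; zlra.
have /choice[g hg] : forall x, exists gx : C, cabs (x - p) < s ->
    cabs gx <= 4 * M / s /\ forall y, cabs (y - x) <= s / 4 ->
    `|w y - w x - Re (gx * (y - x))| <= 16 * M / s ^+ 2 * cabs (y - x) ^+ 2.
  move=> x; have [xp|] := ltP (cabs (x - p)) s; last by exists 0.
  have B := DB x xp.
  have ax : apx (dil x (s / 2) w).
    apply: harm_apx => //; first by apply: cont_sub cw => y /B[/sub_clos].
    by move=> y /ltW yx; have [Dy yr] := B y yx; exact: hw.
  have [|g [g1 g2]] := @gradient _ _ M ax.
    move=> z z1; have zB : cball x (s / 2) (x + (s / 2)%:C * z).
      by rewrite /cball/= cabs_dil ?z1 ?mulr1// ltW.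
    by have [/sub_clos cz zr] := B _ zB; exact: wM.
  have sC : (s / 2)%:C != 0 :> C by rewrite (inj_eq (@complexI _)) gt_eqF.
  have cs : cabs (s / 2)%:C = s / 2 by rewrite cabs_real gtr0_norm.
  exists (g / (s / 2)%:C) => _; split.
    rewrite cabsM cabsV cs ler_pdivrMr//.
    by have -> : 4 * M / s * (s / 2) = 2 * M by field; rewrite gt_eqF.
  move=> y yx; have := g2 ((y - x) / (s / 2)%:C).
  rewrite cabsM cabsV cs ler_pdivrMr// => /(_ _) h.
  have {h} := h (le_trans yx _); rewrite /dil mulr0 addr0.
  have -> : x + (s / 2)%:C * ((y - x) / (s / 2)%:C) = y.
    by move: sC; move: (s / 2)%:C => a a0; field.
  have -> : g * ((y - x) / (s / 2)%:C) = g / (s / 2)%:C * (y - x) by ring.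
  have -> : 4 * M * (cabs (y - x) / (s / 2)) ^+ 2 = 16 * M / s ^+ 2 * cabs (y - x) ^+ 2.
    by field; rewrite gt_eqF.
  by apply; zlra.
exists g.
have KM : 0 <= K * M by rewrite mulr_ge0// ltW.
have T x : D x -> cabs (x - p) < s / 64 -> forall y, D y -> cabs (y - p) < 8 * (s / 64) ->
    `|w y - w x - Re (g x * (y - x))| <= K * M * powR (cabs (y - x)) (1 + al).
  move=> Dx xp y Dy yp; have xs : cabs (x - p) < s by zlra.
  have [_ h] := hg x xs; have yx : cabs (y - x) <= s / 4.
    by have := cabs_tri y p x; rewrite (cabs_sub p x); zlra.
  apply: le_trans (h y yx) _.
  have q := @quad_le_powR (cabs (y - x)) 1 (cabs_ge0 _) ltr01 _.
  rewrite powR1 mul1r expr1n mul1r in q.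
  have -> : 16 * M / s ^+ 2 = K * M * (1 / 4) by rewrite /K; field; rewrite gt_eqF.
  rewrite -[leLHS]mulrA ler_wpM2l//; have y1 : cabs (y - x) <= 1 by zlra.
  have := q y1; have := sqr_ge0 (cabs (y - x)); zlra.
have H := @holder_of_taylor D p (s / 64) K M w g KM T _.
move=> x Dx xp; have xs : cabs (x - p) < s by zlra.
have [h1 _] := hg x xs.
have s2s : s ^+ 2 <= s by rewrite expr2 ler_piMr ?(ltW s0)//; zlra.
split.
  apply: le_trans h1 _; rewrite ler_pdivrMr//.
  have -> : 512 * K * M * s = 512 * 64 * M * (s / s ^+ 2) by rewrite /K; ring.
  have : 1 <= s / s ^+ 2 by rewrite ler_pdivlMr ?exprn_gt0// mul1r.
  move/(ler_wpM2l (ltW M0)); zlra.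
move=> y Dy yp; split.
  apply: le_trans (T x Dx xp y Dy _) _; first by zlra.
  by rewrite ler_wpM2r ?powR_ge0//; zlra.
rewrite -(mulrA _ K M); apply: H => // x' Dx' xp' h h0 h2.
exists x'; first by rewrite subrr cabs0; zlra.
move=> z; rewrite /oball/= => zx; apply: hr1.
by have := cabs_tri z x' p; zlra.
Qed.
End LocalEstimate.

(** * Gradient estimates near a boundary point *)

Section BoundaryEstimate.
Variable R : realType.
Local Notation C := R[i].
Local Notation Re := (@complex.Re R).
Local Notation Im := (@complex.Im R).
Implicit Types (x y z p : C) (u v w f : C -> R) (D E : set C).
Variable al : R.
Hypotheses (al0 : 0 < al) (al1 : al < 1).

Lemma disc_gradient x (s M : R) w : 0 < s -> cont (cball x s) w ->
  (forall y, cabs (y - x) < s -> harm w y) ->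
  (forall y, cabs (y - x) <= s -> `|w y| <= M) ->
  exists g : C, cabs g <= 2 * M / s /\ forall y, cabs (y - x) <= s / 2 ->
    `|w y - w x - Re (g * (y - x))| <= 4 * M / s ^+ 2 * cabs (y - x) ^+ 2.
Proof.
move=> s0 cw hw wM.
have ax : apx (dil x s w) by apply: harm_apx => // y; exact: hw.
have [|g [g1 g2]] := @gradient _ _ M ax.
  by move=> z z1; apply: wM; rewrite cabs_dil ?z1 ?mulr1// ltW.
have sC : s%:C != 0 :> C by rewrite (inj_eq (@complexI _)) gt_eqF.
have cs : cabs s%:C = s by rewrite cabs_real gtr0_norm.
exists (g / s%:C); split.
  by rewrite cabsM cabsV cs ler_pM2r// invr_gt0.
move=> y yx; have := g2 ((y - x) / s%:C).
rewrite cabsM cabsV cs ler_pdivrMr// => /(_ _) h.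
have {h} := h _; rewrite /dil mulr0 addr0.
have -> : x + s%:C * ((y - x) / s%:C) = y.
  by move: sC; move: s%:C => a a0; field.
have -> : g * ((y - x) / s%:C) = g / s%:C * (y - x) by ring.
have -> : 4 * M * (cabs (y - x) / s) ^+ 2 = 4 * M / s ^+ 2 * cabs (y - x) ^+ 2.
  by field; rewrite gt_eqF.
by apply; lra.
Qed.

(** The complement of an open set attains its distance to [x]; the segment from the closest point to
    [x] runs inside [D], so that point is on the boundary. *)
Lemma nearest_boundary D x p : opn D -> D x -> ~ D p -> exists x0, [/\ bd D x0,
  cabs (x0 - x) <= cabs (p - x), 0 < cabs (x0 - x) & oball x (cabs (x0 - x)) `<=` D].
Proof.
move=> oD Dx nDp.
pose K : set C := [set y | ~ D y /\ cabs (y - x) <= cabs (p - x)].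
have [||||x0 [nD x0p] hmin] := @cont_attains R K (fun y => - cabs (y - x)).
- by have [M hM] := bnd_cball x (cabs (p - x)); exists M => y [_ /hM].
- move=> y cy; split.
    move=> /oD[r r0 hr]; have [z [nDz _] zy] := cy r r0; exact: nDz (hr _ zy).
  by apply: clos_cball; apply: clos_mono cy => z [].
- by exists p; split.
- apply: (@cont_lip _ _ 1) => a b _ _; rewrite mul1r.
  have := cabs_tri a b x; have := cabs_tri b a x; rewrite (cabs_sub b a) ler_norml; lra.
have xx0 : x0 != x by apply: contra_notN nD => /eqP->.
have d0 : 0 < cabs (x0 - x) by rewrite cabs_gt0 subr_eq0.
have sub : oball x (cabs (x0 - x)) `<=` D.
  move=> y yx; apply: contrapT => nDy; move: yx; rewrite /oball/= => yx.
  have Ky : K y by split=> //; lra.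
  by have := hmin y Ky; lra.
exists x0; split=> //; split=> // r r0; pose d := cabs (x0 - x).
pose t := Num.min 1 (r / (2 * d)).
have t0 : 0 < t by rewrite lt_min ltr01 divr_gt0// mulr_gt0.
have t1 : t <= 1 by rewrite ge_min lexx.
have tr : t * d <= r / 2.
  have : t <= r / (2 * d) by rewrite ge_min lexx orbT.
  by rewrite ler_pdivlMr ?mulr_gt0// => h; lra.
clearbody t.
exists (x0 + t%:C * (x - x0)); last first.
  by rewrite dist_shift cabsZ (gtr0_norm t0) (cabs_sub x x0) -/d; lra.
apply: sub; rewrite /oball/=.
have -> : x0 + t%:C * (x - x0) - x = (1 - t)%:C * (x0 - x).
  by rewrite rmorphB rmorph1; ring.
rewrite cabsZ ger0_norm ?subr_ge0// -/d.
by rewrite gtr_pMl//; lra.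
Qed.

Lemma flat_sub D x nu (K r s : R) : s <= r -> flat al D x nu K r -> flat al D x nu K s.
Proof.
move=> sr [nu1 h1 h2]; split=> // y ys; first by apply: h1; lra.
by apply: h2; lra.
Qed.

Lemma norm_sub3 (a b c q : R) : 0 <= q -> `|a| <= 25 * q -> `|b| <= 16 * q -> `|c| <= 64 * q ->
  `|a - b - c| <= 128 * q.
Proof. rewrite !ler_norml; lra. Qed.

Lemma powR_scale_mul (k c t Y : R) : 0 < c -> 1 <= k -> 0 < Y -> 0 <= t -> t <= k * Y ->
  c * powR t (1 + al) <= k ^+ 2 * (c * powR Y (1 + al)).
Proof.
by move=> c0 k1 Y0 t0 tY; rewrite mulrCA; apply: (ler_wpM2l (ltW c0)); apply: powR_scale => //; exact: ltW.
Qed.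

Lemma powR_far (c g d Y : R) : 0 < c -> 0 < d -> d <= 4 * Y -> g <= 16 * c * powR d al ->
  g * Y <= 64 * (c * powR Y (1 + al)).
Proof.
move=> c0 d0 dY gd; have Y0 : 0 < Y by rewrite -(pmulr_rgt0 Y (ltr0Sn R 3)); exact: lt_le_trans dY.
apply: le_trans (ler_wpM2r (ltW Y0) gd) _.
have p4 : powR d al <= powR (4 * Y) al by apply: powR_lt_mono; rewrite ?(ltW d0)// ltW.
have Y4 : 0 < 4 * Y by exact: lt_le_trans dY.
have k1 : 1 <= 4 :> R by rewrite ler1n.
have := @powR_scale _ _ al0 al1 4 (4 * Y) Y k1 (ltW Y0) (ltW Y4) (lexx _).
rewrite (powR1D _ Y4) => h; have h' : powR d al * Y <= 4 * powR Y (1 + al).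
  by have := ler_wpM2r (ltW Y0) p4; move: h; clear; move: (powR _ _) (powR _ _) (powR _ _) => *; lra.
have := ler_wpM2l (ltW c0) h'.
have -> : 16 * c * powR d al * Y = 16 * (c * (powR d al * Y)) by ring.
by clear; move: (c * (powR d al * Y)) => a; rewrite mulrCA; lra.
Qed.

Lemma powR_cone (K0 h t : R) : 0 <= K0 -> 0 < h -> K0 * powR h al <= 1 / 8 -> 0 <= t ->
  t <= 5 / 4 * h -> K0 * powR t (1 + al) < 3 / 4 * h.
Proof.
move=> K00 h0 hs t0 th; have t2 : t <= 2 * h by move: h0 th; clear; lra.
have := @powR_scale _ _ al0 al1 2 t h (ler1n _ 2) (ltW h0) t0 t2.
move/(ler_wpM2l K00); rewrite (powR1D _ h0) => hh.
apply: le_lt_trans hh _; have := ler_wpM2l (ltW h0) hs.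
have -> : K0 * (2 ^+ 2 * (h * powR h al)) = 4 * (h * (K0 * powR h al)) by ring.
by move: h0; clear; move: (h * (K0 * _)) => a; lra.
Qed.

(** Subtract the linear function found at the nearest boundary point [x0]. The rest is of order
    [1 + al] in the distance [d] to the boundary, so the interior gradient estimate on the disc of
    radius [d / 2] corrects the slope by only [16 * c] times the power [al] of [d]. *)
Lemma local_est_bd D p (K0 r0 : R) : opn D -> bd D p -> 0 < r0 -> 0 <= K0 ->
  (forall x0, bd D x0 -> cabs (x0 - p) < r0 -> exists nu, flat al D x0 nu K0 r0) ->
  local_est al D p.
Proof.
move=> oD [_ nDp] r00 K00 fl r r_0.
pose r' := Num.min (Num.min r0 (r / 2)) 1.
have r'0 : 0 < r' by rewrite !lt_min r00 divr_gt0//= ltr01.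
have : r' <= r' by []. rewrite {2}/r' !le_min => /andP[/andP[r'r0 r'r] r'1].
have [K [s [s0 sr' Kp PW]]] := pointwise al0 al1 K0 r'0; clearbody r'.
have [s2 s20 hs2] := small_power al0 K0 (divr_gt0 ltr01 (ltr0Sn R 7)).
pose rh := Num.min (s / 64) (s2 / 2).
have rh0 : 0 < rh by rewrite lt_min !divr_gt0.
have : rh <= rh by []. rewrite {2}/rh le_min => /andP[rhs rhs2]; clearbody rh.
have main w M : 0 < M -> cls D p r M w -> forall x, D x -> cabs (x - p) < rh ->
  exists g : C, cabs g <= 17 * K * M /\ forall y, D y -> cabs (y - p) < 8 * rh ->
    `|w y - w x - Re (g * (y - x))| <= 128 * K * M * powR (cabs (y - x)) (1 + al).
  move=> M0 cw x Dx xp; have [x0 [bx0 x0p d0 Bd]] := nearest_boundary oD Dx nDp.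
  pose d := cabs (x0 - x); rewrite -/d in x0p d0 Bd.
  have dp : d < rh by move: x0p; rewrite (cabs_sub p x); zlra.
  have x0p' : cabs (x0 - p) < 2 * rh by have := cabs_tri x0 x p; rewrite -/d; zlra.
  have [nu fnu] := fl x0 bx0 ltac:(zlra).
  have cx0 : cls D x0 s M w by apply: cls_sub cw; zlra.
  have [b [hb hw1]] := PW D x0 nu oD (flat_sub r'r0 fnu) w M M0 cx0.
  have nu1 : cabs nu = 1 by case: fnu.
  pose l y := b * Re (nu^* * (y - x0)); pose w1 y := w y - l y.
  have KM : 0 < K * M by rewrite mulr_gt0.
  set c := K * M in hb hw1 KM *.
  have hw1' y : clos D y -> cabs (y - x0) < s -> `|w1 y| <= c * powR (cabs (y - x0)) (1 + al).
    by move=> cy ys; exact: hw1.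
  pose P := powR d (1 + al); have P0 : 0 < P by apply: powR_gt0.
  have PE : P = d * powR d al by exact: powR1D.
  have dal : powR d al <= 1.
    have := @powR_lt_mono R d 1 al (ltW al0) (ltW d0); rewrite powR1; apply; zlra.
  have pd0 : 0 <= powR d al by exact: powR_ge0.
  have B2 : cball x (d / 2) `<=` D.
    by move=> y; rewrite /cball/= => yx; apply: Bd; rewrite /oball/=; zlra.
  have d20 : 0 < d / 2 by rewrite divr_gt0.
  have [cw1 cw2 cw3 cw4] := cw.
  have [|||g [g1 g2]] := @disc_gradient x (d / 2) (4 * (c * P)) w1 d20.
  - apply: contB.
      apply: cont_sub cw1 => y By; split; first exact/sub_clos/B2.
      by move: By; rewrite /cball/oball/= => By; have := cabs_tri y x p; zlra.
    apply: (@cont_lip _ _ `|b|) => y z _ _; rewrite /l -mulrBr -ReB normrM ler_wpM2l//.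
    have -> : nu^* * (y - x0) - nu^* * (z - x0) = nu^* * (y - z) by ring.
    by apply: le_trans (Re_le _) _; rewrite cabsM cabsJ nu1 mul1r.
  - move=> y yx; apply: harmB.
      apply: cw2; first by apply: B2; exact: ltW.
      by have := cabs_tri y x p; zlra.
    apply: (@harmZ _ _ (fun y => Re (nu^* * (y - x0)))).
    apply: (@taylor3_harm _ (fun y => nu^* * (y - x0))).
    apply: taylor3M; first exact: taylor3_cst.
    by apply: taylor3D; [exact: taylor3_id|exact: taylor3_cst].
  - move=> y yx; have yx0 : cabs (y - x0) <= 2 * d.
      by have := cabs_tri y x x0; rewrite (cabs_sub x x0) -/d; zlra.
    apply: le_trans (hw1' y _ _) _; first exact/sub_clos/B2.
      by zlra.
    have -> : 4 = 2 ^+ 2 :> R by ring.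
    apply: powR_scale_mul KM _ d0 (cabs_ge0 _) yx0; exact: ler1n.
  exists (b%:C * nu^* + g).
  have g1' : cabs g <= 16 * c * powR d al.
    apply: le_trans g1 _; rewrite PE le_eqVlt; apply/orP; left; apply/eqP.
    by field; rewrite gt_eqF.
  split.
    apply: le_trans (cabsD _ _) _; rewrite cabsZ cabsJ nu1 mulr1.
    have := ler_wpM2l (ltW KM) dal; rewrite mulr1.
    have -> : 17 * K * M = 17 * c by rewrite /c mulrA.
    by move: hb g1'; move: `|b| (cabs g) => b' g' *; zlra.
  move=> y Dy yp; pose Y := cabs (y - x); have Y0 : 0 <= Y by exact: cabs_ge0.
  have -> : w y - w x - Re ((b%:C * nu^* + g) * (y - x)) = w1 y - w1 x - Re (g * (y - x)).
    rewrite /w1 /l mulrDl ReD -(mulrA b%:C) ReZ.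
    have -> : y - x = (y - x0) - (x - x0) by ring.
    by rewrite (mulrBr nu^*) ReB; ring.
  have -> : 128 * K * M = 128 * c by rewrite /c mulrA.
  rewrite -/Y; have PY0 : 0 <= powR Y (1 + al) by exact: powR_ge0.
  have cPY : 0 <= c * powR Y (1 + al) by apply: mulr_ge0 => //; exact: ltW.
  (* For [y] close to [x] the quadratic interior remainder suffices. Otherwise [d <= 4 * Y], and the
     three terms are bounded separately, by 25, 16 and 64 times the wanted quantity. *)
  have [Yd|Yd] := leP Y (d / 4).
    apply: le_trans (g2 y _) _; first by rewrite -/Y; zlra.
    have Yd' : Y <= d by zlra.
    have := quad_le_powR al0 al1 Y0 d0 Yd'; rewrite -/P -/Y => q.
    have d2 : 0 < d ^+ 2 by rewrite exprn_gt0.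
    have q' : P * Y ^+ 2 / d ^+ 2 <= powR Y (1 + al).
      by rewrite ler_pdivrMr// mulrC (mulrC (powR _ _)) mulrC.
    have := ler_wpM2l (ltW KM) q'.
    have -> : 4 * (4 * (c * P)) / (d / 2) ^+ 2 * Y ^+ 2 = 64 * (c * (P * Y ^+ 2 / d ^+ 2)).
      by field; rewrite gt_eqF.
    rewrite -(mulrA 128 c); move: cPY; move: (c * powR Y _) (c * (P * _ / _)) => *; zlra.
  have Yp : 0 < Y by zlra.
  have dY : d <= 4 * Y by zlra.
  have yx0 : cabs (y - x0) <= 5 * Y.
    by have := cabs_tri y x x0; rewrite (cabs_sub x x0) -/d -/Y; zlra.
  have e1 : `|w1 y| <= 25 * (c * powR Y (1 + al)).
    apply: le_trans (hw1' y (sub_clos Dy) _) _.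
      by have := cabs_tri y p x0; rewrite (cabs_sub p x0); zlra.
    have -> : 25 = 5 ^+ 2 :> R by ring.
    apply: powR_scale_mul KM _ Yp (cabs_ge0 _) yx0; exact: ler1n.
  have e2 : `|w1 x| <= 16 * (c * powR Y (1 + al)).
    apply: le_trans (hw1' x (sub_clos Dx) _) _; rewrite (cabs_sub x x0) -/d; first by zlra.
    have -> : 16 = 4 ^+ 2 :> R by ring.
    apply: powR_scale_mul KM _ Yp (ltW d0) dY; exact: ler1n.
  have e3 : `|Re (g * (y - x))| <= 64 * (c * powR Y (1 + al)).
    apply: le_trans (Re_le _) _; rewrite cabsM -/Y.
    exact: powR_far KM d0 dY g1'.
  by rewrite -(mulrA 128 c); exact: norm_sub3 cPY e1 e2 e3.
have K128 : 0 < 128 * K by apply: mulr_gt0 Kp; zlra.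
exists (512 * (128 * K)), rh; split; [by apply: mulr_gt0 K128; zlra|by []|].
move=> w M M0 cw.
have /choice[g hg] : forall x, exists g : C, D x -> cabs (x - p) < rh ->
    cabs g <= 17 * K * M /\ forall y, D y -> cabs (y - p) < 8 * rh ->
    `|w y - w x - Re (g * (y - x))| <= 128 * K * M * powR (cabs (y - x)) (1 + al).
  move=> x; have [[Dx xp]|n] := pselect (D x /\ cabs (x - p) < rh).
    by have [g hg] := main w M M0 cw x Dx xp; exists g.
  by exists 0 => Dx xp; case: n.
exists g => x Dx xp; have KM : 0 <= 128 * K * M by rewrite ltW// mulr_gt0.
have [h1 h2] := hg x Dx xp; split.
  have := mulr_gt0 Kp M0; move: h1; rewrite -!mulrA; move: (K * M) => a *; zlra.
move=> y Dy yp; split.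
  apply: le_trans (h2 y Dy _) _; first by zlra.
  rewrite ler_wpM2r ?powR_ge0// -(mulrA 512); move: (128 * K * M) KM => a a0; zlra.
rewrite -(mulrA 512); apply: (@holder_of_taylor _ al al0 al1 D p rh (128 * K) M w g KM) => //.
  by move=> z Dz zp; have [] := hg z Dz zp.
clear h1 h2 hg cw Dx xp KM main.
move=> z Dz zp h h0 hrh; have [x0 [bx0 x0p d0 Bd]] := nearest_boundary oD Dz nDp.
have zp' : cabs (p - z) < rh by rewrite cabs_sub.
(* Either a ball around [z] itself lies in [D], or [z] is close to the boundary, and moving from the
   nearest boundary point by [h] along the inner normal gives a centre inside. *)
have [hd|hd] := leP (h / 4) (cabs (x0 - z)).
  exists z; first by rewrite subrr cabs0; zlra.
  by move=> t; rewrite /oball/= => th; apply: Bd; rewrite /oball/=; zlra.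
have [nu [nu1 _ hnu]] := fl x0 bx0 ltac:(have := cabs_tri x0 z p; zlra).
have ch : cabs (h%:C * nu) = h by rewrite cabsZ nu1 mulr1 gtr0_norm.
exists (x0 + h%:C * nu).
  by have := cabs_tri (x0 + h%:C * nu) x0 z; rewrite dist_shift ch; zlra.
move=> t; rewrite /oball/= => th.
pose e := t - (x0 + h%:C * nu).
have tE : t - x0 = h%:C * nu + e by rewrite /e; ring.
have ce : cabs e < h / 4 by [].
have tx : cabs (t - x0) <= 5 / 4 * h.
  by rewrite tE; apply: le_trans (cabsD _ _) _; rewrite ch; zlra.
apply: hnu; first by zlra.
have Re1 : 3 / 4 * h <= Re (nu^* * (t - x0)).
  rewrite tE mulrDr ReD mulrCA (mulrC nu^*) (conj_unit nu1) mulr1.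
  have -> : Re h%:C = h by [].
  by have := Re_le (nu^* * e); rewrite cabsM cabsJ nu1 mul1r ler_norml; zlra.
apply: lt_le_trans Re1.
have hs : K0 * powR h al <= 1 / 8 by apply: hs2; [exact: ltW|zlra].
exact: powR_cone K00 h0 hs (cabs_ge0 _) tx.
Qed.
End BoundaryEstimate.

(** * Flatness and sectors for domains of class C^(1,alpha) *)

Section Charts.
Variable R : realType.
Local Notation C := R[i].
Local Notation Re := (@complex.Re R).
Local Notation Im := (@complex.Im R).
Implicit Types (O : set (R * R)) (D : set C).
Variable al : R.
Hypotheses (al0 : 0 < al) (al1 : al < 1).

Definition dom O : set C := [set z | O (ofC z)].

Lemma domE O q : O q <-> dom O (toC q).
Proof. by rewrite /dom/= toCK. Qed.

Lemma closure_dom O p : closure O p <-> clos (dom O) (toC p).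
Proof. exact/closure_toC/domE. Qed.

Lemma opn_dom O : open O -> opn (dom O).
Proof.
move=> oO z Oz; have /nbhs_ballP[e /= e0 he] : nbhs (ofC z) O by exact: open_nbhs_nbhs.
exists e => // y yz; apply: he; apply: ball_toC; by rewrite !ofCK.
Qed.

Lemma bdry_dom O p : open O -> bdry O p <-> bd (dom O) (toC p).
Proof.
move=> oO; rewrite /bdry /bd/= (closure_dom O p) -domE.
by rewrite (proj1 (interior_id O) oO).
Qed.

Lemma mean_value (f : R -> R) (r s0 s : R) : (forall s, `|s| < r -> derivable f s 1) ->
  `|s0| < r -> `|s| < r -> exists c, [/\ `|c - s0| <= `|s - s0|, `|c| < r &
    f s - f s0 = 'D_1 f c * (s - s0)].
Proof.
move=> df; have key a b : a < b -> `|a| < r -> `|b| < r -> exists c, [/\ a < c, c < b, `|c| < r &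
    f b - f a = 'D_1 f c * (b - a)].
  move=> ab ar br; have inr c : a <= c -> c <= b -> `|c| < r.
    by move: ar br; rewrite !ltr_norml => /andP[? ?] /andP[? ?] ? ?; apply/andP; split; lra.
  have [||c /[!in_itv]/= /andP[ac cb] e] := @MVT R f (fun x => 'D_1 f x) a b ab.
  - move=> x; rewrite in_itv/= => /andP[ax xb].
    by apply: derivableP; apply: df; apply: inr; exact: ltW.
  - apply: derivable_within_continuous => x; rewrite in_itv/= => /andP[ax xb].
    by apply: df; exact: inr.
  by exists c; split=> //; apply: inr; exact: ltW.
move=> s0r sr; have [ss|ss|ss] := ltgtP s0 s.
- have [c [h1 h2 h3 h4]] := key _ _ ss s0r sr; exists c; split=> //.
  by rewrite !gtr0_norm ?subr_gt0//; lra.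
- have [c [h1 h2 h3 h4]] := key _ _ ss sr s0r; exists c; split=> //.
    by rewrite !ltr0_norm ?subr_lt0//; lra.
  by rewrite -(opprB (f s0)) h4; ring.
- by exists s0; split; rewrite ?ss ?subrr ?normr0 ?mulr0.
Qed.

Lemma C1a_taylor (f : R -> R) (r : R) : C1a_itv al r f -> exists2 K : R, 0 <= K &
  forall s0 s, `|s0| < r -> `|s| < r ->
  `|f s - f s0 - 'D_1 f s0 * (s - s0)| <= K * powR `|s - s0| (1 + al).
Proof.
move=> [df [K hK]]; exists `|K| => // s0 s s0r sr.
have [->|ss] := eqVneq s s0.
  by rewrite !subrr mulr0 subr0 normr0 mulr_ge0 ?powR_ge0.
have [c [h1 h2 ->]] := mean_value df s0r sr.
rewrite -mulrBl normrM powR1D ?normr_gt0 ?subr_eq0// mulrC mulrCA ler_wpM2l//.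
apply: le_trans (hK c s0 h2 s0r) _.
apply: le_trans (ler_wpM2r (powR_ge0 _ _) (ler_norm K)) _.
by rewrite ler_wpM2l// powR_lt_mono// ltW.
Qed.

Lemma frameE (x0 tau : R * R) (s t : R) :
  toC (frame_pt x0 tau s t) = toC x0 + toC tau * (s +i* t).
Proof. by apply: complex_ext; rewrite /frame_pt/toC/= ?ReM ?ImM/= /GRing.scale/=; ring. Qed.

Lemma enorm_toC (x : R * R) : enorm x = cabs (toC x). Proof. by []. Qed.

(** The Taylor remainder of [gam] is uniform in the base point, so one constant serves all boundary
    points near the centre of the chart, each with its own normal. *)
Lemma chart_flat O (x0 tau : R * R) (r d : R) gam : graph_chart al O x0 tau r d gam ->
  exists K r' : R, [/\ 0 <= K, 0 < r' & forall x, bd (dom O) x -> cabs (x - toC x0) < r' ->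
    exists nu, flat al (dom O) x nu K r'].
Proof.
move=> [tau1 r0 d0 cg [g0 ch]]; have [K K0 hK] := C1a_taylor cg.
pose T := toC tau; have cT : cabs T = 1 by rewrite -enorm_toC.
have TT : T * T^* = 1 by exact: conj_unit.
pose r' := Num.min r d / 2; have m0 : 0 < Num.min r d by rewrite lt_min r0.
have r'0 : 0 < r' by rewrite divr_gt0.
have : 2 * r' <= Num.min r d by rewrite /r'; lra.
rewrite le_min => /andP[r'r r'd]; clearbody r'.
pose S y := Re (T^* * (y - toC x0)); pose U y := Im (T^* * (y - toC x0)).
have SU y : y = toC x0 + T * (S y +i* U y).
  have -> : S y +i* U y = T^* * (y - toC x0) by apply: complex_ext.
  by rewrite mulrA TT mul1r addrC subrK.
have Sle y : `|S y| <= cabs (y - toC x0).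
  by apply: le_trans (Re_le _) _; rewrite cabsM cabsJ cT mul1r.
have Ule y : `|U y| <= cabs (y - toC x0).
  by apply: le_trans (Im_le _) _; rewrite cabsM cabsJ cT mul1r.
have SB y x : `|S y - S x| <= cabs (y - x).
  rewrite -ReB -mulrBr opprB addrA subrK.
  by apply: le_trans (Re_le _) _; rewrite cabsM cabsJ cT mul1r.
have DE y : cabs (y - toC x0) < 2 * r' -> dom O y <-> U y < gam (S y).
  move=> yr; have [_ h] := ch (S y) ltac:(have := Sle y; clear -yr r'r; lra).
  rewrite -h; last by have := Ule y; clear -yr r'd; lra.
  by rewrite domE frameE -/T -SU.
exists K, r'; split=> // x [cx nx] xx0.
have xr : cabs (x - toC x0) < 2 * r' by clear -xx0 r'0; lra.
have Sxr : `|S x| < r by have := Sle x; clear -xr r'r; lra.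
(* A boundary point lies on the graph: not below it, since [x] is outside the domain, and not above
   it by continuity of [gam], since [x] is a limit of points below. *)
have Ux : U x = gam (S x).
  apply/eqP; rewrite eq_le; apply/andP; split; last first.
    by rewrite leNgt; apply/negP => h; apply: nx; exact/DE.
  apply/ler_addgt0Pr => e e0; pose L := `|'D_1 gam (S x)| + K.
  have L0 : 0 <= L by rewrite addr_ge0.
  pose q := Num.min (Num.min 1 (r' - cabs (x - toC x0))) (e / (L + 1)).
  have q0 : 0 < q by rewrite !lt_min ltr01 subr_gt0 xx0 divr_gt0// ltr_wpDl.
  have : q <= q by []. rewrite {2}/q !le_min => /andP[/andP[q1 qr] qe]; clearbody q.
  have [y Dy yx] := cx q q0.
  have yr : cabs (y - toC x0) < 2 * r'.
    by have := cabs_tri y x (toC x0); clear -yx qr r'0; lra.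
  have /DE := Dy => /(_ yr) hy.
  have Syr : `|S y| < r by have := Sle y; clear -yr r'r; lra.
  have UB : `|U y - U x| <= cabs (y - x).
    rewrite -ImB -mulrBr opprB addrA subrK.
    by apply: le_trans (Im_le _) _; rewrite cabsM cabsJ cT mul1r.
  have hg : `|gam (S y) - gam (S x)| <= L * cabs (y - x).
    have := hK _ _ Sxr Syr; set A := gam (S y) - _; set B := _ * (S y - _) => hAB.
    have -> : A = (A - B) + B by ring.
    apply: le_trans (ler_normD _ _) _; rewrite /L mulrDl addrC lerD//.
      by rewrite /B normrM ler_wpM2l.
    apply: le_trans hAB _; rewrite ler_wpM2l//.
    have c1 : cabs (y - x) <= 1 by clear -yx q1; lra.
    apply: le_trans (powR_lt_mono (ltW (addr_gt0 ltr01 al0)) (normr_ge0 _) (SB y x)) _.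
    have [->|cp] := eqVneq (cabs (y - x)) 0; first by rewrite powR0// gt_eqF// addr_gt0.
    have cp0 : 0 < cabs (y - x) by rewrite lt0r cp cabs_ge0.
    rewrite powR1D// -[leRHS]mulr1 ler_wpM2l ?cabs_ge0//.
    by have := powR_lt_mono (ltW al0) (cabs_ge0 _) c1; rewrite powR1.
  have : (L + 1) * cabs (y - x) <= e.
    by rewrite mulrC -ler_pdivlMr ?ltr_wpDl// (le_trans (ltW yx)).
  rewrite mulrDl mul1r; move: UB hg hy; rewrite !ler_norml.
  clear; move: (L * _) => q; lra.
pose g := 'D_1 gam (S x); pose n := Num.sqrt (1 + g ^+ 2).
have n0 : 1 <= n.
  by rewrite -[X in X <= _]sqrtr1 ler_wsqrtr// lerDl sqr_ge0.
have n00 : 0 < n by exact: lt_le_trans n0.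
have nn : n ^+ 2 = 1 + g ^+ 2 by rewrite sqr_sqrtr// addr_ge0// sqr_ge0.
(* In the frame of the chart the inner normal of the hypograph is [(g, -1)] divided by its length
   [n]. *)
pose nu := T * (g / n +i* (- n^-1)).
have ReE y : Re (nu^* * (y - x)) = (g * (S y - S x) - (U y - U x)) / n.
  have -> : nu^* * (y - x) = (g / n +i* (- n^-1))^* * (T^* * (y - toC x0) - T^* * (x - toC x0)).
    by rewrite /nu conjM; ring.
  by rewrite ReM ReJ ImJ ReB ImB /= -/(S y) -/(S x) -/(U y) -/(U x); field; rewrite gt_eqF.
have bound y : cabs (y - x) < r' ->
  [/\ `|gam (S y) - gam (S x) - g * (S y - S x)| <= K * powR (cabs (y - x)) (1 + al) &
      dom O y <-> U y < gam (S y)].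
  move=> yx; have yr : cabs (y - toC x0) < 2 * r'.
    by have := cabs_tri y x (toC x0); clear -yx xx0; lra.
  have Syr : `|S y| < r by have := Sle y; clear -yr r'r; lra.
  split; last exact: DE.
  apply: le_trans (hK _ _ Sxr Syr) _; rewrite ler_wpM2l//.
  by apply: powR_lt_mono; rewrite ?normr_ge0// ltW// addr_gt0.
exists nu; split.
- rewrite cabsM cT mul1r /cabs/=.
  have -> : (g / n) ^+ 2 + (- n^-1) ^+ 2 = 1.
    have -> : (g / n) ^+ 2 + (- n^-1) ^+ 2 = (1 + g ^+ 2) / n ^+ 2 by field; rewrite gt_eqF.
    by rewrite nn divff// -nn expf_neq0// gt_eqF.
  by rewrite sqrtr1.
- move=> y /bound[h1 h2] /h2 hy; rewrite ReE ler_pdivlMr//.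
  have B0 : 0 <= K * powR (cabs (y - x)) (1 + al) by rewrite mulr_ge0// powR_ge0.
  have := ler_peMr B0 n0; move: h1; rewrite ler_norml Ux.
  by move: hy; clear; move: (K * _) => q; rewrite mulNr; lra.
- move=> y /bound[h1 h2] hq; apply/h2; move: hq; rewrite ReE ltr_pdivlMr//.
  have B0 : 0 <= K * powR (cabs (y - x)) (1 + al) by rewrite mulr_ge0// powR_ge0.
  have := ler_peMr B0 n0; move: h1; rewrite ler_norml Ux.
  by clear; move: (K * _) => q; lra.
Qed.

Lemma class_flat O p : open O -> class_C1a al O -> bd (dom O) p -> exists K r : R,
  [/\ 0 <= K, 0 < r & forall x, bd (dom O) x -> cabs (x - p) < r ->
    exists nu, flat al (dom O) x nu K r].
Proof.
move=> oO cO bp; have [|tau [r [d [gam ch]]]] := cO (ofC p).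
  by apply/bdry_dom; rewrite ?ofCK.
by have := chart_flat ch; rewrite ofCK.
Qed.

(** Close to [x] the deviation from the tangent line is at most half the distance, so the domain and
    its complement both lie in sectors; the complement is needed for the region around the hole. *)
Lemma flat_sector D x nu (K r : R) : 0 < r -> 0 <= K -> flat al D x nu K r ->
  exists2 s : R, 0 < s & forall y, cabs (y - x) < s ->
    (D y -> - (1 / 2) * cabs (y - x) <= Re (nu^* * (y - x))) /\
    (~ D y -> - (1 / 2) * cabs (y - x) <= Re (- nu^* * (y - x))).
Proof.
move=> r0 K0 [nu1 h1 h2].
have [s s0 hs] := small_power al0 K (divr_gt0 ltr01 (ltr0Sn R 1)).
exists (Num.min s r); first by rewrite lt_min s0.
move=> y; rewrite lt_min => /andP[ys yr].
have q : K * powR (cabs (y - x)) (1 + al) <= 1 / 2 * cabs (y - x).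
  have [->|cp] := eqVneq (cabs (y - x)) 0.
    by rewrite powR0 ?mulr0// gt_eqF// addr_gt0.
  rewrite powR1D ?lt0r ?cp ?cabs_ge0// mulrCA mulrC ler_wpM2r ?cabs_ge0//.
  by apply: hs; [exact: cabs_ge0|exact: ltW].
split=> [Dy|nDy]; first by apply: le_trans (h1 y yr Dy); rewrite mulNr lerN2.
rewrite !mulNr ReN lerN2; apply: le_trans q; rewrite leNgt.
by apply/negP => /(h2 y yr).
Qed.

Lemma class_sector O x : open O -> class_C1a al O -> bd (dom O) x -> sector (dom O) x.
Proof.
move=> oO cO bx; have [K [r [K0 r0 h]]] := class_flat oO cO bx.
have [|nu fl] := h x bx; first by rewrite subrr cabs0.
have nu1 : cabs nu = 1 by case: fl.
have [s s0 hs] := flat_sector r0 K0 fl; exists nu^*, (1 / 2), s; split=> //.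
- by rewrite cabsJ.
- lra.
- by move=> y Dy /hs[+ _]; apply.
Qed.

Lemma class_sector_compl O x : open O -> class_C1a al O -> bd (dom O) x -> sector (~` dom O) x.
Proof.
move=> oO cO bx; have [K [r [K0 r0 h]]] := class_flat oO cO bx.
have [|nu fl] := h x bx; first by rewrite subrr cabs0.
have nu1 : cabs nu = 1 by case: fl.
have [s s0 hs] := flat_sector r0 K0 fl; exists (- nu^*), (1 / 2), s; split=> //.
- by rewrite cabsN cabsJ.
- lra.
- by move=> y Dy /hs[_]; apply.
Qed.
End Charts.

(** * The Schauder norm away from the origin *)

Section Schauder.
Variable R : realType.
Local Notation C := R[i].
Local Notation Re := (@complex.Re R).
Local Notation Im := (@complex.Im R).
Implicit Types (x y z p : C) (w f : C -> R) (D E : set C) (O : set (R * R)).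
Variable al : R.
Hypotheses (al0 : 0 < al) (al1 : al < 1).

(** The partial derivatives of the real linear map [Re (g * z)]. *)
Definition dgr (g : C) (i : 'I_2) : R := if i == ord0 then Re g else - Im g.

Lemma dgr_le g i : `|dgr g i| <= cabs g.
Proof. by rewrite /dgr; case: ifP => _; rewrite ?normrN ?Re_le ?Im_le. Qed.

Lemma dgrB g h i : dgr g i - dgr h i = dgr (g - h) i.
Proof. by rewrite /dgr; case: ifP => _; rewrite ?ReB ?ImB; ring. Qed.

Lemma toCD q v (h : R) : toC (h *: v + q) = toC q + h%:C * toC v :> C.
Proof. by apply: complex_ext; rewrite /toC/= ?ReM ?ImM/= /GRing.scale/=; ring. Qed.

Lemma dgr_evec (g : C) i (h : R) : Re (g * (h%:C * toC (evec R i))) = h * dgr g i.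
Proof.
by rewrite mulrCA ReZ /dgr /evec; case: ifP => _; rewrite ReM /toC/=; congr (_ * _); ring.
Qed.

Lemma cabs_evec i : cabs (toC (evec R i)) = 1.
Proof. by rewrite /evec /cabs; case: ifP => _ /=; rewrite expr0n expr1n ?addr0 ?add0r sqrtr1. Qed.

Lemma taylor_partial f (q : R * R) (g : C) (K r : R) : 0 < r ->
  (forall y, cabs (y - toC q) < r ->
    `|f y - f (toC q) - Re (g * (y - toC q))| <= K * powR (cabs (y - toC q)) (1 + al)) ->
  forall i, derivable (f \o @toC R) q (evec R i) /\ partial i (f \o @toC R) q = dgr g i.
Proof.
move=> r0 hT i.
have lim : h^-1 *: ((f \o @toC R) (h *: evec R i + q) - (f \o @toC R) q) @[h --> 0^'] --> dgr g i.
  apply/cvgrPdist_le => e e0; have [s s0 hs] := small_power al0 K e0.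
  apply/nbhs_ballP; exists (Num.min r s) => /=; first by rewrite lt_min r0.
  move=> h; rewrite /ball/= sub0r normrN lt_min => /andP[hr hs'] h0.
  have nh : 0 < `|h| by rewrite normr_gt0.
  have cE : cabs (toC (h *: evec R i + q) - toC q) = `|h|.
    by rewrite toCD dist_shift cabsZ cabs_evec mulr1.
  have := hT (toC (h *: evec R i + q)); rewrite cE => /(_ hr).
  have -> : toC (h *: evec R i + q) - toC q = h%:C * toC (evec R i).
    by rewrite toCD addrAC subrr add0r.
  rewrite dgr_evec powR1D// mulrCA => h1.
  rewrite -(ler_pM2l nh); apply: le_trans (ler_wpM2l (ltW nh) (hs _ (ltW nh) (ltW hs'))).
  by rewrite -normrM mulrBr /GRing.scale/= mulrA mulfV// mul1r distrC.
split; first by apply/cvg_ex; exists (dgr g i).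
exact/cvg_lim.
Qed.

Lemma powR_sum_le (a b c : R) : 0 <= a -> 0 <= b -> 0 <= c -> c <= a + b ->
  powR c al <= 2 * (powR a al + powR b al).
Proof.
move=> a0 b0 c0 cab; wlog ab : a b a0 b0 cab / a <= b.
  move=> h; have [ab|ba] := leP a b; first exact: h.
  by rewrite [X in _ * X]addrC; apply: h; rewrite ?(ltW ba)// addrC.
apply: (@le_trans _ _ (powR (2 * b) al)).
  by apply: powR_lt_mono => //; [exact: ltW|lra].
have h2 : powR 2 al <= 2 :> R.
  by rewrite -[leRHS]powRr1 ?ler_powR ?(ltW al1)//; lra.
rewrite powRM//; apply: le_trans (ler_wpM2r (powR_ge0 b al) h2) _.
by rewrite ler_wpM2l// lerDr powR_ge0.
Qed.

(** McShane's formula. The power [al] of the distance satisfies the triangle inequality here only up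
    to the factor 2 of [powR_sum_le], which explains the slope [2 * H]. *)
Lemma holder_extension E (F : C -> R) (H : R) : 0 <= H ->
  (forall x y, E x -> E y -> `|F x - F y| <= H * powR (cabs (x - y)) al) ->
  exists2 G : C -> R, cont (clos E) G & forall x, E x -> G x = F x.
Proof.
move=> H0 hF; pose P x y := 2 * H * powR (cabs (y - x)) al.
have P0 x y : 0 <= P x y by rewrite !mulr_ge0 ?powR_ge0.
have key x y z : E y -> E z -> F y - P x y <= F z + P x z.
  move=> Ey Ez; have := hF y z Ey Ez.
  have := @powR_sum_le (cabs (y - x)) (cabs (z - x)) (cabs (y - z)) (cabs_ge0 _) (cabs_ge0 _) (cabs_ge0 _).
  rewrite (cabs_sub z x) => /(_ (cabs_tri y x z))/(ler_wpM2l H0) h1.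
  rewrite ler_norml => /andP[_ h2]; rewrite /P (cabs_sub z x).
  move: h1 h2; rewrite mulrCA mulrDr -!mulrA.
  clear; move: (H * powR (cabs (y - z)) _) (H * powR (cabs (y - x)) _) (H * powR (cabs (x - z)) _).
  by move=> *; lra.
pose S x := [set F y - P x y | y in E].
pose G x := sup (S x).
have GE x z : E z -> F z - P x z <= G x <= F z + P x z.
  move=> Ez; apply/andP; split.
    apply: ub_le_sup; last by exists z.
    by exists (F z + P x z) => _ [y Ey <-]; exact: key.
  apply: ge_sup; first by exists (F z - P x z), z.
  by move=> _ [y Ey <-]; exact: key.
exists G; last first.
  move=> x Ex; have := GE x x Ex.
  by rewrite /P subrr cabs0 powR0 ?gt_eqF// mulr0 subr0 addr0 => h; apply/eqP; rewrite eq_le andbC.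
move=> x cx e e0; have e4 : 0 < e / 4 by rewrite divr_gt0.
have [s s0 hs] := small_power al0 (2 * H) e4.
exists (s / 2); first by rewrite divr_gt0.
move=> y cy yx; have [z Ez zx] := cx (s / 2) (divr_gt0 s0 (ltr0Sn R 1)).
have h1 : P x z <= e / 4 by apply: hs; [exact: cabs_ge0|clear -zx s0; lra].
have h2 : P y z <= e / 4.
  apply: hs; [exact: cabs_ge0|].
  have := cabs_tri z x y; rewrite (cabs_sub x y); clear -zx yx; lra.
have := GE x z Ez; have := GE y z Ez; rewrite ltr_norml; move: h1 h2 e0.
  by move: (G x) (G y) (F z) (P x z) (P y z); clear; move=> *; lra.
Qed.

Definition vanishing D (r M : R) w := [/\ cont [set x | clos D x /\ r <= cabs x] w,
  forall x, D x -> r < cabs x -> harm w x,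
  forall x, clos D x -> r <= cabs x -> `|w x| <= M &
  forall x, bd D x -> r <= cabs x -> w x = 0].

Variables (O O' : set (R * R)) (r : R).
Hypotheses (oO : open O) (cO : class_C1a al O) (bO : bnd (dom O)) (sO : O' `<=` O) (r0 : 0 < r)
  (rO : forall x, clos (dom O') x -> 2 * r <= cabs x).

Lemma closure_sub (p : R * R) : closure O' p -> clos (dom O) (toC p).
Proof. by move/closure_dom; apply: clos_mono => x /sO. Qed.

Lemma local_est_dom p : clos (dom O) p -> local_est al (dom O) p.
Proof.
move=> cp; have [Dp|nDp] := pselect (dom O p).
  by apply: local_est_int => //; exact: opn_dom.
have [K [s [K0 s0 h]]] := class_flat al0 oO cO (conj cp nDp).
exact: (local_est_bd al0 al1 (opn_dom oO) (conj cp nDp) s0 K0 h).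
Qed.

Lemma vanishing_cls w M p : clos (dom O') p -> vanishing (dom O) r M w ->
  cls (dom O) p r M w.
Proof.
move=> /rO rp [cw hw wM w0]; have far x : cabs (x - p) < r -> r < cabs x.
  by move=> xp; have := cabs_leD p x; rewrite cabs_sub; lra.
split.
- by apply: cont_sub cw => x [cx /far/ltW].
- by move=> x Dx /far; exact: hw.
- by move=> x cx /far/ltW; exact: wM.
- by move=> x bx /far/ltW; exact: w0.
Qed.

Lemma global_est : exists K s : R, [/\ 0 < K, 0 < s & forall w M, 0 < M ->
  vanishing (dom O) r M w -> forall q, O' q -> forall i,
  [/\ derivable (w \o @toC R) q (evec R i), `|partial i (w \o @toC R) q| <= K * M &
   forall q', O' q' -> cabs (toC q - toC q') < s ->
    `|partial i (w \o @toC R) q - partial i (w \o @toC R) q'| <= K * M * powR (cabs (toC q - toC q')) al]].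
Proof.
pose E := dom O'; pose D := dom O.
have ED : E `<=` D by move=> x /sO.
have /choice[kp hkp] : forall p, exists k : R * R, [/\ 0 < k.1, 0 < k.2 & clos E p ->
  forall w M, 0 < M -> cls D p r M w -> exists g : C -> C,
  forall x, D x -> cabs (x - p) < k.2 -> cabs (g x) <= k.1 * M /\
  forall y, D y -> cabs (y - p) < k.2 ->
    `|w y - w x - Re (g x * (y - x))| <= k.1 * M * powR (cabs (y - x)) (1 + al) /\
    cabs (g x - g y) <= k.1 * M * powR (cabs (x - y)) al].
  move=> p; have [cp|ncp] := pselect (clos E p); last by exists (1, 1).
  have [k [rh [k0 rh0 h]]] := local_est_dom (clos_mono ED cp) r0.
  by exists (k, rh).
have k1 p : 0 < (kp p).1 by case: (hkp p).
have k2 p : 0 < (kp p).2 by case: (hkp p).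
have [|||s [sE cov]] := @finite_cover R (clos E) (fun p => (kp p).2 / 2).
- by apply/bnd_clos/(bnd_sub _ bO).
- exact: clos_clos.
- by move=> x _; rewrite divr_gt0.
(* Sums over the finite cover stand in for the maximum of the constants and, through [T^-1], for the
   minimum of the radii. *)
pose K := 1 + \sum_(p <- s) (kp p).1.
pose T := 1 + \sum_(p <- s) 2 / (kp p).2.
have sumle (a : C -> R) p : (forall p, 0 < a p) -> p \in s -> a p <= \sum_(p <- s) a p.
  move=> a0; elim: s {sE cov K T} => // b s IH; rewrite inE big_cons => /orP[/eqP->|/IH].
    by rewrite lerDl sumr_ge0// => i _; exact: ltW.
  by move/le_trans; apply; rewrite lerDr ltW.
have KP p : p \in s -> (kp p).1 <= K.
  by move=> ps; apply: le_trans (sumle _ _ k1 ps) _; rewrite lerDr.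
have T0 : 0 < T by rewrite ltr_wpDr// sumr_ge0// => i _; rewrite divr_ge0// ltW.
have TP p : p \in s -> T^-1 <= (kp p).2 / 2.
  move=> ps; rewrite -[leRHS]invrK lef_pV2 ?posrE ?invr_gt0 ?divr_gt0//.
  rewrite invf_div; have h q : 0 < 2 / (kp q).2 by rewrite divr_gt0.
  by apply: le_trans (sumle (fun p => 2 / (kp p).2) p h ps) _; rewrite lerDr.
have K0 : 0 < K by rewrite ltr_wpDr// sumr_ge0// => i _; exact: ltW.
exists K, T^-1; split=> //; first by rewrite invr_gt0.
move=> w M M0 vw q Oq i.
have Eq : E (toC q) := proj1 (domE O' q) Oq.
have [p ps qp] := cov _ (sub_clos Eq).
have cp := sE p ps; have [_ _ /(_ cp w M M0 (vanishing_cls cp vw))[g hg]] := hkp p.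
have qp2 : cabs (toC q - p) < (kp p).2 by have := k2 p; lra.
have main q' : O' q' -> cabs (toC q' - p) < (kp p).2 ->
   derivable (w \o @toC R) q' (evec R i) /\ partial i (w \o @toC R) q' = dgr (g (toC q')) i.
  move=> Oq' q'p; have Eq' : E (toC q') := proj1 (domE O' q') Oq'.
  have [d d0 hd] := opn_dom oO (ED _ Eq').
  have [_ h2] := hg _ (ED _ Eq') q'p.
  apply: (@taylor_partial _ _ _ ((kp p).1 * M) (Num.min d ((kp p).2 - cabs (toC q' - p)))).
    by rewrite lt_min d0 subr_gt0.
  move=> y; rewrite lt_min => /andP[yd yp].
  have [] := h2 y (hd _ yd) _ => //.
  by have := cabs_tri y (toC q') p; lra.
have [d1 d2] := main q Oq qp2; have [h1 h2] := hg _ (ED _ Eq) qp2; split=> //.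
  rewrite d2; apply: le_trans (dgr_le _ _) _; apply: le_trans h1 _.
  by rewrite ler_wpM2r ?(ltW M0)// KP.
move=> q' Oq' qq'; have q'p : cabs (toC q' - p) < (kp p).2.
  have := cabs_tri (toC q') (toC q) p; rewrite (cabs_sub (toC q') (toC q)).
  by have := TP p ps; lra.
have [_ ->] := main q' Oq' q'p; rewrite d2 dgrB; apply: le_trans (dgr_le _ _) _.
have Dq' : D (toC q') := ED _ (proj1 (domE O' q') Oq').
have [_ h] := h2 _ Dq' q'p; apply: le_trans h _.
by rewrite ler_wpM2r ?powR_ge0// ler_wpM2r ?(ltW M0)// KP.
Qed.

Theorem schauder_estimate : exists2 K : R, 0 <= K & forall w M, 0 <= M ->
  vanishing (dom O) r M w ->
  C1a_closure al O' (w \o @toC R) /\ schauder_norm al O' (w \o @toC R) <= K * M.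
Proof.
have [K [s [K0 s0 main]]] := global_est.
(* Points at distance at least [s] are not covered by the local estimates; there the gradient bound
   is divided by the power [al] of [s]. *)
pose H := K + 2 * K / powR s al; have ps : 0 < powR s al by exact: powR_gt0.
have H0 : 0 <= H by rewrite addr_ge0 ?(ltW K0)// divr_ge0 ?mulr_ge0 ?ltW.
have c0 : 0 < 1 + ((K + H) + (K + H)).
  have KH : 0 <= K + H by exact: addr_ge0 (ltW K0) H0.
  by rewrite ltr_wpDr// addr_ge0.
exists (1 + ((K + H) + (K + H))); first exact: ltW.
have pos w M : 0 < M -> vanishing (dom O) r M w ->
  C1a_closure al O' (w \o @toC R) /\ schauder_norm al O' (w \o @toC R) <= (1 + ((K + H) + (K + H))) * M.
  move=> M0 vw; have HM : 0 <= H * M by exact: mulr_ge0 H0 (ltW M0).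
  have KM : 0 <= K * M := mulr_ge0 (ltW K0) (ltW M0).
  have hol i q q' : O' q -> O' q' -> `|partial i (w \o @toC R) q - partial i (w \o @toC R) q'| <=
      H * M * powR (cabs (toC q - toC q')) al.
    move=> Oq Oq'; have [_ b1 h] := main w M M0 vw q Oq i.
    have [_ b2 _] := main w M M0 vw q' Oq' i.
    have [qq|qq] := ltP (cabs (toC q - toC q')) s.
      apply: le_trans (h q' Oq' qq) _; rewrite ler_wpM2r ?powR_ge0// ler_wpM2r ?(ltW M0)//.
      by rewrite /H lerDl divr_ge0 ?mulr_ge0 ?ltW.
    apply: le_trans (ler_normB _ _) _; apply: le_trans (lerD b1 b2) _.
    have e : H * M = K * M + 2 * (K * M) / powR s al by rewrite /H; ring.
    have h3 : 1 <= powR (cabs (toC q - toC q')) al / powR s al.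
      by rewrite ler_pdivlMr// mul1r powR_lt_mono// ltW.
    apply: (@le_trans _ _ (2 * (K * M) / powR s al * powR (cabs (toC q - toC q')) al)).
      have h4 := ler_wpM2l KM h3.
      have -> : 2 * (K * M) / powR s al * powR (cabs (toC q - toC q')) al =
        2 * (K * M * (powR (cabs (toC q - toC q')) al / powR s al)) by ring.
      by move: h4; rewrite mulr1; move: (powR _ al / powR s al) (K * M) => a b; lra.
    by rewrite ler_wpM2r ?powR_ge0// e lerDr.
  have hq i (z : (R * R) * (R * R)) : (O' `*` O') z -> `|holder_quot al (partial i (w \o @toC R)) z| <= H * M.
    move=> [Oz1 Oz2]; rewrite /holder_quot.
    have [z12|z12] := eqVneq z.1 z.2; first by rewrite z12 subrr mul0r normr0.
    have -> : enorm (z.1 - z.2) = cabs (toC z.1 - toC z.2).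
      by rewrite enorm_toC; congr cabs.
    have cz : 0 < powR (cabs (toC z.1 - toC z.2)) al.
      by rewrite powR_gt0// cabs_gt0 subr_eq0 (inj_eq (can_inj (@toCK R))).
    by rewrite normrM normfV (gtr0_norm cz) ler_pdivrMr//; exact: hol.
  have wM q : closure O' q -> `|(w \o @toC R) q| <= M.
    move=> cq; have [_ _ h _] := vw; apply: h; first exact: closure_sub.
    have := rO (proj1 (closure_dom _ _) cq).
    by apply: le_trans; rewrite mulr2n mulrDl mul1r lerDl ltW.
  have pM i q : O' q -> `|partial i (w \o @toC R) q| <= K * M.
    by move=> Oq; have [] := main w M M0 vw q Oq i.
  split.
    split; [split| | |].
    - apply/(cont_within (w \o @toC R) (@closure_dom R O')).
      have [h _ _ _] := vw; apply: (@cont_eq _ _ w); first by move=> x _ /=; rewrite ofCK.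
      apply: cont_sub h => x cx; split; first by apply: clos_mono cx => y /sO.
      have := rO cx.
      by apply: le_trans; rewrite mulr2n mulrDl mul1r lerDl ltW.
    - by move=> i q Oq; have [] := main w M M0 vw q Oq i.
    - move=> i; have [|G cG GE] := @holder_extension (dom O') (partial i (w \o @toC R) \o @ofC R) (H * M) HM.
        by move=> x y Ex Ey /=; have := hol i _ _ Ex Ey; rewrite !ofCK.
      exists (G \o @toC R).
        apply/(cont_within (G \o @toC R) (@closure_dom R O')).
        by apply: cont_eq cG => x _ /=; rewrite ofCK.
      by move=> q /domE Oq /=; rewrite GE//= toCK.
    - by exists M => _ [q cq <-]; exact: wM.
    - by move=> i; exists (K * M) => _ [q Oq <-]; exact: pM.
    - by move=> i; exists (H * M) => _ [q Oq <-]; exact: hq.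
  rewrite mulrDl mul1r; apply: lerD; first by apply: sup_norm_le (ltW M0) wM.
  apply: (@le_trans _ _ (\sum_(i < 2) (K * M + H * M))).
    by apply: ler_sum => i _; apply: lerD; [exact: sup_norm_le KM (pM _)|exact: sup_norm_le HM (hq _)].
  by rewrite sumr_const card_ord mulr2n -mulrDl -mulrDl.
move=> w M M0 vw.
(* The local estimates assume [0 < M]; the case [M = 0] is reached through [M + e]. *)
have vw' e : 0 < e -> vanishing (dom O) r (M + e) w.
  move=> e0; case: vw => h1 h2 h3 h4; split=> // x cx rx.
  by rewrite (le_trans (h3 x cx rx))// lerDl ltW.
split; first by have [|] := pos w (M + 1) _ (vw' 1 ltr01); rewrite ?ltr_wpDl.
set c := 1 + _ in pos c0 *.
apply: le_eps => e e0; have ec : 0 < e / c by rewrite divr_gt0.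
have [_] := pos w (M + e / c) ltac:(by rewrite ltr_wpDl) (vw' _ ec).
by rewrite mulrDr (mulrC c (e / c)) divfK ?gt_eqF.
Qed.
End Schauder.

(** * Analytic families of continuous functions *)

Section SeriesLimits.
Variable R : realType.
Implicit Types (a s : nat -> R).

Definition Lim s (l : R) := forall e : R, 0 < e -> exists n0, forall n, (n0 <= n)%N -> `|s n - l| <= e.

Lemma Lim_uniq s l l' : Lim s l -> Lim s l' -> l = l'.
Proof.
move=> h h'; apply/eqP; rewrite -subr_eq0 -normr_le0; apply: le_eps => e e0.
have e2 : 0 < e / 2 by rewrite divr_gt0.
have [n hn] := h _ e2; have [m hm] := h' _ e2.
have := hn _ (leq_maxl n m); have := hm _ (leq_maxr n m); rewrite !ler_norml; lra.
Qed.

Lemma LimD s s' l l' : Lim s l -> Lim s' l' -> Lim (fun n => s n + s' n) (l + l').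
Proof.
move=> h h' e e0; have e2 : 0 < e / 2 by rewrite divr_gt0.
have [n hn] := h _ e2; have [m hm] := h' _ e2; exists (maxn n m) => k.
rewrite geq_max => /andP[/hn + /hm]; rewrite !ler_norml; lra.
Qed.

Lemma LimZ c s l : Lim s l -> Lim (fun n => c * s n) (c * l).
Proof.
move=> h e e0; have c0 : 0 < `|c| + 1 by rewrite ltr_wpDl.
have [n hn] := h (e / (`|c| + 1)) (divr_gt0 e0 c0); exists n => k /hn.
rewrite -mulrBr normrM ler_pdivlMr// => h1; apply: le_trans h1; rewrite mulrC.
by rewrite ler_wpM2l// lerDl.
Qed.

Lemma Lim_ext s s' l : (forall n, s n = s' n) -> Lim s l -> Lim s' l.
Proof. by move=> e h d /h[n hn]; exists n => k /hn; rewrite e. Qed.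

Lemma Lim_le s l (b M : R) : Lim s l -> (exists n0, forall n, (n0 <= n)%N -> `|s n - b| <= M) ->
  `|l - b| <= M.
Proof.
move=> h [m hm]; apply: le_eps => e e0; have [n hn] := h e e0.
have := hn _ (leq_maxl n m); have := hm _ (leq_maxr n m); rewrite !ler_norml; lra.
Qed.

Variables (N : nat -> R) (M : R).
Hypotheses (N0 : forall n, 0 <= N n) (NM : forall n, \sum_(i < n) N i <= M).

Lemma sum_tail_small (e : R) : 0 < e -> exists n0, forall n m, (n0 <= n)%N -> (n <= m)%N ->
  \sum_(i < m) N i - \sum_(i < n) N i <= e.
Proof.
move=> e0; pose S := [set \sum_(i < n) N i | n in [set: nat]].
have hs : has_sup S.
  by split; [exists (\sum_(i < 0) N i), 0%N|exists M => _ [n _ <-]; exact: NM].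
have mono n m : (n <= m)%N -> \sum_(i < n) N i <= \sum_(i < m) N i.
  elim: m => [|m IH]; first by rewrite leqn0 => /eqP->.
  rewrite leq_eqVlt => /orP[/eqP->//|/IH h].
  by rewrite big_ord_recr/=; apply: le_trans h _; rewrite lerDl.
have [_ [n0 _ <-] hn0] := sup_adherent e0 hs.
exists n0 => n m nn nm; have : \sum_(i < m) N i <= sup S.
  by apply: (ub_le_sup (proj2 hs)); exists m.
by have := mono _ _ nn; lra.
Qed.

Lemma sum_diff_le a n m : (forall i, `|a i| <= N i) -> (n <= m)%N ->
  `|\sum_(i < m) a i - \sum_(i < n) a i| <= \sum_(i < m) N i - \sum_(i < n) N i.
Proof.
move=> aN; elim: m => [|m IH]; first by rewrite leqn0 => /eqP->; rewrite !subrr normr0.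
rewrite leq_eqVlt => /orP[/eqP->|/IH h]; first by rewrite !subrr normr0.
rewrite !big_ord_recr/=; have := aN m; move: h; rewrite !ler_norml; lra.
Qed.

Lemma Lim_exists a : (forall i, `|a i| <= N i) -> exists l, Lim (fun n => \sum_(i < n) a i) l.
Proof.
move=> aN; have /choice[k hk] : forall j : nat, exists n0, forall n m, (n0 <= n)%N ->
    (n <= m)%N -> \sum_(i < m) N i - \sum_(i < n) N i <= j.+1%:R^-1.
  by move=> j; apply: sum_tail_small; rewrite invr_gt0.
pose K j := \max_(i < j.+1) k i.
have kK i j : (i <= j)%N -> (k i <= K j)%N.
  by rewrite -ltnS => ij; exact: (leq_bigmax (Ordinal ij)).
have [|l hl] := @cauchy_limit R (fun j => \sum_(i < k j) a i).
  move=> i j; wlog ij : i j / (k i <= k j)%N.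
    move=> h; have [/h//|/ltnW/h] := leqP (k i) (k j).
    by rewrite distrC [X in _ <= X]addrC.
  rewrite distrC; apply: le_trans (sum_diff_le aN ij) _.
  by apply: le_trans (hk i _ _ (leqnn _) ij) _; rewrite lerDl invr_ge0.
exists l => e e0; have e2 : 0 < e / 2 by rewrite divr_gt0.
have [j hj] := inv_lt e2; exists (k j) => n kn.
have h1 := le_trans (sum_diff_le aN kn) (hk j _ _ (leqnn _) kn).
have h2 := hl j; move: h1 h2 hj; move: (j.+1%:R^-1) => q; rewrite !ler_norml; lra.
Qed.

Lemma Lim_tail a l n (e : R) : (forall i, `|a i| <= N i) -> Lim (fun n => \sum_(i < n) a i) l ->
  (forall m, (n <= m)%N -> \sum_(i < m) N i - \sum_(i < n) N i <= e) ->
  `|l - \sum_(i < n) a i| <= e.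
Proof.
move=> aN hl h; apply: Lim_le hl _; exists n => m nm.
exact: le_trans (sum_diff_le aN nm) (h m nm).
Qed.
End SeriesLimits.

Lemma geo_sum_le (R : realType) (c q : R) n : 0 <= c -> 0 <= q -> q < 1 ->
  \sum_(i < n) c * q ^+ i <= c / (1 - q).
Proof.
move=> c0 q0 q1; have q1' : 0 < 1 - q by rewrite subr_gt0.
have -> : \sum_(i < n) c * q ^+ i = c * (1 - q ^+ n) / (1 - q).
  elim: n => [|n IH]; first by rewrite big_ord0 expr0 subrr mulr0 mul0r.
  by rewrite big_ord_recr/= IH exprS; field; rewrite gt_eqF.
rewrite ler_pM2r ?invr_gt0// -[leRHS]mulr1 ler_wpM2l//.
by rewrite lerBlDr lerDl exprn_ge0.
Qed.

Section AnalyticFamilies.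
Variable R : realType.
Local Notation C := R[i].
Local Notation Re := (@complex.Re R).
Local Notation Im := (@complex.Im R).
Variables (V : normedModType R) (I : Type) (lin : I -> V -> R) (off : I -> R) (rr : R).
Hypotheses (lin_lin : forall i (a : R) x y, lin i (a *: x + y) = a * lin i x + lin i y)
  (lin_le : forall i v, `|lin i v| <= `|v|) (rr0 : 0 <= rr).
Implicit Types (A B : set C) (f g : V -> C -> R) (t : V) (x : C).

Definition co i t := lin i t - off i.
Definition box : set V := [set t | forall i, `|co i t| <= rr].

(* [An A f N]: on the box, [f] is a power series in the coordinates [co i] with coefficients
in the bounded continuous functions on [A], and [N] bounds the sum of the norms of its terms. *)
Inductive An A : (V -> C -> R) -> R -> Prop :=
| An_cst a (N : R) : 0 <= N -> cont A a -> (forall x, A x -> `|a x| <= N) -> An A (fun=> a) N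
| An_X i f N : An A f N -> An A (fun t x => co i t * f t x) (rr * N)
| An_sum (F : nat -> V -> C -> R) (N : nat -> R) f M : (forall n, An A (F n) (N n)) ->
    (forall n, \sum_(i < n) N i <= M) ->
    (forall t x, box t -> A x -> Lim (fun n => \sum_(i < n) F i t x) (f t x)) -> An A f M.

Lemma An_ge0 A f N : An A f N -> 0 <= N.
Proof.
elim=> {f N} //= [i f N _|F N f M _ _ h _]; first exact: mulr_ge0.
by have := h 0%N; rewrite big_ord0.
Qed.

Lemma An0 A : An A (fun _ _ => 0) 0.
Proof. by apply: An_cst => //; [exact: cont_cst|move=> *; rewrite normr0]. Qed.

(** The only sums in [An] are series, so a binary sum is a series with two nonzero terms. In the
    same way [An_ext] uses a series with one term to exchange the function and enlarge the bound. *)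
Lemma An_add A f g N M : An A f N -> An A g M -> An A (fun t x => f t x + g t x) (N + M).
Proof.
move=> hf hg.
pose F n := if n is n'.+1 then if n' is _.+1 then fun _ _ => 0 else g else f.
pose K n : R := if n is n'.+1 then if n' is _.+1 then 0 else M else N.
have E (a : nat -> R) n : (forall k, a k.+2 = 0) -> \sum_(i < n.+2) a i = a 0%N + a 1%N.
  by move=> a0; rewrite big_ord_recl big_ord_recl big1 ?addr0// => i _; exact: a0.
apply: (@An_sum A F K).
- by case=> [|[|n]] //; exact: An0.
- case=> [|[|n]].
  + by rewrite big_ord0 addr_ge0 ?(An_ge0 hf) ?(An_ge0 hg).
  + by rewrite big_ord_recl big_ord0 addr0 lerDl (An_ge0 hg).
  + by rewrite E.
- move=> t x _ _ e e0; exists 2%N => -[|[|n]]// _.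
  by rewrite (E (fun i => F i t x))// subrr normr0 ltW.
Qed.

Lemma An_ext A f g N M : An A f N -> (forall t x, box t -> A x -> f t x = g t x) -> N <= M ->
  An A g M.
Proof.
move=> hf fg NM; pose F n := if n is n'.+1 then fun _ _ => 0 else f.
pose K n : R := if n is n'.+1 then 0 else N.
have E (a : nat -> R) n : (forall k, a k.+1 = 0) -> \sum_(i < n.+1) a i = a 0%N.
  by move=> a0; rewrite big_ord_recl big1 ?addr0// => i _; exact: a0.
apply: (@An_sum A F K).
- by case=> [|n] //; exact: An0.
- case=> [|n]; first by rewrite big_ord0 (le_trans (An_ge0 hf)).
  by rewrite E.
- move=> t x bt Ax e e0; exists 1%N => -[|n]// _.
  by rewrite (E (fun i => F i t x))// /F fg// subrr normr0 ltW.
Qed.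

Lemma cont_sum A n (F : nat -> C -> R) : (forall i, cont A (F i)) ->
  cont A (fun y => \sum_(i < n) F i y).
Proof.
move=> cF; elim: n => [|k IH].
  apply: (@cont_eq R A (fun=> 0)); last exact: cont_cst.
  by move=> y _; rewrite big_ord0.
apply: (@cont_eq _ _ (fun y => \sum_(i < k) F i y + F k y)); last exact: contD.
by move=> y _; rewrite big_ord_recr.
Qed.

Lemma An_bd A f N : An A f N -> forall t, box t -> cont A (f t) /\ forall x, A x -> `|f t x| <= N.
Proof.
elim=> {f N} [a N N0 ca aN|i f N _ IH|F N f M hF IH NM hf] t bt; first by [].
  have [cf fN] := IH t bt; split; first exact: contZ.
  by move=> x Ax; rewrite normrM ler_pM// ?bt// fN.
have N0 n : 0 <= N n by exact: An_ge0 (hF n).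
have FN x i : A x -> `|F i t x| <= N i by move=> Ax; have [_ h] := IH i t bt; exact: h.
split.
  apply: cont_unif_lim => x Ax e e0; exists 1 => //.
  have [n hn] := sum_tail_small N0 NM e0; exists (fun x => \sum_(i < n) F i t x).
    by apply: (@cont_sum A n (fun i => F i t)) => i; have [] := IH i t bt.
  move=> y Ay _; apply: (Lim_tail (a := fun i => F i t y) _ (hf t y bt Ay)) => [i|m nm]; first exact: FN.
  exact: hn.
move=> x Ax; rewrite -[f t x]subr0; apply: Lim_le (hf t x bt Ax) _; exists 0%N => n _.
rewrite subr0; apply: le_trans (ler_norm_sum _ _ _) _; apply: le_trans (NM n).
by apply: ler_sum => i _; exact: FN.
Qed.

Lemma An_cont A f N t : An A f N -> box t -> cont A (f t).
Proof. by move=> h /(An_bd h)[]. Qed.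

Lemma An_le A f N t x : An A f N -> box t -> A x -> `|f t x| <= N.
Proof. by move=> h /(An_bd h)[_]; exact. Qed.

(** A bounded linear operator between spaces of bounded continuous functions, acting on functions of
    the whole plane; that only the values on [A] matter follows from linearity and the bound, see
    [Op_ext]. *)
Record Op A B (L : (C -> R) -> C -> R) (K : R) : Prop := {
  Op_ge0 : 0 <= K;
  Op_cont : forall f : C -> R, cont A f -> cont B (L f);
  Op_lin : forall a (f g : C -> R), cont A f -> cont A g -> forall x, B x ->
    L (fun y => a * f y + g y) x = a * L f x + L g x;
  Op_bd : forall (f : C -> R) M, 0 <= M -> cont A f -> (forall x, A x -> `|f x| <= M) ->
    forall x, B x -> `|L f x| <= K * M }.

Lemma Op_ext A B L K (f g : C -> R) x : Op A B L K -> cont A f -> (forall y, A y -> f y = g y) ->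
  B x -> L f x = L g x.
Proof.
move=> H cf fg Bx; have cg : cont A g by apply: cont_eq cf.
apply/eqP; rewrite eq_sym -subr_eq0 -normr_le0.
have -> : L g x - L f x = L (fun y => - 1 * f y + g y) x.
  by rewrite (Op_lin H)// mulN1r addrC.
rewrite -(mulr0 K); apply: (Op_bd H) => //.
  by apply: contD => //; exact: contZ.
by move=> y Ay; rewrite fg// mulN1r addNr normr0.
Qed.

Lemma Op0 A B L K x : Op A B L K -> B x -> L (fun=> 0) x = 0.
Proof.
move=> H Bx; apply/eqP; rewrite -normr_le0; apply: (@le_trans _ _ (K * 0)); last by rewrite mulr0.
have h y : A y -> `|0 : R| <= 0 by rewrite normr0.
by apply: (@Op_bd _ _ _ _ H (fun=> 0) 0) => //; exact: cont_cst.
Qed.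

Lemma OpD A B L K (f g : C -> R) x : Op A B L K -> cont A f -> cont A g -> B x ->
  L (fun y => f y + g y) x = L f x + L g x.
Proof.
move=> H cf cg Bx; rewrite -[L f x]mul1r -(Op_lin H)//.
by apply: (Op_ext H) => //; [exact: contD|move=> y _; rewrite mul1r].
Qed.

Lemma OpZ A B L K (a : R) (f : C -> R) x : Op A B L K -> cont A f -> B x ->
  L (fun y => a * f y) x = a * L f x.
Proof.
move=> H cf Bx; rewrite -[a * L f x]addr0 -(Op0 H Bx) -(Op_lin H)//; last exact: cont_cst.
by apply: (Op_ext H) => //; [exact: contZ|move=> y _; rewrite addr0].
Qed.

Lemma OpB A B L K (f g : C -> R) x : Op A B L K -> cont A f -> cont A g -> B x ->
  L (fun y => f y - g y) x = L f x - L g x.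
Proof.
move=> H cf cg Bx; rewrite -mulN1r -(OpZ _ H)// -(OpD H)//; last exact: contZ.
by apply: (Op_ext H) => //; [exact: contB|move=> y _; rewrite mulN1r].
Qed.

Lemma Op_sum A B L K n (f : nat -> C -> R) x : Op A B L K -> (forall i, cont A (f i)) -> B x ->
  L (fun y => \sum_(i < n) f i y) x = \sum_(i < n) L (f i) x.
Proof.
move=> H cf Bx; have cs k : cont A (fun y => \sum_(i < k) f i y) by exact: cont_sum.
elim: n => [|n IH].
  rewrite big_ord0; apply: eq_trans (Op0 H Bx).
  by apply: (Op_ext H _ _ Bx); [exact: cs|move=> y _; rewrite big_ord0].
rewrite big_ord_recr/= -IH -(OpD H)//.
by apply: (Op_ext H _ _ Bx); [exact: cs|move=> y _; rewrite big_ord_recr].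
Qed.

(** Induction over the construction of [f]: the operator acts on the coefficients, commutes with the
    coordinates by linearity and with series by its bound. *)
Lemma An_op A B L K f N : Op A B L K -> An A f N -> An B (fun t => L (f t)) (K * N).
Proof.
move=> H; elim=> {f N} [a N N0 ca aN|i f N hf IH|F N f M hF IH NM hf].
- apply: An_cst; [exact: mulr_ge0 (Op_ge0 H) N0|exact: (Op_cont H)|exact: (Op_bd H)].
- apply: An_ext (An_X i IH) _ _; last by rewrite mulrCA.
  by move=> t x bt Bx; rewrite (OpZ _ H)//; exact: An_cont hf bt.
- have N0 n : 0 <= N n by exact: An_ge0 (hF n).
  have K0 := Op_ge0 H.
  apply: (An_sum IH) => [n|t x bt Bx e e0].
    by rewrite -mulr_sumr ler_wpM2l.
  have K1 : 0 < K + 1 by rewrite ltr_wpDl.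
  have [n hn] := sum_tail_small N0 NM (divr_gt0 e0 K1); exists n => m nm.
  have cF i : cont A (F i t) by exact: An_cont (hF i) bt.
  have cs : cont A (fun y => \sum_(i < m) F i t y) by exact: (@cont_sum A m (fun i => F i t)).
  have cf : cont A (f t) by apply: An_cont bt; exact: An_sum hF NM hf.
  rewrite -(@Op_sum A B L K m (fun i => F i t) x H cF Bx) distrC -(OpB H)//.
  have e1 : 0 <= e / (K + 1) by rewrite divr_ge0// ltW.
  apply: (@le_trans _ _ (K * (e / (K + 1)))).
    apply: (Op_bd H) => //; first exact: contB.
    move=> y Ay; apply: (Lim_tail (a := fun i => F i t y) _ (hf t y bt Ay)) => [i|k mk]; first exact: An_le (hF i) bt Ay.
    by apply: hn.
  by rewrite -{2}(divfK (lt0r_neq0 K1) e) mulrC ler_wpM2l// lerDl.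
Qed.

Lemma Op_mul A (a : C -> R) (N : R) : 0 <= N -> cont A a -> (forall x, A x -> `|a x| <= N) ->
  (forall f : C -> R, cont A f -> cont A (fun x => a x * f x)) ->
  Op A A (fun (f : C -> R) x => a x * f x) N.
Proof.
move=> N0 ca aN cM; split=> //.
- by move=> c f g _ _ x _; ring.
- by move=> f M M0 _ fM x Ax; rewrite normrM ler_pM ?aN ?fM.
Qed.

Lemma cont_mul A (f g : C -> R) : cont A f -> cont A g -> cont A (fun x => f x * g x).
Proof.
move=> cf cg x Ax e e0; pose M := `|f x| + `|g x| + 1.
have M0 : 0 < M by rewrite ltr_wpDl// addr_ge0.
pose d := Num.min 1 (e / (2 * M)).
have d0 : 0 < d by rewrite lt_min ltr01 divr_gt0// mulr_gt0.
have [r r0 hr] := cf x Ax d d0; have [s s0 hs] := cg x Ax d d0.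
exists (Num.min r s); first by rewrite lt_min r0.
move=> y Ay; rewrite lt_min => /andP[/(hr y Ay) h1 /(hs y Ay) h2].
have : d <= d by []. rewrite {2}/d le_min => /andP[d1 de].
have dM : d * M <= e / 2.
  by move: de; rewrite ler_pdivlMr ?mulr_gt0// => h; lra.
have -> : f y * g y - f x * g x = (f y - f x) * (g y - g x) + ((f y - f x) * g x + f x * (g y - g x)).
  by ring.
apply: le_lt_trans (ler_normD _ _) _.
have a1 : `|(f y - f x) * (g y - g x)| <= d.
  by rewrite normrM -[leRHS]mulr1; apply: ler_pM => //; [exact: ltW|rewrite ltW// (lt_le_trans h2)].
have a2 : `|(f y - f x) * g x + f x * (g y - g x)| <= d * `|g x| + d * `|f x|.
  apply: le_trans (ler_normD _ _) _; rewrite !normrM; apply: lerD; first by rewrite ler_wpM2r// ltW.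
  by rewrite mulrC ler_wpM2r// ltW.
have : d * M = d * `|g x| + d * `|f x| + d by rewrite /M; ring.
by clearbody d M; clear h1 h2; lra.
Qed.

Lemma An_mul A f g N M : An A f N -> An A g M -> An A (fun t x => f t x * g t x) (N * M).
Proof.
move=> + hg; elim=> {f N} [a N N0 ca aN|i f N hf IH|F N f K hF IH NK hf].
- have H : Op A A (fun (f : C -> R) x => a x * f x) N by apply: Op_mul => // f cf; exact: cont_mul.
  exact: (An_op H hg).
- by apply: An_ext (An_X i IH) _ _; [move=> t x _ _; rewrite mulrA|rewrite mulrA].
- have M0 := An_ge0 hg.
  apply: (An_sum IH) => [n|t x bt Ax].
    by rewrite -mulr_suml ler_wpM2r.
  rewrite mulrC; apply: Lim_ext (LimZ (g t x) (hf t x bt Ax)) => n.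
  by rewrite mulr_sumr; apply: eq_bigr => i _; rewrite mulrC.
Qed.

Lemma An_scale A (c : R) f N : An A f N -> An A (fun t x => c * f t x) (`|c| * N).
Proof.
have H : Op A A (fun (f : C -> R) x => c * f x) `|c|; last exact: (An_op H).
split=> //.
- by move=> g cg; exact: contZ.
- by move=> a g h _ _ x _; ring.
- by move=> g M M0 _ gM x Ax; rewrite normrM ler_wpM2l// gM.
Qed.

Lemma An_opp A f N : An A f N -> An A (fun t x => - f t x) N.
Proof. by move/(@An_scale A (-1)) => h; apply: An_ext h _ _; [move=> *; rewrite mulN1r|rewrite normrN1 mul1r]. Qed.

Lemma An_geo A (F : nat -> V -> C -> R) (N q : R) : 0 <= q -> q < 1 -> 0 <= N ->
  (forall n, An A (F n) (N * q ^+ n)) ->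
  exists f, An A f (N / (1 - q)) /\
    forall t x, box t -> A x -> Lim (fun n => \sum_(i < n) F i t x) (f t x).
Proof.
move=> q0 q1 N0 hF; pose f t x := xget 0 [set l | Lim (fun n => \sum_(i < n) F i t x) l].
have NM n : \sum_(i < n) N * q ^+ i <= N / (1 - q) by exact: geo_sum_le.
have hf t x : box t -> A x -> Lim (fun n => \sum_(i < n) F i t x) (f t x).
  move=> bt Ax; have [|l hl] := @Lim_exists R _ _ (fun n => An_ge0 (hF n)) NM (fun n => F n t x).
    by move=> i; exact: An_le (hF i) bt Ax.
  by apply: (@xgetPex _ 0 [set l | Lim _ l]); exists l.
by exists f; split=> //; exact: An_sum hF NM hf.
Qed.
End AnalyticFamilies.

(** * Multilinear expansions of analytic families *)

Section Expansions.
Variable R : realType.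
Local Notation C := R[i].
Local Notation Re := (@complex.Re R).
Local Notation Im := (@complex.Im R).
Variables (V : normedModType R) (I : Type) (lin : I -> V -> R) (off : I -> R) (rr : R).
Hypotheses (lin_lin : forall i (a : R) x y, lin i (a *: x + y) = a * lin i x + lin i y)
  (lin_le : forall i v, `|lin i v| <= `|v|) (rr0 : 0 <= rr).
Implicit Types (A B : set C) (f g : V -> C -> R) (t : V) (x : C).
Local Notation co := (co lin off).
Local Notation box := (box lin off rr).
Local Notation An := (An lin off rr).

Lemma co_shift i t s : co i (t + s) = co i t + lin i s.
Proof. by have := lin_lin i 1 s t; rewrite scale1r mul1r addrC /co => ->; ring. Qed.

Lemma prod_norm_ge0 k (v : 'I_k -> V) : 0 <= \prod_(i < k) `|v i|.
Proof. by apply: prodr_ge0 => i _. Qed.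

Lemma with_lift k (v : 'I_k.+1 -> V) (j : 'I_k) (x : V) :
  (fun l => [eta v with lift ord0 j |-> x] (lift ord0 l)) =
  [eta (fun l => v (lift ord0 l)) with j |-> x].
Proof. by apply/funext => l /=; rewrite (inj_eq lift_inj). Qed.

Lemma with_lift0 k (v : 'I_k.+1 -> V) (x : V) :
  (fun l => [eta v with ord0 |-> x] (lift ord0 l)) = (fun l => v (lift ord0 l)).
Proof. by apply/funext => l. Qed.

Variables (t0 : V) (r : R).
Hypotheses (r0 : 0 < r) (t0r : forall i, `|co i t0| + r <= rr).

Lemma box_shift s : `|s| < r -> box (t0 + s).
Proof.
move=> sr i; rewrite co_shift; apply: le_trans (ler_normD _ _) _.
by have := t0r i; have := lin_le i s; lra.
Qed.

(** The remainder is controlled after every number of terms, from [n = 0] on. This closes the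
    induction over [An]: a product with a coordinate uses the estimate for two consecutive [n], a
    series uses it term by term. *)
Definition expansion A f (N : R) (Ak : forall k, ('I_k -> V) -> C -> R) := [/\
  forall k v, cont A (Ak k v),
  forall k v x, A x -> `|Ak k v x| <= N / r ^+ k * \prod_(i < k) `|v i|,
  forall k (i : 'I_k) v (a : R) p q x, A x -> Ak k [eta v with i |-> a *: p + q] x =
    a * Ak k [eta v with i |-> p] x + Ak k [eta v with i |-> q] x &
  forall s x n, `|s| < r -> A x ->
    `|f (t0 + s) x - \sum_(k < n) Ak k (fun=> s) x| <= N * (`|s| / r) ^+ n / (1 - `|s| / r)].

Lemma expansion_cst A a (N : R) : 0 <= N -> cont A a -> (forall x, A x -> `|a x| <= N) ->
  exists Ak, expansion A (fun=> a) N Ak.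
Proof.
move=> N0 ca aN; exists (fun k v => if k == 0%N then a else fun=> 0); split.
- by move=> [|k] v //=; exact: cont_cst.
- move=> [|k] v x Ax /=; first by rewrite big_ord0 expr0 divr1 mulr1 aN.
  by rewrite normr0 mulr_ge0 ?prod_norm_ge0// divr_ge0// exprn_ge0// ltW.
- by move=> [[]//|k] i v b p q x _ /=; rewrite mulr0 addr0.
- move=> s x n sr Ax; have q1 : `|s| / r < 1 by rewrite ltr_pdivrMr// mul1r.
  have q0 : 0 <= `|s| / r by rewrite divr_ge0// ltW.
  have q2 : 0 < 1 - `|s| / r by rewrite subr_gt0.
  case: n => [|n].
    rewrite big_ord0 subr0 expr0 mulr1; apply: le_trans (aN x Ax) _.
    by rewrite ler_pdivlMr// -[leRHS]mulr1 ler_wpM2l// lerBlDr lerDl.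
  rewrite big_ord_recl big1//= addr0 subrr normr0.
  by rewrite divr_ge0 ?(ltW q2)// mulr_ge0// exprn_ge0.
Qed.

Lemma expansion_X A i f (N : R) Ak : 0 <= N -> expansion A f N Ak ->
  exists Bk, expansion A (fun t x => co i t * f t x) (rr * N) Bk.
Proof.
move=> N0 [h1 h2 h3 h4]; have rrE := t0r i; have rn := ltW r0.
(* The coordinate is [co i t0 + lin i s]. Its linear part takes the first argument of the new term
   of order [k.+1] and leaves the others to the old term of order [k]; since [|co i t0| + r <= rr],
   the bound grows by the factor [rr]. *)
exists (fun k => match k return ('I_k -> V) -> C -> R with
  | 0%N => fun v x => co i t0 * Ak 0%N v x
  | k.+1 => fun v x => co i t0 * Ak k.+1 v x + lin i (v ord0) * Ak k (fun l => v (lift ord0 l)) x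
  end); split.
- by move=> [|k] v; [exact: contZ|apply: contD; exact: contZ].
- move=> [|k] v x Ax.
    rewrite normrM -mulrA -mulrA; apply: ler_pM => //; last by have := h2 0%N v x Ax; rewrite -mulrA.
    by lra.
  apply: le_trans (ler_normD _ _) _; rewrite !normrM.
  set v' := fun l => v (lift ord0 l).
  have e1 := ler_wpM2l (normr_ge0 (co i t0)) (h2 k.+1 v x Ax).
  have e2 : `|lin i (v ord0)| * `|Ak k v' x| <= `|v ord0| * (N / r ^+ k * \prod_(j < k) `|v' j|).
    by apply: ler_pM => //; exact: h2.
  have e3 : `|v ord0| * (N / r ^+ k * \prod_(j < k) `|v' j|) = r * (N / r ^+ k.+1 * \prod_(j < k.+1) `|v j|).
    rewrite big_ord_recl exprS; have rk : r ^+ k != 0 by rewrite expf_neq0// gt_eqF.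
    by move: rk; rewrite /v'; move: (r ^+ k) => rk rk0; field; rewrite rk0 gt_eqF.
  have X0 : 0 <= N / r ^+ k.+1 * \prod_(j < k.+1) `|v j|.
    by rewrite mulr_ge0 ?prod_norm_ge0// divr_ge0// exprn_ge0.
  have := ler_wpM2r X0 rrE; rewrite e3 in e2; move: e1 e2; rewrite -!mulrA mulrDl.
  by clear; move: (_ * `|Ak k.+1 v x|) (_ * `|Ak k v' x|) => a b; lra.
- move=> [[]//|k] j v b p q x Ax.
  have gen (c X1 Y1 Z1 X2 Y2 Z2 : R) : X1 = b * Y1 + Z1 -> X2 = b * Y2 + Z2 ->
    c * X1 + X2 = b * (c * Y1 + Y2) + (c * Z1 + Z2) by move=> -> ->; ring.
  apply: gen; first exact: h3.
  case: (unliftP ord0 j) => [j'|] ->.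
    by rewrite !with_lift h3//= mulrDr mulrCA.
  by rewrite !with_lift0 /= lin_lin mulrDl mulrA.
- move=> s x n sr Ax; have q1 : `|s| / r < 1 by rewrite ltr_pdivrMr// mul1r.
  have q0 : 0 <= `|s| / r by rewrite divr_ge0.
  have q2 : 0 < 1 - `|s| / r by rewrite subr_gt0.
  have sE : `|s| = `|s| / r * r by rewrite divfK// gt_eqF.
  case: n => [|n].
    have := h4 s x 0%N sr Ax; rewrite !big_ord0 !subr0 normrM => h.
    by rewrite -!mulrA; apply: ler_pM => //; [exact: box_shift sr i|rewrite mulrA].
  rewrite big_ord_recl/= co_shift.
  have -> : \sum_(j < n) (co i t0 * Ak (lift ord0 j) (fun=> s) x + lin i s * Ak j (fun=> s) x) =
     co i t0 * \sum_(j < n) Ak (lift ord0 j) (fun=> s) x + lin i s * \sum_(j < n) Ak j (fun=> s) x.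
    by rewrite big_split/= !mulr_sumr.
  have e1 := h4 s x n.+1 sr Ax; rewrite big_ord_recl/= in e1.
  have e2 := h4 s x n sr Ax.
  set S1 := \sum_(j < n) Ak (lift ord0 j) _ x in e1 *; set S2 := \sum_(j < n) Ak j _ x in e2 *.
  have -> : (co i t0 + lin i s) * f (t0 + s) x - (co i t0 * Ak 0%N (fun=> s) x + (co i t0 * S1 + lin i s * S2)) =
    co i t0 * (f (t0 + s) x - (Ak 0%N (fun=> s) x + S1)) + lin i s * (f (t0 + s) x - S2) by ring.
  apply: le_trans (ler_normD _ _) _; rewrite !normrM.
  have e3 := ler_wpM2l (normr_ge0 (co i t0)) e1.
  have e4 := ler_pM (normr_ge0 _) (normr_ge0 _) (lin_le i s) e2.
  set q := `|s| / r in q0 q2 sE e3 e4 *.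
  have X0 : 0 <= N * q ^+ n.+1 / (1 - q) by rewrite divr_ge0 ?(ltW q2)// mulr_ge0// exprn_ge0.
  have e5 : `|s| * (N * q ^+ n / (1 - q)) = r * (N * q ^+ n.+1 / (1 - q)).
    by rewrite {1}sE exprS; ring.
  have := ler_wpM2r X0 rrE; rewrite e5 in e4; rewrite -!mulrA mulrDl.
  rewrite !mulrA in X0 e3 e4 *.
  by move: e3 e4; clear; move: `|_ - _| => *; lra.
Qed.

Lemma expansion_sum A (F : nat -> V -> C -> R) (N : nat -> R) f M : (forall n, 0 <= N n) ->
  (forall n, \sum_(i < n) N i <= M) ->
  (forall t x, box t -> A x -> Lim (fun n => \sum_(i < n) F i t x) (f t x)) ->
  (forall n, exists Ak, expansion A (F n) (N n) Ak) -> exists Ak, expansion A f M Ak.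
Proof.
move=> N0 NM hf /choice[B hB]; have rn := ltW r0.
pose c k (v : 'I_k -> V) := \prod_(i < k) `|v i| / r ^+ k.
have c0 k v : 0 <= c k v by rewrite divr_ge0 ?prod_norm_ge0// exprn_ge0.
have Bc k v x i : A x -> `|B i k v x| <= N i * c k v.
  move=> Ax; have [_ h _ _] := hB i; apply: le_trans (h k v x Ax) _.
  by rewrite /c mulrAC mulrA.
have Nc0 k v i : 0 <= N i * c k v by exact: mulr_ge0.
have NcM k v n : \sum_(i < n) N i * c k v <= M * c k v.
  by rewrite -mulr_suml ler_wpM2r.
pose Ak k v x := xget 0 [set l | Lim (fun n => \sum_(i < n) B i k v x) l].
have hA k v x : A x -> Lim (fun n => \sum_(i < n) B i k v x) (Ak k v x).
  move=> Ax; have [|l hl] := @Lim_exists R _ _ (Nc0 k v) (NcM k v) (fun i => B i k v x).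
    by move=> i; exact: Bc.
  by apply: (@xgetPex _ 0 [set l | Lim _ l]); exists l.
have le0 (s : nat -> R) l K : Lim s l -> (forall n, `|s n| <= K) -> `|l| <= K.
  move=> hl h; rewrite -[l]subr0; apply: Lim_le hl _; exists 0%N => n _.
  by rewrite subr0.
exists Ak; split.
- move=> k v; apply: cont_unif_lim => x Ax e e0; exists 1 => //.
  have [n hn] := sum_tail_small (Nc0 k v) (NcM k v) e0.
  exists (fun x => \sum_(i < n) B i k v x).
    by apply: (@cont_sum R A n (fun i => B i k v)) => i; have [] := hB i.
  move=> y Ay _; apply: (Lim_tail (a := fun i => B i k v y) _ (hA k v y Ay)) => [i|m nm].
    exact: Bc.
  exact: hn.
- move=> k v x Ax; have -> : M / r ^+ k * \prod_(i < k) `|v i| = M * c k v by rewrite /c; ring.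
  apply: le0 (hA k v x Ax) _ => n; apply: le_trans (ler_norm_sum _ _ _) _.
  by apply: le_trans (NcM k v n); apply: ler_sum => i _; exact: Bc.
- move=> k i v a p q x Ax; apply: Lim_uniq (hA _ _ _ Ax) _.
  apply: Lim_ext (LimD (LimZ a (hA _ _ _ Ax)) (hA _ _ _ Ax)) => n.
  rewrite mulr_sumr -big_split/=; apply: eq_bigr => j _.
  by have [_ _ h _] := hB j; rewrite h.
- move=> s x n sr Ax; have q1 : `|s| / r < 1 by rewrite ltr_pdivrMr// mul1r.
  have q0 : 0 <= `|s| / r by rewrite divr_ge0.
  have q2 : 0 < 1 - `|s| / r by rewrite subr_gt0.
  set q := `|s| / r in q0 q1 q2 *.
  have LS m : Lim (fun j => \sum_(i < j) \sum_(k < m) B i k (fun=> s) x) (\sum_(k < m) Ak k (fun=> s) x).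
    elim: m => [|m IH].
      move=> e e0; exists 0%N => j _; rewrite big_ord0 big1 ?subrr ?normr0 ?ltW// => i _.
      by rewrite big_ord0.
    rewrite big_ord_recr/=; apply: Lim_ext (LimD IH (hA m (fun=> s) x Ax)) => j.
    by rewrite -big_split/=; apply: eq_bigr => i _; rewrite big_ord_recr.
  have := LimD (hf _ x (box_shift sr) Ax) (LimZ (-1) (LS n)); rewrite mulN1r.
  move/le0; apply=> j; rewrite mulN1r -sumrB; apply: le_trans (ler_norm_sum _ _ _) _.
  apply: (@le_trans _ _ (\sum_(i < j) N i * (q ^+ n / (1 - q)))).
    by apply: ler_sum => i _; have [_ _ _ h] := hB i; rewrite mulrA; exact: h.
  rewrite -mulr_suml -mulrA ler_wpM2r//.
  by rewrite divr_ge0 ?(ltW q2)// exprn_ge0.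
Qed.

Lemma An_expansion A f N : An A f N -> exists Ak, expansion A f N Ak.
Proof.
elim=> {f N} [a N N0 ca aN|i f N hf [Ak hA]|F N f M hF IH NM hf].
- exact: expansion_cst.
- exact: expansion_X (An_ge0 rr0 hf) hA.
- by apply: expansion_sum NM hf IH => n; exact: An_ge0 (hF n).
Qed.

End Expansions.

(** * Analytic maps into normed spaces *)

Section AnalyticMap.
Variable R : realType.
Local Notation C := R[i].
Variables (V W : normedModType R) (I : Type) (lin : I -> V -> R) (off : I -> R) (rr : R).
Hypotheses (lin_lin : forall i (a : R) x y, lin i (a *: x + y) = a * lin i x + lin i y)
  (lin_le : forall i v, `|lin i v| <= `|v|) (rr0 : 0 <= rr).
Variables (A : set C) (L : (C -> R) -> W) (K : R).
Hypotheses (K0 : 0 <= K)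
  (L_lin : forall (a : R) f g, cont A f -> cont A g -> L (fun x => a * f x + g x) = a *: L f + L g)
  (L_bd : forall f (M : R), 0 <= M -> cont A f -> (forall x, A x -> `|f x| <= M) -> `|L f| <= K * M).

Lemma bounded_ext f g : cont A f -> (forall x, A x -> f x = g x) -> L f = L g.
Proof.
move=> cf fg; have cg : cont A g by apply: cont_eq cf.
apply/eqP; rewrite eq_sym -subr_eq0 -normr_le0 addrC -scaleN1r -L_lin//.
apply: (@le_trans _ _ (K * 0)); last by rewrite mulr0.
apply: L_bd => //; first by apply: contD => //; exact: contZ.
by move=> y Ay; rewrite fg// mulN1r addNr normr0.
Qed.

Lemma bounded0 : L (fun=> 0) = 0.
Proof.
apply/eqP; rewrite -normr_le0; apply: (@le_trans _ _ (K * 0)); last by rewrite mulr0.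
by apply: L_bd => //; [exact: cont_cst|move=> *; rewrite normr0].
Qed.

Lemma bounded_sum n (F : nat -> C -> R) : (forall i, cont A (F i)) ->
  L (fun x => \sum_(i < n) F i x) = \sum_(i < n) L (F i).
Proof.
move=> cF; elim: n => [|n IH].
  rewrite big_ord0 -bounded0; apply: bounded_ext => [|x _]; last by rewrite big_ord0.
  exact: (cont_sum _ cF).
rewrite big_ord_recr/= -IH addrC -[L (F n)]scale1r -L_lin//; last exact: (cont_sum _ cF).
apply: bounded_ext => [|x _]; first exact: (cont_sum _ cF).
by rewrite big_ord_recr/= addrC mul1r.
Qed.

(** The sum of the series is known in advance to be [L (f t)], so convergence in [W] follows by
    sending the uniform remainder bound through [L]; no limit has to be constructed there. *)
Theorem An_analytic (f : V -> C -> R) N (D : set V) (t0 : V) (r : R) : 0 < r ->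
  (forall i, `|co lin off i t0| + r <= rr) -> An lin off rr A f N ->
  analytic_at_within D (fun t => L (f t)) t0.
Proof.
move=> r0 t0r hf; have [Ak [h1 h2 h3 h4]] := An_expansion lin_lin lin_le rr0 r0 t0r hf.
have N0 := An_ge0 rr0 hf.
(* On half the radius the majorant series is geometric with ratio [1 / 2]. *)
exists (fun k v => L (Ak k v)), (fun k => K * N / r ^+ k), (r / 2); split.
- by rewrite divr_gt0.
- move=> k i v a x y; rewrite -L_lin//; apply: bounded_ext => // p Ap; exact: h3.
- move=> k v; rewrite -mulrA -mulrA; apply: L_bd => //.
    by rewrite mulr_ge0// mulr_ge0 ?prod_norm_ge0// invr_ge0 exprn_ge0// ltW.
  by move=> x Ax; rewrite mulrA; exact: h2.
- have -> : (fun k => K * N / r ^+ k * (r / 2) ^+ k) = geometric (K * N) (1 / 2).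
    apply/funext => k; rewrite /geometric/= !expr_div_n expr1n.
    have rk : r ^+ k != 0 by rewrite expf_neq0// gt_eqF.
    by have k2 : (2 : R) ^+ k != 0 by []; field; rewrite rk k2.
  by apply: is_cvg_geometric_series; rewrite ger0_norm; lra.
- move=> t _ tr; pose s := t - t0; have sr : `|s| < r / 2 by [].
  have tE : t = t0 + s by rewrite /s addrC subrK.
  have sr' : `|s| < r by lra.
  have q0 : 0 <= `|s| / r by rewrite divr_ge0// ltW.
  have q1 : `|s| / r <= 1 / 2 by rewrite ler_pdivrMr//; lra.
  have bt : box lin off rr (t0 + s) by exact: box_shift sr'.
  apply/cvgrPdist_le => e e0.
  have c0 : 0 < K * (2 * N) + 1 by rewrite ltr_wpDl// mulr_ge0// mulr_ge0.
  have [n hn] := small_exp q0 q1 (divr_gt0 e0 c0).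
  exists n => // m /= nm; rewrite /series/= big_mkord -/s.
  rewrite -(@bounded_sum m (fun k => Ak k (fun=> s)) (fun k => h1 k _)).
  have cs : cont A (fun x => \sum_(k < m) Ak k (fun=> s) x) by apply: (@cont_sum R A m (fun k => Ak k (fun=> s))).
  have ct : cont A (f t) by rewrite tE; exact: An_cont hf bt.
  rewrite distrC [_ - L _]addrC -scaleN1r -L_lin//.
  have qm : (`|s| / r) ^+ m <= e / (K * (2 * N) + 1).
    by apply: le_trans hn; rewrite ler_wiXn2l//; lra.
  apply: (@le_trans _ _ (K * (2 * N * (e / (K * (2 * N) + 1))))).
    apply: L_bd.
    - by rewrite !mulr_ge0 ?invr_ge0 ?(ltW e0) ?(ltW c0).
    - by apply: contD => //; exact: contZ.
    move=> x Ax; rewrite mulN1r addrC distrC tE; apply: le_trans (h4 s x m sr' Ax) _.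
    have q2 : 0 < 1 - `|s| / r by lra.
    rewrite ler_pdivrMr//; apply: le_trans (ler_wpM2l N0 qm) _.
    move: (e / _) (divr_ge0 (ltW e0) (ltW c0)) => E E0.
    have -> : 2 * N * E * (1 - `|s| / r) = N * E * (2 * (1 - `|s| / r)) by ring.
    by rewrite -[leLHS]mulr1 ler_wpM2l ?mulr_ge0//; lra.
  have -> : K * (2 * N * (e / (K * (2 * N) + 1))) = e * (K * (2 * N) / (K * (2 * N) + 1)) by ring.
  rewrite -[leRHS]mulr1 ler_wpM2l ?(ltW e0)// ler_pdivrMr// mul1r lerDl.
  done.
Qed.
End AnalyticMap.

(** * Operators depending analytically on parameters *)

Section DiscExtension.
Variable R : realType.
Local Notation C := R[i].
Local Notation Re := (@complex.Re R).
Local Notation Im := (@complex.Im R).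
Implicit Types (A B : set C) (f g v : C -> R) (x z : C).

Definition circ : set C := [set z | cabs z = 1].

(** The Poisson extension of [f] to the closed disc, chosen as the function supplied by
    [disc_dirichlet]. *)
Definition dv f : C -> R := xget (fun=> 0) [set v | apx v /\ forall z, cabs z = 1 -> v z = f z].

Lemma dvP f : cont circ f -> apx (dv f) /\ forall z, cabs z = 1 -> dv f z = f z.
Proof.
move=> cf; apply: (@xgetPex _ (fun=> 0) [set v | apx v /\ forall z, cabs z = 1 -> v z = f z]).
have [|u [u1 u2 u3]] := @disc_dirichlet R f 0 1 ltr01.
  by apply: cont_sub cf => z /=; rewrite subr0.
exists u; split; last by move=> z z1; apply: u3; rewrite subr0.
by apply: apx_eq u1 => z _; rewrite /dil add0r mul1r.
Qed.

Lemma apx_max v (M : R) z : apx v -> (forall z, cabs z = 1 -> `|v z| <= M) -> cabs z <= 1 ->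
  `|v z| <= M.
Proof.
move=> av vM z1; apply: le_eps => e e0; have e2 : 0 < e / 2 by rewrite divr_gt0.
have [P hP] := av _ e2.
have : `|Re P.[z]| <= M + e / 2.
  apply: poly_max_disc z1 => w w1; have := hP w; rewrite w1 => /(_ (lexx _)).
  by have := vM w w1; rewrite !ler_norml; lra.
by have := hP z z1; rewrite !ler_norml; lra.
Qed.

Lemma apx_eq_circ u v z : apx u -> apx v -> (forall z, cabs z = 1 -> u z = v z) -> cabs z <= 1 ->
  u z = v z.
Proof.
move=> au av uv z1; apply/eqP; rewrite -subr_eq0 -normr_le0.
apply: (@apx_max (fun z => u z + - v z) 0) => //; first by apply: apxD => //; exact: apxN.
by move=> w w1; rewrite uv// subrr normr0.
Qed.

Lemma apxZ (a : R) v : apx v -> apx (fun z => a * v z).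
Proof.
move=> av e e0; have a0 : 0 < `|a| + 1 by rewrite ltr_wpDl.
have [P hP] := av _ (divr_gt0 e0 a0); exists (a%:C *: P) => z /hP.
rewrite hornerZ ReZ -mulrBr normrM ler_pdivlMr// => h; apply: le_trans h; rewrite mulrC.
by rewrite ler_wpM2l// lerDl.
Qed.

Lemma dv_lin (a : R) f g z : cont circ f -> cont circ g -> cabs z <= 1 ->
  dv (fun y => a * f y + g y) z = a * dv f z + dv g z.
Proof.
move=> cf cg; have [af df] := dvP cf; have [ag dg] := dvP cg.
have [ah dh] := dvP (contD (contZ a cf) cg).
apply: (apx_eq_circ (v := fun z => a * dv f z + dv g z)) => //; first by apply: apxD => //; exact: apxZ.
by move=> w w1; rewrite dh// df// dg.
Qed.

Lemma dv_bd f (M : R) z : cont circ f -> (forall x, circ x -> `|f x| <= M) -> cabs z <= 1 ->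
  `|dv f z| <= M.
Proof.
move=> cf fM; have [af df] := dvP cf; apply: apx_max => // w w1.
by rewrite df//; exact: fM.
Qed.

Lemma dv_apx v z : apx v -> cabs z <= 1 -> dv v z = v z.
Proof.
move=> av; have cv : cont circ v.
  by apply: cont_sub (apx_cont av) => w w1; rewrite /cball/= subr0 w1.
by have [ad dd] := dvP cv; exact: apx_eq_circ.
Qed.

Lemma coef_dv_lin (a : R) f g k : cont circ f -> cont circ g ->
  coef (dv (fun y => a * f y + g y)) k = a%:C * coef (dv f) k + coef (dv g) k.
Proof.
move=> cf cg; have [af df] := dvP cf; have [ag dg] := dvP cg.
rewrite -coefZ// -coefD//; last exact: apxZ.
by apply: coef_eq => z z1; rewrite dv_lin// z1.
Qed.

Lemma coef_dv_bd f (M : R) k : cont circ f -> (forall x, circ x -> `|f x| <= M) ->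
  cabs (coef (dv f) k) <= M.
Proof.
move=> cf fM; have [af df] := dvP cf; apply: coef_bound => // z z1.
by rewrite df//; exact: fM.
Qed.

Lemma Op_dv0 A : Op circ A (fun f _ => dv f 0) 1.
Proof.
split=> //.
- by move=> f _; exact: cont_cst.
- by move=> a f g cf cg x _; rewrite dv_lin// cabs0.
- by move=> f M M0 cf fM x _; rewrite mul1r; apply: dv_bd => //; rewrite cabs0.
Qed.

Lemma Op_Re_coef A k : Op circ A (fun f _ => Re (coef (dv f) k)) 1.
Proof.
split=> //.
- by move=> f _; exact: cont_cst.
- by move=> a f g cf cg x _; rewrite coef_dv_lin// ReD ReZ.
- by move=> f M M0 cf fM x _; rewrite mul1r (le_trans (Re_le _))// coef_dv_bd.
Qed.

Lemma Op_Im_coef A k : Op circ A (fun f _ => Im (coef (dv f) k)) 1.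
Proof.
split=> //.
- by move=> f _; exact: cont_cst.
- by move=> a f g cf cg x _; rewrite coef_dv_lin// ImD ImZ.
- by move=> f M M0 cf fM x _; rewrite mul1r (le_trans (Im_le _))// coef_dv_bd.
Qed.
End DiscExtension.

(** * Disc extensions composed with analytic arguments *)

Section Composition.
Variable R : realType.
Local Notation C := R[i].
Local Notation Re := (@complex.Re R).
Local Notation Im := (@complex.Im R).
Variables (V : normedModType R) (I : Type) (lin : I -> V -> R) (off : I -> R) (rr : R).
Hypothesis rr0 : 0 <= rr.
Implicit Types (A B : set C) (f g : V -> C -> R) (z w : V -> C -> C) (t : V) (x : C).
Local Notation co := (co lin off).
Local Notation box := (box lin off rr).
Local Notation An := (An lin off rr).

Definition AnC A z (q : R) := exists a b, [/\ An A (fun t x => Re (z t x)) a,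
  An A (fun t x => Im (z t x)) b & a + b <= q].

Lemma AnC_ext A z w p q : AnC A z p -> (forall t x, box t -> A x -> z t x = w t x) -> p <= q ->
  AnC A w q.
Proof.
move=> [a [b [ha hb ab]]] zw pq; exists a, b; split; last exact: le_trans ab pq.
  by apply: (An_ext rr0 ha) => // t x bt Ax; rewrite zw.
by apply: (An_ext rr0 hb) => // t x bt Ax; rewrite zw.
Qed.

Lemma AnC_le A z q t x : AnC A z q -> box t -> A x -> cabs (z t x) <= q.
Proof.
move=> [a [b [ha hb ab]]] bt Ax; apply: le_trans ab; apply: le_trans (cabs_le _) _.
by apply: lerD; [exact: (An_le rr0 ha)|exact: (An_le rr0 hb)].
Qed.

Lemma AnC_ge0 A z q : AnC A z q -> 0 <= q.
Proof.
by move=> [a [b [/(An_ge0 rr0) ha /(An_ge0 rr0) hb ab]]]; exact: le_trans (addr_ge0 ha hb) ab.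
Qed.

Lemma AnC_mul A z w p q : AnC A z p -> AnC A w q -> AnC A (fun t x => z t x * w t x) (p * q).
Proof.
move=> hz hw; have p0 := AnC_ge0 hz; have q0 := AnC_ge0 hw.
case: hz hw => [a [b [ha hb ab]]] [c [d [hc hd cd]]].
have := An_ge0 rr0 ha; have := An_ge0 rr0 hb; have := An_ge0 rr0 hc; have := An_ge0 rr0 hd.
move=> d0 c0 b0 a0.
exists (a * c + b * d), (b * c + a * d); split.
- apply: (An_ext rr0 (An_add rr0 (An_mul rr0 ha hc) (An_opp rr0 (An_mul rr0 hb hd)))) => // t x _ _.
  by rewrite ReM.
- apply: (An_ext rr0 (An_add rr0 (An_mul rr0 hb hc) (An_mul rr0 ha hd))) => // t x _ _.
  by rewrite ImM addrC [X in X + _]mulrC [RHS]addrC [X in _ = X + _]mulrC; ring.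
- apply: (@le_trans _ _ ((a + b) * (c + d))); first by rewrite le_eqVlt; apply/orP; left; apply/eqP; ring.
  by apply: ler_pM => //; exact: addr_ge0.
Qed.

Lemma AnC_cst A (c : C -> C) (M : R) : cont A (fun x => Re (c x)) -> cont A (fun x => Im (c x)) ->
  0 <= M -> (forall x, A x -> cabs (c x) <= M) -> AnC A (fun=> c) (2 * M).
Proof.
move=> c1 c2 M0 cM; exists M, M; split; last by rewrite mulr2n mulrDl mul1r.
  by apply: An_cst => // x Ax; exact: le_trans (Re_le _) (cM x Ax).
by apply: An_cst => // x Ax; exact: le_trans (Im_le _) (cM x Ax).
Qed.

Lemma AnC_X A i z q : AnC A z q -> AnC A (fun t x => (co i t)%:C * z t x) (rr * q).
Proof.
move=> [a [b [ha hb ab]]]; exists (rr * a), (rr * b); split.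
- by apply: (An_ext rr0 (An_X i ha)) => // t x _ _; rewrite ReZ.
- by apply: (An_ext rr0 (An_X i hb)) => // t x _ _; rewrite ImZ.
- by rewrite -mulrDr ler_wpM2l.
Qed.

Lemma AnC_exp A z q n : AnC A z q -> AnC A (fun t x => z t x ^+ n.+1) (q ^+ n.+1).
Proof.
move=> hz; elim: n => [|n IH]; first by apply: AnC_ext hz _ _ => [t x _ _|]; rewrite expr1.
by rewrite exprS; apply: AnC_ext (AnC_mul hz IH) _ _ => // t x _ _; rewrite [RHS]exprS.
Qed.

Lemma half_pow_small (q M e : R) : 0 <= q -> q <= 1 / 2 -> 0 <= M -> 0 < e ->
  exists n0, forall n, (n0 <= n)%N -> M * q ^+ n <= e.
Proof.
move=> q0 q1 M0 e0; have M1 : 0 < M + 1 by rewrite ltr_wpDl.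
have [n0 hn] := small_exp q0 q1 (divr_gt0 e0 M1); exists n0 => n nn.
have h : q ^+ n <= e / (M + 1) by apply: le_trans hn; rewrite ler_wiXn2l//; lra.
move: h; rewrite ler_pdivlMr// mulrDr mulr1 mulrC => h.
by apply: le_trans h; rewrite lerDl exprn_ge0.
Qed.

Lemma AnC_geom A z q : q <= 1 / 2 -> AnC A z q -> AnC A (fun t x => (1 - z t x)^-1) 6.
Proof.
move=> q1 hz; have q0 := AnC_ge0 hz; have ql : q < 1 by lra.
have hn n : exists a b, [/\ An A (fun t x => Re (z t x ^+ n.+1)) a,
  An A (fun t x => Im (z t x ^+ n.+1)) b, a <= q * q ^+ n & b <= q * q ^+ n].
  have [a [b [ha hb ab]]] := AnC_exp n hz; exists a, b.
  have := An_ge0 rr0 ha; have := An_ge0 rr0 hb; rewrite -exprS; split=> //; lra.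
have s1 : An A (fun _ _ => 1) 1.
  by apply: An_cst => //; [exact: cont_cst|move=> x _; rewrite normr1].
have rem t x n : box t -> A x ->
    cabs ((1 - z t x)^-1 - 1 - \sum_(i < n) z t x ^+ i.+1) <= 2 * q ^+ n.
  move=> bt Ax; have zq := AnC_le hz bt Ax.
  have d1 : 1 / 2 <= cabs (1 - z t x).
    by have := cabs_leD 1 (z t x); rewrite cabs1; lra.
  have d0 : 1 - z t x != 0 by rewrite -cabs_gt0; lra.
  have -> : (1 - z t x)^-1 - 1 - \sum_(i < n) z t x ^+ i.+1 = z t x ^+ n.+1 / (1 - z t x).
    elim: n => [|n IH]; first by rewrite big_ord0 subr0 expr1; field.
    by rewrite big_ord_recr/= opprD addrA IH (exprS _ n.+1); field.
  rewrite cabsM cabsV cabsX ler_pdivrMr; last by lra.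
  rewrite exprS; apply: (@le_trans _ _ (q * q ^+ n)).
    by apply: ler_pM; rewrite ?exprn_ge0 ?cabs_ge0// lerXn2r ?nnegrE ?cabs_ge0.
  rewrite mulrAC ler_wpM2r ?exprn_ge0//; lra.
have part (P : C -> R) (h : forall n, An A (fun t x => P (z t x ^+ n.+1)) (q * q ^+ n))
    (PD : forall a b, P (a - b) = P a - P b) (Ps : forall n (F : nat -> C), P (\sum_(i < n) F i) = \sum_(i < n) P (F i))
    (Ple : forall a, `|P a| <= cabs a) : An A (fun t x => P ((1 - z t x)^-1 - 1)) 2.
  have [f [hf lf]] := An_geo rr0 q0 ql q0 h.
  apply: (An_ext rr0 hf) => [t x bt Ax|].
    apply: Lim_uniq (lf t x bt Ax) _ => e e0.
    have [n0 hn0] := half_pow_small q0 q1 (ler0n R 2) e0; exists n0 => n nn.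
    rewrite distrC -(Ps n (fun i => z t x ^+ i.+1)) -PD; apply: le_trans (Ple _) _.
    exact: le_trans (rem t x n bt Ax) (hn0 n nn).
  by rewrite ler_pdivrMr; lra.
have hRe := part Re; have hIm := part Im.
exists (2 + 1), 2; split.
- apply: (An_ext rr0 (An_add rr0 (hRe _ _ _ _) s1)) => //.
  + by move=> n; have [a [b [ha _ aq _]]] := hn n; exact: (An_ext rr0 ha).
  + exact: ReB.
  + by move=> n F; exact: Re_sum.
  + exact: Re_le.
  + by move=> t x _ _; rewrite ReB /= subrK.
- apply: (An_ext rr0 (hIm _ _ _ _)) => //.
  + by move=> n; have [a [b [_ hb _ bq]]] := hn n; exact: (An_ext rr0 hb).
  + exact: ImB.
  + by move=> n F; exact: Im_sum.
  + exact: Im_le.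
  + by move=> t x _ _; rewrite ImB /= subr0.
- lra.
Qed.

(** The Fourier coefficients of [dv (G t)] are bounded linear in [G t], hence analytic in [t], and
    [q <= 1 / 2] makes the powers of [z] summable. Subtracting the value at the centre removes the
    constant term and leaves the factor [q], a source of smallness in the equation. *)
Lemma An_comp A (G : V -> C -> R) z (N q : R) : q <= 1 / 2 -> An (@circ R) G N -> AnC A z q ->
  An A (fun t x => dv (G t) (z t x) - dv (G t) 0) (4 * N * q).
Proof.
move=> q1 hG hz; have q0 := AnC_ge0 hz; have ql : q < 1 by lra.
have N0 := An_ge0 rr0 hG.
pose F k t x := 2 * Re (coef (dv (G t)) k.+1 * z t x ^+ k.+1).
have hF k : An A (F k) (2 * N * q * q ^+ k).
  have [a [b [ha hb ab]]] := AnC_exp k hz.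
  have h1 := An_op rr0 (Op_Re_coef A k.+1) hG; have h2 := An_op rr0 (Op_Im_coef A k.+1) hG.
  have h3 := An_add rr0 (An_mul rr0 h1 ha) (An_opp rr0 (An_mul rr0 h2 hb)).
  apply: (An_ext rr0 (An_scale rr0 2 h3)) => [t x _ _|]; first by rewrite /F ReM.
  rewrite ger0_norm// !mul1r -mulrDr -!mulrA ler_wpM2l// ler_wpM2l// -exprS.
  done.
have [f [hf lf]] := An_geo rr0 q0 ql (mulr_ge0 (mulr_ge0 (ler0n R 2) N0) q0) hF.
apply: (An_ext rr0 hf) => [t x bt Ax|]; last first.
  rewrite ler_pdivrMr; last lra.
  have X0 : 0 <= N * q by exact: mulr_ge0.
  have -> : 4 * N * q * (1 - q) = N * q * (4 * (1 - q)) by ring.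
  have -> : 2 * N * q = N * q * 2 by ring.
  by rewrite ler_wpM2l//; lra.
apply: Lim_uniq (lf t x bt Ax) _ => e e0.
have cG : cont (@circ R) (G t) by exact: (An_cont rr0 hG).
have [aG dG] := dvP cG; have zq := AnC_le hz bt Ax.
have z1 : cabs (z t x) < 1 by lra.
have [n0 hn0] := half_pow_small q0 q1 (mulr_ge0 (ler0n R 4) N0) e0; exists n0 => n nn.
have := @apx_exp R (dv (G t)) n.+1 (z t x) N aG _ z1.
have cb k : cabs (coef (dv (G t)) k) <= N.
  by apply: coef_dv_bd => // y cy; exact: (An_le rr0 hG).
move=> /(_ (fun k _ => cb k)).
have -> : hp n.+1 (coef (dv (G t))) (z t x) = dv (G t) 0 + \sum_(i < n) F i t x.
  rewrite /hp big_ord_recl ReD (coef0E aG) /= /wt /= expr0 mulr1 mul1r Re_sum.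
  by congr (_ + _); apply: eq_bigr => i _; rewrite /F -Re2 mulrA.
rewrite opprD addrA distrC => h; apply: le_trans h _; apply: le_trans (hn0 n nn).
rewrite ler_pdivrMr; last by lra.
have zn : cabs (z t x) ^+ n.+1 <= q ^+ n.
  rewrite exprS; apply: (@le_trans _ _ (1 * q ^+ n)); last by rewrite mul1r.
  by apply: ler_pM; rewrite ?exprn_ge0 ?cabs_ge0 ?(ltW z1)// lerXn2r ?nnegrE ?cabs_ge0.
apply: (@le_trans _ _ (2 * N * q ^+ n)); first by rewrite ler_wpM2l// mulr_ge0.
have X0 : 0 <= N * q ^+ n by rewrite mulr_ge0// exprn_ge0.
have -> : 4 * N * q ^+ n * (1 - cabs (z t x)) = N * q ^+ n * (4 * (1 - cabs (z t x))) by ring.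
have -> : 2 * N * q ^+ n = N * q ^+ n * 2 by ring.
by rewrite ler_wpM2l//; lra.
Qed.

Lemma An_comp_fix A (v : C -> R) z (M q : R) : q <= 1 / 2 -> apx v -> 0 <= M ->
  (forall x, cabs x = 1 -> `|v x| <= M) -> AnC A z q ->
  An A (fun t x => v (z t x) - v 0) (4 * M * q).
Proof.
move=> q1 av M0 vM hz; have cv : cont (@circ R) v.
  by apply: cont_sub (apx_cont av) => w w1; rewrite /cball/= subr0 w1.
apply: (An_ext rr0 (An_comp q1 (An_cst _ _ _ M0 cv vM) hz)) => // t x bt Ax.
by rewrite !dv_apx ?cabs0//; have := AnC_le hz bt Ax; lra.
Qed.
End Composition.

(** * Dirichlet operators and odd reflection *)

Section Operators.
Variable R : realType.
Local Notation C := R[i].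
Local Notation Re := (@complex.Re R).
Local Notation Im := (@complex.Im R).
Implicit Types (A B D : set C) (f g u v w : C -> R) (x y z : C).

Definition good D := [/\ opn D, bnd D & forall x, bd D x -> sector D x].

Definition dir D f : C -> R := xget (fun=> 0) [set u | [/\ cont (clos D) u,
  forall x, D x -> harm u x & forall x, bd D x -> u x = f x]].

Lemma dirP D f : good D -> cont (bd D) f -> [/\ cont (clos D) (dir D f),
  forall x, D x -> harm (dir D f) x & forall x, bd D x -> dir D f x = f x].
Proof.
move=> [oD bD sD] cf; apply: (@xgetPex _ (fun=> 0) [set u | [/\ cont (clos D) u,
  forall x, D x -> harm u x & forall x, bd D x -> u x = f x]]).
exact: dirichlet_exists.
Qed.

Lemma dir_uniq D f u : good D -> cont (bd D) f -> cont (clos D) u -> (forall x, D x -> harm u x) ->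
  (forall x, bd D x -> u x = f x) -> forall x, clos D x -> dir D f x = u x.
Proof.
move=> gD cf cu hu uf; have [c h e] := dirP gD cf; have [oD bD _] := gD.
by apply: (harm_uniq oD bD) => // x bx; rewrite e// uf.
Qed.

Lemma Op_dir D : good D -> Op (bd D) (clos D) (dir D) 1.
Proof.
move=> gD; have [oD bD _] := gD; split=> //.
- by move=> f cf; have [] := dirP gD cf.
- move=> a f g cf cg x cx; have [c1 h1 e1] := dirP gD cf; have [c2 h2 e2] := dirP gD cg.
  apply: (dir_uniq (u := fun y => a * dir D f y + dir D g y)) => //; first by apply: contD => //; exact: contZ.
  + by apply: contD => //; exact: contZ.
  + by move=> y Dy; apply: harmD; [apply: harmZ; exact: h1|exact: h2].
  + by move=> y by_; rewrite e1// e2.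
- move=> f M M0 cf fM x cx; have [c h e] := dirP gD cf; rewrite mul1r.
  by apply: (max_principle_abs oD bD c h) cx => y by_; rewrite e//; exact: fM.
Qed.

Lemma Op_comp A B E L L' (K K' : R) : Op A B L K -> Op B E L' K' ->
  Op A E (fun f => L' (L f)) (K' * K).
Proof.
move=> H H'; have K0 := Op_ge0 H; have K'0 := Op_ge0 H'; split.
- exact: mulr_ge0.
- by move=> f /(Op_cont H)/(Op_cont H').
- move=> a f g cf cg x Ex; have c1 := Op_cont H cf; have c2 := Op_cont H cg.
  rewrite -(Op_lin H')//; apply: (Op_ext H') => //; first by apply: (Op_cont H); apply: contD => //; exact: contZ.
  by move=> y By; exact: (Op_lin H).
- move=> f M M0 cf fM x Ex; rewrite -mulrA; apply: (Op_bd H') => //; first exact: mulr_ge0.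
    exact: (Op_cont H).
  by move=> y By; exact: (Op_bd H).
Qed.

(** Second differences do not pass to uniform limits by themselves; approximability on discs
    does. *)
Lemma harm_unif_lim D f : opn D -> (forall e : R, 0 < e -> exists g, [/\ cont D g,
  forall x, D x -> harm g x & forall x, D x -> `|f x - g x| <= e]) -> forall x, D x -> harm f x.
Proof.
move=> oD hf x Dx; have [r r0 hr] := oD x Dx.
have r20 : 0 < r / 2 by rewrite divr_gt0.
have sub : cball x (r / 2) `<=` D by move=> y; rewrite /cball/= => yx; apply: hr; lra.
apply: (@apx_harm R f x (r / 2) x r20); last by rewrite /oball/= subrr cabs0.
apply: apx_lim => e e0; have [g [cg hg fg]] := hf e e0.
exists (dil x (r / 2) g); first exact: (harm_cont oD cg hg).
move=> z z1; apply: fg; apply: sub; rewrite /cball/= cabs_dil ?(ltW r20)//.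
by rewrite -[leRHS]mulr1 ler_wpM2l// ltW.
Qed.

Lemma taylor3_comp_poly (th : C -> C) (P : {poly C}) a : taylor3 th a -> taylor3 (fun y => P.[th y]) a.
Proof.
move=> ta; elim/poly_ind: P => [|P c IH].
  have -> : (fun y => (0 : {poly C}).[th y]) = fun=> 0 by apply/funext => y; rewrite horner0.
  exact: taylor3_cst.
have -> : (fun y => (P * 'X + c%:P).[th y]) = fun y => P.[th y] * th y + c.
  by apply/funext => y; rewrite hornerMXaddC.
by apply: taylor3D; [exact: taylor3M|exact: taylor3_cst].
Qed.

Lemma comp_cont B v (th : C -> C) : apx v -> (forall y, B y -> cabs (th y) <= 1 /\ taylor3 th y) ->
  cont B (fun y => v (th y)).
Proof.
move=> av hth; apply: cont_unif_lim => x Bx e e0; exists 1 => //.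
have [P hP] := av e e0; exists (fun y => Re P.[th y]).
  by apply: (@taylor3_cont R (fun y => P.[th y])) => a /hth[_ ta]; exact: taylor3_comp_poly.
by move=> y /hth[h _] _; exact: hP.
Qed.

Lemma comp_harm D v (th : C -> C) : opn D -> apx v ->
  (forall y, D y -> cabs (th y) <= 1 /\ taylor3 th y) -> forall x, D x -> harm (fun y => v (th y)) x.
Proof.
move=> oD av hth; apply: harm_unif_lim => // e e0.
have [P hP] := av e e0; exists (fun y => Re P.[th y]); split.
- by apply: (@taylor3_cont R (fun y => P.[th y])) => a /hth[_ ta]; exact: taylor3_comp_poly.
- by move=> x /hth[_ ta]; apply: (@taylor3_harm R (fun y => P.[th y])); exact: taylor3_comp_poly.
- by move=> x /hth[h _]; exact: hP.
Qed.

Lemma apxJ v : apx v -> apx (fun z => v z^*).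
Proof.
move=> av e e0; have [P hP] := av e e0; exists (map_poly (@conjc R) P) => z z1.
have := hP z^*; rewrite cabsJ => /(_ z1).
have -> : Re (map_poly (@conjc R) P).[z] = Re P.[z^*]; last by [].
by rewrite -{1}(conjcK z) horner_map ReJ.
Qed.

Lemma apx_rot v (a : C) : cabs a <= 1 -> apx v -> apx (fun z => v (a * z)).
Proof.
move=> a1 av e e0; have [P hP] := av e e0; exists (P \Po (a%:P * 'X)) => z z1.
rewrite horner_comp hornerM hornerC hornerX; apply: hP.
by rewrite cabsM mulr_ile1 ?cabs_ge0.
Qed.

Definition refl (r : R) w z : R := if 0 <= Im z then w (r%:C * z) else - w (r%:C * z^*).

(** A turn by ['i] puts the flat side on the imaginary axis. With zero data there [half_disc_approx]
    supplies odd polynomials, and oddness carries the approximation to the other half. *)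
Lemma refl_apx (r : R) w : 0 < r -> cont [set x | cabs x <= r /\ 0 <= Im x] w ->
  (forall x, cabs x < r -> 0 < Im x -> harm w x) ->
  (forall x, cabs x <= r -> Im x = 0 -> w x = 0) -> apx (refl r w).
Proof.
move=> r0 cw hw w0; pose V z := w ((r%:C * 'i) * z).
have cr z : cabs (r%:C * z) = r * cabs z by rewrite cabsZ gtr0_norm.
have ci z : cabs ('i * z) = cabs z by rewrite cabsM cabs_i mul1r.
have cri z : cabs (r%:C * 'i * z) = r * cabs z by rewrite -mulrA cr ci.
have Imi z : Im ('i * z) = Re z by rewrite ImM /=; ring.
have Imri z : Im (r%:C * 'i * z) = r * Re z by rewrite -mulrA ImZ Imi.
have le1 z : cabs z <= 1 -> r * cabs z <= r by move=> z1; rewrite -[leRHS]mulr1 ler_wpM2l// ltW.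
have cV : cont (@half_disc R) V.
  move=> z [z1 z2] e e0.
  have [|d d0 hd] := cw (r%:C * 'i * z) _ e e0.
    by rewrite /= cri Imri le1// mulr_ge0// ltW.
  exists (d / r); first by rewrite divr_gt0.
  move=> y [y1 y2] yz; apply: hd; first by rewrite /= cri Imri le1// mulr_ge0// ltW.
  by rewrite -mulrBr cri mulrC -ltr_pdivlMr.
have ri0 : r%:C * 'i != 0 :> C by rewrite -cabs_gt0 -[_ * 'i]mulr1 cri cabs1 mulr1.
have hV z : cabs z < 1 -> 0 < Re z -> harm V z.
  move=> z1 z2; pose D : set C := [set x | cabs x < r /\ 0 < Im x].
  have oD : opn D.
    move=> x [x1 x2]; exists (Num.min (r - cabs x) (Im x)); first by rewrite lt_min subr_gt0 x1.
    move=> y; rewrite lt_min => /andP[h1 h2]; split.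
      by have := cabs_leD y x; lra.
    by have := Im_le (y - x); rewrite ImB ler_norml; lra.
  have := @harm_affine R D w 0 (r%:C * 'i) z oD; rewrite add0r.
  have -> : (fun y => w (0 + r%:C * 'i * y)) = V by apply/funext => y; rewrite add0r.
  apply=> //.
  - by apply: cont_sub cw => x [/ltW ? /ltW ?].
  - by move=> x []; exact: hw.
  - by split; [rewrite cri -[ltRHS]mulr1 ltr_pM2l|rewrite Imri mulr_gt0].
have [m m0 hm] : exists2 m : R, 0 <= m & forall z, half_disc z -> `|V z| <= m.
  apply: cont_bounded => //.
  - by exists 1 => z [].
  - move=> z cz; split.
      have : clos (cball 0 1) z by apply: clos_mono cz => y [y1 _]; exact: cabs1_cball.
      by move/clos_cball; rewrite /cball/= subr0.
    rewrite leNgt; apply/negP => zn; have [y [_ yr] yz] := cz (- Re z) ltac:(by rewrite oppr_gt0).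
    by have := Re_le (y - z); rewrite ReB ler_norml; lra.
apply: apx_lim => e e0.
have [|N [c [fc hc1 hc2]]] := @half_disc_approx R V m 0 e (lexx _) e0 cV hV hm.
  by move=> z z1 z2; rewrite /V w0 ?normr0// ?cri ?le1// Imri z2 mulr0.
exists (fun z => hp N (odd_coef c) (- 'i * z)).
  by apply: apx_rot; [rewrite cabsN cabs_i|exact: apx_hpoly].
move=> z z1; have mi : cabs (- 'i * z) = cabs z by rewrite mulNr cabsN ci.
have ii y : r%:C * 'i * (- 'i * y) = r%:C * y.
  rewrite -mulrA; congr (_ * _); have i2 : 'i * 'i = -1 :> C by apply: complex_ext; rewrite ?ReM ?ImM /=; ring.
  by rewrite mulrA mulrN i2 opprK mul1r.
rewrite /refl; case: ifP => [z2|/negbT z2].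
  have := hc2 (- 'i * z); rewrite /V ii add0r; apply; split; first by rewrite mi.
  by rewrite ReM /=; lra.
have := hc2 (- 'i * z^*); rewrite /V ii add0r => h.
have -> : hp N (odd_coef c) (- 'i * z) = - hp N (odd_coef c) (- 'i * z^*).
  have -> : - 'i * z^* = - (- 'i * z)^* :> C by apply: complex_ext; rewrite ?ReN ?ImN ?ReJ ?ImJ ?ReM ?ImM ?ReN ?ImN ?ReJ ?ImJ /=; ring.
  by rewrite !hp_odd conj_negJ; ring.
rewrite opprK addrC -normrN opprD opprK addrC distrC distrC; apply: h; split.
  by rewrite mulNr cabsN ci cabsJ.
by rewrite -ltNge in z2; rewrite ReM ReN ImN ReJ ImJ /=; lra.
Qed.

Lemma ReJM x y : Re (x^* * (y - x)) = (cabs y ^+ 2 - cabs x ^+ 2 - cabs (y - x) ^+ 2) / 2.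
Proof. by rewrite !cabs_sqr ReM ReJ ImJ ReB ImB; field. Qed.

Lemma sector_mono D E x : D `<=` E -> sector E x -> sector D x.
Proof. by move=> DE [nu [k [r [h1 h2 h3 h4]]]]; exists nu, k, r; split=> // y /DE; exact: h4. Qed.

Lemma good_minus_disc D (r : R) : good D -> 0 < r -> good (D `\` cball 0 r).
Proof.
move=> [oD bD sD] r0; split.
- move=> x [Dx nx]; have [s s0 hs] := oD x Dx.
  have xr : r < cabs x by rewrite ltNge; apply/negP => h; apply: nx; rewrite /cball/= subr0.
  exists (Num.min s (cabs x - r)); first by rewrite lt_min s0 subr_gt0.
  move=> y; rewrite lt_min => /andP[/hs Dy yx]; split=> //; rewrite /cball/= subr0.
  by have := cabs_leD x y; rewrite cabs_sub => h1 h2; lra.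
- by apply: bnd_sub bD => x [].
- move=> x [cx nx].
  have cDx : clos D x by apply: clos_mono cx => y [].
  have rx : r <= cabs x.
    rewrite leNgt; apply/negP => xr; have [y [_ ny] yx] := cx (r - cabs x) ltac:(by rewrite subr_gt0).
    by apply: ny; rewrite /cball/= subr0; have := cabs_leD y x; lra.
  have [xr|xr] := ltP r (cabs x).
    apply: (@sector_mono _ D); first by move=> y [].
    apply: sD; split=> // Dx; apply: nx; split=> //; rewrite /cball/= subr0; lra.
  have xE : cabs x = r by lra.
  (* On the removed circle the outward radius is the axis of the sector; within distance [r] the
     curvature costs at most half of the distance. *)
  exists ((r^-1)%:C * x^*), (1 / 2), r; split=> //.
  + by rewrite cabsZ cabsJ xE ger0_norm ?invr_ge0 ?ltW// mulVf// gt_eqF.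
  + lra.
  + move=> y [_ ny] yx; rewrite -mulrA ReZ ReJM xE [X in _ <= X]mulrC ler_pdivlMr//.
    have ry : r < cabs y by rewrite ltNge; apply/negP => h; apply: ny; rewrite /cball/= subr0.
    have h1 : r ^+ 2 <= cabs y ^+ 2 by rewrite lerXn2r ?nnegrE ?cabs_ge0 ?ltW.
    have h2 : cabs (y - x) ^+ 2 <= cabs (y - x) * r by rewrite expr2 ler_wpM2l ?cabs_ge0// ltW.
    by move: h1 h2; clear; move: (cabs y ^+ 2) (r ^+ 2) (cabs (y - x) ^+ 2) => a b c; rewrite mulNr mulrAC; lra.
Qed.

(** On the hole the sector condition is that of the complement of [om]; on the outer circle the disc
    is convex, so [k = 0] suffices. *)
Lemma good_annular (om : set C) (rho : R) : opn om -> 0 < rho ->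
  (forall x, bd om x -> sector (~` om) x) -> good (oball 0 rho `\` clos om).
Proof.
move=> oo r0 so; split.
- move=> x [xr nx]; have [s s0 hs] := @opn_oball R 0 rho x xr.
  have [t t0 ht] : exists2 t : R, 0 < t & forall y, cabs (y - x) < t -> ~ clos om y.
    apply: contrapT => h; apply: nx => t t0.
    have [y [yx cy]] : exists y, cabs (y - x) < t / 2 /\ clos om y.
      apply: contrapT => h'; apply: h; exists (t / 2); first by rewrite divr_gt0.
      by move=> y yx cy; apply: h'; exists y.
    have [z oz zy] := cy (t / 2) (divr_gt0 t0 (ltr0Sn R 1)); exists z => //.
    by have := cabs_tri z y x; lra.
  exists (Num.min s t); first by rewrite lt_min s0.
  by move=> y; rewrite lt_min => /andP[/hs ? /ht].
- by apply: bnd_sub (@bnd_oball R 0 rho) => x [].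
- move=> x [cx nx].
  have xr : cabs x <= rho.
    have : clos (oball 0 rho) x by apply: clos_mono cx => y [].
    by move/clos_oball; rewrite /cball/= subr0.
  have [xr'|xr'] := ltP (cabs x) rho.
    apply: (@sector_mono _ (~` om)); first by move=> y [_ ny] oy; apply: ny; exact: sub_clos.
    apply: so; split.
      by apply: contrapT => h; apply: nx; split; rewrite /oball/= ?subr0.
    move=> ox; have [s s0 hs] := oo x ox; have [y [_ ny] yx] := cx s s0.
    by apply: ny; apply: sub_clos; exact: hs.
  have xE : cabs x = rho by lra.
  exists (- ((rho^-1)%:C * x^*)), 0, rho; split=> //.
  + by rewrite cabsN cabsZ cabsJ xE ger0_norm ?invr_ge0 ?ltW// mulVf// gt_eqF.
  + move=> y [yr _] _; rewrite oppr0 mul0r mulNr ReN -mulrA ReZ ReJM xE oppr_ge0.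
    rewrite /oball/= subr0 in yr.
    apply: mulr_ge0_le0; first by rewrite invr_ge0 ltW.
    have h1 : cabs y ^+ 2 <= rho ^+ 2 by rewrite lerXn2r ?nnegrE ?cabs_ge0 ?(ltW r0)// ltW.
    by have := sqr_ge0 (cabs (y - x)); move: h1; clear; move: (cabs y ^+ 2) (rho ^+ 2) (cabs (y - x) ^+ 2) => a b c; lra.
Qed.

Lemma bd_annular (om : set C) (rho : R) x : opn om -> bd (oball 0 rho `\` clos om) x ->
  cabs x = rho \/ bd om x.
Proof.
move=> oo [cx nx].
have xr : cabs x <= rho.
  have : clos (oball 0 rho) x by apply: clos_mono cx => y [].
  by move/clos_oball; rewrite /cball/= subr0.
have [xr'|xr'] := ltP (cabs x) rho; last by left; lra.
right; split; first by apply: contrapT => h; apply: nx; split; rewrite /oball/= ?subr0.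
move=> ox; have [s s0 hs] := oo x ox; have [y [_ ny] yx] := cx s s0.
by apply: ny; apply: sub_clos; exact: hs.
Qed.
End Operators.

(** * Analytic families of operators and their Neumann series *)

Section OperatorFamilies.
Variable R : realType.
Local Notation C := R[i].
Local Notation Re := (@complex.Re R).
Local Notation Im := (@complex.Im R).
Variables (V : normedModType R) (I : Type) (lin : I -> V -> R) (off : I -> R) (rr : R).
Hypothesis rr0 : 0 <= rr.
Implicit Types (A B E : set C) (f g : V -> C -> R) (z w : V -> C -> C) (t : V) (x : C).
Implicit Types (L : V -> (C -> R) -> C -> R).
Local Notation co := (co lin off).
Local Notation box := (box lin off rr).
Local Notation An := (An lin off rr).
Local Notation AnC := (AnC lin off rr).

(** The constant [k] governs the action on analytic families and plays the part of an operator norm;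
    the bound of a single [L t] is left unspecified and serves only to pass to limits. *)
Definition Fam A B L (k : R) := (forall t, box t -> exists K, Op A B (L t) K) /\
  forall f N, An A f N -> An B (fun t => L t (f t)) (k * N).

Lemma Fam_le A B L (k k' : R) : k <= k' -> Fam A B L k -> Fam A B L k'.
Proof.
move=> kk [h1 h2]; split=> // f N hf; apply: (An_ext rr0 (h2 f N hf)) => //.
by rewrite ler_wpM2r// (An_ge0 rr0 hf).
Qed.

Lemma Fam_op A B (L : (C -> R) -> C -> R) (K : R) : Op A B L K -> Fam A B (fun=> L) K.
Proof. by move=> H; split=> [t _|f N hf]; [exists K|exact: (An_op rr0 H)]. Qed.

Lemma Fam_comp A B E L L' (k k' : R) : Fam A B L k -> Fam B E L' k' ->
  Fam A E (fun t (f : C -> R) => L' t (L t f)) (k' * k).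
Proof.
move=> [h1 h2] [h3 h4]; split.
  by move=> t bt; have [K H] := h1 t bt; have [K' H'] := h3 t bt; exists (K' * K); exact: Op_comp H H'.
by move=> f N hf; rewrite -mulrA; exact: (h4 _ _ (h2 _ _ hf)).
Qed.

Lemma Fam_add A B L L' (k k' : R) : Fam A B L k -> Fam A B L' k' ->
  Fam A B (fun t (f : C -> R) x => L t f x + L' t f x) (k + k').
Proof.
move=> [h1 h2] [h3 h4]; split; last by move=> f N hf; rewrite mulrDl; exact: (An_add rr0 (h2 _ _ hf) (h4 _ _ hf)).
move=> t bt; have [K H] := h1 t bt; have [K' H'] := h3 t bt; exists (K + K'); split.
- exact: addr_ge0 (Op_ge0 H) (Op_ge0 H').
- by move=> f cf; apply: contD; [exact: (Op_cont H)|exact: (Op_cont H')].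
- by move=> a f g cf cg x Bx; rewrite (Op_lin H)// (Op_lin H')//; ring.
- move=> f M M0 cf fM x Bx; rewrite mulrDl; apply: le_trans (ler_normD _ _) _.
  by apply: lerD; [exact: (Op_bd H)|exact: (Op_bd H')].
Qed.

Lemma Fam_mul A B L (a : V -> C -> R) (k M : R) : An B a M -> Fam A B L k ->
  Fam A B (fun t (f : C -> R) x => a t x * L t f x) (M * k).
Proof.
move=> ha [h1 h2]; split; last by move=> f N hf; rewrite -mulrA; exact: (An_mul rr0 ha (h2 _ _ hf)).
move=> t bt; have [K H] := h1 t bt; exists (M * K); split.
- exact: mulr_ge0 (An_ge0 rr0 ha) (Op_ge0 H).
- by move=> f cf; apply: cont_mul; [exact: (An_cont rr0 ha)|exact: (Op_cont H)].
- by move=> c f g cf cg x Bx; rewrite (Op_lin H)//; ring.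
- move=> f N N0 cf fN x Bx; rewrite normrM -mulrA; apply: ler_pM => //; first exact: (An_le rr0 ha).
  exact: (Op_bd H).
Qed.

Lemma An_coord A i : An A (fun t _ => co i t) rr.
Proof.
have s1 : An A (fun _ _ => 1) 1.
  by apply: An_cst => //; [exact: cont_cst|move=> x _; rewrite normr1].
by apply: (An_ext rr0 (An_X i s1)) => [t x _ _|]; rewrite mulr1.
Qed.

Lemma Fam_X A B L i (k : R) : Fam A B L k -> Fam A B (fun t (f : C -> R) x => co i t * L t f x) (rr * k).
Proof. exact/Fam_mul/An_coord. Qed.

Lemma Fam_scale A B L (c k : R) : Fam A B L k -> Fam A B (fun t (f : C -> R) x => c * L t f x) (`|c| * k).
Proof. by apply: Fam_mul; apply: An_cst => //; exact: cont_cst. Qed.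

Lemma AnC_add A z w p q : AnC A z p -> AnC A w q -> AnC A (fun t x => z t x + w t x) (p + q).
Proof.
move=> [a [b [ha hb ab]]] [c [d [hc hd cd]]]; exists (a + c), (b + d); split.
- by apply: (An_ext rr0 (An_add rr0 ha hc)) => // t x _ _; rewrite ReD.
- by apply: (An_ext rr0 (An_add rr0 hb hd)) => // t x _ _; rewrite ImD.
- by rewrite addrACA lerD.
Qed.

Lemma Fam_compz A z (q : R) : q <= 1 / 2 -> AnC A z q ->
  Fam (@circ R) A (fun t (f : C -> R) x => dv f (z t x) - dv f 0) (4 * q).
Proof.
move=> q1 hz; have z1 t x : box t -> A x -> cabs (z t x) <= 1.
  by move=> bt Ax; have := AnC_le rr0 hz bt Ax; lra.
split; last by move=> f N hf; rewrite -mulrA (mulrC q) mulrA; exact: An_comp.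
move=> t bt; exists 2; split=> //.
- move=> f cf; have [M M0 fM] : exists2 M : R, 0 <= M & forall x, circ x -> `|f x| <= M.
    by apply: cont_bounded => //; [exact: bnd_circ|exact: clos_circ].
  exact: (An_cont rr0 (An_comp rr0 q1 (An_cst _ _ _ M0 cf fM) hz) bt).
- by move=> a f g cf cg x Ax; rewrite !dv_lin ?cabs0 ?z1//; ring.
- move=> f M M0 cf fM x Ax; apply: le_trans (ler_normB _ _) _; rewrite mulr2n mulrDl mul1r.
  by apply: lerD; apply: dv_bd => //; rewrite ?cabs0 ?z1.
Qed.

(** Neumann series: the iterates on [d] decay like [k ^+ n] in [An], so their sum is again analytic.
    The equation for the sum is checked at fixed [t], where some operator bound carries [L t]
    through the limit. *)
Theorem Fam_fix A L (d : V -> C -> R) (k N : R) : 0 <= k -> k < 1 -> Fam A A L k -> An A d N ->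
  exists f, An A f (N / (1 - k)) /\ forall t x, box t -> A x -> f t x = d t x + L t (f t) x.
Proof.
move=> k0 k1 [h1 h2] hd; have N0 := An_ge0 rr0 hd.
pose F := fix F n : V -> C -> R := if n is n'.+1 then fun t => L t (F n' t) else d.
have hF n : An A (F n) (N * k ^+ n).
  elim: n => [|n IH]; first by rewrite expr0 mulr1.
  by apply: (An_ext rr0 (h2 _ _ IH)) => //; rewrite exprS mulrCA.
have [f [hf lf]] := An_geo rr0 k0 k1 N0 hF; exists f; split=> // t x bt Ax.
have [K H] := h1 t bt; have K0 := Op_ge0 H.
have cF n : cont A (F n t) by exact: (An_cont rr0 (hF n)).
have cf : cont A (f t) by exact: (An_cont rr0 hf).
pose P n : C -> R := fun y => \sum_(i < n) F i t y.
have cP n : cont A (P n) by exact: (@cont_sum R A n (fun i => F i t)).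
have NM n : \sum_(i < n) N * k ^+ i <= N / (1 - k) by exact: geo_sum_le.
have Nk0 n : 0 <= N * k ^+ n by rewrite mulr_ge0// exprn_ge0.
have S n : P n.+1 x = d t x + L t (P n) x.
  by rewrite /P big_ord_recl (@Op_sum R A A (L t) K n (fun i => F i t) x H cF Ax).
apply: Lim_uniq (lf t x bt Ax) _ => e e0.
have K1 : 0 < K + 1 by rewrite ltr_wpDl.
have [n0 hn0] := sum_tail_small Nk0 NM (divr_gt0 e0 K1).
exists n0.+1 => -[//|n] nn; rewrite -/(P n.+1 x) S opprD addrACA subrr add0r.
rewrite -(OpB H)//; apply: (@le_trans _ _ (K * (e / (K + 1)))).
  apply: (Op_bd H) => //; [by rewrite divr_ge0 ?(ltW e0) ?(ltW K1)|exact: contB|].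
  move=> y Ay; rewrite distrC.
  apply: (Lim_tail (a := fun i => F i t y) _ (lf t y bt Ay)) => [i|m nm]; first exact: (An_le rr0 (hF i)).
  exact: hn0.
rewrite -{2}(divfK (lt0r_neq0 K1) e) mulrC ler_wpM2l ?divr_ge0 ?(ltW e0) ?(ltW K1)//.
by rewrite lerDl.
Qed.
End OperatorFamilies.

(** * The equation for the singular part *)

Section Geometry.
Variable R : realType.
Local Notation C := R[i].
Local Notation Re := (@complex.Re R).
Local Notation Im := (@complex.Im R).
Implicit Types (A B D E : set C) (f g u v w : C -> R) (x y z : C).

Lemma ln_lip (a b d : R) : 0 < d -> d <= a -> d <= b -> `|ln a - ln b| <= `|a - b| / d.
Proof.
move=> d0; have key a' b' : d <= a' -> d <= b' -> ln a' - ln b' <= `|a' - b'| / d.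
  move=> da db; have a0 : 0 < a' by exact: lt_le_trans da.
  have b0 : 0 < b' by exact: lt_le_trans db.
  rewrite -ln_div ?posrE//; apply: le_trans (ln_le_sub1 _) _; first by rewrite divr_gt0.
  have -> : a' / b' - 1 = (a' - b') / b' by field; rewrite gt_eqF.
  apply: (@le_trans _ _ (`|a' - b'| / b')); first by rewrite ler_pM2r ?invr_gt0// ler_norm.
  by rewrite ler_wpM2l// lef_pV2 ?posrE.
move=> da db; rewrite ler_norml lerNl opprB; apply/andP; split; last exact: key.
by rewrite distrC; exact: key.
Qed.

Lemma cont_ln_cabs A : (forall x, A x -> x != 0) -> cont A (fun x => ln (cabs x)).
Proof.
move=> nA x Ax e e0; have x0 : 0 < cabs x by rewrite cabs_gt0 nA.
have x20 : 0 < cabs x / 2 by rewrite divr_gt0.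
exists (Num.min (cabs x / 2) (e * (cabs x / 2))); first by rewrite lt_min x20 mulr_gt0.
move=> y Ay; rewrite lt_min => /andP[h1 h2].
have h3 := cabs_leD x y; have h4 := cabs_leD y x; rewrite cabs_sub in h3.
apply: le_lt_trans (ln_lip x20 _ _) _; [by lra|by lra|].
rewrite ltr_pdivrMr//; apply: le_lt_trans h2; rewrite ler_norml; lra.
Qed.

Lemma cont_shift B A (f : C -> R) (th : C -> C) (k : R) : 0 < k -> cont A f ->
  (forall y, B y -> A (th y)) -> (forall y z, B y -> B z -> cabs (th y - th z) <= k * cabs (y - z)) ->
  cont B (fun y => f (th y)).
Proof.
move=> k0 cf hB hl x Bx e e0; have [d d0 hd] := cf _ (hB x Bx) e e0.
exists (d / k); first by rewrite divr_gt0.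
move=> y By yx; apply: hd; first exact: hB.
by apply: le_lt_trans (hl y x By Bx) _; rewrite mulrC -ltr_pdivlMr.
Qed.

(** The division by 2 keeps the singularity, at 2, outside the closed unit disc, so that [apx]
    holds. *)
Definition vlog z : R := ln (cabs (1 - z / 2)).

Lemma vlog0 : vlog 0 = 0.
Proof. by rewrite /vlog mul0r subr0 cabs1 ln1. Qed.

Lemma half_le z (k : R) : cabs z <= k -> cabs (z / 2) <= k / 2.
Proof. by move=> h; rewrite cabsM cabsV cabs_nat ler_pM2r ?invr_gt0. Qed.

Lemma vlog_apx : apx vlog.
Proof.
have nz z : cabs z < 3 / 2 -> 1 - z / 2 != 0.
  move=> z1; rewrite -cabs_gt0; have := half_le (ltW z1).
  by have := cabs_leD 1 (z / 2); rewrite cabs1; lra.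
have cv : cont (oball 0 (3 / 2)) vlog.
  apply: (@cont_shift _ [set x | x != 0] (fun x => ln (cabs x)) (fun z => 1 - z / 2) 1) => //.
  - exact: cont_ln_cabs.
  - by move=> z; rewrite /oball/= subr0; exact: nz.
  - move=> y z _ _; have -> : 1 - y / 2 - (1 - z / 2) = (z - y) / 2 by ring.
    by rewrite mul1r (cabs_sub y z) cabsM cabsV cabs_nat ler_pdivrMr// ler_peMr ?cabs_ge0//; lra.
have h : apx (dil 0 1 vlog).
  apply: harm_apx => //.
    by apply: cont_sub cv => z; rewrite /cball/oball/=; lra.
  move=> z; rewrite /oball/= subr0 => z1.
  have := @harm_affine R [set x | x != 0] (fun x => ln (cabs x)) 1 (- 2^-1) z.
  have -> : (fun y : C => ln (cabs (1 + - 2^-1 * y))) = vlog.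
    by apply/funext => y; rewrite /vlog mulNr (mulrC _ y).
  apply.
  - move=> x /=; rewrite -cabs_gt0 => x0; exists (cabs x) => // y yx.
    by rewrite /= -cabs_gt0; have := cabs_leD x y; rewrite cabs_sub; lra.
  - exact: cont_ln_cabs.
  - by move=> x; exact: harm_ln.
  - by rewrite oppr_eq0 invr_eq0 pnatr_eq0.
  - by rewrite /= mulNr (mulrC _ z); apply: nz; lra.
by apply: apx_eq h => z _; rewrite /dil add0r mul1r.
Qed.

Variables (D : set C) (r1 rp : R).
Hypotheses (gD : good D) (r10 : 0 < r1) (rp0 : 0 < rp) (rpr1 : rp < r1)
  (G1 : forall x, cabs x < r1 -> 0 < Im x -> D x) (G2 : forall x, D x -> 0 < Im x).

Definition ext : set C := [set x | rp <= cabs x].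

Lemma clos_upper x : clos D x -> 0 <= Im x.
Proof.
move=> cx; rewrite leNgt; apply/negP => xn.
have [y /G2 y0 yx] := cx (- Im x) ltac:(by rewrite oppr_gt0).
by have := Im_le (y - x); rewrite ImB ler_norml; lra.
Qed.

Lemma bd_axis x : bd D x -> cabs x < r1 -> Im x = 0.
Proof.
move=> [cx nx] xr; apply/eqP; rewrite eq_le clos_upper// andbT leNgt.
by apply/negP => h; apply: nx; exact: G1.
Qed.

Lemma axis_bd x : cabs x < r1 -> Im x = 0 -> bd D x.
Proof.
move=> xr x0; split; last by move=> /G2; rewrite x0 ltxx.
move=> e e0; pose d := Num.min (e / 2) ((r1 - cabs x) / 2).
have d0 : 0 < d by rewrite lt_min !divr_gt0 ?subr_gt0.
have : d <= d by []. rewrite {2}/d le_min => /andP[de dr]; clearbody d.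
exists (x + d%:C * 'i); last by rewrite dist_shift cabs_hi gtr0_norm//; lra.
apply: G1; first by have := cabsD x (d%:C * 'i); rewrite cabs_hi gtr0_norm//; lra.
by rewrite ImD x0 ImZ /=; lra.
Qed.

Lemma conj_axis x : Im x = 0 -> x^* = x.
Proof. by move=> x0; apply: complex_ext; rewrite ?ReJ ?ImJ// x0 oppr0. Qed.

Lemma cont_conj f : cont ext f -> cont ext (fun x => f x^*).
Proof.
move=> cf; apply: (@cont_shift _ ext f (fun x => x^*) 1) => //.
  by move=> y; rewrite /ext/= cabsJ.
move=> y z _ _; rewrite mul1r; have -> : y^* - z^* = (y - z)^* by rewrite rmorphB.
by rewrite cabsJ.
Qed.

(** The boundary near 0 is real, so the difference is 0 there; writing this value explicitly gives
    sense to the data although [f] is controlled only for [rp <= cabs x]. *)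
Definition cut f x : R := if cabs x < r1 then 0 else f x - f x^*.

Lemma cutE f x : bd D x -> cut f x = f x - f x^*.
Proof.
move=> bx; rewrite /cut; case: ifP => // xr.
by rewrite (conj_axis (bd_axis bx xr)) subrr.
Qed.

Lemma Op_cut : Op ext (bd D) cut 2.
Proof.
split=> //.
- move=> f cf x bx e e0; have [xr|xr] := ltP (cabs x) r1.
    exists (r1 - cabs x); first by rewrite subr_gt0.
    move=> y by_ yx; have yr : cabs y < r1 by have := cabs_leD y x; lra.
    by rewrite /cut xr yr subrr normr0.
  have ex : ext x by exact: ltW (lt_le_trans rpr1 xr).
  have [d d0 hd] := contB cf (cont_conj cf) ex e0.
  exists (Num.min d (r1 - rp)); first by rewrite lt_min d0 subr_gt0.
  move=> y by_; rewrite lt_min => /andP[yd yr].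
  rewrite !cutE//; apply: hd => //; rewrite /ext/=.
  by have := cabs_leD x y; rewrite cabs_sub; lra.
- by move=> a f g _ _ x _; rewrite /cut; case: ifP => _; ring.
- move=> f M M0 cf fM x bx; rewrite /cut; case: ifPn => [_|].
    by rewrite normr0 mulr_ge0.
  rewrite -leNgt => xr; apply: le_trans (ler_normB _ _) _; rewrite mulr2n mulrDl mul1r.
  by apply: lerD; apply: fM; rewrite /ext/= ?cabsJ; exact: ltW (lt_le_trans rpr1 xr).
Qed.

Definition hsol f : C -> R := dir D (cut f).

Lemma Op_hsol : Op ext (clos D) hsol 2.
Proof. by have := Op_comp Op_cut (Op_dir gD); rewrite mul1r. Qed.

Lemma hsolP f : cont ext f -> [/\ cont (clos D) (hsol f), forall x, D x -> harm (hsol f) x &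
  forall x, bd D x -> hsol f x = f x - f x^*].
Proof.
move=> cf; have [h1 h2 h3] := dirP gD (Op_cont Op_cut cf).
by split=> // x bx; rewrite /hsol h3// cutE.
Qed.

Lemma half_clos x : cabs x < r1 -> 0 <= Im x -> clos D x.
Proof.
move=> xr; rewrite le_eqVlt => /orP[/eqP x0|x0]; last exact/sub_clos/G1.
by have [] := axis_bd xr (esym x0).
Qed.

(** Near 0 the correction vanishes on the axis, so its odd reflection is harmonic in a full disc.
    Transported to the unit disc it can be composed with analytic arguments that leave the upper
    half plane, as they do for parameters of other signs. *)
Definition hrefl f : C -> R := refl (r1 / 2) (hsol f).

Lemma hrefl_apx f : cont ext f -> apx (hrefl f).
Proof.
move=> cf; have [h1 h2 h3] := hsolP cf; apply: refl_apx; first by rewrite divr_gt0.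
- by apply: cont_sub h1 => x [x1 x2]; apply: half_clos => //; move: r10; lra.
- by move=> x x1 x2; apply: h2; apply: G1 => //; move: r10; lra.
- move=> x x1 x2; have xr : cabs x < r1 by move: r10; lra.
  by rewrite h3 ?(conj_axis x2) ?subrr//; exact: axis_bd.
Qed.

Lemma cabs_scale (r : R) z : 0 < r -> cabs (r%:C * z) = r * cabs z.
Proof. by move=> r0; rewrite cabsZ gtr0_norm. Qed.

Lemma hrefl_arg z : cabs z <= 1 -> 0 <= Im z -> clos D ((r1 / 2)%:C * z).
Proof.
move=> z1 z2; apply: half_clos; last by rewrite ImZ mulr_ge0// ltW// divr_gt0.
rewrite cabs_scale ?divr_gt0//; have : r1 / 2 * cabs z <= r1 / 2 * 1.
  by rewrite ler_wpM2l// ltW// divr_gt0.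
by move: r10; lra.
Qed.

Lemma Op_hrefl : Op ext (@circ R) hrefl 2.
Proof.
have arg z : circ z -> 0 <= Im z \/ 0 <= Im z^*.
  by move=> _; rewrite ImJ; case: (leP 0 (Im z)) => h; [left|right; lra].
split=> //.
- move=> f cf; apply: cont_sub (apx_cont (hrefl_apx cf)) => z z1.
  by rewrite /cball/= subr0 z1.
- move=> a f g cf cg z z1; rewrite /hrefl /refl; case: ifPn => h.
    by rewrite (Op_lin Op_hsol)//; apply: hrefl_arg => //; rewrite z1.
  rewrite -ltNge in h; rewrite (Op_lin Op_hsol)//; first ring.
  by apply: hrefl_arg; rewrite ?cabsJ ?z1// ImJ; lra.
- move=> f M M0 cf fM z z1; rewrite /hrefl /refl; case: ifPn => h.
    by apply: (Op_bd Op_hsol) => //; apply: hrefl_arg => //; rewrite z1.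
  rewrite -ltNge in h; rewrite normrN; apply: (Op_bd Op_hsol) => //.
  by apply: hrefl_arg; rewrite ?cabsJ ?z1// ImJ; lra.
Qed.

Lemma hrefl0 f : cont ext f -> hrefl f 0 = 0.
Proof.
move=> cf; have [_ _ h3] := hsolP cf; rewrite /hrefl /refl /= lexx mulr0 h3.
  by rewrite conj_axis// subrr.
by apply: axis_bd => //; rewrite cabs0.
Qed.

Lemma dv_hrefl f z : cont ext f -> cabs z <= 1 -> 0 <= Im z ->
  dv (hrefl f) z - dv (hrefl f) 0 = hsol f ((r1 / 2)%:C * z).
Proof.
move=> cf z1 z2; have a := hrefl_apx cf; rewrite !dv_apx ?cabs0// hrefl0// subr0.
by rewrite /hrefl /refl z2.
Qed.
End Geometry.

(** * Dirichlet problems around the hole *)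

Section Annulus.
Variable R : realType.
Local Notation C := R[i].
Local Notation Re := (@complex.Re R).
Local Notation Im := (@complex.Im R).
Implicit Types (A B D E : set C) (f g u v w : C -> R) (x y z : C).
Variables (om : set C) (s0 sg : R).
Hypotheses (oo : opn om) (so : forall x, bd om x -> sector (~` om) x) (s00 : 0 < s0)
  (os : cball 0 s0 `<=` om) (osg : forall x, clos om x -> cabs x < sg).

Let rho := 2 * sg.
Definition ann : set C := oball 0 rho `\` clos om.
(** The part of the boundary on the hole. The threshold [sg] separates it from the outer circle of
    radius [2 * sg], so that data on the two parts can be glued. *)
Definition bdin : set C := [set y | bd ann y /\ cabs y < sg].

Lemma s0sg : s0 < sg.
Proof.
have : om s0%:C by apply: os; rewrite /cball/= subr0 cabs_real gtr0_norm.
by move/sub_clos/osg; rewrite cabs_real gtr0_norm.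
Qed.

Lemma sg0 : 0 < sg. Proof. exact: lt_trans s0sg. Qed.

Lemma rho0 : 0 < rho. Proof. by rewrite mulr_gt0// sg0. Qed.

Lemma good_ann : good ann. Proof. exact: good_annular rho0 so. Qed.

Lemma bd_ann y : bd ann y -> ~~ (cabs y < sg) -> cabs y = rho.
Proof. by move=> /(bd_annular oo)[//|[cy _]]; rewrite osg. Qed.

Lemma ann_mid y : sg <= cabs y -> cabs y < rho -> ann y.
Proof.
by move=> h1 h2; split; [rewrite /oball/= subr0|move=> /osg; rewrite ltNge h1].
Qed.

Lemma bdin_s0 y : bdin y -> s0 <= cabs y.
Proof.
move=> [[cy ny] ysg]; rewrite leNgt; apply/negP => h.
have [z [_ nz] zy] := cy (s0 - cabs y) ltac:(by rewrite subr_gt0).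
by apply: nz; apply/sub_clos/os; rewrite /cball/= subr0; have := cabs_leD z y; lra.
Qed.

Definition glue f g y : R := if cabs y < sg then f y else g y.

Lemma cont_glue f g : cont bdin f -> cont [set y | cabs y = rho] g -> cont (bd ann) (glue f g).
Proof.
move=> cf cg y by_ e e0; rewrite /glue; case: ifPn => ys.
  have [d d0 hd] := cf y (conj by_ ys) e e0.
  exists (Num.min d (sg - cabs y)); first by rewrite lt_min d0 subr_gt0.
  move=> z bz; rewrite lt_min => /andP[zd zy].
  have zs : cabs z < sg by have := cabs_leD z y; lra.
  by rewrite zs; exact: hd.
have yr := bd_ann by_ ys; have [d d0 hd] := cg y yr e e0.
exists (Num.min d sg); first by rewrite lt_min d0 sg0.
move=> z bz; rewrite lt_min => /andP[zd zy].
have zs : ~~ (cabs z < sg).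
  by rewrite -leNgt; have := cabs_leD y z; rewrite cabs_sub yr /rho; lra.
by rewrite (negbTE zs); apply: hd => //; exact: bd_ann.
Qed.

Lemma Op_in : Op bdin (bd ann) (fun f => glue f (fun=> 0)) 1.
Proof.
split=> //.
- by move=> f cf; apply: cont_glue => //; exact: cont_cst.
- by move=> a f g _ _ x _; rewrite /glue; case: ifP => _; ring.
- move=> f M M0 cf fM x bx; rewrite /glue mul1r; case: ifP => xs; last by rewrite normr0.
  exact: fM.
Qed.

(** The argument is the inversion in the circle of radius [sg], scaled to the unit disc. Moving the
    conjugation onto [dv f], which stays approximable by [apxJ], leaves a holomorphic argument for
    [comp_cont] and [comp_harm]. *)
Lemma kelvinE f y : dv f (sg%:C / y^*) = (fun z => dv f z^*) (sg%:C * y^-1).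
Proof. by rewrite /= conjM fmorphV; congr (dv f (_ / _)); apply: complex_ext; rewrite ?ReJ ?ImJ//= oppr0. Qed.

Lemma kelvin_arg y : sg <= cabs y -> cabs (sg%:C * y^-1) <= 1 /\ taylor3 (fun y => sg%:C * y^-1) y.
Proof.
move=> ys; have y0 : 0 < cabs y by exact: lt_le_trans sg0 ys.
split; first by rewrite cabsM cabsV cabs_real (gtr0_norm sg0) ler_pdivrMr// mul1r.
by apply: taylor3M; [exact: taylor3_cst|apply: taylor3V; rewrite -cabs_gt0].
Qed.

Lemma kelvin_cont f A : cont (@circ R) f -> (forall y, A y -> sg <= cabs y) ->
  cont A (fun y => dv f (sg%:C / y^*)).
Proof.
move=> cf hA; have [af _] := dvP cf.
apply: cont_eq (comp_cont (apxJ af) (fun y Ay => kelvin_arg (hA y Ay))) => y _.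
by rewrite kelvinE.
Qed.

Lemma kelvin_harm f y : cont (@circ R) f -> sg < cabs y -> harm (fun y => dv f (sg%:C / y^*)) y.
Proof.
move=> cf ys; have [af _] := dvP cf.
have -> : (fun y => dv f (sg%:C / y^*)) = (fun y => (fun z => dv f z^*) (sg%:C * y^-1)).
  by apply/funext => x; rewrite kelvinE.
apply: (@comp_harm R [set y | sg < cabs y] (fun z => dv f z^*) (fun y => sg%:C * y^-1)) => //.
- move=> x xs; exists (cabs x - sg); first by rewrite subr_gt0.
  by move=> z zx /=; have := cabs_leD x z; rewrite cabs_sub; lra.
- exact: apxJ.
- by move=> x /ltW; exact: kelvin_arg.
Qed.

Lemma kelvin_unit f y : cont (@circ R) f -> cabs y = sg -> dv f (sg%:C / y^*) = f (sg%:C^-1 * y).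
Proof.
move=> cf ys; have [_ hf] := dvP cf.
have s1 : sg%:C != 0 :> C by rewrite -cabs_gt0 cabs_real gtr0_norm sg0.
have y0 : y != 0 by rewrite -cabs_gt0 ys sg0.
have -> : sg%:C / y^* = sg%:C^-1 * y.
  have yy : y * y^* = sg%:C * sg%:C.
    have := cabs_sqr y; rewrite ys => h; apply: complex_ext; rewrite ?ReM ?ImM ?ReJ ?ImJ /=; last by ring.
    by transitivity (Re y ^+ 2 + Im y ^+ 2); [ring|rewrite -h; ring].
  have yc : y^* != 0 by rewrite -cabs_eq0 cabsJ cabs_eq0.
  apply: (mulIf yc); rewrite divfK// -mulrA yy mulrA mulVf// mul1r.
  done.
by apply: hf; rewrite cabsM cabsV cabs_real (gtr0_norm sg0) ys mulVf// gt_eqF// sg0.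
Qed.

Definition outer f : C -> R := glue (fun=> 0) (fun y => dv f (sg%:C / y^*)).

Lemma Op_outer : Op (@circ R) (bd ann) outer 1.
Proof.
have le1 y : bd ann y -> ~~ (cabs y < sg) -> cabs (sg%:C / y^*) <= 1.
  move=> by_ ny; have [+ _] := @kelvin_arg y ltac:(by rewrite leNgt).
  by rewrite !cabsM !cabsV cabsJ.
split=> //.
- move=> f cf; apply: cont_glue; first exact: cont_cst.
  by apply: kelvin_cont => // y /= ->; rewrite /rho; have := sg0; lra.
- move=> a f g cf cg y by_; rewrite /outer /glue; case: ifPn => h; first by ring.
  by rewrite dv_lin// le1.
- move=> f M M0 cf fM y by_; rewrite mul1r /outer /glue; case: ifPn => h; first by rewrite normr0.
  by apply: dv_bd => //; exact: le1.
Qed.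

Lemma circ_mid z : circ z -> ann (sg%:C * z).
Proof.
move=> z1; have h : cabs (sg%:C * z) = sg by rewrite cabs_scale ?sg0// z1 mulr1.
by apply: ann_mid; rewrite h// /rho; have := sg0; lra.
Qed.

Lemma Op_restr : Op (clos ann) (@circ R) (fun f z => f (sg%:C * z)) 1.
Proof.
split=> //.
- move=> f cf; apply: (@cont_shift R _ (clos ann) f (fun z => sg%:C * z) sg) => //; first exact: sg0.
    by move=> z /circ_mid/sub_clos.
  by move=> y z _ _; rewrite -mulrBr cabs_scale ?sg0.
- by move=> f M M0 cf fM z /circ_mid/sub_clos h; rewrite mul1r fM.
Qed.

(** Traces on the middle circle of radius [sg]: here of the annular solution with data on the hole,
    next of the one whose data on the outer circle are the decaying multipoles of [f]. *)
Definition inner_op f z : R := dir ann (glue f (fun=> 0)) (sg%:C * z).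
Definition outer_op f z : R := dir ann (outer f) (sg%:C * z).

Lemma Op_inner : Op bdin (@circ R) inner_op 1.
Proof. by have := Op_comp (Op_comp Op_in (Op_dir good_ann)) Op_restr; rewrite !mul1r. Qed.

Definition theta : R := ln (sg / s0) / ln (rho / s0).

Let lnr : 0 < ln (rho / s0).
Proof. by apply: ln_gt0; rewrite ltr_pdivlMr// mul1r /rho; have := s0sg; have := s00; lra. Qed.

Lemma theta_lt1 : 0 <= theta /\ theta < 1.
Proof.
have h1 : 1 < sg / s0 by rewrite ltr_pdivlMr// mul1r s0sg.
split; first by rewrite divr_ge0 ?(ltW lnr)// ltW// ln_gt0.
rewrite ltr_pdivrMr// mul1r ltr_ln ?posrE ?divr_gt0 ?sg0 ?rho0//.
by rewrite ltr_pM2r ?invr_gt0// /rho; have := sg0; lra.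
Qed.

(* Comparison with the radial harmonic function that vanishes on the circle of radius [s0]
inside the hole and equals [1] on the outer circle. *)
Lemma Op_outer_op : Op (@circ R) (@circ R) outer_op theta.
Proof.
have H := Op_comp (Op_comp Op_outer (Op_dir good_ann)) Op_restr; rewrite !mul1r in H.
split; [exact: (theta_lt1.1)|exact: (Op_cont H)|exact: (Op_lin H)|].
move=> f M M0 cf fM z z1.
have [c h e] := dirP good_ann (Op_cont Op_outer cf).
have [oD bD _] := good_ann.
pose L y := (ln (cabs y) - ln s0) / ln (rho / s0).
have nz y : clos ann y -> y != 0.
  move=> cy; rewrite -cabs_gt0; apply: lt_le_trans s00 _; rewrite leNgt; apply/negP => yh.
  have [x [_ nx] xy] := cy (s0 - cabs y) ltac:(by rewrite subr_gt0).
  by apply: nx; apply/sub_clos/os; rewrite /cball/= subr0; have := cabs_leD x y; lra.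
have LE y : L y = (ln (rho / s0))^-1 * (ln (cabs y) - ln s0) by rewrite /L mulrC.
have cL : cont (clos ann) (fun y => M * L y).
  apply: contZ; apply: (cont_eq (f := fun y => (ln (rho / s0))^-1 * (ln (cabs y) - ln s0))).
    by move=> y _; rewrite LE.
  by apply: contZ; apply: contB; [exact: cont_ln_cabs|exact: cont_cst].
have hL y : ann y -> harm (fun y => M * L y) y.
  move=> ay; apply: harmZ; have -> : L = fun y => (ln (rho / s0))^-1 * (ln (cabs y) - ln s0) by apply/funext.
  by apply: harmZ; apply: harmB; [apply: harm_ln; exact/nz/sub_clos|exact: harm_cst].
have bL y : bd ann y -> `|outer f y| <= M * L y.
  move=> by_; rewrite /outer /glue; case: ifPn => ys.
    rewrite normr0 mulr_ge0// divr_ge0 ?(ltW lnr)// subr_ge0 ler_ln ?posrE//.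
      exact: bdin_s0.
    by apply: lt_le_trans s00 _; exact: bdin_s0.
  have -> : L y = 1 by rewrite /L (bd_ann by_ ys) -ln_div ?posrE ?rho0// divff// gt_eqF.
  rewrite mulr1; apply: dv_bd => //.
  have [+ _] := @kelvin_arg y ltac:(by rewrite leNgt).
  by rewrite !cabsM !cabsV cabsJ.
have up := max_principle oD bD (contB c cL) (fun y Dy => harm_subh (harmB (h y Dy) (hL y Dy))) (M := 0).
have dn := max_principle oD bD (contB (contN c) cL) (fun y Dy => harm_subh (harmB (harmN (h y Dy)) (hL y Dy))) (M := 0).
have cz := sub_clos (circ_mid z1).
have Lz : M * L (sg%:C * z) = theta * M.
  by rewrite /L cabs_scale ?sg0// z1 mulr1 -ln_div ?posrE ?sg0// mulrC.
rewrite -Lz /outer_op ler_norml; apply/andP; split.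
  rewrite lerNl -subr_le0; apply: dn cz => y by_; rewrite e// subr_le0.
  by have := bL y by_; rewrite ler_norml => /andP[? _]; rewrite lerNl.
rewrite -subr_le0; apply: up cz => y by_; rewrite e// subr_le0.
exact: le_trans (ler_norm _) (bL y by_).
Qed.
End Annulus.

(** * The fixed point equation and its solution *)

Section Equation.
Variable R : realType.
Local Notation C := R[i].
Local Notation Re := (@complex.Re R).
Local Notation Im := (@complex.Im R).
Local Notation V := ((R * R) * (R * R))%type.
Implicit Types (A B D E : set C) (f g u v w : C -> R) (x y z : C) (t : V).

Definition plin (i : nat) t : R :=
  match i with 0%N => t.1.1 | 1%N => t.1.2 | 2%N => t.2.1 | _ => t.2.2 end.

Lemma plin_lin i (a : R) t s : plin i (a *: t + s) = a * plin i t + plin i s.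
Proof. by case: i => [|[|[|i]]]. Qed.

Lemma plin_le i t : `|plin i t| <= `|t|.
Proof.
case: t => [[a b] [c d]]; rewrite !prod_normE/=.
by case: i => [|[|[|i]]] /=; rewrite !le_max ?lexx ?orbT.
Qed.

Variable lam : R.
(** Centres the box at the singular point: the fourth coordinate is the deviation of the second
    logarithmic parameter from [lam]. *)
Definition poff (i : nat) : R := match i with 0%N => 0 | 1%N => 0 | 2%N => 0 | _ => lam end.

Variables (D om : set C) (r1 rp s0 sg : R) (pi : C) (U0 gi : C -> R).
Hypotheses (lam0 : 0 <= lam) (lam1 : lam < 1).
Hypotheses (gD : good D) (r10 : 0 < r1) (rp0 : 0 < rp) (rpr1 : rp < r1)
  (G1 : forall x, cabs x < r1 -> 0 < Im x -> D x) (G2 : forall x, D x -> 0 < Im x).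
Hypotheses (oo : opn om) (so : forall x, bd om x -> sector (~` om) x) (s00 : 0 < s0)
  (os : cball 0 s0 `<=` om) (osg : forall x, clos om x -> cabs x < sg).
Hypotheses (pi0 : 0 < Im pi).

Local Notation co := (co plin poff).
Local Notation ext := (ext rp).
Local Notation bdin := (bdin om sg).
Local Notation r := (r1 / 2).

Let rho := 2 * sg.
Let c := (1 - lam)^-1.
Let p2 := Im pi.
Let c0 : 0 < c. Proof. by rewrite invr_gt0 subr_gt0. Qed.
Let sgp : 0 < sg. Proof. exact: (sg0 s00 os osg). Qed.
Let rr0 : 0 < r. Proof. by rewrite divr_gt0. Qed.

(** [co 2 t * ctil f] is the coefficient of the logarithm. The normalisation of the mean [dv f 0] by
    [1 - lam] makes the constants cancel in [woutE]. *)
Definition ctil f : R := c * dv f 0.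

(** For positive parameters [zG] is the inverted rescaled point of [zGE], and [1 - zL t x / 2] is
    the quotient of [x - e1 * pi] by [x]. These forms are power series at vanishing parameters, with
    the small coordinates as factors. *)
Definition zG t x : C := (co 0 t)%:C * ((co 1 t)%:C * (sg%:C / x^* * (1 - (co 0 t)%:C * (pi^* / x^*))^-1)).
Definition zL t x : C := (co 0 t)%:C * (2 * pi / x).

(* The singular part of the perturbation; the argument of [dv] is the Kelvin image of the
rescaled point, divided by [sg]. *)
Definition Gsing t f x : R := co 2 t * (vlog (zL t x) * ctil f) + (dv f (zG t x) - dv f 0).

(** Arguments seen from the hole: [2 * 'i * p2] times [1 - zI / 2] is the position relative to the
    reflected centre, divided by [e1]; [zM] is the inverted point for the reflected multipoles, and
    [zP] the original point divided by [r]. *)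
Definition zI t y : C := (co 1 t)%:C * ('i * y / p2%:C).
Definition zM t y : C := (co 1 t)%:C * (sg%:C / (2 * 'i * p2%:C) *
  (1 - (co 1 t)%:C * ('i * y / (2 * p2%:C)))^-1).
Definition zP t y : C := (co 0 t)%:C * (pi / r%:C) + (co 0 t)%:C * ((co 1 t)%:C * (y / r%:C)).

(** What remains of the exterior representation across the hole: the constant, the reflected
    logarithm, the reflected multipoles and the boundary correction. Of the logarithms only the
    fixed number [ln (2 * p2)] is left. *)
Definition regular t f y : R :=
  - 1 * (co 3 t * ctil f) + (- 1 * (co 2 t * ((ln (2 * p2) + vlog (zI t y)) * ctil f)) +
  (- 1 * (dv f (zM t y) - dv f 0) +
   - 1 * (dv (hrefl D r1 (Gsing t f)) (zP t y) - dv (hrefl D r1 (Gsing t f)) 0))).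

(** The response to the radial logarithm: its value [ln rho] on the outer circle is solved inwards,
    and its value [ln sg] on the middle circle is subtracted. *)
Definition beta z : R := ln rho * dir (ann om sg) (glue sg (fun=> 0) (fun=> 1)) (sg%:C * z) - ln sg.

(** On the middle circle the exterior representation is [f], plus the logarithm, plus [regular]. The
    last extends harmonically over the annular region, so it can be subtracted from the annular
    solution: it leaves [datum - regular] on the hole and logarithm plus multipoles on the outer
    circle. Solving for [f] gives these terms. *)
Definition Qop t f z : R := outer_op om sg f z + (co 2 t * (beta z * ctil f) +
  - 1 * inner_op om sg (regular t f) z).

Definition datum t y : R := gi y - U0 (r%:C * zP t y).

Lemma cont_beta : cont (@circ R) beta.
Proof.
have cg : cont (bd (ann om sg)) (glue sg (fun=> 0) (fun=> 1)).
  by apply: (cont_glue oo s00 os osg); exact: cont_cst.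
have [h1 _ _] := dirP (good_ann oo so s00 os osg) cg.
apply: contB; last exact: cont_cst.
by apply: contZ; exact: (Op_cont (Op_restr s00 os osg) h1).
Qed.

Lemma vlog_bound : exists2 M : R, 0 <= M & forall z, cabs z = 1 -> `|@vlog R z| <= M.
Proof.
apply: (@cont_bounded R (@circ R)); [exact: bnd_circ|exact: clos_circ|].
by apply: cont_sub (apx_cont (@vlog_apx R)) => z z1; rewrite /cball/= subr0 z1.
Qed.

Lemma beta_bound : exists2 M : R, 0 <= M & forall z, cabs z = 1 -> `|beta z| <= M.
Proof. by apply: (@cont_bounded R (@circ R)); [exact: bnd_circ|exact: clos_circ|exact: cont_beta]. Qed.

Lemma Op_ctil A : Op (@circ R) A (fun f _ => ctil f) c.
Proof.
have H := @Op_dv0 R A; split; first exact: ltW.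
- by move=> f _; exact: cont_cst.
- by move=> a f g cf cg x Ax; rewrite /ctil (Op_lin H a cf cg Ax); ring.
- move=> f M M0 cf fM x Ax; rewrite /ctil normrM (gtr0_norm c0) ler_pM2l//.
  by have := Op_bd H M0 cf fM Ax; rewrite mul1r.
Qed.

Lemma cont_inv (k : C) (a : R) A : 0 < a -> (forall x, A x -> a <= cabs x) ->
  cont A (fun x => Re (k / x)) /\ cont A (fun x => Im (k / x)).
Proof.
move=> a0 hA; have lip x y : A x -> A y -> cabs (k / x - k / y) <= cabs k / a ^+ 2 * cabs (x - y).
  move=> Ax Ay; have x0 := lt_le_trans a0 (hA x Ax); have y0 := lt_le_trans a0 (hA y Ay).
  have -> : k / x - k / y = k * (y - x) / (x * y).
    by field; rewrite -!cabs_gt0 x0 y0.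
  rewrite !cabsM cabsV cabsM (cabs_sub y x) mulrAC ler_wpM2r ?cabs_ge0// ler_wpM2l ?cabs_ge0//.
  rewrite lef_pV2 ?posrE ?mulr_gt0 ?exprn_gt0// expr2.
  by apply: ler_pM; rewrite ?(ltW a0)// hA.
split; apply: (@cont_lip _ _ (cabs k / a ^+ 2)) => x y Ax Ay; rewrite -?ReB -?ImB.
  by apply: le_trans (Re_le _) (lip _ _ Ax Ay).
by apply: le_trans (Im_le _) (lip _ _ Ax Ay).
Qed.

Lemma cont_mulc (k : C) A : cont A (fun x => Re (k * x)) /\ cont A (fun x => Im (k * x)).
Proof.
split; apply: (@cont_lip _ _ (cabs k)) => x y Ax Ay; rewrite -?ReB -?ImB -mulrBr -cabsM.
  exact: Re_le.
exact: Im_le.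
Qed.

Section Box.
Variable rr : R.
Hypotheses (rr_0 : 0 <= rr) (rr_1 : rr <= 1).
Local Notation AnC := (AnC plin poff rr).
Local Notation An := (An plin poff rr).
Local Notation Fam := (Fam plin poff rr).
Local Notation box := (box plin poff rr).

Lemma AnC_inv (k : C) : AnC ext (fun _ x => k / x) (2 * (cabs k / rp)).
Proof.
have [h1 h2] := @cont_inv k rp ext rp0 (fun x h => h).
apply: AnC_cst => //; first by rewrite divr_ge0 ?cabs_ge0// ltW.
move=> x ex; rewrite cabsM cabsV ler_wpM2l ?cabs_ge0// lef_pV2 ?posrE//.
exact: lt_le_trans rp0 ex.
Qed.

Lemma AnC_invJ (k : C) : AnC ext (fun _ x => k / x^*) (2 * (cabs k / rp)).
Proof.
have [a [b [ha hb ab]]] := AnC_inv k^*.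
exists a, b; rewrite cabsJ in ab; split=> //.
  by apply: (An_ext rr_0 ha) => // t x _ _; rewrite -ReJ conjM fmorphV conjcK.
apply: (An_ext rr_0 (An_opp rr_0 hb)) => // t x _ _.
by rewrite -ImJ conjM fmorphV conjcK.
Qed.

Lemma AnC_lin (k : C) : AnC bdin (fun _ y => k * y) (2 * (cabs k * sg)).
Proof.
have [h1 h2] := cont_mulc k bdin.
apply: AnC_cst => //; first by rewrite mulr_ge0 ?cabs_ge0// ltW.
by move=> y [_ ys]; rewrite cabsM ler_wpM2l ?cabs_ge0// ltW.
Qed.

Lemma AnC_const A (k : C) : AnC A (fun _ _ => k) (2 * cabs k).
Proof. by apply: AnC_cst => //; [exact: cont_cst|exact: cont_cst|exact: cabs_ge0]. Qed.

Lemma AnC_zL : AnC ext zL (rr * (4 * cabs pi / rp)).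
Proof.
apply: (AnC_ext rr_0 (AnC_X rr_0 0%N (AnC_inv (2 * pi)))) => //.
by rewrite cabsM cabs_nat ler_wpM2l//; rewrite le_eqVlt; apply/orP; left; apply/eqP; ring.
Qed.

Hypothesis small1 : rr * (4 * cabs pi / rp) <= 1 / 2.

Lemma AnC_zG : AnC ext zG (rr * (12 * sg / rp)).
Proof.
have ap : 0 <= cabs pi / rp by rewrite divr_ge0 ?cabs_ge0// ltW.
have h1 := AnC_X rr_0 0%N (AnC_invJ pi^*).
have h2 : AnC ext (fun t x => (1 - (co 0 t)%:C * (pi^* / x^*))^-1) 6.
  apply: (AnC_geom rr_0) h1; rewrite cabsJ; apply: le_trans small1; rewrite ler_wpM2l//.
  have -> : 4 * cabs pi / rp = 4 * (cabs pi / rp) by ring.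
  lra.
have h3 := AnC_mul rr_0 (AnC_invJ sg%:C) h2.
apply: (AnC_ext rr_0 (AnC_X rr_0 0%N (AnC_X rr_0 1%N h3))) => //.
rewrite cabs_real (gtr0_norm sgp) ler_wpM2l//.
have -> : 12 * sg / rp = 12 * (sg / rp) by ring.
have a0 : 0 <= sg / rp by rewrite divr_ge0// ltW.
have -> : rr * (2 * (sg / rp) * 6) = rr * (12 * (sg / rp)) by ring.
by rewrite ler_piMl// mulr_ge0.
Qed.

Hypothesis small2 : rr * (12 * sg / rp) <= 1 / 2.
Variables (Ml Mb : R).
Hypotheses (Ml0 : 0 <= Ml) (hMl : forall z, cabs z = 1 -> `|@vlog R z| <= Ml)
  (Mb0 : 0 <= Mb) (hMb : forall z, cabs z = 1 -> `|beta z| <= Mb).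

Lemma An_vlog A (z : V -> C -> C) (q : R) : q <= 1 / 2 -> AnC A z q -> An A (fun t x => vlog (z t x)) (2 * Ml).
Proof.
move=> q1 hz; apply: (An_ext rr_0 (An_comp_fix rr_0 q1 (@vlog_apx R) Ml0 hMl hz)).
  by move=> t x _ _; rewrite vlog0 subr0.
have : 4 * Ml * q <= 4 * Ml * (1 / 2) by rewrite ler_wpM2l// mulr_ge0.
by move: Ml0; lra.
Qed.

(** The two terms of [Gsing]; [48 = 4 * 12], from [Fam_compz] and the bound of [AnC_zG]. *)
Definition kG : R := 2 * Ml * c + 48 * sg / rp.

Lemma kG0 : 0 <= kG.
Proof.
have h1 : 0 <= 2 * Ml * c by apply: mulr_ge0; [exact: mulr_ge0 (ler0n _ 2) Ml0|exact: ltW].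
have h2 : 0 <= 48 * sg / rp by apply: divr_ge0; [exact: mulr_ge0 (ler0n _ 48) (ltW sgp)|exact: ltW].
exact: addr_ge0.
Qed.

Lemma Fam_G : Fam (@circ R) ext Gsing (rr * kG).
Proof.
have h1 := Fam_X rr_0 2 (Fam_mul rr_0 (An_vlog small1 AnC_zL) (Fam_op plin poff rr_0 (Op_ctil ext))).
have h2 := Fam_compz rr_0 small2 AnC_zG.
apply: Fam_le (Fam_add rr_0 h1 h2) => //; rewrite /kG.
by rewrite le_eqVlt; apply/orP; left; apply/eqP; ring.
Qed.

Hypotheses (small3 : rr * (12 * sg / p2) <= 1 / 2)
  (small4 : rr * (2 * (cabs pi / r)) + rr * (2 * (sg / r)) <= 1 / 2).

Lemma AnC_zP : AnC bdin zP (rr * (2 * (cabs pi / r)) + rr * (2 * (sg / r))).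
Proof.
have cr : cabs (r%:C^-1) = r^-1 by rewrite cabsV cabs_real gtr0_norm.
have h1 := AnC_X rr_0 0%N (AnC_const bdin (pi / r%:C)).
have h2 := AnC_X rr_0 0%N (AnC_X rr_0 1%N (AnC_lin r%:C^-1)).
apply: (AnC_ext rr_0 (AnC_add rr_0 h1 h2)) => [t y _ _|].
  by rewrite /zP (mulrC y).
rewrite cabsM cr lerD2l ler_wpM2l// (mulrC r^-1) ler_piMl// mulr_ge0// divr_ge0 ?(ltW sgp)//.
exact: ltW.
Qed.

Let p20 : 0 < p2. Proof. exact: pi0. Qed.

Lemma AnC_zI : AnC bdin zI (rr * (2 * (sg / p2))).
Proof.
apply: (AnC_ext rr_0 (AnC_X rr_0 1%N (AnC_lin ('i / p2%:C)))) => [t y _ _|].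
  by rewrite /zI mulrAC.
by rewrite cabsM cabs_i cabsV cabs_real gtr0_norm// mul1r (mulrC _ sg).
Qed.

Let sp0 : 0 <= sg / p2. Proof. by rewrite divr_ge0// ltW. Qed.

Let small3' (k : R) : 0 <= k -> k <= 12 -> rr * (k * (sg / p2)) <= 1 / 2.
Proof.
move=> k0 k1; apply: le_trans small3; rewrite ler_wpM2l//.
by rewrite -(mulrA 12) ler_wpM2r.
Qed.

Lemma AnC_zM : AnC bdin zM (rr * (6 * (sg / p2))).
Proof.
have c2 : cabs (2 * p2%:C) = 2 * p2 by rewrite cabsM cabs_nat cabs_real gtr0_norm.
have h1 := AnC_X rr_0 1%N (AnC_lin ('i / (2 * p2%:C))).
have h2 : AnC bdin (fun t y => (1 - (co 1 t)%:C * ('i * y / (2 * p2%:C)))^-1) 6.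
  have h3 : AnC bdin (fun t y => (co 1 t)%:C * ('i * y / (2 * p2%:C))) (rr * (1 * (sg / p2))).
    apply: (AnC_ext rr_0 h1) => [t y _ _|]; first by rewrite mulrAC.
    rewrite ler_wpM2l// cabsM cabs_i cabsV c2 mul1r le_eqVlt; apply/orP; left; apply/eqP.
    by field; rewrite gt_eqF.
  by apply: (AnC_geom rr_0) h3; apply: small3' => //; lra.
have h3 := AnC_X rr_0 1%N (AnC_mul rr_0 (AnC_const bdin (sg%:C / (2 * 'i * p2%:C))) h2).
have c2' : cabs (2 * 'i * p2%:C) = 2 * p2 by rewrite !cabsM cabs_nat cabs_i mulr1 cabs_real gtr0_norm.
apply: (AnC_ext rr_0 h3) => //; rewrite ler_wpM2l// cabsM cabsV c2' cabs_real gtr0_norm// le_eqVlt; apply/orP; left; apply/eqP.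
by field; rewrite gt_eqF.
Qed.

(** One summand for each term of [regular]. In the last, the factor 2 of [hrefl] and the argument
    bound [1 / 2] for [zP] turn [rr * kG] into [4 * (rr * kG)]. *)
Definition kN : R := c + (`|ln (2 * p2)| + 2 * Ml) * c + 24 * (sg / p2) + 4 * kG.

Lemma kN0 : 0 <= kN.
Proof.
have h1 : 0 <= (`|ln (2 * p2)| + 2 * Ml) * c by rewrite mulr_ge0 ?(ltW c0)// addr_ge0// mulr_ge0.
rewrite /kN; have := kG0; move: h1 (c0) sp0; lra.
Qed.

Lemma Fam_regular : Fam (@circ R) bdin regular (rr * kN).
Proof.
have hc := Fam_op plin poff rr_0 (Op_ctil bdin).
have h1 := Fam_scale rr_0 (- 1) (Fam_X rr_0 3 hc).
have hz : An bdin (fun t y => ln (2 * p2) + vlog (zI t y)) (`|ln (2 * p2)| + 2 * Ml).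
  apply: An_add => //; first by apply: An_cst => //; exact: cont_cst.
  by apply: An_vlog AnC_zI; apply: small3' => //; lra.
have h2 := Fam_scale rr_0 (- 1) (Fam_X rr_0 2 (Fam_mul rr_0 hz hc)).
have s3 : rr * (6 * (sg / p2)) <= 1 / 2 by apply: small3'; lra.
have h3 := Fam_scale rr_0 (- 1) (Fam_compz rr_0 s3 AnC_zM).
have hH := Fam_op plin poff rr_0 (Op_hrefl gD r10 rpr1 G1 G2).
have h4 := Fam_scale rr_0 (- 1) (Fam_comp (Fam_comp Fam_G hH) (Fam_compz rr_0 small4 AnC_zP)).
apply: Fam_le (Fam_add rr_0 h1 (Fam_add rr_0 h2 (Fam_add rr_0 h3 h4))) => //.
rewrite normrN1 !mul1r /kN.
have rk : 0 <= rr * kG by rewrite mulr_ge0 ?kG0.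
have := ler_wpM2r rk small4; move: (rr * (2 * (cabs pi / r)) + _) => q hq.
have -> : rr * (c + (`|ln (2 * p2)| + 2 * Ml) * c + 24 * (sg / p2) + 4 * kG) =
  rr * c + (rr * ((`|ln (2 * p2)| + 2 * Ml) * c) + (4 * (rr * (6 * (sg / p2))) + 4 * (rr * kG))) by ring.
by rewrite !lerD2l; move: hq; move: (rr * kG) => a; lra.
Qed.

Definition kQ : R := Mb * c + kN.

Lemma kQ0 : 0 <= kQ.
Proof. by rewrite addr_ge0 ?kN0// mulr_ge0// ltW. Qed.

(** [outer_op] is the only term without a small factor, and its bound is below 1; all others are
    [rr] times a constant independent of [rr]. *)
Lemma Fam_Q : Fam (@circ R) (@circ R) Qop (theta s0 sg + rr * kQ).
Proof.
have h1 := Fam_op plin poff rr_0 (Op_outer_op oo so s00 os osg).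
have hb : An (@circ R) (fun=> beta) Mb by apply: An_cst => //; exact: cont_beta.
have h2 := Fam_X rr_0 2 (Fam_mul rr_0 hb (Fam_op plin poff rr_0 (Op_ctil (@circ R)))).
have h3 := Fam_scale rr_0 (- 1) (Fam_comp Fam_regular (Fam_op plin poff rr_0 (Op_inner oo so s00 os osg))).
apply: Fam_le (Fam_add rr_0 h1 (Fam_add rr_0 h2 h3)) => //.
by rewrite normrN1 !mul1r /kQ (mulrDr rr (Mb * c)).
Qed.

Hypotheses (U0c : cont (oball 0 r1) U0) (U0h : forall x, cabs x < r1 -> harm U0 x)
  (gic : cont bdin gi) (small5 : rr * kQ <= (1 - theta s0 sg) / 2).

Lemma U0_apx : apx (fun z => U0 (r%:C * z)).
Proof.
have h : apx (dil 0 r U0).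
  apply: harm_apx => //.
    by apply: cont_sub U0c => x; rewrite /cball/oball/= => h; move: r10; lra.
  by move=> x; rewrite /oball/= subr0 => h; apply: U0h; move: r10; lra.
by apply: apx_eq h => z _; rewrite /dil add0r.
Qed.

Lemma An_datum : exists N, An bdin datum N.
Proof.
have aU := U0_apx; have [M M0 hM] : exists2 M : R, 0 <= M & forall z, circ z -> `|U0 (r%:C * z)| <= M.
  apply: cont_bounded; [exact: bnd_circ|exact: clos_circ|].
  by apply: cont_sub (apx_cont aU) => z z1; rewrite /cball/= subr0 z1.
have [Mg Mg0 hMg] : exists2 M : R, 0 <= M & forall y, bdin y -> `|gi y| <= M.
  apply: cont_bounded gic; first by exists sg => y [_ /ltW].
  move=> y cy.
  have by_ : bd (ann om sg) y.
    have [oD _ _] := good_ann oo so s00 os osg; apply: (clos_bd oD).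
    by apply: clos_mono cy => x [].
  split=> //; rewrite ltNge; apply/negP => h.
  have yE := bd_ann oo osg by_ ltac:(by rewrite -leNgt).
  have [x [_ xs] xy] := cy sg sgp.
  by have := cabs_leD y x; rewrite cabs_sub yE /rho; lra.
have h1 := An_comp_fix rr_0 small4 aU M0 hM AnC_zP.
have h2 : An bdin (fun=> fun y => gi y - U0 (r%:C * 0)) (Mg + `|U0 (r%:C * 0)|).
  apply: An_cst; first exact: addr_ge0.
    by apply: contB => //; exact: cont_cst.
  move=> y by_; apply: le_trans (ler_normB _ _) _; rewrite lerD2r; exact: hMg.
eexists; apply: (An_ext rr_0 (An_add rr_0 h2 (An_opp rr_0 h1))) => // t y _ _.
by rewrite /datum; ring.
Qed.

Theorem solution_exists : exists F N, An (@circ R) F N /\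
  forall t z, box t -> circ z -> F t z = inner_op om sg (datum t) z + Qop t (F t) z.
Proof.
have [N hN] := An_datum; have hd := An_op rr_0 (Op_inner oo so s00 os osg) hN.
have [t0 t1] := theta_lt1 s00 os osg.
(* [small5] leaves a contraction factor of at most [(1 + theta s0 sg) / 2]. *)
have [||F [hF hE]] := Fam_fix rr_0 _ _ Fam_Q hd.
- by rewrite addr_ge0// mulr_ge0 ?kQ0.
- by move: small5; lra.
by exists F; eexists; split; [exact: hF|exact: hE].
Qed.
End Box.
End Equation.

(** * The solution in the perforated domain *)

Section Verification.
Variable R : realType.
Local Notation C := R[i].
Local Notation Re := (@complex.Re R).
Local Notation Im := (@complex.Im R).
Local Notation V := ((R * R) * (R * R))%type.
Implicit Types (A B D E : set C) (g u v w : C -> R) (x y z : C).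
Variables (lam : R) (D om : set C) (r1 rp s0 sg : R) (pi : C) (U0 gi : C -> R).
Hypotheses (lam1 : lam < 1).
Hypotheses (gD : good D) (r10 : 0 < r1) (rp0 : 0 < rp) (rpr1 : rp < r1)
  (G1 : forall x, cabs x < r1 -> 0 < Im x -> D x) (G2 : forall x, D x -> 0 < Im x).
Hypotheses (oo : opn om) (so : forall x, bd om x -> sector (~` om) x) (s00 : 0 < s0)
  (os : cball 0 s0 `<=` om) (osg : forall x, clos om x -> cabs x < sg).
Hypotheses (pi0 : 0 < Im pi).
Local Notation co := (co (@plin R) (poff lam)).
Local Notation ext := (ext rp).
Local Notation bdin := (bdin om sg).
Local Notation r := (r1 / 2).
Variables (t : V) (f : C -> R).
Local Notation e1 := (co 0%N t).
Local Notation e2 := (co 1%N t).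
Local Notation d1 := (co 2%N t).
Local Notation mu := (co 3%N t).
Let rho := 2 * sg.
Let p2 := Im pi.
Let e := e1 * e2.
Let ct := ctil lam f.
Let Gs := Gsing lam sg pi t f.
Let H := hsol D r1 Gs.
Hypotheses (e10 : 0 < e1) (e20 : 0 < e2) (rel : d1 * ln e2 = 1 - lam - mu).
Hypotheses (sm2 : e2 * (24 * sg) <= p2) (smp : e1 * cabs pi <= rp / 8) (sme : e * sg <= rp / 24)
  (smr : e1 * cabs pi + e * (2 * sg) <= r1 / 4).
Hypotheses (cf : cont (@circ R) f) (cG : cont ext Gs) (cR : cont bdin (regular lam D r1 sg pi t f))
  (cD : cont bdin (datum lam r1 pi U0 gi t))
  (fE : forall z, circ z -> f z = inner_op om sg (datum lam r1 pi U0 gi t) z +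
     Qop lam D om r1 sg pi t f z).

Let sgp : 0 < sg. Proof. exact: (sg0 s00 os osg). Qed.
Let p20 : 0 < p2. Proof. exact: pi0. Qed.
Let e0 : 0 < e. Proof. exact: mulr_gt0. Qed.
Let ctE : ct * (1 - lam) = dv f 0.
Proof. by rewrite /ct /ctil mulrAC mulVf ?mul1r// gt_eqF// subr_gt0. Qed.

Definition Xm y : C := e1%:C * pi + e%:C * y.
Definition Ym x : C := (e^-1)%:C * (x - e1%:C * pi).
(** The rescaling about the mirror image of the centre, in which the reflected singular part is
    written. *)
Definition Y2m x : C := (e^-1)%:C * (x - e1%:C * pi^*).

Let eC : e%:C != 0 :> C. Proof. by rewrite -cabs_gt0 cabs_real gtr0_norm. Qed.
Let eV : (e^-1)%:C = e%:C^-1 :> C. Proof. by rewrite fmorphV. Qed.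
Let eV0 : 0 < e^-1. Proof. by rewrite invr_gt0. Qed.

Lemma XmK y : Ym (Xm y) = y.
Proof. by rewrite /Ym /Xm addrAC subrr add0r eV mulrA mulVf// mul1r. Qed.

Lemma YmK x : Xm (Ym x) = x.
Proof. by rewrite /Ym /Xm eV mulrA mulfV// mul1r addrC subrK. Qed.

Lemma cabs_YmB x y : cabs (Ym x - Ym y) = e^-1 * cabs (x - y).
Proof. by rewrite /Ym -mulrBr opprB addrA subrK cabsZ gtr0_norm. Qed.

Lemma cabs_XmB x y : cabs (Xm x - Xm y) = e * cabs (x - y).
Proof. by rewrite /Xm opprD addrACA subrr add0r -mulrBr cabsZ gtr0_norm. Qed.

Lemma Im_Xm y : Im (Xm y) = e1 * (p2 + e2 * Im y).
Proof. by rewrite /Xm ImD !ImZ /e; ring. Qed.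

Lemma Xm_upper y : cabs y <= rho -> 0 < Im (Xm y).
Proof.
move=> yr; rewrite Im_Xm mulr_gt0//; have := Im_le y.
have : e2 * cabs y <= e2 * rho by rewrite ler_pM2l.
have : e2 * - cabs y <= e2 * Im y.
  by rewrite ler_pM2l//; have := Im_le y; rewrite ler_norml => /andP[].
by move: sm2 (p20); rewrite /rho; lra.
Qed.

Lemma Xm_small y : cabs y <= rho -> cabs (Xm y) <= r1 / 4.
Proof.
move=> yr; apply: le_trans smr; apply: le_trans (cabsD _ _) _.
by rewrite !cabs_scale// lerD2l ler_pM2l.
Qed.

Lemma Xm_D y : cabs y <= rho -> D (Xm y).
Proof. by move=> yr; apply: G1 (Xm_upper yr); have := Xm_small yr; move: r10; lra. Qed.

Lemma far_Ym x : rp <= cabs x -> sg < cabs (Ym x).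
Proof.
move=> xr; rewrite ltNge; apply/negP => h.
have : cabs (Xm (Ym x)) <= e1 * cabs pi + e * sg.
  apply: le_trans (cabsD _ _) _; rewrite (@cabs_scale R _ pi e10) (@cabs_scale R _ (Ym x) e0).
  by rewrite lerD2l ler_pM2l.
by rewrite YmK; move: smp sme rp0 xr; lra.
Qed.

Lemma Y2m_far x : 0 <= Im x -> sg < cabs (Y2m x).
Proof.
move=> x0; rewrite cabs_scale// mulrC ltr_pdivlMr//.
have h : e1 * p2 <= cabs (x - e1%:C * pi^*).
  apply: le_trans (Im_le _); apply: le_trans (ler_norm _).
  by rewrite ImB ImZ ImJ -/p2 mulrN opprK lerDr.
apply: lt_le_trans h; rewrite /e mulrCA ltr_pM2l//.
by rewrite mulrC; move: sm2 (p20) (mulr_gt0 e20 sgp); lra.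
Qed.

Lemma Y2m_conj x : Y2m x = (Ym x^*)^*.
Proof.
by rewrite /Y2m /Ym; apply: complex_ext; rewrite ?ReJ ?ImJ ?ReZ ?ImZ ?ReB ?ImB ?ReJ ?ImJ ?ReZ ?ImZ ?ReJ ?ImJ; ring.
Qed.

Lemma harm_ln_shift (a : C) x : x != a -> harm (fun x => ln (cabs (x - a))) x.
Proof.
move=> xa; have := @harm_scale R (fun x => ln (cabs x)) (- a) 1 x (oner_neq0 R).
have -> : (fun z => ln (cabs (- a + 1%:C * z))) = fun x => ln (cabs (x - a)).
  by apply/funext => z; rewrite mul1r addrC.
by apply; apply: harm_ln; rewrite mul1r addrC subr_eq0.
Qed.

Lemma cont_ln_shift A (a : C) : (forall x, A x -> x != a) -> cont A (fun x => ln (cabs (x - a))).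
Proof.
move=> hA; apply: (@cont_shift R _ [set x | x != 0] (fun x => ln (cabs x)) (fun x => x - a) 1) => //.
- exact: cont_ln_cabs.
- by move=> x /hA; rewrite /= subr_eq0.
- by move=> x y _ _; rewrite opprB addrA subrK mul1r.
Qed.

Let af : apx (dv f). Proof. by have [] := dvP cf. Qed.

Lemma taylor3_Y2m x : Y2m x != 0 -> taylor3 (fun x => sg%:C * (Y2m x)^-1) x.
Proof.
move=> nx; apply: taylor3M; first exact: taylor3_cst.
have := @taylor3_affine R (fun z => z^-1) (e^-1)%:C (- ((e^-1)%:C * (e1%:C * pi^*))) x.
have -> : (fun z => ((e^-1)%:C * z + - ((e^-1)%:C * (e1%:C * pi^*)))^-1) = fun x => (Y2m x)^-1.
  by apply/funext => z; rewrite /Y2m mulrBr.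
by apply; apply: taylor3V; rewrite -mulrBr.
Qed.

Lemma Y2m_arg x : 0 <= Im x -> cabs (sg%:C * (Y2m x)^-1) <= 1 /\ taylor3 (fun x => sg%:C * (Y2m x)^-1) x.
Proof.
move=> /Y2m_far h; have h0 : 0 < cabs (Y2m x) by exact: lt_trans sgp h.
split; last by apply: taylor3_Y2m; rewrite -cabs_gt0.
by rewrite cabsM cabsV cabs_real (gtr0_norm sgp) ler_pdivrMr// mul1r ltW.
Qed.

Let Dup x : clos D x -> 0 <= Im x. Proof. exact: (clos_upper G2). Qed.
Let oD : opn D. Proof. by case: gD. Qed.

Let H_props : [/\ cont (clos D) H, forall x, D x -> harm H x & forall x, bd D x -> H x = Gs x - Gs x^*].
Proof. exact: (hsolP gD rpr1 G1 G2 cG). Qed.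

(** The terms of [wout] that are harmonic in all of [D], because their singularities lie at the
    mirror image below the axis; adding logarithm and multipoles at the hole itself gives [wout]. *)
Definition N0 x : R := (- (ct * mu) - d1 * ct * (ln (cabs (x - e1%:C * pi^*)) - ln e1)) -
  ((dv f (sg%:C * (Y2m x)^-1) - dv f 0) + H x).

Let ne2 x : 0 <= Im x -> x != e1%:C * pi^*.
Proof.
move=> x0; apply/eqP => h; move: x0; rewrite h ImZ ImJ mulrN oppr_ge0 leNgt.
by rewrite mulr_gt0.
Qed.

Lemma N0_cont : cont (clos D) N0.
Proof.
have [h1 h2 h3] := H_props; apply: contB; [apply: contB; [exact: cont_cst|]|apply: contD => //].
  apply: contZ; apply: contB; last exact: cont_cst.
  by apply: cont_ln_shift => x /Dup; exact: ne2.
apply: contB; last exact: cont_cst.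
by apply: comp_cont => // x /Dup; exact: Y2m_arg.
Qed.

Lemma N0_harm x : D x -> harm N0 x.
Proof.
move=> Dx; have [h1 h2 h3] := H_props.
have x0 : 0 <= Im x by exact/Dup/sub_clos.
apply: harmB; [apply: harmB; [exact: harm_cst|]|apply: harmD; last exact: h2].
  by apply: harmZ; apply: harmB; [apply: harm_ln_shift; exact: ne2|exact: harm_cst].
apply: harmB; last exact: harm_cst.
by apply: (@comp_harm R D) => // y Dy; apply: Y2m_arg; exact/Dup/sub_clos.
Qed.

Definition wout x : R := N0 x + (d1 * ct * ln (cabs (Ym x)) + dv f (sg%:C / (Ym x)^*)).

Let cYm A B g : cont B g -> (forall x, A x -> B (Ym x)) -> cont A (fun x => g (Ym x)).
Proof.
move=> cg hA; apply: (@cont_shift R _ B g Ym e^-1) => // x y _ _.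
by rewrite cabs_YmB.
Qed.

Let hYm E g x : opn E -> cont E g -> (forall y, E y -> harm g y) -> E (Ym x) -> harm (fun x => g (Ym x)) x.
Proof.
move=> oE cg hg Ex.
have YE z : Ym z = - ((e^-1)%:C * (e1%:C * pi)) + (e^-1)%:C * z by rewrite /Ym mulrBr addrC.
have -> : (fun x => g (Ym x)) = fun z => g (- ((e^-1)%:C * (e1%:C * pi)) + (e^-1)%:C * z).
  by apply/funext => z; rewrite YE.
apply: (harm_affine oE cg hg); last by rewrite -YE.
by rewrite -cabs_gt0 cabs_real gtr0_norm.
Qed.

Let hXm E g x : opn E -> cont E g -> (forall y, E y -> harm g y) -> E (Xm x) -> harm (fun x => g (Xm x)) x.
Proof. by move=> oE cg hg Ex; exact: (harm_affine oE cg hg). Qed.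

Let cXm A B g : cont B g -> (forall x, A x -> B (Xm x)) -> cont A (fun x => g (Xm x)).
Proof.
move=> cg hA; apply: (@cont_shift R _ B g Xm e) => // x y _ _.
by rewrite cabs_XmB.
Qed.

Definition exterior : set C := [set y | sg < cabs y].

Let opn_exterior : opn exterior.
Proof.
move=> x xs; exists (cabs x - sg); first by rewrite subr_gt0.
by move=> z zx; rewrite /exterior/=; have := cabs_leD x z; rewrite cabs_sub; lra.
Qed.

Let multipole y : R := d1 * ct * ln (cabs y) + dv f (sg%:C / y^*).

Let multipole_cont A : (forall y, A y -> sg <= cabs y) -> cont A multipole.
Proof.
move=> hA; apply: contD; last exact: (kelvin_cont s00 os osg cf hA).
apply: contZ; apply: cont_ln_cabs => y /hA h; rewrite -cabs_gt0.
exact: lt_le_trans h.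
Qed.

Let multipole_harm y : sg < cabs y -> harm multipole y.
Proof.
move=> ys; apply: harmD; last exact: (kelvin_harm s00 os osg).
by apply: harmZ; apply: harm_ln; rewrite -cabs_gt0; exact: lt_trans ys.
Qed.

Lemma wout_cont A : (forall x, A x -> clos D x /\ sg <= cabs (Ym x)) -> cont A wout.
Proof.
move=> hA; apply: contD; first by apply: cont_sub N0_cont => x /hA[].
apply: (@cYm _ [set y | sg <= cabs y] multipole); last by move=> x /hA[].
by apply: multipole_cont.
Qed.

Lemma wout_harm x : D x -> sg < cabs (Ym x) -> harm wout x.
Proof.
move=> Dx xs; apply: harmD; first exact: N0_harm.
apply: (@hYm exterior multipole) => //.
by apply: multipole_cont => y /ltW.
Qed.

Lemma ln_Ym x : x != e1%:C * pi -> ln (cabs (Ym x)) = ln (cabs (x - e1%:C * pi)) - ln e1 - ln e2.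
Proof.
move=> nx; have c0 : 0 < cabs (x - e1%:C * pi) by rewrite cabs_gt0 subr_eq0.
rewrite cabs_scale// lnM ?posrE// lnV ?posrE// lnM ?posrE//; ring.
Qed.

Let Ym_ne x : sg <= cabs (Ym x) -> x != e1%:C * pi.
Proof.
move=> h; apply/eqP => xe; move: h; rewrite /Ym xe subrr mulr0 cabs0 leNgt.
by rewrite sgp.
Qed.

(** Here the logarithms of the parameters disappear. The constants left over are [dv f 0],
    [- ct * mu] and [- d1 * ct * ln e2]; they add up to 0 by the normalisation of [ct] and by [rel].
    What remains is odd under reflection, up to the correction [H]. *)
Lemma woutE x : sg <= cabs (Ym x) -> wout x =
  d1 * ct * (ln (cabs (x - e1%:C * pi)) - ln (cabs (x - e1%:C * pi^*))) +
  (dv f (sg%:C / (Ym x)^*) - dv f (sg%:C * (Y2m x)^-1)) - H x.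
Proof.
move=> xs; rewrite /wout /N0 (ln_Ym (Ym_ne xs)) -ctE.
have h2 : d1 * ct * ln e2 = ct * (1 - lam - mu) by rewrite -rel; ring.
have -> : ct * mu = ct * (1 - lam) - d1 * ct * ln e2 by rewrite h2; ring.
ring.
Qed.

Lemma zGE x : x != 0 -> zG lam sg pi t x = sg%:C / (Ym x)^*.
Proof.
move=> nx; rewrite /zG; have xc : x^* != 0 by rewrite -cabs_eq0 cabsJ cabs_eq0.
have -> : (Ym x)^* = e%:C^-1 * (x^* * (1 - e1%:C * (pi^* / x^*))).
  have -> : x^* * (1 - e1%:C * (pi^* / x^*)) = x^* - e1%:C * pi^* by field.
  by rewrite -eV; apply: complex_ext; rewrite ?ReJ ?ImJ ?ReZ ?ImZ ?ReB ?ImB ?ReJ ?ImJ ?ReZ ?ImZ ?ReJ ?ImJ; ring.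
rewrite !invfM invrK /e rmorphM/=; ring.
Qed.

Lemma vlogE x : x != 0 -> x != e1%:C * pi ->
  vlog (zL lam pi t x) = ln (cabs (x - e1%:C * pi)) - ln (cabs x).
Proof.
move=> x0 nx; rewrite /vlog /zL -ln_div ?posrE ?cabs_gt0 ?subr_eq0//.
have two : (2 : C) != 0 by rewrite pnatr_eq0.
by rewrite -cabsV -cabsM; congr (ln (cabs _)); field; rewrite ?two ?x0.
Qed.

(** The terms [ln (cabs x)] and [dv f 0] subtracted inside [Gsing] to make it analytic are invariant
    under conjugation, so they drop out of the difference of [Gs] at [x] and at its conjugate. *)
Lemma wout_G x : x != 0 -> 0 <= Im x -> sg <= cabs (Ym x) -> wout x = Gs x - Gs x^* - H x.
Proof.
move=> x0 xi xs; have xc : x^* != 0 by rewrite -cabs_eq0 cabsJ cabs_eq0.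
have nxc : x^* != e1%:C * pi.
  by apply: contra_neq (ne2 xi) => h; rewrite -[x]conjcK h; apply: complex_ext; rewrite ?ReJ ?ImJ ?ReZ ?ImZ ?ReJ ?ImJ; ring.
rewrite woutE// /Gs /Gsing !vlogE ?(Ym_ne xs)// !zGE// -Y2m_conj cabsJ.
have -> : cabs (x^* - e1%:C * pi) = cabs (x - e1%:C * pi^*).
  rewrite -cabsJ; congr cabs; apply: complex_ext; rewrite ?ReJ ?ImJ ?ReB ?ImB ?ReJ ?ImJ ?ReZ ?ImZ ?ReJ ?ImJ; ring.
rewrite -/ct; ring.
Qed.

Lemma bd_far x : ~ D x -> rho < cabs (Ym x).
Proof.
by move=> nx; rewrite ltNge; apply/negP => h; apply: nx; rewrite -(YmK x); exact: Xm_D.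
Qed.

(** On the real axis every term equals its mirror image, including at 0 where [Gs] is of no use. On
    the rest of the boundary [H] was built to cancel the difference. *)
Lemma wout_bd x : bd D x -> wout x = 0.
Proof.
move=> bx; have [cx nx] := bx; have [_ _ hH] := H_props.
have xs : sg <= cabs (Ym x) by have := bd_far nx; rewrite /rho; move: (sgp); lra.
have := Dup cx; rewrite le_eqVlt => /orP[/eqP/esym x0|x0].
  rewrite woutE// hH// Y2m_conj (conj_axis x0) !subrr subr0 addr0.
  have -> : x - e1%:C * pi^* = (x - e1%:C * pi)^*.
    rewrite -{1}(conj_axis x0); apply: complex_ext; rewrite ?ReJ ?ImJ ?ReB ?ImB ?ReJ ?ImJ ?ReZ ?ImZ ?ReJ ?ImJ; ring.
  by rewrite cabsJ subrr mulr0.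
rewrite wout_G//; [by rewrite hH// subrr| |exact: ltW].
by apply: contraTneq x0 => ->; rewrite ltxx.
Qed.

(** The log of the distance to the reflected centre splits as [ln e1 + ln (2 * p2) + vlog (zI y)].
    Positive parameters keep [zP] in the closed upper half disc, where the odd reflection is the
    original correction. *)
Lemma regularE y : bdin y -> regular lam D r1 sg pi t f y = N0 (Xm y).
Proof.
move=> [_ ys]; have yr : cabs y <= rho by rewrite /rho; move: (sgp); lra.
have pC : p2%:C != 0 :> C by rewrite -cabs_gt0 cabs_real gtr0_norm.
have e1C : e1%:C != 0 :> C by rewrite -cabs_gt0 cabs_real gtr0_norm.
have e2C : e2%:C != 0 :> C by rewrite -cabs_gt0 cabs_real gtr0_norm.
have iC : 'i != 0 :> C by rewrite -cabs_gt0 cabs_i.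
have two : (2 : C) != 0 by rewrite pnatr_eq0.
have i2 : 'i * 'i = -1 :> C by apply: complex_ext; rewrite ?ReM ?ImM /=; ring.
have pE : pi - pi^* = 2 * 'i * p2%:C.
  apply: complex_ext; rewrite ?ReB ?ImB ?ReM ?ImM ?ReM ?ImM ?ReJ ?ImJ /=; first by ring.
  by rewrite -/p2; ring.
have XE : Xm y - e1%:C * pi^* = e1%:C * (2 * 'i * p2%:C + e2%:C * y).
  by rewrite -pE /Xm /e rmorphM/=; ring.
have ZE : 2 * 'i * p2%:C + e2%:C * y = 'i * (2 * p2%:C) * (1 - zI lam pi t y / 2).
  have -> : zI lam pi t y / 2 = e2%:C * ('i * y) / (2 * p2%:C) by rewrite /zI -/p2; field; rewrite ?two ?pC.
  have -> : 'i * (2 * p2%:C) * (1 - e2%:C * ('i * y) / (2 * p2%:C)) = 2 * 'i * p2%:C - 'i * 'i * (e2%:C * y).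
    by field; rewrite ?two ?pC.
  by rewrite i2 mulN1r opprK.
have Zpos : 0 < cabs (1 - zI lam pi t y / 2).
  rewrite cabs_gt0; apply/eqP => h; have := ne2 (ltW (Xm_upper yr)).
  by rewrite -subr_eq0 XE ZE h !mulr0 eqxx.
have lnE : ln (cabs (Xm y - e1%:C * pi^*)) - ln e1 = ln (2 * p2) + vlog (zI lam pi t y).
  rewrite XE ZE !cabsM !cabs_real cabs_i cabs_nat mul1r !gtr0_norm//.
  by rewrite lnM ?posrE ?mulr_gt0// lnM ?posrE ?mulr_gt0// /vlog; ring.
have ME : zM lam sg pi t y = sg%:C * (Y2m (Xm y))^-1.
  have -> : Y2m (Xm y) = e2%:C^-1 * ((2 * 'i * p2%:C) * (1 - e2%:C * ('i * y / (2 * p2%:C)))).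
    by rewrite /Y2m XE eV /e rmorphM/= ZE /zI -/p2; field; rewrite ?two ?pC ?e1C ?e2C.
  by rewrite /zM -/p2 !invfM invrK; ring.
have PE : r%:C * zP lam r1 pi t y = Xm y.
  have rC : r%:C != 0 :> C by rewrite -cabs_gt0 cabs_real gtr0_norm// divr_gt0.
  by rewrite /zP /Xm; move: rC; move: r%:C => a a0; rewrite /e rmorphM/=; field.
have r0 : 0 < r by rewrite divr_gt0.
have P1 : cabs (zP lam r1 pi t y) <= 1.
  have := Xm_small yr; rewrite -PE cabs_scale// => h.
  by rewrite -(ler_pM2l r0) mulr1; move: h r10; lra.
have P2 : 0 <= Im (zP lam r1 pi t y).
  by have := ltW (Xm_upper yr); rewrite -PE ImZ pmulr_rge0.
rewrite /regular (dv_hrefl gD r10 rpr1 G1 G2 cG P1 P2) PE ME /N0 lnE -/H -/ct; ring.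
Qed.

Local Notation ann := (ann om sg).
Let gA : good ann. Proof. exact: good_ann oo so s00 os osg. Qed.
Let oA : opn ann. Proof. by case: gA. Qed.
Let bA : bnd ann. Proof. by case: gA. Qed.

Lemma clos_ann_le y : clos ann y -> cabs y <= rho.
Proof.
move=> cy; have : clos (oball 0 rho) y by apply: clos_mono cy => x [].
by move/clos_oball; rewrite /cball/= subr0.
Qed.

Definition bdata : C -> R := glue sg (fun y => gi y - U0 (Xm y)) (fun y => wout (Xm y)).
Definition win : C -> R := dir ann bdata.

Let PE y : r%:C * zP lam r1 pi t y = Xm y.
Proof.
have rC : r%:C != 0 :> C by rewrite -cabs_gt0 cabs_real gtr0_norm// divr_gt0.
by rewrite /zP /Xm; move: rC; move: r%:C => a a0; rewrite /e rmorphM/=; field.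
Qed.

Let datumE y : datum lam r1 pi U0 gi t y = gi y - U0 (Xm y).
Proof. by rewrite /datum PE. Qed.

Lemma bdata_cont : cont (bd ann) bdata.
Proof.
apply: (cont_glue oo s00 os osg).
  by apply: cont_eq cD => y _; exact: datumE.
apply: (@cXm _ [set x | clos D x /\ sg <= cabs (Ym x)] wout); first by apply: wout_cont.
move=> y /= yr; rewrite XmK yr; split; last by rewrite /rho; move: (sgp); lra.
by apply/sub_clos/Xm_D; rewrite yr.
Qed.

Let win_props := dirP gA bdata_cont.

(** The equation for [f] is used here and nowhere else in the matching: it says that the trace of
    the annular solution on the middle circle is that of the exterior representation. *)
Lemma win_mid y : cabs y = sg -> win y = wout (Xm y).
Proof.
move=> ys; have [w1 w2 w3] := win_props.
have in1 g : cont bdin g -> cont (bd ann) (glue sg g (fun=> 0)) by exact: (Op_cont (Op_in oo s00 os osg)).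
have [a1 a2 a3] := dirP gA (in1 _ cD); have [b1 b2 b3] := dirP gA (in1 _ cR).
have [q1 q2 q3] := dirP gA (Op_cont (Op_outer oo s00 os osg) cf).
have cone : cont (bd ann) (glue sg (fun=> 0) (fun=> 1)).
  by apply: (cont_glue oo s00 os osg); exact: cont_cst.
have [c1 c2 c3] := dirP gA cone.
pose M y := win y - N0 (Xm y) - d1 * ct * ln sg.
(* The right hand side of the equation before restriction to the middle circle. It has the same
   boundary values as [M] on the hole and on the outer circle, so uniqueness identifies the two. *)
pose M2 y := dir ann (glue sg (datum lam r1 pi U0 gi t) (fun=> 0)) y + (dir ann (outer sg f) y +
   (d1 * ct * (ln rho * dir ann (glue sg (fun=> 0) (fun=> 1)) y - ln sg) -
    dir ann (glue sg (regular lam D r1 sg pi t f) (fun=> 0)) y)).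
have Xcl y' : clos ann y' -> D (Xm y') by move=> /clos_ann_le/Xm_D.
have MM y' : clos ann y' -> M2 y' = M y'.
  apply: (harm_uniq oA bA).
  - apply: contD => //; apply: contD => //; apply: contB => //; apply: contZ.
    by apply: contB; [exact: contZ|exact: cont_cst].
  - apply: contB; last exact: cont_cst.
    by apply: contB => //; apply: (@cXm _ (clos D) N0) => [|x /Xcl/sub_clos//]; exact: N0_cont.
  - move=> x ax; apply: harmD; first exact: a2.
    apply: harmD; first exact: q2.
    apply: harmB; last exact: b2.
    by apply: harmZ; apply: harmB; [apply: harmZ; exact: c2|exact: harm_cst].
  - move=> x ax; apply: harmB; last exact: harm_cst.
    apply: harmB; first exact: w2.
    apply: (@hXm D N0) => //; [by apply: cont_sub N0_cont; exact: sub_clos|exact: N0_harm|].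
    exact/Xcl/sub_clos.
  - move=> x bx; rewrite /M2 /M /win a3// b3// q3// c3// w3// /bdata /outer /glue; case: ifPn => xs.
      by rewrite datumE regularE//; ring.
    have xr := bd_ann oo osg bx xs; rewrite /wout XmK xr -/rho; ring.
have yC : circ (sg%:C^-1 * y) by rewrite /circ/= cabsM cabsV cabs_real (gtr0_norm sgp) ys mulVf// gt_eqF.
have sC : sg%:C != 0 :> C by rewrite -cabs_gt0 cabs_real gtr0_norm.
have yE : sg%:C * (sg%:C^-1 * y) = y by rewrite mulrA mulfV// mul1r.
have cy : clos ann y.
  by apply/sub_clos/(ann_mid osg); rewrite ys /rho//; move: (sgp); lra.
have : f (sg%:C^-1 * y) = M y.
  rewrite -(MM _ cy) fE// /Qop /beta /inner_op /outer_op yE /M2 -/rho -/ct; ring.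
move=> h; rewrite /wout XmK (kelvin_unit s00 os osg cf ys) h /M ys; ring.
Qed.

(** Both functions are harmonic between the circles of radius [sg] and [rho]; they agree on the
    first by [win_mid] and on the second by construction. *)
Lemma win_wout y : sg < cabs y -> cabs y < rho -> win y = wout (Xm y).
Proof.
move=> y1 y2; have [w1 w2 w3] := win_props.
pose E : set C := exterior `&` oball 0 rho.
have oE : opn E by apply: opnI => //; exact: opn_oball.
have bE : bnd E by apply: bnd_sub (@bnd_oball R 0 rho) => x [].
have EA : E `<=` ann.
  by move=> x [x1 x2]; apply: (ann_mid osg); [exact: ltW|rewrite /oball/= subr0 in x2].
have cE x : clos E x -> sg <= cabs x /\ cabs x <= rho.
  move=> cx; split; last by apply: clos_ann_le; apply: clos_mono cx.
  rewrite leNgt; apply/negP => h; have [z [z1 _] zx] := cx (sg - cabs x) ltac:(by rewrite subr_gt0).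
  by move: z1; rewrite /exterior/=; have := cabs_leD z x; lra.
apply: (@harm_uniq R E win (fun y => wout (Xm y)) oE bE) => [||||x [cx nx]|].
- by apply: cont_sub w1; exact: clos_mono.
- apply: (@cXm _ [set x | clos D x /\ sg <= cabs (Ym x)] wout); first by apply: wout_cont.
  by move=> x /cE[x1 x2] /=; rewrite XmK; split=> //; exact/sub_clos/Xm_D.
- by move=> x /EA; exact: w2.
- move=> x Ex; have [x1 x2] := cE _ (sub_clos Ex).
  apply: (@hXm (D `&` [set x | sg < cabs (Ym x)]) wout).
  + apply: opnI => // z zs; exists (e * (cabs (Ym z) - sg)); first by rewrite mulr_gt0// subr_gt0.
    move=> q qz /=; have := cabs_leD (Ym z) (Ym q); rewrite cabs_YmB cabs_sub.
    by have : e^-1 * cabs (q - z) < cabs (Ym z) - sg; [rewrite mulrC ltr_pdivrMr// mulrC|lra].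
  + by apply: wout_cont => z [Dz /ltW]; split=> //; exact: sub_clos.
  + by move=> z [Dz]; exact: wout_harm.
  + by split; [exact: Xm_D|rewrite /= XmK; case: Ex].
- have [x1 x2] := cE _ cx; have [xs|xs] := ltP sg (cabs x); last by apply: win_mid; lra.
  have xr : cabs x = rho.
    apply/eqP; rewrite eq_le x2 leNgt; apply/negP => h; apply: nx.
    by split=> //; rewrite /oball/= subr0.
  have bx : bd ann x.
    split; first by apply: clos_mono cx.
    by move=> [+ _]; rewrite /oball/= subr0 xr ltxx.
  by rewrite /win w3// /bdata /glue ltNge x1.
- by apply: sub_clos; split=> //; rewrite /oball/= subr0.
Qed.

Definition perf : set C := D `\` [set x | clos om (Ym x)].
(** Switching at [3 / 2 * sg], strictly between the radii where the two formulas agree, makes a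
    single formula valid near each point. *)
Definition wsol x : R := if cabs (Ym x) < 3 / 2 * sg then win (Ym x) else wout x.

Lemma wsol_out x : sg < cabs (Ym x) -> wsol x = wout x.
Proof.
move=> xs; rewrite /wsol; case: ifP => // h.
rewrite win_wout ?YmK// /rho; move: h (sgp); lra.
Qed.

Lemma opn_perf : opn perf.
Proof.
move=> x [Dx nx]; have [d d0 hd] := oD Dx.
have [s s0' hs] : exists2 s : R, 0 < s & forall y, cabs (y - Ym x) < s -> ~ clos om y.
  apply: contrapT => h; apply: nx => s s0'.
  have [y [yx cy]] : exists y, cabs (y - Ym x) < s / 2 /\ clos om y.
    apply: contrapT => h'; apply: h; exists (s / 2); first by rewrite divr_gt0.
    by move=> y yx cy; apply: h'; exists y.
  have [z oz zy] := cy (s / 2) (divr_gt0 s0' (ltr0Sn R 1)); exists z => //.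
  by have := cabs_tri z y (Ym x); lra.
exists (Num.min d (e * s)); first by rewrite lt_min d0 mulr_gt0.
move=> y; rewrite lt_min => /andP[/hd Dy yx]; split=> //=; apply: hs.
by rewrite cabs_YmB mulrC ltr_pdivrMr// mulrC.
Qed.

Lemma perf_ann x : perf x -> cabs (Ym x) < rho -> ann (Ym x).
Proof. by move=> [_ nx] xr; split=> //; rewrite /oball/= subr0. Qed.

Lemma clos_perf x : clos perf x -> cabs (Ym x) < rho -> clos ann (Ym x).
Proof.
move=> cx xr d d0; pose d' := Num.min d (rho - cabs (Ym x)).
have d'0 : 0 < d' by rewrite lt_min d0 subr_gt0.
have [y py yx] := cx (e * d') (mulr_gt0 e0 d'0).
have h : cabs (Ym y - Ym x) < d' by rewrite cabs_YmB mulrC ltr_pdivrMr// mulrC.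
move: h; rewrite lt_min => /andP[h1 h2]; exists (Ym y) => //.
by apply: perf_ann => //; have := cabs_leD (Ym y) (Ym x); lra.
Qed.

Lemma wsol_cont : cont (clos perf) wsol.
Proof.
have [w1 w2 w3] := win_props.
move=> x cx d d0; have [xs|xs] := ltP (cabs (Ym x)) (3 / 2 * sg).
  have xr : cabs (Ym x) < rho by rewrite /rho; move: (sgp); lra.
  have [s s0' hs] := w1 _ (clos_perf cx xr) d d0.
  exists (e * Num.min s (3 / 2 * sg - cabs (Ym x))).
    by rewrite mulr_gt0// lt_min s0' subr_gt0.
  move=> y cy yx; have h : cabs (Ym y - Ym x) < Num.min s (3 / 2 * sg - cabs (Ym x)).
    by rewrite cabs_YmB mulrC ltr_pdivrMr// mulrC.
  move: h; rewrite lt_min => /andP[h1 h2].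
  have ys : cabs (Ym y) < 3 / 2 * sg by have := cabs_leD (Ym y) (Ym x); lra.
  rewrite /wsol ys xs; apply: hs => //; apply: clos_perf => //.
  by rewrite /rho; move: (sgp); lra.
have xs' : sg < cabs (Ym x) by move: xs (sgp); lra.
have cA : cont [set x | clos D x /\ sg <= cabs (Ym x)] wout by apply: wout_cont.
have cD' y : clos perf y -> clos D y by apply: clos_mono => z [].
have [s s0' hs] := cA x (conj (cD' _ cx) (ltW xs')) d d0.
exists (Num.min s (e * (cabs (Ym x) - sg))); first by rewrite lt_min s0' mulr_gt0// subr_gt0.
move=> y cy; rewrite lt_min => /andP[yx1 yx2].
have h : cabs (Ym y - Ym x) < cabs (Ym x) - sg by rewrite cabs_YmB mulrC ltr_pdivrMr// mulrC.
have ys : sg < cabs (Ym y) by have := cabs_leD (Ym x) (Ym y); rewrite cabs_sub; lra.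
by rewrite !wsol_out//; apply: hs => //; split; [exact: cD'|exact: ltW].
Qed.

Lemma wsol_harm x : perf x -> harm wsol x.
Proof.
have [w1 w2 w3] := win_props; move=> px; have [Dx nx] := px.
have [xs|xs] := ltP sg (cabs (Ym x)).
  apply: (@harm_local R wout wsol x (e * (cabs (Ym x) - sg))); first by rewrite mulr_gt0// subr_gt0.
    move=> y yx; rewrite wsol_out//.
    have h : cabs (Ym y - Ym x) < cabs (Ym x) - sg by rewrite cabs_YmB mulrC ltr_pdivrMr// mulrC.
    by have := cabs_leD (Ym x) (Ym y); rewrite cabs_sub; lra.
  exact: wout_harm.
apply: (@harm_local R (fun x => win (Ym x)) wsol x (e * (sg / 2))); first by rewrite mulr_gt0// divr_gt0.
  move=> y yx; have h : cabs (Ym y - Ym x) < sg / 2 by rewrite cabs_YmB mulrC ltr_pdivrMr// mulrC.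
  rewrite /wsol; have -> : cabs (Ym y) < 3 / 2 * sg by have := cabs_leD (Ym y) (Ym x); lra.
  by [].
apply: (@hYm ann win) => //; first by apply: cont_sub w1; exact: sub_clos.
by apply: perf_ann => //; rewrite /rho; move: (sgp); lra.
Qed.

Lemma wsol_bd_out x : bd D x -> wsol x = 0.
Proof.
move=> bx; have [_ nx] := bx; rewrite wsol_out ?wout_bd//.
by have := bd_far nx; rewrite /rho; move: (sgp); lra.
Qed.

Lemma wsol_bd_in x : bd perf x -> D x -> clos om (Ym x) /\ wsol x = gi (Ym x) - U0 x.
Proof.
have [w1 w2 w3] := win_props; move=> [cx nx] Dx.
have co_ : clos om (Ym x) by apply: contrapT => h; apply: nx.
have xs := osg co_; split=> //.
have xr : cabs (Ym x) < rho by rewrite /rho; move: (sgp); lra.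
rewrite /wsol; have -> : cabs (Ym x) < 3 / 2 * sg by move: xs (sgp); lra.
rewrite /win w3; first by rewrite /bdata /glue xs YmK.
by split; [exact: clos_perf|move=> [_]].
Qed.

Definition Wout g x : R := g x - g x^* - hsol D r1 g x.

(** Outside the disc [wout] is harmonic and given by [Wout Gs], so it is the Dirichlet solution with
    its own boundary values; in this form the dependence on [Gs] is through a bounded linear
    operator. *)
Theorem wsol_far x : clos D x -> rp <= cabs x -> wsol x = dir (D `\` cball 0 rp) (Wout Gs) x \/ cabs x = rp.
Proof.
move=> cx; rewrite le_eqVlt => /orP[/eqP->|xr]; first by right.
left; have gD' := good_minus_disc gD rp0; have [oD' bD' _] := gD'.
have far z : clos (D `\` cball 0 rp) z -> clos D z /\ rp <= cabs z.
  move=> cz; split; first by apply: clos_mono cz => y [].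
  rewrite leNgt; apply/negP => h; have [y [_ ny] yz] := cz (rp - cabs z) ltac:(by rewrite subr_gt0).
  by apply: ny; rewrite /cball/= subr0; have := cabs_leD y z; lra.
have WE z : clos D z -> rp <= cabs z -> wout z = Wout Gs z.
  move=> cz zr; apply: wout_G; [|exact: Dup|exact/ltW/far_Ym].
  by rewrite -cabs_gt0; exact: lt_le_trans zr.
have cW : cont (clos (D `\` cball 0 rp)) wout.
  by apply: wout_cont => z /far[cz zr]; split=> //; exact/ltW/far_Ym.
have cx' : clos (D `\` cball 0 rp) x.
  move=> d d0; have m0 : 0 < Num.min d (cabs x - rp) by rewrite lt_min d0 subr_gt0.
  have [y Dy] := cx _ m0; rewrite lt_min => /andP[yd yx]; exists y => //; split=> //.
  by rewrite /cball/= subr0; have := cabs_leD x y; rewrite cabs_sub; lra.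
rewrite wsol_out; last exact/far_Ym/ltW.
symmetry; apply: (dir_uniq gD' _ cW) => //.
- apply: (@cont_eq R _ wout); last by apply: cont_sub cW => z [].
  by move=> z [cz _]; have [c1 c2] := far _ cz; exact: WE.
- move=> z [Dz nz]; apply: wout_harm => //; apply: far_Ym; rewrite leNgt; apply/negP => h.
  by apply: nz; rewrite /cball/= subr0 ltW.
- by move=> z [cz _]; have [c1 c2] := far _ cz; exact: WE.
Qed.

(** Uniqueness in the perforated domain: [wsol] vanishes on the outer boundary and equals the inner
    data minus [U0] on the hole, where [U0] and [u0] agree. *)
Theorem perturbed_solution (ue u0 : C -> R) : cont (clos perf) ue -> (forall x, perf x -> harm ue x) ->
  cont (clos D) u0 -> (forall x, D x -> harm u0 x) -> (forall x, bd D x -> ue x = u0 x) ->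
  (forall x, bd perf x -> clos om (Ym x) -> ue x = gi (Ym x)) ->
  (forall x, D x -> cabs x < r1 -> U0 x = u0 x) ->
  forall x, clos D x -> rp < cabs x -> ue x = u0 x + dir (D `\` cball 0 rp) (Wout Gs) x.
Proof.
move=> cue hue cu0 hu0 bout bin U0E x cx xr.
have pD : clos perf `<=` clos D by apply: clos_mono => y [].
have bP : bnd perf by have [_ bD _] := gD; apply: bnd_sub bD => y [].
have cxp : clos perf x.
  have xs := far_Ym (ltW xr); move=> d d0.
  have m0 : 0 < Num.min d (e * (cabs (Ym x) - sg)) by rewrite lt_min d0 mulr_gt0// subr_gt0.
  have [y Dy] := cx _ m0; rewrite lt_min => /andP[yd yx]; exists y => //; split=> //= /osg.
  have h : cabs (Ym y - Ym x) < cabs (Ym x) - sg by rewrite cabs_YmB mulrC ltr_pdivrMr// mulrC.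
  by have := cabs_leD (Ym x) (Ym y); rewrite cabs_sub; lra.
have -> : ue x = u0 x + wsol x.
  apply: (@harm_uniq R perf ue (fun x => u0 x + wsol x) opn_perf bP) => //.
  - by apply: contD; [exact: cont_sub cu0|exact: wsol_cont].
  - by move=> y py; apply: harmD; [apply: hu0; case: py|exact: wsol_harm].
  - move=> y bpy; have [cy ny] := bpy; have [Dy|nDy] := pselect (D y).
      have [coy ->] := wsol_bd_in bpy Dy; rewrite bin// U0E//; first by ring.
      have yr : cabs (Ym y) <= rho by have := osg coy; rewrite /rho; move: (sgp); lra.
      by rewrite -(YmK y); have := Xm_small yr; move: r10; lra.
    have bDy : bd D y by split=> //; exact: pD.
    by rewrite wsol_bd_out// addr0 bout.
by have [->//|xE] := wsol_far cx (ltW xr); rewrite xE ltxx in xr.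
Qed.
End Verification.

(** * Schauder spaces and the solution map *)

Section ClassicalHarmonic.
Variable R : realType.
Local Notation C := R[i].
Local Notation Re := (@complex.Re R).
Local Notation Im := (@complex.Im R).
Implicit Types (O : set (R * R)) (u w : R * R -> R) (p q : R * R).

Lemma line_quotient u p i (s : R) :
  (fun h : R => h^-1 *: (((fun s : R => u (s *: evec R i + p)) \o shift s) (h *: (1 : R)) - u (s *: evec R i + p))) =
  (fun h : R => h^-1 *: ((u \o shift (s *: evec R i + p)) (h *: evec R i) - u (s *: evec R i + p))).
Proof.
apply/funext => h; congr (_ *: (u _ - _)); rewrite /= addrA; congr (_ + _).
by rewrite -scalerDl [h *: 1]mulr1.
Qed.

Lemma line_derivable u p i (s : R) : derivable u (s *: evec R i + p) (evec R i) ->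
  derivable (fun s : R => u (s *: evec R i + p)) s 1.
Proof. by rewrite /derivable line_quotient. Qed.

Lemma line_derive u p i (s : R) :
  'D_1 (fun s : R => u (s *: evec R i + p)) s = partial i u (s *: evec R i + p).
Proof. by rewrite /partial /derive line_quotient. Qed.

(** Second order Taylor formula with only the second derivative at 0: the mean value theorem is
    applied to [g] minus its quadratic polynomial, whose derivative is small compared with the
    distance to 0. *)
Lemma second_difference (g : R -> R) (d : R) : 0 < d -> (forall s, `|s| < d -> derivable g s 1) ->
  derivable ('D_1 g) 0 1 -> forall e : R, 0 < e -> exists2 b : R, 0 < b & forall h, 0 < h -> h < b ->
  `|g h + g (- h) - 2 * g 0 - h ^+ 2 * 'D_1 ('D_1 g) 0| <= e * h ^+ 2.
Proof.
move=> d0 dg ddg e e0; set L := 'D_1 ('D_1 g) 0; set a := 'D_1 g 0.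
have e2 : 0 < e / 2 by rewrite divr_gt0.
have [b b0 hb] : exists2 b : R, 0 < b & forall s, `|s| < b -> `|'D_1 g s - a - L * s| <= e / 2 * `|s|.
  have : h^-1 *: (('D_1 g \o shift 0) (h *: (1 : R)) - 'D_1 g 0) @[h --> 0^'] --> L by exact: ddg.
  move/cvgrPdist_le => /(_ _ e2)/nbhs_ballP[b /= b0 hb]; exists b => // s sb.
  have [->|s0] := eqVneq s 0; first by rewrite mulr0 subr0 subrr normr0 mulr0.
  have := hb s; rewrite /ball/= sub0r normrN => /(_ sb s0).
  rewrite addr0 [s *: 1]mulr1 -(ler_pM2r (x := `|s|)) ?normr_gt0// -normrM mulrBl.
  by rewrite [s^-1 *: _]mulrC divfK// distrC.
clearbody a L.
pose b' := Num.min b d; have b'0 : 0 < b' by rewrite lt_min b0.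
pose f : R -> R := g - ((a \*: id) + ((L / 2) \*: (id * id))).
have df (c : R) : `|c| < d -> is_derive c 1 f ('D_1 g c - (a + L * c)).
  move=> cd; have hg : is_derive c 1 g ('D_1 g c) by apply: derivableP; exact: dg.
  have h1 := is_deriveZ a (is_derive_id c (1 : R)).
  have h2 := is_deriveZ (L / 2) (is_deriveM (is_derive_id c (1 : R)) (is_derive_id c (1 : R))).
  have h3 := is_deriveB hg (is_deriveD h1 h2).
  apply: (is_derive_eq h3).
  rewrite /GRing.scale/= !mulr1; congr (_ - (_ + _)).
  by field.
have key h : `|h| < b' -> `|g h - g 0 - (a * h + L / 2 * h ^+ 2)| <= e / 2 * h ^+ 2.
  rewrite lt_min => /andP[hb' hd].
  have [||c [h1 h2 h3]] := @mean_value R f d 0 h _ _ hd.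
  - by move=> s /df [].
  - by rewrite normr0.
  have [_ fc] := df c h2; rewrite fc !subr0 in h1 h3.
  have -> : g h - g 0 - (a * h + L / 2 * h ^+ 2) = f h - f 0.
    have fE s : f s = g s - (a * s + L / 2 * (s * s)) by [].
    by rewrite !fE; ring.
  rewrite h3 normrM; have -> : h ^+ 2 = `|h| * `|h| by rewrite -expr2 real_normK ?num_real.
  rewrite mulrA ler_wpM2r//; apply: (@le_trans _ _ (e / 2 * `|c|)); last by rewrite ler_pM2l.
  by rewrite opprD addrA; apply: hb; exact: le_lt_trans h1 hb'.
exists b' => // h h0 hb'.
have k1 := key h; rewrite gtr0_norm// in k1; have k2 := key (- h); rewrite normrN gtr0_norm// in k2.
have := k1 hb'; have := k2 hb'; rewrite sqrrN !ler_norml.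
move: (g h) (g (- h)) (g 0) (h ^+ 2) => x y z q; clear; move=> *; lra.
Qed.

Lemma ballP2 p q (d : R) : ball p d q <-> `|q.1 - p.1| < d /\ `|q.2 - p.2| < d.
Proof.
have E (a b : R) : ball a d b = (`|b - a| < d) :> Prop by rewrite distrC.
by split=> -[h1 h2]; split; rewrite -?E// ?E.
Qed.

Lemma axis_lip w p (d M : R) : 0 < d ->
  (forall q, ball p d q -> forall i, derivable w q (evec R i) /\ `|partial i w q| <= M) ->
  forall q, ball p d q -> `|w q - w p| <= M * (`|q.1 - p.1| + `|q.2 - p.2|).
Proof.
move=> d0 hw q /ballP2[q1 q2]; pose p' : R * R := (q.1, p.2).
have e0 (s : R) (a : R * R) : s *: evec R ord0 + a = (s + a.1, a.2) :> R * R.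
  by apply: (can_inj (@toCK R)); apply: complex_ext; rewrite toCD ?ReD ?ImD ?ReZ ?ImZ /toC /evec /=; ring.
have e1 (s : R) (a : R * R) : s *: evec R ord_max + a = (a.1, s + a.2) :> R * R.
  by apply: (can_inj (@toCK R)); apply: complex_ext; rewrite toCD ?ReD ?ImD ?ReZ ?ImZ /toC /evec /=; ring.
have step (a : R * R) (i : 'I_2) (s : R) : (forall s, `|s| < d -> ball p d (s *: evec R i + a)) -> `|s| < d ->
    `|w (s *: evec R i + a) - w a| <= M * `|s|.
  move=> ha sd; have [||c [h1 h2 h3]] := @mean_value R (fun s : R => w (s *: evec R i + a)) d 0 s _ _ sd.
  - by move=> s' sd'; apply: line_derivable; have [] := hw _ (ha s' sd') i.
  - by rewrite normr0.
  rewrite scale0r add0r subr0 in h3; rewrite h3 line_derive normrM ler_wpM2r//.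
  by have [] := hw _ (ha c h2) i.
have s1 := step p ord0 (q.1 - p.1); have s2 := step p' ord_max (q.2 - p.2).
rewrite e0 subrK in s1; rewrite e1 /p' /= subrK -surjective_pairing in s2.
have -> : w q - w p = (w q - w p') + (w p' - w p) by ring.
apply: le_trans (ler_normD _ _) _; rewrite mulrDr addrC lerD//.
  by apply: s1 => // s sd; rewrite e0; apply/ballP2; rewrite /= addrK subrr normr0.
case: q q1 q2 @p' s2 {s1 step} => qa qb /= q1 q2 s2.
by apply: s2 => // s sd; rewrite e1; apply/ballP2; rewrite /= addrK.
Qed.

(** The passage from the classical definition: [lap4] is the sum of one second difference along each
    axis, and the second derivatives add up to 0. *)
Lemma harmonic_harm O u z : open O -> harmonic_on O u -> dom O z -> harm (u \o @ofC R) z.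
Proof.
move=> oO [du ddu lap] Oz e e0; have [d d0 hd] := opn_dom oO Oz.
have line i (s : R) : `|s| < d -> O (s *: evec R i + ofC z).
  move=> sd; rewrite domE toCD ofCK; apply: hd.
  by rewrite dist_shift cabsZ cabs_evec mulr1.
have e4 : 0 < e / 2 by rewrite divr_gt0.
have key i : exists2 b : R, 0 < b & forall h, 0 < h -> h < b ->
    `|u (h *: evec R i + ofC z) + u (- h *: evec R i + ofC z) - 2 * u (ofC z) -
      h ^+ 2 * partial i (partial i u) (ofC z)| <= e / 2 * h ^+ 2.
  have DE : 'D_1 (fun s : R => u (s *: evec R i + ofC z)) = fun s : R => partial i u (s *: evec R i + ofC z).
    by apply/funext => s; exact: line_derive.
  have [||b b0 hb] := @second_difference (fun s : R => u (s *: evec R i + ofC z)) d d0 _ _ _ e4.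
  - by move=> s sd; apply: line_derivable; apply: du; exact: line.
  - rewrite DE; apply: line_derivable; rewrite scale0r add0r.
    by have [] := ddu i i (ofC z) Oz.
  exists b; first exact: b0.
  move=> h h0 hh; have := hb h h0 hh.
  have -> : 'D_1 ('D_1 (fun s : R => u (s *: evec R i + ofC z))) 0 = partial i (partial i u) (ofC z).
    by rewrite DE line_derive scale0r add0r.
  by rewrite scale0r add0r.
have [b0 b00 h0] := key ord0; have [b1 b10 h1] := key ord_max.
exists (Num.min b0 b1); first by rewrite lt_min b00.
move=> h hp; rewrite lt_min => /andP[hb0 hb1].
have := h0 h hp hb0; have := h1 h hp hb1.
have := lap (ofC z) Oz; rewrite big_ord_recl big_ord1.
have -> : lift ord0 ord0 = ord_max :> 'I_2 by apply/val_inj.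
have oE i (s : R) : s *: evec R i + ofC z = ofC (z + s%:C * toC (evec R i)) :> R * R.
  by apply: (can_inj (@toCK R)); rewrite ofCK toCD ofCK.
have t0 : toC (evec R ord0) = 1 :> C by [].
have t1 : toC (evec R ord_max) = 'i :> C by [].
rewrite /lap4 /= !oE t0 t1 !mulr1 !rmorphN !mulNr.
move: (partial _ _ _) (partial _ _ _) => A B AB; have -> : B = - A by lra.
have -> : h ^+ 2 * - A = - (h ^+ 2 * A) by ring.
rewrite !ler_norml; move: (h ^+ 2 * A) (h ^+ 2) => m q.
by move: (u _) (u _) (u _) (u _) (u _) => a b c' d' k; clear; lra.
Qed.

(** Continuity is not part of [harmonic_on] and is recovered by descent: locally bounded second
    partial derivatives bound the first ones through [axis_lip], and these make [u] Lipschitz. *)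
Lemma harmonic_cont O u : open O -> harmonic_on O u -> cont (dom O) (u \o @ofC R).
Proof.
move=> oO [du ddu _] z Oz e e0; pose p := ofC z.
have Op : O p by [].
have nb i j : exists2 d : R, 0 < d & forall q, ball p d q ->
    O q /\ `|partial j (partial i u) q| <= `|partial j (partial i u) p| + 1.
  have [_ c] := ddu i j p Op; have /nbhs_ballP[d /= d0 hd] : nbhs p O by exact: open_nbhs_nbhs.
  move/cvgrPdist_le: c => /(_ 1 ltr01)/nbhs_ballP[d' /= d'0 hd'].
  exists (Num.min d d'); first by rewrite lt_min d0.
  move=> q /ballP2[]; rewrite !lt_min => /andP[a1 a2] /andP[b1 b2]; split.
    by apply: hd; apply/ballP2.
  have : `|partial j (partial i u) p - partial j (partial i u) q| <= 1 by apply: hd'; apply/ballP2.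
  move: (partial j _ p) (partial j _ q) => A B.
  have := ler_normB A (A - B); rewrite opprB addrC subrK; lra.
have [d00 p00 h00] := nb ord0 ord0; have [d01 p01 h01] := nb ord0 ord_max.
have [d10 p10 h10] := nb ord_max ord0; have [d11 p11 h11] := nb ord_max ord_max.
pose d := Num.min (Num.min d00 d01) (Num.min d10 d11).
have d0 : 0 < d by rewrite !lt_min p00 p01 p10 p11.
have sub d' q : d <= d' -> ball p d q -> ball p d' q.
  by move=> dd /ballP2[a b]; apply/ballP2; split; exact: lt_le_trans dd.
have le00 : d <= d00 by rewrite !ge_min lexx.
have le01 : d <= d01 by rewrite !ge_min lexx !orbT.
have le10 : d <= d10 by rewrite !ge_min lexx !orbT.
have le11 : d <= d11 by rewrite !ge_min lexx !orbT.
have ii (i : 'I_2) : i = ord0 \/ i = ord_max.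
  by case: i => [[|[|//]] hi]; [left|right]; apply/val_inj.
pose P (i j : 'I_2) : R := `|partial j (partial i u) p| + 1.
have P0 i j : 0 <= P i j by exact: addr_ge0.
have sum4 (a b c' d' : R) : 0 <= a -> 0 <= b -> 0 <= c' -> 0 <= d' ->
  [/\ a <= a + b + (c' + d'), b <= a + b + (c' + d'), c' <= a + b + (c' + d') & d' <= a + b + (c' + d')].
  by clear; move=> *; split; lra.
have [m1 m2 m3 m4] := sum4 _ _ _ _ (P0 ord0 ord0) (P0 ord0 ord_max) (P0 ord_max ord0) (P0 ord_max ord_max).
pose M := P ord0 ord0 + P ord0 ord_max + (P ord_max ord0 + P ord_max ord_max).
have all_le i j q : ball p d q -> O q /\ `|partial j (partial i u) q| <= M.
  move=> bq; case: (ii i) => ->; case: (ii j) => ->.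
  - by have [Oq hq] := h00 _ (sub _ _ le00 bq); split=> //; exact: le_trans hq m1.
  - by have [Oq hq] := h01 _ (sub _ _ le01 bq); split=> //; exact: le_trans hq m2.
  - by have [Oq hq] := h10 _ (sub _ _ le10 bq); split=> //; exact: le_trans hq m3.
  - by have [Oq hq] := h11 _ (sub _ _ le11 bq); split=> //; exact: le_trans hq m4.
have M0 : 0 <= M by exact: le_trans (P0 _ _) m1.
have Md : 0 <= M * (2 * d) by apply: mulr_ge0 => //; apply: mulr_ge0 => //; exact: ltW.
pose Q (i : 'I_2) : R := `|partial i u p| + M * (2 * d).
have Q0 i : 0 <= Q i by exact: addr_ge0.
pose M' := Q ord0 + Q ord_max.
have QM i : Q i <= M' by case: (ii i) => ->; [rewrite /M' lerDl|rewrite /M' lerDr].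
have M'0 : 0 <= M' by exact: addr_ge0.
have first i q : ball p d q -> `|partial i u q| <= M'.
  move=> bq; have := @axis_lip (partial i u) p d M d0 _ q bq.
  move=> /(_ _)h; have {h} := h (fun q' bq' j => let: conj a b := all_le i j q' bq' in conj (proj1 (ddu i j q' a)) b).
  have [a b] := proj1 (ballP2 _ _ _) bq.
  have h1 : M * (`|q.1 - p.1| + `|q.2 - p.2|) <= M * (2 * d).
    by rewrite ler_wpM2l// mulr2n mulrDl mul1r lerD// ltW.
  move=> h2; have := le_trans h2 h1; move=> h3.
  apply: le_trans (QM i); rewrite /Q; move: h3; clear; move: (M * _) => k.
  have := ler_normD (partial i u q - partial i u p) (partial i u p); rewrite subrK.
  by lra.
have lip q : ball p d q -> `|u q - u p| <= M' * (`|q.1 - p.1| + `|q.2 - p.2|).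
  apply: axis_lip => // q' bq' i; split; last exact: first.
  by apply: du; have [] := all_le ord0 ord0 q' bq'.
have M1 : 0 < 2 * M' + 1 by rewrite ltr_wpDl// mulr_ge0.
exists (Num.min d (e / (2 * M' + 1))); first by rewrite lt_min d0 divr_gt0.
move=> y Oy; rewrite lt_min => /andP[yd ye]; rewrite /= -/p.
have c1 : `|(ofC y).1 - p.1| <= cabs (y - z) by rewrite /= -ReB Re_le.
have c2 : `|(ofC y).2 - p.2| <= cabs (y - z) by rewrite /= -ImB Im_le.
apply: le_lt_trans (lip (ofC y) _) _.
  by apply/ballP2; split; [exact: le_lt_trans c1 yd|exact: le_lt_trans c2 yd].
rewrite ltr_pdivlMr// in ye; apply: le_lt_trans (ler_wpM2l M'0 (lerD c1 c2)) _.
apply: le_lt_trans ye; have -> : cabs (y - z) * (2 * M' + 1) =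
  M' * (cabs (y - z) + cabs (y - z)) + cabs (y - z) by move: (cabs _) (M') => a b; ring.
by rewrite lerDl cabs_ge0.
Qed.
End ClassicalHarmonic.

(** * Elements of the Schauder space *)

Section SchauderSpace.
Variable R : realType.
Variables (al : R) (O : set (R * R)).
Hypothesis oO : open O.
Implicit Types (f g : R * R -> R).

Lemma C1a_closure_eq f g : (forall x, closure O x -> f x = g x) -> C1a_closure al O f ->
  C1a_closure al O g /\ schauder_norm al O f = schauder_norm al O g.
Proof.
move=> fg [[cf df ef] bf bdf hf].
have near_fg x : O x -> \forall y \near x, f y = g y.
  move=> Ox; have : nbhs x O by exact: open_nbhs_nbhs.
  by apply: filterS => y Oy; apply: fg; exact: subset_closure.
have dE i x : O x -> partial i f x = partial i g x.
  by move=> Ox; apply: near_eq_derive; exact: near_fg.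
split; last first.
  rewrite /schauder_norm (eq_sup_norm fg); congr (_ + _); apply: eq_bigr => i _.
  rewrite (eq_sup_norm (dE i)); congr (_ + _); apply: eq_sup_norm => z Oz.
  exact: (eq_holder_quot al (dE i) Oz).
split; first split.
- by apply: subspace_eq_continuous cf => x; rewrite inE; exact: fg.
- move=> i x Ox; apply: near_eq_derivable (df i x Ox); exact: near_fg.
- by move=> i; have [h ch hE] := ef i; exists h => // x Ox; rewrite hE// dE.
- exact: eq_bounded_fn bf.
- by move=> i; apply: eq_bounded_fn (bdf i) => x Ox; exact: dE.
- by move=> i; apply: eq_bounded_fn (hf i) => z Oz; exact: (eq_holder_quot al (dE i) Oz).
Qed.

Definition restr f : R * R -> R := fun x => if `[< closure O x >] then f x else 0.

Lemma restrE f x : closure O x -> f x = restr f x.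
Proof. by move=> cx; rewrite /restr; case: asboolP. Qed.

Lemma restr_pred f : C1a_closure al O f -> restr f \in C1a_pred al O.
Proof.
move=> cf; apply/asboolP; split; first by have [] := C1a_closure_eq (@restrE f) cf.
by move=> x ncx; rewrite /restr; case: asboolP.
Qed.

(** A total map into the space with default 0, so that families of functions can be mapped before
    their regularity is known; it is linear where [C1a_closure] holds. *)
Definition mk f : C1a_space al O :=
  if pselect (C1a_closure al O f) is left cf then C1aSpace (restr_pred cf) else 0.

Lemma mkE f x : C1a_closure al O f -> closure O x -> mk f x = f x.
Proof. by move=> cf cx; rewrite /mk; case: pselect => //= _; rewrite -restrE. Qed.

Lemma mk_norm f : C1a_closure al O f -> `|mk f| = schauder_norm al O f.
Proof.
move=> cf; have [_ ->] := C1a_closure_eq (@restrE f) cf.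
transitivity (C1a_norm (mk f)); first by [].
rewrite /C1a_norm /mk; case: pselect => [c|nc]; [exact: erefl|by case: nc].
Qed.

Lemma mk_lin (a : R) f g h : C1a_closure al O f -> C1a_closure al O g ->
  (forall x, closure O x -> h x = a * f x + g x) -> mk h = a *: mk f + mk g.
Proof.
move=> cf cg hE; have ch : C1a_closure al O h.
  apply: (proj1 (C1a_closure_eq _ (C1a_closure_lin a cf cg))) => x cx.
  by rewrite hE.
apply/val_inj/funext => x /=.
have [cx|ncx] := pselect (closure O x).
  by rewrite (mkE ch cx) hE// -(mkE cf cx) -(mkE cg cx).
have off (k : C1a_space al O) : C1a_fun k x = 0.
  by case: k => k /= /asboolP[_]; exact.
by rewrite [LHS]off; exact/esym/(off (a *: mk f + mk g)).
Qed.
End SchauderSpace.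

Lemma analytic_add_cst (R : realType) (V W : normedModType R) (D : set V) (f : V -> W) (w : W) x0 :
  analytic_at_within D f x0 -> analytic_at_within D (fun x => w + f x) x0.
Proof.
move=> [A [M [r [r0 hA hM cM hf]]]].
exists (fun k v => if k == 0%N then w + A k v else A k v),
  (fun k => if k == 0%N then `|w| + M k else M k), r; split=> //.
- by move=> [|k] i v a x y /=; [case: i|exact: hA].
- move=> [|k] v /=; last exact: hM.
  apply: le_trans (ler_normD _ _) _; have := hM 0%N v; rewrite big_ord0 !mulr1.
  by rewrite lerD2l.
(* The constant sits in the term of order 0, so every partial sum is shifted by [|w|] except the
   empty one. *)
- have -> : series (fun k => (if k == 0%N then `|w| + M k else M k) * r ^+ k) =
    (fun n => if n == 0%N then 0 else `|w| + series (fun k => M k * r ^+ k) n).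
    apply/funext => -[|n]; rewrite /series/=; first by rewrite big_geq.
    by rewrite !big_mkord !big_ord_recl/= expr0 !mulr1 addrA.
  have h : (fun n => `|w| + series (fun k => M k * r ^+ k) n) @ \oo --> `|w| + limn (series (fun k => M k * r ^+ k)).
    by apply: cvgD => //; exact: cvg_cst.
  apply/cvg_ex; exists (`|w| + limn (series (fun k => M k * r ^+ k))).
  apply: cvg_trans h; apply: near_eq_cvg; near=> n.
  by case: ifP => // /eqP n0; exfalso; move: n0; apply/eqP; rewrite -lt0n; near: n; exists 1%N.
- move=> x Dx xr; have h := hf x Dx xr.
  have h' : (fun n => w + series (fun k => A k (fun=> x - x0)) n) @ \oo --> w + f x.
    by apply: cvgD => //; exact: cvg_cst.
  apply: cvg_trans h'; apply: near_eq_cvg; near=> n.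
  have n0 : (0 < n)%N by near: n; exists 1%N.
  by rewrite -(prednK n0) /series/= !big_mkord !big_ord_recl/= addrA.
Unshelve. all: by end_near.
Qed.

(** * The perforated domain in rescaled coordinates *)

Section PerforatedDomain.
Variable R : realType.
Local Notation C := R[i].
Local Notation Re := (@complex.Re R).
Local Notation Im := (@complex.Im R).
Local Notation V := ((R * R) * (R * R))%type.
Implicit Types (x y z : C) (t : V).

Lemma bnd_dom (O : set (R * R)) : bounded_set O -> bnd (dom O).
Proof.
move=> [M [_ hM]]; exists ((M + 1) + (M + 1)) => z Oz; have := hM (M + 1) ltac:(by rewrite ltrDl) _ Oz.
rewrite /= prod_normE/= ge_max => /andP[h1 h2]; exact: le_trans (cabs_le z) (lerD h1 h2).
Qed.

Variables (lam : R) (Om om : set (R * R)) (p : R * R) (t : V).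
Local Notation co := (co (@plin R) (poff lam)).
Local Notation Y := (Ym lam (toC p) t).
Local Notation X := (Xm lam (toC p) t).
Local Notation D := (dom Om).
Local Notation D' := (perf lam (dom Om) (dom om) (toC p) t).
Hypotheses (e10 : 0 < t.1.1) (e20 : 0 < t.1.2).

Let co0 : co 0%N t = t.1.1. Proof. exact: subr0. Qed.
Let co1 : co 1%N t = t.1.2. Proof. exact: subr0. Qed.
Let e10' : 0 < co 0%N t. Proof. by rewrite co0. Qed.
Let e20' : 0 < co 1%N t. Proof. by rewrite co1. Qed.
Let e0 : 0 < t.1.1 * t.1.2. Proof. exact: mulr_gt0. Qed.

Lemma XmE (y : R * R) : toC (t.1.1 *: p + (t.1.1 * t.1.2) *: y) = X (toC y).
Proof.
rewrite /Xm co0 co1; apply: complex_ext; rewrite ?ReD ?ImD ?ReZ ?ImZ /toC /=; by [].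
Qed.

Lemma YmE x : (t.1.1 * t.1.2)^-1 *: (ofC x - t.1.1 *: p) = ofC (Y x).
Proof.
apply: (can_inj (@toCK R)); rewrite ofCK /Ym co0 co1.
by apply: complex_ext; rewrite ?ReZ ?ImZ ?ReB ?ImB ?ReZ ?ImZ /toC /=.
Qed.

Lemma dom_hole x : dom (hole p om t.1) x <-> dom om (Y x).
Proof.
split=> [[y oy yx]|ox].
  have -> : x = X (toC y) by rewrite -XmE yx ofCK.
  by rewrite XmK// -domE.
exists (ofC (Y x)) => //; apply: (can_inj (@toCK R)).
by rewrite XmE !ofCK YmK.
Qed.

Lemma clos_hole x : clos (dom (hole p om t.1)) x <-> clos (dom om) (Y x).
Proof.
split=> h d d0.
  have [y hy yx] := h (t.1.1 * t.1.2 * d) (mulr_gt0 e0 d0); exists (Y y); first exact/dom_hole.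
  by rewrite cabs_YmB// co0 co1 mulrC ltr_pdivrMr// mulrC.
have [y oy yx] := h (d / (t.1.1 * t.1.2)) (divr_gt0 d0 e0); exists (X y).
  by apply/dom_hole; rewrite XmK.
rewrite -(YmK (toC p) e10' e20' x) cabs_XmB// co0 co1 mulrC.
by rewrite -ltr_pdivlMr.
Qed.

Lemma dom_perforated x : dom (perforated Om om p t.1) x <-> D' x.
Proof.
have h : closure (hole p om t.1) (ofC x) <-> clos (dom om) (Y x).
  by rewrite -clos_hole closure_dom ofCK.
by split=> -[h1 h2]; split=> // /h.
Qed.

Lemma closure_perforated q : closure (perforated Om om p t.1) q <-> clos D' (toC q).
Proof. by apply: closure_toC => q'; rewrite domE; exact: dom_perforated. Qed.

Hypothesis oo : opn (dom om).

Lemma clos_perf_hole x : clos D' x -> ~ dom om (Y x).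
Proof.
move=> cx ox; have [r r0 hr] := oo ox.
have [y [_ ny] yx] := cx (t.1.1 * t.1.2 * r) (mulr_gt0 e0 r0).
apply: ny; apply: sub_clos; apply: hr.
by rewrite cabs_YmB// co0 co1 mulrC ltr_pdivrMr// mulrC.
Qed.

Lemma bdry_hole x : clos D' x -> clos (dom om) (Y x) -> bdry (hole p om t.1) (ofC x).
Proof.
move=> cx cy; split; first by apply/closure_dom; rewrite ofCK; exact/clos_hole.
by move=> /interior_subset h; apply: (clos_perf_hole cx); exact/dom_hole.
Qed.

(** A solution for one positive parameter is continuous up to the hole and carries [gi] as its
    trace; rescaling it gives continuity of the data without boundary charts. *)
Lemma hole_data_cont (gi u : R * R -> R) (sg : R) : opn D ->
  (forall y, clos (dom om) y -> D (X y)) ->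
  cont (clos D') (u \o @ofC R) ->
  (forall q, bdry (hole p om t.1) q -> u q = gi ((t.1.1 * t.1.2)^-1 *: (q - t.1.1 *: p))) ->
  (forall y, clos (dom om) y -> cabs y < sg) ->
  cont (bdin (dom om) sg) (gi \o @ofC R).
Proof.
move=> oD hX cu ug osg.
have key y : bdin (dom om) sg y -> clos D' (X y) /\ gi (ofC y) = u (ofC (X y)).
  move=> [by_ ys]; have [cy _] := by_.
  have coy : clos (dom om) y.
    have [yr|[]//] := bd_annular oo by_.
    by move: ys; rewrite yr; have := cabs_ge0 y; rewrite yr; lra.
  have cX : clos D' (X y).
    move=> d d0; have [s s0 hs] := oD _ (hX y coy).
    have m0 : 0 < Num.min d s / (t.1.1 * t.1.2) by rewrite divr_gt0// lt_min d0.
    have [z [_ nz] zy] := cy _ m0; have h : cabs (X z - X y) < Num.min d s.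
      by rewrite cabs_XmB// co0 co1 mulrC -ltr_pdivlMr.
    move: h; rewrite lt_min => /andP[h1 h2]; exists (X z) => //; split; first exact: hs.
    by rewrite /= XmK.
  by split=> //; rewrite (ug _ (bdry_hole cX _)) ?YmE XmK.
apply: (@cont_eq R _ (fun y => (u \o @ofC R) (X y))).
  by move=> y /key[_ /= ->].
apply: (@cont_shift R _ (clos D') (u \o @ofC R) X (t.1.1 * t.1.2)) => //.
  by move=> y /key[].
by move=> y z _ _; rewrite cabs_XmB// co0 co1.
Qed.
End PerforatedDomain.

(** * From the singular part to the Schauder space *)

Section OutputOperator.
Variable R : realType.
Local Notation C := R[i].
Local Notation Re := (@complex.Re R).
Local Notation Im := (@complex.Im R).
Variables (al : R) (Om Om' : set (R * R)) (r1 rp : R).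
Hypotheses (al0 : 0 < al) (al1 : al < 1) (oO : open Om) (cO : class_C1a al Om) (bO : bnd (dom Om))
  (oO' : open Om') (sO : Om' `<=` Om).
Hypotheses (rp0 : 0 < rp) (rpr1 : rp < r1)
  (G1 : forall x : C, cabs x < r1 -> 0 < Im x -> dom Om x) (G2 : forall x, dom Om x -> 0 < Im x)
  (far : forall x, clos (dom Om') x -> 2 * (2 * rp) <= cabs x).
Local Notation D := (dom Om).
Local Notation Dp := (dom Om `\` cball 0 rp).

Lemma good_dom : good D.
Proof. by split=> //; [exact: opn_dom|move=> x; exact: (class_sector al0 oO cO)]. Qed.

Let gp : good Dp. Proof. exact: good_minus_disc good_dom rp0. Qed.

Lemma far_clos x : clos D x -> rp < cabs x -> clos Dp x.
Proof.
move=> cx xr d d0; have m0 : 0 < Num.min d (cabs x - rp) by rewrite lt_min d0 subr_gt0.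
have [y Dy] := cx _ m0; rewrite lt_min => /andP[yd yx]; exists y => //; split=> //.
by rewrite /cball/= subr0; have := cabs_leD x y; rewrite cabs_sub; lra.
Qed.

Lemma clos_far x : clos Dp x -> clos D x /\ rp <= cabs x.
Proof.
move=> cx; split; first by apply: clos_mono cx => y [].
rewrite leNgt; apply/negP => h; have [y [_ ny] yx] := cx (rp - cabs x) ltac:(by rewrite subr_gt0).
by apply: ny; rewrite /cball/= subr0; have := cabs_leD y x; lra.
Qed.

Lemma Op_Wout : Op (ext rp) (bd Dp) (Wout D r1) 4.
Proof.
have H := Op_hsol good_dom rpr1 G1 G2; split=> //.
- move=> g cg; apply: contB.
    by apply: contB; [apply: cont_sub cg|apply: cont_sub (cont_conj cg)] => x [/clos_far[]].
  by apply: cont_sub (Op_cont H cg) => x [/clos_far[]].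
- move=> a f g cf cg x [/clos_far[cx _] _]; rewrite /Wout (Op_lin H)//; ring.
- move=> f M M0 cf fM x [/clos_far[cx xr] _].
  have h1 := fM x xr; have h2 : `|f x^*| <= M by apply: fM; rewrite /ext/= cabsJ.
  have h3 := Op_bd H M0 cf fM cx; rewrite /Wout.
  apply: le_trans (ler_normB _ _) _; have := ler_normB (f x) (f x^*); lra.
Qed.

(** For a general continuous [g] the function [Wout D r1 g] is not harmonic. Solving with its values
    as data gives a harmonic function, equal to it when [g] is the singular part, so the Schauder
    estimate applies on all continuous functions, as the coefficients of the power series
    require. *)
Definition Wext g : C -> R := dir Dp (Wout D r1 g).

Lemma Op_Wext : Op (ext rp) (clos Dp) Wext 4.
Proof. by have := Op_comp Op_Wout (Op_dir gp); rewrite mul1r. Qed.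

Lemma Wext_schauder : exists2 K : R, 0 <= K & forall g M, 0 <= M -> cont (ext rp) g ->
  (forall x, clos Dp x -> `|Wext g x| <= M) ->
  C1a_closure al Om' (Wext g \o @toC R) /\ schauder_norm al Om' (Wext g \o @toC R) <= K * M.
Proof.
have rp20 : 0 < 2 * rp by rewrite mulr_gt0.
have [K K0 hK] := schauder_estimate al0 al1 oO cO bO sO rp20 far.
exists K => // g M M0 cg gM; apply: hK => //.
have big x : 2 * rp <= cabs x -> rp < cabs x by move: rp0; lra.
have [w1 w2 w3] := dirP gp (Op_cont Op_Wout cg); split.
- by apply: cont_sub w1 => x [cx /big xr]; exact: far_clos.
- move=> x Dx xr; apply: w2; split=> //; rewrite /cball/= subr0.
  by have := big x (ltW xr); lra.
- by move=> x cx /big xr; apply: gM; exact: far_clos.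
- move=> x bx /big xr; have [cx nx] := bx.
  rewrite /Wext w3; last by split; [exact: far_clos|move=> []].
  have [_ _ hh] := hsolP good_dom rpr1 G1 G2 cg.
  by rewrite /Wout hh// subrr.
Qed.

Lemma closure_far q : closure Om' q -> clos D (toC q) /\ rp < cabs (toC q).
Proof.
move=> /closure_dom cq; split; first by apply: clos_mono cq => x; exact: sO.
by have := far cq; move: rp0; lra.
Qed.

Definition Wmk g : C1a_space al Om' := mk al oO' (Wext g \o @toC R).

Lemma Wmk_bounded_linear : exists2 K : R, 0 <= K & [/\
  forall (a : R) f g, cont (ext rp) f -> cont (ext rp) g ->
    Wmk (fun x => a * f x + g x) = a *: Wmk f + Wmk g,
  forall f (M : R), 0 <= M -> cont (ext rp) f -> (forall x, ext rp x -> `|f x| <= M) ->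
    `|Wmk f| <= K * M &
  forall f, cont (ext rp) f -> forall q, closure Om' q -> Wmk f q = Wext f (toC q)].
Proof.
have [K K0 hK] := Wext_schauder; exists (K * 4); first by rewrite mulr_ge0.
have bdd h : cont (ext rp) h -> C1a_closure al Om' (Wext h \o @toC R).
  move=> ch; have [_ bD _] := gp.
  have [M M0 hM] := cont_bounded (bnd_clos bD) (@clos_clos R Dp) (Op_cont Op_Wext ch).
  by have [] := hK h M M0 ch hM.
split.
- move=> a f g cf cg; apply: mk_lin; [exact: bdd|exact: bdd|].
  move=> q /closure_far[cq qr] /=; rewrite (Op_lin Op_Wext)//; exact: far_clos.
- move=> f M M0 cf fM; rewrite mk_norm; last exact: bdd.
  have M4 : 0 <= 4 * M by rewrite mulr_ge0.
  rewrite -mulrA; have [] := hK f (4 * M) M4 cf _ => //.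
  by move=> x cx; exact: (Op_bd Op_Wext).
- by move=> f cf q cq; rewrite mkE//; exact: bdd.
Qed.
End OutputOperator.

(** * Choice of the small parameter and assembly *)

Section FinalLemmas.
Variable R : realType.
Local Notation C := R[i].
Local Notation Re := (@complex.Re R).
Local Notation Im := (@complex.Im R).

Lemma open_of_opn (O : set (R * R)) : opn (dom O) -> open O.
Proof.
move=> oO; rewrite openE => q Oq; have [r r0 hr] := oO (toC q) (proj1 (domE O q) Oq).
apply/nbhs_ballP; exists (r / 2); first by rewrite /= divr_gt0.
by move=> q' /toC_ball qq; apply/domE; exact: hr.
Qed.

Lemma open_eball (r : R) : open (@eball R r).
Proof.
apply: open_of_opn => x xr; have [d d0 hd] := @opn_oball R 0 r x ltac:(by rewrite /oball/= subr0).
by exists d => // y /hd; rewrite /oball/= subr0.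
Qed.

Lemma C1a_closure_sub (al : R) (O O' : set (R * R)) f : O' `<=` O -> C1a_closure al O f ->
  C1a_closure al O' f.
Proof.
move=> sO [[cf df ef] [M bf] bdf hf]; have cO : closure O' `<=` closure O by exact: closureS.
have bsub (T : Type) (A B : set T) (g : T -> R) : A `<=` B -> bounded_fn B g -> bounded_fn A g.
  by move=> AB [N hN]; exists N => _ [z Az <-]; apply: hN; exists z => //; exact: AB.
split; first split.
- exact: continuous_subspaceW cf.
- by move=> i x /sO; exact: df.
- move=> i; have [g cg gE] := ef i; exists g; first exact: continuous_subspaceW cg.
  by move=> x /sO; exact: gE.
- by apply: bsub cO _; exists M.
- by move=> i; apply: bsub sO (bdf i).
- by move=> i; apply: bsub (hf i) => -[x y] [/sO ? /sO ?]; split.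
Qed.

Lemma dist_pos (E : set C) : ~ clos E 0 -> exists2 d : R, 0 < d & forall x, clos E x -> d <= cabs x.
Proof.
move=> h; apply: contrapT => n; apply: h => r r0; apply: contrapT => h'; apply: n.
exists r => // x cx; rewrite leNgt; apply/negP => xr.
have [y Ey yx] := cx (r - cabs x) ltac:(by rewrite subr_gt0); apply: h'; exists y => //.
by rewrite subr0; have := cabs_leD y x; lra.
Qed.

Lemma cont_of_C1a (al : R) (O : set (R * R)) (B : set C) f : (forall q, closure O q <-> B (toC q)) ->
  C1a_closure al O f -> cont B (f \o @ofC R).
Proof. by move=> h [[cf _ _] _ _ _]; apply/(cont_within f h). Qed.

(** Since [ln (a * b) = ln a + ln b], the quotients of the two summands by the sum add up to 1; both
    parameters below 1 make the denominator negative. *)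
Lemma log_delta_rel (a b lam : R) : 0 < a -> a < 1 -> 0 < b -> b < 1 ->
  1 / ln (a * b) * ln b = 1 - lam - (ln a / ln (a * b) - lam).
Proof.
move=> a0 a1 b0 b1; have l0 : ln (a * b) != 0.
  by rewrite lnM ?posrE// lt_eqF//; have := @ln_lt0 R a; have := @ln_lt0 R b; rewrite a0 a1 b0 b1 => /(_ isT) ? /(_ isT) ?; lra.
have E : ln (a * b) = ln a + ln b by rewrite lnM.
by move: l0; rewrite E => l0; field.
Qed.
(** All smallness conditions are linear in [rr]: with [KK] above each coefficient,
    [rr * KK <= 1 / 2] meets them at once, and the geometric conditions of the verification are read
    off from the same bounds. *)
Lemma small_parameter (ap sg p2 rp r1 kq th a b : R) : 0 <= ap -> 0 < sg -> 0 < p2 -> 0 < rp ->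
  0 < r1 -> 0 <= kq -> 0 < th -> 0 < a -> 0 < b -> exists rr : R,
  [/\ [/\ 0 < rr, rr <= 1, rr < a & rr < b],
      [/\ rr * (4 * ap / rp) <= 1 / 2, rr * (12 * sg / rp) <= 1 / 2, rr * (12 * sg / p2) <= 1 / 2,
          rr * (2 * (ap / (r1 / 2))) + rr * (2 * (sg / (r1 / 2))) <= 1 / 2 & rr * kq <= th / 2],
      rr * ap <= rp / 8 /\ rr * sg <= rp / 24, rr * (24 * sg) <= p2 & rr * ap + rr * sg <= r1 / 8].
Proof.
move=> ap0 sg0 p20 rp0 r10 kq0 th0 a0 b0; have sg0' := ltW sg0.
pose a1 := 4 * ap / rp; pose a2 := 12 * sg / rp; pose a3 := 12 * sg / p2.
pose a4 := 2 * (ap / (r1 / 2)) + 2 * (sg / (r1 / 2)); pose a5 := kq / th.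
have r20 : 0 < r1 / 2 by rewrite divr_gt0.
have a10 : 0 <= a1 by rewrite divr_ge0 ?mulr_ge0// ltW.
have a20 : 0 <= a2 by rewrite divr_ge0 ?mulr_ge0// ltW.
have a30 : 0 <= a3 by rewrite divr_ge0 ?mulr_ge0// ltW.
have a40 : 0 <= a4 by rewrite addr_ge0// mulr_ge0// divr_ge0// ltW.
have a50 : 0 <= a5 by rewrite divr_ge0// ltW.
pose KK := a1 + a2 + a3 + a4 + a5 + 1.
have KK0 : 0 < KK by apply: ltr_wpDl; [do 4 (apply: addr_ge0 => //)|exact: ltr01].
have [K1 K2 K3 K4 K5] : [/\ a1 <= KK, a2 <= KK, a3 <= KK, a4 <= KK & a5 <= KK].
  by rewrite /KK; move: a10 a20 a30 a40 a50; clear; move: a1 a2 a3 a4 a5 => *; split; lra.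
pose rr := Num.min (Num.min 1 (1 / (2 * KK))) (Num.min (a / 2) (b / 2)); exists rr.
have rr0 : 0 < rr by rewrite !lt_min ltr01 !divr_gt0 ?mulr_gt0.
have [[rr1 rrK] [ra rb]] : (rr <= 1 /\ rr <= 1 / (2 * KK)) /\ (rr <= a / 2 /\ rr <= b / 2).
  by rewrite /rr !ge_min !lexx !orbT.
have rrKK : rr * KK <= 1 / 2.
  by move: rrK; rewrite ler_pdivlMr ?mulr_gt0// mulrCA; clear; move: (rr * KK) => x h; lra.
have small x : x <= KK -> rr * x <= 1 / 2.
  by move=> xK; apply: le_trans rrKK; rewrite ler_wpM2l// ltW.
have sm1 := small _ K1; have sm2 := small _ K2; have sm3 := small _ K3.
have sm4 := small _ K4; have sm5 := small _ K5.
have E4 : rr * a4 = (rr * ap + rr * sg) * 4 / r1 by rewrite /a4; field; rewrite gt_eqF.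
split.
- split=> //; first by apply: le_lt_trans ra _; move: a0; clear; lra.
  by apply: le_lt_trans rb _; move: b0; clear; lra.
- split=> //; first by rewrite -mulrDr.
  by move: sm5; rewrite /a5 mulrA ler_pdivrMr// [1 / 2 * th]mulrC mul1r.
- split; first by move: sm1; rewrite /a1 mulrA ler_pdivrMr//; clear; move: rr => *; lra.
  by move: sm2; rewrite /a2 mulrA ler_pdivrMr//; clear; move: rr => *; lra.
- by move: sm3; rewrite /a3 (mulrA rr (12 * sg)) ler_pdivrMr//; clear; move: rr => *; lra.
- by move: sm4; rewrite E4 ler_pdivrMr//; clear; move: rr => *; lra.
Qed.
End FinalLemmas.
Local Close Scope complex_scope.
Theorem theorem1p3 (R : realType) (al : R) (hal : 0 < al < 1)
  (Om : set (R * R)) (hOm : admissible_domain al Om)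
  (om : set (R * R)) (hom : admissible_hole al om)
  (p : R * R) (hp : 0 < p.2)
  (ead : R * R)
  (head : [/\ 0 < ead.1, ead.1 < 1, 1 < ead.2 & ead.2 < 1 / ead.1])
  (hhole : forall e, rect (0, 0) ead e -> closure (hole p om e) `<=` Om)
  (go : R * R -> R) (hgo : C1a_bdry al Om go)
  (gi : R * R -> R) (hgi : C1a_bdry al om gi)
  (r0 : R) (hr0 : 0 < r0)
  (hgo_an : analytic_on [set t : R | (eball r0 `&` bdry0 Om) (t, 0)]
                        (fun t : R => go (t, 0)))
  (u : R * R -> R * R -> R)
  (hu : forall e, rect (0, 0) ead e ->
          perforated_solution al Om om p go gi e (u e))
  (u0 : R * R -> R) (hu0 : dirichlet_solution al Om go u0)
  (r1 : R) (hr1 : 0 < r1 <= r0)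
  (hr1Om : eball r1 `&` @upper_half R `<=` Om)
  (U0 : R * R -> R) (hU0 : harmonic_on (eball r1) U0)
  (hU0u0 : forall x, closure (eball r1 `&` @upper_half R) x -> U0 x = u0 x)
  (hr1hole : forall e, rect (- ead) ead e ->
     [set e.1 *: p + (e.1 * e.2) *: y | y in closure om] `<=` eball r1)
  (lam : R) (hlam : 0 <= lam < 1)
  (Om' : set (R * R)) (hOm'_open : open Om') (hOm'_sub : Om' `<=` Om)
  (hOm'0 : ~ closure Om' (0, 0)) :
  exists (e' : R * R) (V : set (R * R))
         (U : (R * R) * (R * R) -> C1a_space al Om'),
    [/\ rect (0, 0) ead e'
          /\ (forall e, rect (- e') e' e ->
                closure (hole p om e) `&` closure Om' = set0),
        open V /\ V (0, lam),
        analytic_on (rect (- e') e' `*` V) U,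
        (forall eps : R -> R * R,
           (forall eta, 0 < eta < 1 -> rect (0, 0) ead (eps eta)) ->
           eps eta @[eta --> (0 : R)^'+] --> ((0, 0) : R * R) ->
           ln (eps eta).1 / ln ((eps eta).1 * (eps eta).2)
             @[eta --> (0 : R)^'+] --> lam ->
           forall eta', 0 < eta' < 1 ->
             (forall eta, 0 < eta < eta' ->
                rect (0, 0) e' (eps eta) /\ V (log_delta (eps eta))) ->
             forall eta, 0 < eta < eta' ->
               forall x, closure Om' x ->
                 u (eps eta) x = U (eps eta, log_delta (eps eta)) x)
      & forall x, closure Om' x -> U ((0, 0), (0, lam)) x = u0 x].
Proof.
have [al0 al1] := andP hal.
have [[oO bO _ cO] Oup _ _] := hOm; have [oo' bo _ clo om0] := hom.
have [ead10 ead11 ead21 eadb] := head; have /andP[r10 r1r0] := hr1.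
have [lam0 lam1] := andP hlam.
have bD := bnd_dom bO; have oD := opn_dom oO.
have G1 (x : R[i]) : cabs x < r1 -> 0 < complex.Im x -> dom Om x.
  by move=> x1 x2; apply: hr1Om; split.
have G2 (x : R[i]) : dom Om x -> 0 < complex.Im x by move=> Dx; exact: Oup Dx.
have gD : good (dom Om) := good_dom al0 oO cO bD.
have oom := opn_dom oo'.
have som (x : R[i]) : bd (dom om) x -> sector (~` dom om) x by exact: (class_sector_compl al0 oo' clo).
(* A disc inside the hole carries the radial comparison function, and [sg] is a radius containing
   the closed hole. *)
have [s s_0 hs] := oom 0 om0.
have s00 : 0 < s / 2 by rewrite divr_gt0.
have os : cball 0 (s / 2) `<=` dom om by move=> x; rewrite /cball/= => xs; apply: hs; lra.
have [Mo hMo] := bnd_clos (bnd_dom bo).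
have osg x : clos (dom om) x -> cabs x < Mo + 1 by move=> /hMo; lra.
set s0 := s / 2 in s00 os; set sg := Mo + 1 in osg.
have sg0 : 0 < sg := sg0 s00 os osg.
have ncl : ~ clos (dom Om') 0 by move=> h; apply: hOm'0; exact/closure_dom.
have [d d0 hd] := dist_pos ncl.
(* [d / 4] puts the region of interest beyond [4 * rp], twice the radius from which the Schauder
   estimate assumes harmonicity; [r1 / 2] keeps the removed disc within the range of the
   reflection. *)
pose rp := Num.min (d / 4) (r1 / 2).
have rp0 : 0 < rp by rewrite lt_min !divr_gt0.
have [rpd rpr] : rp <= d / 4 /\ rp <= r1 / 2 by rewrite !ge_min !lexx orbT.
clearbody s0 sg rp.
have rpr1 : rp < r1 by lra.
have far x : clos (dom Om') x -> 2 * (2 * rp) <= cabs x by move=> /hd; lra.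
have [KW KW0 [Wlin Wbd Wval]] :=
  Wmk_bounded_linear al0 al1 oO cO bD hOm'_open hOm'_sub rp0 rpr1 G1 G2 far.
have domball (x : R[i]) : oball 0 r1 x -> dom (@eball R r1) x by rewrite /oball/= subr0.
have U0c : cont (oball 0 r1) (U0 \o @ofC R).
  exact: cont_sub domball (harmonic_cont (@open_eball R r1) hU0).
have U0h (x : R[i]) : cabs x < r1 -> harm (U0 \o @ofC R) x.
  by move=> xr; apply: (harmonic_harm (@open_eball R r1) hU0).
have pip : 0 < complex.Im (toC p) by [].
(* Continuity of the inner data is read off from the solution at half of the admissible
   parameters. *)
have gic : cont (bdin (dom om) sg) (gi \o @ofC R).
  pose t : (R * R) * (R * R) := ((ead.1 / 2, ead.2 / 2), (0, 0)).
  have t1 : 0 < t.1.1 by rewrite divr_gt0.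
  have ead20 : 0 < ead.2 := lt_trans ltr01 ead21.
  have t2 : 0 < t.1.2 by rewrite divr_gt0.
  have rt : rect (0, 0) ead t.1.
    by split; split=> //=; rewrite ltr_pdivrMr// ltr_pMr//; exact: ltr1n.
  have [cu _ _ ui] := hu _ rt.
  have c1 : 0 < co (@plin R) (poff lam) 0 t by rewrite /co subr0.
  have c2 : 0 < co (@plin R) (poff lam) 1 t by rewrite /co subr0.
  apply: (@hole_data_cont R lam Om om p t t1 t2 oom gi (u t.1) sg oD) => //.
  - move=> y cy; apply: (hhole _ rt); apply/closure_dom; rewrite ofCK.
    by apply/(@clos_hole R lam om p t t1 t2); rewrite XmK.
  - exact: cont_of_C1a (@closure_perforated R lam Om om p t t1 t2) cu.
have [Ml Ml0 hMl] := vlog_bound R.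
have [Mb Mb0 hMb] := beta_bound oom som s00 os osg.
have [th0 th1] := theta_lt1 s00 os osg.
have th1' : 0 < 1 - theta s0 sg by rewrite subr_gt0.
have p20 := pip; set p2 := complex.Im (toC p) in p20.
have piA := cabs_ge0 (toC p); set ap := cabs (toC p) in piA.
have kq0 : 0 <= kQ lam rp sg (toC p) Ml Mb by exact: (kQ0 lam1 rp0 s00 os osg pip Ml0 Mb0).
have ead20 : 0 < ead.2 := lt_trans ltr01 ead21.
have [rr [[rr0 rr1 rre1 rre2] [sm1 sm2 sm3 sm4 sm5] [apB sgB] sgP sm4']] :=
  small_parameter piA sg0 p20 rp0 r10 kq0 th1' ead10 ead20.
have rr0' := ltW rr0.
have [F [N [hF hE]]] := solution_exists lam1 gD r10 rp0 rpr1 G1 G2 oom som s00 os osg pip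
  rr0' rr1 sm1 sm2 Ml0 hMl Mb0 hMb sm3 sm4 U0c U0h gic sm5.
have FG := Fam_G lam1 rp0 s00 os osg rr0' rr1 sm1 sm2 Ml0 hMl.
have FR := Fam_regular lam1 gD r10 rp0 rpr1 G1 G2 s00 os osg pip rr0' rr1 sm1 sm2 Ml0 hMl sm3 sm4.
have [Nd hDat] := An_datum lam r10 oom som s00 os osg rr0' rr1 sm4 U0c U0h gic.
have hG := FG.2 _ _ hF.
have [c1u0 hu0h hu0b] := hu0.
have cu0' := C1a_closure_sub hOm'_sub c1u0.
pose W := @Wmk R al Om Om' r1 rp hOm'_open.
pose G t := Gsing lam sg (toC p) t (F t).
pose e' : R * R := (rr, rr).
(* A ball of the sup norm: both logarithmic coordinates stay within [rr] of the singular point, as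
   the box requires. *)
pose V : set (R * R) := ball ((0, lam) : R * R) rr.
have inbox (t : (R * R) * (R * R)) : (rect (- e') e' `*` V) t ->
    [/\ `|co (@plin R) (poff lam) 0 t| < rr, `|co (@plin R) (poff lam) 1 t| < rr,
        `|co (@plin R) (poff lam) 2 t| < rr & forall i, `|co (@plin R) (poff lam) i.+3 t| < rr].
  move=> [[[/= h1 h2] [/= h3 h4]] /ballP2[/= h5 h6]].
  split; [| |exact: h5|by move=> i; exact: h6].
    by rewrite /co subr0 ltr_norml; apply/andP.
  by rewrite /co subr0 ltr_norml; apply/andP.
have inbox' t : (rect (- e') e' `*` V) t -> box (@plin R) (poff lam) rr t.
  by move=> /inbox[h0 h1 h2 h3] [|[|[|i]]]; exact: ltW.
exists e', V, (fun t => mk al hOm'_open u0 + W (G t)); split.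
- split.
    by split; split.
  move=> e [[/= h1 h2] [/= h3 h4]]; apply/seteqP; split=> // q [cq cq'].
  have n1 : `|e.1| <= rr by rewrite ler_norml; apply/andP; split; exact: ltW.
  have n2 : `|e.2| <= rr by rewrite ler_norml; apply/andP; split; exact: ltW.
  (* For parameters of any sign the closed hole stays within radius [rp], since
     [rr * ap + rr * sg <= rp / 8 + rp / 24]. *)
  have hc : clos (cball 0 rp) (toC q).
    move/closure_dom: cq; apply: clos_mono => x [y oy yx].
    rewrite /cball/= subr0 -(ofCK x) -yx.
    have -> : toC (e.1 *: p + (e.1 * e.2) *: y) = e.1%:C%C * toC p + (e.1 * e.2)%:C%C * toC y.
      by apply: complex_ext; rewrite ?ReD ?ImD ?ReZ ?ImZ.
    apply: le_trans (cabsD _ _) _; rewrite !cabsZ normrM -/ap.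
    have ys : cabs (toC y) <= sg by apply/ltW/osg/sub_clos; rewrite -domE.
    have b1 : `|e.1| * ap <= rr * ap by rewrite ler_wpM2r.
    have b2 : `|e.1| * `|e.2| * cabs (toC y) <= rr * sg.
      apply: ler_pM; rewrite ?mulr_ge0 ?cabs_ge0// -[leRHS]mulr1.
      by apply: ler_pM => //; exact: le_trans n2 rr1.
    by apply: le_trans (lerD b1 b2) _; move: apB sgB rp0; clear; lra.
  have := clos_cball hc; rewrite /cball/= subr0.
  by have := far _ (proj1 (closure_dom _ _) cq'); move: rp0; clear; lra.
- split; first exact: ball_open.
  exact: ballxx.
- move=> t Dt; apply: analytic_add_cst; have [h0 h1 h2 h3] := inbox t Dt.
  (* The distance of [t] to the sides of the box serves as radius of the expansion; all indices from
     3 on name the same coordinate. *)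
  pose m := Num.min (Num.min (rr - `|co (@plin R) (poff lam) 0 t|) (rr - `|co (@plin R) (poff lam) 1 t|))
    (Num.min (rr - `|co (@plin R) (poff lam) 2 t|) (rr - `|co (@plin R) (poff lam) 3 t|)).
  have m0 : 0 < m by rewrite !lt_min !subr_gt0 h0 h1 h2 (h3 0%N).
  have le x y : x <= rr - y -> y + x <= rr by clear; lra.
  have mle i : `|co (@plin R) (poff lam) i t| + m <= rr.
    by case: i => [|[|[|i]]]; apply: le; rewrite /m !ge_min /co /= lexx ?orbT.
  have An1 := @An_analytic R _ _ nat (@plin R) (poff lam) rr (@plin_lin R) (@plin_le R) rr0' (ext rp) W KW KW0 Wlin Wbd.
  have An2 := An1 _ _ (rect (- e') e' `*` V) t m m0 mle hG.
  exact: An2.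
- move=> eps heps _ _ eta' heta' hin eta heta q cq.
  have /andP[eta0 etal] := heta; have /andP[_ eta'1] := heta'.
  have [re Ve] := hin _ heta.
  have re0 : rect (0, 0) ead (eps eta) by apply: heps; rewrite eta0 (lt_trans etal eta'1).
  pose t : (R * R) * (R * R) := (eps eta, log_delta (eps eta)).
  have e10 : 0 < t.1.1 by case: re0 => -[].
  have e20 : 0 < t.1.2 by case: re0 => -[].
  have [e1r e2r] : t.1.1 < rr /\ t.1.2 < rr by case: re => _ [].
  have Dt : (rect (- e') e' `*` V) t.
    have nr : - rr < 0 by rewrite oppr_lt0.
    by split=> //; split; split=> //; [exact: lt_trans nr e10|exact: lt_trans nr e20].
  have bt := inbox' t Dt.
  have E0 : co (@plin R) (poff lam) 0 t = t.1.1 by exact: subr0.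
  have E1 : co (@plin R) (poff lam) 1 t = t.1.2 by exact: subr0.
  (* The values of [log_delta] supply the relation under which the constants cancel in [woutE]. *)
  have rel : co (@plin R) (poff lam) 2 t * ln (co (@plin R) (poff lam) 1 t) =
      1 - lam - co (@plin R) (poff lam) 3 t.
    rewrite E1 /co /= subr0; apply: log_delta_rel => //; exact: lt_le_trans rr1.
  have e12 : t.1.1 * t.1.2 <= rr.
    by rewrite -[leRHS]mulr1; apply: ler_pM; [exact: ltW|exact: ltW|exact: ltW|apply: ltW; exact: lt_le_trans rr1].
  have [cu hu_h hu_o hu_i] := hu _ re0.
  have Dq := @dom_perforated R lam Om om p t e10 e20.
  have Cq := @closure_perforated R lam Om om p t e10 e20.
  have e10' : 0 < co (@plin R) (poff lam) 0 t by rewrite E0.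
  have e20' : 0 < co (@plin R) (poff lam) 1 t by rewrite E1.
  have oP : open (perforated Om om p t.1).
    apply: open_of_opn => x /Dq Px; have [r r_0 hr] := @opn_perf R lam (dom Om) (dom om) (toC p) gD t e10' e20' x Px.
    by exists r => // y /hr; move/Dq.
  have cG := An_cont rr0' hG bt.
  have [cqD rq] := closure_far hOm'_sub rp0 far cq.
  rewrite -[q in LHS]toCK.
  have -> : (mk al hOm'_open u0 + W (G t)) q = (u0 \o @ofC R) (toC q) + Wext Om r1 rp (G t) (toC q).
    by rewrite -(Wval _ cG) //= toCK -(mkE hOm'_open cu0' cq).
  apply: (@perturbed_solution R lam (dom Om) (dom om) r1 rp s0 sg (toC p) (U0 \o @ofC R) (gi \o @ofC R)
    lam1 gD r10 rp0 rpr1 G1 G2 oom som s00 os osg pip t (F t) e10' e20' rel _ _ _ _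
    (An_cont rr0' hF bt) cG (An_cont rr0' (FR.2 _ _ hF) bt) (An_cont rr0' hDat bt)
    (fun z => hE t z bt) (u t.1 \o @ofC R)).
  + by rewrite E1; apply: le_trans sgP; rewrite ler_wpM2r ?ltW// mulr_gt0.
  + by rewrite E0; apply: le_trans apB; rewrite ler_wpM2r// ltW.
  + by rewrite E0 E1; apply: le_trans sgB; rewrite ler_wpM2r// ltW.
  + have h1 : t.1.1 * ap <= rr * ap by rewrite ler_wpM2r// ltW.
    have h2 : t.1.1 * t.1.2 * sg <= rr * sg by rewrite ler_wpM2r// ltW.
    by rewrite E0 E1 mulrCA; move: h1 h2 sm4' (mulr_ge0 rr0' piA); rewrite -/ap; clear; lra.
  + exact: cont_of_C1a Cq cu.
  + by move=> x /Dq; exact: harmonic_harm.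
  + by apply: cont_of_C1a c1u0 => q'; exact: closure_dom.
  + by move=> x; exact: harmonic_harm.
  + move=> x bx; have bo' : bdry Om (ofC x) by apply/bdry_dom => //; rewrite ofCK.
    by rewrite /= hu_o// hu0b.
  + move=> x [cx _] cy; rewrite /= hu_i; first exact: (congr1 gi (YmE lam p t x)).
    exact: (@bdry_hole R lam Om om p t e10 e20 oom).
  + move=> x Dx xr; apply: hU0u0; apply: subset_closure; split; last exact: G2 Dx.
    by apply: domball; rewrite /oball/= subr0.
  + by [].
  + by [].
- move=> q cq; pose t : (R * R) * (R * R) := ((0, 0), (0, lam)).
  have Dt : (rect (- e') e' `*` V) t.
    by split; [split; split=> //=; rewrite oppr_lt0|exact: ballxx].
  have bt := inbox' t Dt; have cG := An_cont rr0' hG bt.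
  have [cqD rq] := closure_far hOm'_sub rp0 far cq.
  have OW := Op_Wext al0 oO cO bD rp0 rpr1 G1 G2.
  (* At the centre of the box the coefficient of the logarithm and the argument [zG] both vanish, so
     no singular part is left. *)
  have G0 x : ext rp x -> G t x = 0.
    by move=> _; rewrite /G /Gsing /zG /co /= subrr mul0r add0r mul0r subrr.
  have W0 : Wext Om r1 rp (G t) (toC q) = 0.
    by rewrite (Op_ext OW cG G0 (far_clos cqD rq)) (Op0 OW (far_clos cqD rq)).
  have -> : (mk al hOm'_open u0 + W (G t)) q = u0 q + Wext Om r1 rp (G t) (toC q).
    by rewrite -(Wval _ cG) // -(mkE hOm'_open cu0' cq).
  by rewrite W0 addr0.
Qed.
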